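(* Let $V$ be an $n$-dimensional vector space and let $A(\mathsf{w})$ be a $3$-Calabi-Yau algebra where $\mathsf{w}\in V^{\otimes(m+1)}$ is a superpotential. For each $x\in V$, let $I_x$ be the ideal of $TV$ generated by $$\{\langle\psi,\mathsf{w}\rangle \mid \psi\in x^\perp\}\quad\text{and}\quad \{[y,\langle\psi,\mathsf{w}\rangle]\mid y\in V,\ \psi\in V^*\},$$ and put $D_x=TV/I_x$ (so $D_0=A(\mathsf{w})$, and $D_{\lambda x}=D_x$ for $\lambda\in\Bbbk^\times$). (1) $\{D_x\mid x\in\mathbb{P}(V)\}$, with $\mathbb P(V)=\mathbb{P}^{n-1}$, is a flat family of $4$-Calabi-Yau algebras having degree-$m$ central regular elements $\Omega_x$ such that $A(\mathsf{w})=D_x/(\Omega_x)$ for all non-zero $x\in V$. Here ''flat family'' means that there is a flat sheaf of graded $\mathcal{O}_{\mathbb{P}(V)}$-algebras whose fiber at each $\Bbbk$-point $x\in\mathbb{P}(V)$ is $D_x$. (2) All degree-$m$ central extensions of $A(\mathsf{w})$ are obtained in this way, and they are $4$-Calabi-Yau: if $D'$ is a connected graded algebra generated in degree one with a central regular homogeneous element $\Omega'$ of degree $m$ such that $D'/(\Omega')\cong A(\mathsf{w})$ as graded algebras, then $D'$ is isomorphic as a graded algebra to $D_x$ for some non-zero $x\in V$, and $D'$ is $4$-Calabi-Yau.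
   Context: Fix a field $\Bbbk$. Graded algebras are $\mathbb{N}$-graded, connected, finitely presented and generated in degree one; $m\ge2$. For $x\in V$, $x^\perp=\{\psi\in V^*\mid\psi(x)=0\}$. The pairing $\langle-,-\rangle\colon V^*\times V^{\otimes(m+1)}\to V^{\otimes m}$ is $\langle\psi,\mathsf{w}\rangle=(\psi\otimes\mathrm{id}^{\otimes m})(\mathsf{w})$. $A(\mathsf{w})=TV/(\langle\psi,\mathsf{w}\rangle:\psi\in V^* )$. A superpotential is an element of $V^{\otimes\ell}$ invariant under $v_1\otimes\cdots\otimes v_\ell\mapsto v_\ell\otimes v_1\otimes\cdots\otimes v_{\ell-1}$. $[y,z]=yz-zy$. The space $\mathbb{P}(V)=\mathrm{Proj}$ of the symmetric algebra on $V^*$, so its $\Bbbk$-points are the lines $\Bbbk x\subseteq V$. An element is regular if it is not a zero-divisor. For a graded algebra $A$ let $A^e=A\otimes A^{\circ}$; bimodules are left $A^e$-modules via $(a\otimes b)\cdot x=axb$. $A$ is $d$-Calabi-Yau if, as a left $A^e$-module, $A$ has a finite-length resolution by finitely generated projectives and $\mathrm{Ext}^i_{A^e}(A,A^e)$ is $0$ for $i\ne d$ and isomorphic to $A(\ell)$ for $i=d$ (as graded bimodules), for some $\ell\in\mathbb{Z}$. *)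

(* Defs.v *)
From HB Require Import structures.
From mathcomp Require Import all_boot all_order all_algebra.
From mathcomp.classical Require Import boolp.
From mathcomp.finmap Require Import finmap.
(* monalg after mpoly: msupp and <<_ *g _>> below refer to monoid algebras. *)
From mathcomp.multinomials Require Import mpoly.
From mathcomp.multinomials Require Import monalg.

Set Implicit Arguments.
Unset Strict Implicit.
Unset Printing Implicit Defensive.

Import Order.TTheory GRing.Theory Num.Theory.
Local Open Scope ring_scope.

(** * Gradings and graded algebras *)

(* V is the internal direct sum of the subgroups deg k, for k : int. *)
Record grading (V : zmodType) (deg : int -> V -> Prop) : Prop := Grading {
  deg_0 : forall k, deg k 0;
  deg_B : forall k u v, deg k u -> deg k v -> deg k (u - v);
  deg_sum : forall v, exists (s : seq int) (f : int -> V),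
    [/\ uniq s, forall k, deg k (f k) & v = \sum_(k <- s) f k];
  deg_free : forall (s : seq int) (f : int -> V), uniq s ->
    (forall k, deg k (f k)) -> \sum_(k <- s) f k = 0 ->
    forall k, k \in s -> f k = 0 }.

(* N-graded algebras over a commutative ring R, presented as a ring together
   with a central ring morphism from R; the zero algebra is allowed.  Degrees
   are integers so that algebras and their shifted modules share one notion of
   grading. *)
Record gralg (R : comPzRingType) := GrAlg {
  carrier :> pzRingType;
  str : {rmorphism R -> carrier};
  adeg : int -> carrier -> Prop;
  str_central : forall r a, str r * a = a * str r;
  adegP : grading adeg;
  adeg_str : forall r, adeg 0 (str r);
  adegM : forall i j a b, adeg i a -> adeg j b -> adeg (i + j) (a * b);
  adegN : forall i a, i < 0 -> adeg i a -> a = 0 }.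

Arguments str {R} g.
Arguments adeg {R} g _ _.

Definition gralg_iso_map (R : comPzRingType) (A B : gralg R)
    (f : {rmorphism A -> B}) : Prop :=
  [/\ bijective f, forall r, f (str A r) = str B r
    & forall k a, adeg A k a -> adeg B k (f a)].

Definition gralg_iso (R : comPzRingType) (A B : gralg R) : Prop :=
  exists f : {rmorphism A -> B}, gralg_iso_map f.

Definition connected (K : fieldType) (A : gralg K) : Prop :=
  (1 : A) <> 0 /\ forall a, adeg A 0 a -> exists c, a = str A c.

(* G generates A as an R-algebra. *)
Definition generates (R : comPzRingType) (A : gralg R) (G : A -> Prop) : Prop :=
  forall P : A -> Prop,
    (forall r, P (str A r)) -> (forall a, G a -> P a) ->
    (forall a b, P a -> P b -> P (a + b)) ->
    (forall a b, P a -> P b -> P (a * b)) -> forall a, P a.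

Definition generated_in_degree_one (K : fieldType) (A : gralg K) : Prop :=
  generates (adeg A 1).

Definition central (A : pzRingType) (z : A) : Prop :=
  forall a, z * a = a * z.

Definition regular (A : pzRingType) (z : A) : Prop :=
  forall a, (z * a = 0 -> a = 0) /\ (a * z = 0 -> a = 0).

Section Restriction.
Context (R S : comPzRingType) (g : {rmorphism R -> S}) (A : gralg S).

Definition restrict_scalars : gralg R :=
  @GrAlg R A (str A \o g) (adeg A)
    (fun r a => str_central (g r) a) (adegP A) (fun r => adeg_str A (g r))
    (@adegM S A) (@adegN S A).

End Restriction.

(** * Quotient by the two-sided ideal generated by a set *)

Inductive ideal_gen (A : pzRingType) (S : A -> Prop) : A -> Prop :=
| IdealGen0 : ideal_gen S 0
| IdealGenS a s b x : S s -> ideal_gen S x -> ideal_gen S (a * s * b + x).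

Section Quotient.
Context (A : pzRingType) (S : A -> Prop).

Lemma ideal_genD x y : ideal_gen S x -> ideal_gen S y -> ideal_gen S (x + y).
Proof.
move=> + hy; elim=> [|a s b {}x hs _ ih]; first by rewrite add0r.
by rewrite -addrA; apply: IdealGenS.
Qed.

Lemma ideal_genMl c x : ideal_gen S x -> ideal_gen S (c * x).
Proof.
elim=> [|a s b {}x hs _ ih]; first by rewrite mulr0; apply: IdealGen0.
by rewrite mulrDr !mulrA; apply: IdealGenS.
Qed.

Lemma ideal_genMr c x : ideal_gen S x -> ideal_gen S (x * c).
Proof.
elim=> [|a s b {}x hs _ ih]; first by rewrite mul0r; apply: IdealGen0.
by rewrite mulrDl -mulrA; apply: IdealGenS.
Qed.

Lemma ideal_genN x : ideal_gen S x -> ideal_gen S (- x).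
Proof. by rewrite -mulN1r; apply: ideal_genMl. Qed.

Lemma ideal_gen_sub s : S s -> ideal_gen S s.
Proof.
move=> hs; rewrite -[s]addr0 -[s in s + 0]mul1r -[1 * s]mulr1.
by apply: IdealGenS => //; apply: IdealGen0.
Qed.

Definition ideal_pred : {pred A} := fun a => `[< ideal_gen S a >].

Lemma ideal_predE a : (a \in ideal_pred) = `[< ideal_gen S a >].
Proof. by []. Qed.

Lemma ideal_pred_zmod_closed : zmod_closed ideal_pred.
Proof.
split=> [|x y /asboolP hx /asboolP hy]; apply/asboolP.
  exact: IdealGen0.
by apply: ideal_genD => //; apply: ideal_genN.
Qed.

HB.instance Definition _ :=
  GRing.isZmodClosed.Build A ideal_pred ideal_pred_zmod_closed.

Definition qring := Quotient.quot ideal_pred.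
HB.instance Definition _ := GRing.Zmodule.on qring.

Definition qpi (a : A) : qring := \pi_(Quotient.quot ideal_pred)%qT a.

Lemma qpi_eq a b : qpi a = qpi b <-> ideal_gen S (a - b).
Proof.
rewrite /qpi; split=> [/eqP|h].
  by rewrite -Quotient.idealrBE => /asboolP.
by apply/eqP; rewrite -Quotient.idealrBE; apply/asboolP.
Qed.

Lemma qpi_surj (x : qring) : exists a, x = qpi a.
Proof. by exists (repr x); rewrite /qpi reprK. Qed.

Lemma qpiB : {morph qpi : a b / a - b}.
Proof. by move=> a b; rewrite /qpi raddfB. Qed.

Definition qmul (x y : qring) : qring := qpi (repr x * repr y).

Lemma qpiM a b : qpi (a * b) = qmul (qpi a) (qpi b).
Proof.
apply/qpi_eq; set a' := repr (qpi a); set b' := repr (qpi b).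
have ha : ideal_gen S (a - a') by apply/qpi_eq; rewrite /a' /qpi reprK.
have hb : ideal_gen S (b - b') by apply/qpi_eq; rewrite /b' /qpi reprK.
have -> : a * b - a' * b' = (a - a') * b + a' * (b - b').
  by rewrite mulrBl mulrBr addrA subrK.
by apply: ideal_genD; [apply: ideal_genMr | apply: ideal_genMl].
Qed.

Lemma qpiD a b : qpi (a + b) = qpi a + qpi b.
Proof. by rewrite /qpi raddfD. Qed.

Lemma qmulA : associative qmul.
Proof.
move=> x y z; have [a ->] := qpi_surj x; have [b ->] := qpi_surj y.
by have [c ->] := qpi_surj z; rewrite -!qpiM mulrA.
Qed.

Lemma qmul1 : left_id (qpi 1) qmul.
Proof. by move=> x; have [a ->] := qpi_surj x; rewrite -qpiM mul1r. Qed.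

Lemma q1mul : right_id (qpi 1) qmul.
Proof. by move=> x; have [a ->] := qpi_surj x; rewrite -qpiM mulr1. Qed.

Lemma qmulDl : left_distributive qmul +%R.
Proof.
move=> x y z; have [a ->] := qpi_surj x; have [b ->] := qpi_surj y.
by have [c ->] := qpi_surj z; rewrite -qpiD -!qpiM -qpiD mulrDl.
Qed.

Lemma qmulDr : right_distributive qmul +%R.
Proof.
move=> x y z; have [a ->] := qpi_surj x; have [b ->] := qpi_surj y.
by have [c ->] := qpi_surj z; rewrite -qpiD -!qpiM -qpiD mulrDr.
Qed.

HB.instance Definition _ := GRing.Zmodule_isPzRing.Build qring
  qmulA qmul1 q1mul qmulDl qmulDr.

HB.instance Definition _ := GRing.isZmodMorphism.Build A qring qpi qpiB.
Lemma qpi_monoid : monoid_morphism qpi.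
Proof. by split=> // a b; rewrite qpiM. Qed.
HB.instance Definition _ := GRing.isMonoidMorphism.Build A qring qpi qpi_monoid.

End Quotient.
Arguments qpi {A} S a.

Section GradingFacts.
Context (V : zmodType) (deg : int -> V -> Prop) (hdeg : grading deg).

Lemma gradingN k u : deg k u -> deg k (- u).
Proof. by move=> hu; rewrite -sub0r; apply: deg_B hdeg _ _ _ (deg_0 hdeg k) hu. Qed.

Lemma gradingD k u v : deg k u -> deg k v -> deg k (u + v).
Proof. by move=> hu hv; rewrite -[v]opprK; apply: deg_B hdeg _ _ _ hu (gradingN hv). Qed.

Lemma grading_regroup (l : seq (int * V)) (P : V -> Prop) :
  P 0 -> (forall u v, P u -> P v -> P (u + v)) ->
  (forall p, p \in l -> deg p.1 p.2 /\ P p.2) ->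
  exists (s : seq int) (f : int -> V),
    [/\ uniq s, forall k, deg k (f k), forall k, P (f k)
      & \sum_(p <- l) p.2 = \sum_(k <- s) f k].
Proof.
move=> P0 PD hl; exists (undup (map fst l)).
exists (fun k => \sum_(p <- l | p.1 == k) p.2).
split; first exact: undup_uniq.
- move=> k; rewrite big_seq_cond; elim/big_rec: _ => [|p v]; first exact: deg_0.
  by move=> /andP[/hl [hp _] /eqP <-]; apply: gradingD.
- move=> k; rewrite big_seq_cond; elim/big_rec: _ => [//|p v].
  by move=> /andP[/hl [_ hp] _]; apply: PD.
rewrite (exchange_big_dep predT) //= big_seq [RHS]big_seq.
apply: eq_bigr => p hp.
have -> : \sum_(k <- undup (map fst l) | p.1 == k) p.2 =
          \sum_(k <- undup (map fst l) | k == p.1) p.2.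
  by apply: eq_bigl => k; rewrite eq_sym.
rewrite -big_filter filter_pred1_uniq ?undup_uniq ?big_seq1 //.
by rewrite mem_undup; apply: map_f.
Qed.

Lemma grading_uniq (s t : seq int) (f g : int -> V) : uniq s -> uniq t ->
  (forall k, deg k (f k)) -> (forall k, deg k (g k)) ->
  \sum_(k <- s) f k = \sum_(k <- t) g k ->
  forall k, (if k \in s then f k else 0) = (if k \in t then g k else 0).
Proof.
move=> us ut hf hg e.
set f' := fun k => if k \in s then f k else 0.
set g' := fun k => if k \in t then g k else 0.
have ext (r r' : seq int) (h : int -> V) : uniq r -> uniq r' ->
    {subset r <= r'} ->
    \sum_(k <- r') (if k \in r then h k else 0) = \sum_(k <- r) h k.
  move=> ur ur' sub; rewrite -big_mkcond /= -big_filter; apply: perm_big.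
  apply: uniq_perm => // [|k]; first exact: filter_uniq.
  by rewrite mem_filter; case: (boolP (k \in r)) => //= /sub ->.
pose u := undup (s ++ t).
have uu : uniq u by apply: undup_uniq.
have su : {subset s <= u} by move=> k hk; rewrite mem_undup mem_cat hk.
have tu : {subset t <= u} by move=> k hk; rewrite mem_undup mem_cat hk orbT.
have hfg k : deg k (f' k - g' k).
  by apply: deg_B hdeg _ _ _ _ _; rewrite /f' /g'; case: ifP => _ //; apply: deg_0.
have := @deg_free _ _ hdeg u (fun k => f' k - g' k) uu hfg.
rewrite sumrB /f' /g' !ext // e subrr => /(_ erefl) h k.
have [ku|] := boolP (k \in u); first by apply/eqP; rewrite -subr_eq0; apply/eqP/h.
by rewrite mem_undup mem_cat negb_or => /andP[/negbTE -> /negbTE ->].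
Qed.

End GradingFacts.

Definition homogeneous_set (R : comPzRingType) (A : gralg R) (S : A -> Prop) :=
  forall s, S s -> exists k, adeg A k s.

Section GradedQuotient.
Context (R : comPzRingType) (A : gralg R) (S : A -> Prop).
Hypothesis hS : homogeneous_set S.

Definition qdeg (k : int) (x : qring S) : Prop :=
  exists2 a, adeg A k a & x = qpi S a.

Lemma homogeneous_ideal_gen x : ideal_gen S x ->
  exists l : seq (int * A), x = \sum_(p <- l) p.2 /\
    forall p, p \in l -> adeg A p.1 p.2 /\ ideal_gen S p.2.
Proof.
elim=> [|a s b {}x hs _ [l [-> hl]]]; first by exists [::]; rewrite big_nil.
have [k hk] := hS hs.
have [sa [fa [_ ha ->]]] := deg_sum (adegP A) a.
have [sb [fb [_ hb ->]]] := deg_sum (adegP A) b.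
exists ([seq (i + k + j, fa i * s * fb j) | i <- sa, j <- sb] ++ l); split.
  rewrite big_cat /= big_allpairs_dep /=; congr (_ + _).
  by rewrite !mulr_suml; apply: eq_bigr => i _; rewrite mulr_sumr.
move=> p; rewrite mem_cat => /orP[|]; last exact: hl.
case/allpairsPdep=> i [j [hi hj ->]] /=; split; last first.
  by apply: ideal_genMr; apply: ideal_genMl; apply: ideal_gen_sub.
by do 2![apply: adegM => //].
Qed.

Lemma homogeneous_component x (s : seq int) (f : int -> A) : ideal_gen S x ->
  uniq s -> (forall k, adeg A k (f k)) -> x = \sum_(k <- s) f k ->
  forall k, k \in s -> ideal_gen S (f k).
Proof.
move=> /homogeneous_ideal_gen [l [xl hl]] us hf xs k ks.
have [t [g [ut hg Pg eg]]] := grading_regroup (adegP A)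
  (IdealGen0 S) (@ideal_genD _ S) hl.
have := grading_uniq (adegP A) us ut hf hg; rewrite -xs xl -eg => /(_ erefl k).
by rewrite ks => ->; case: ifP => // _; apply: IdealGen0.
Qed.

Lemma qdegP : grading qdeg.
Proof.
split.
- by move=> k; exists 0; [apply: deg_0 (adegP A) k | rewrite rmorph0].
- move=> k _ _ [a ha ->] [b hb ->]; exists (a - b); last by rewrite rmorphB.
  exact: deg_B (adegP A) _ _ _ ha hb.
- move=> x; have [a ->] := qpi_surj x.
  have [s [f [us hf ->]]] := deg_sum (adegP A) a.
  exists s, (fun k => qpi S (f k)); split=> // [k|]; first by exists (f k).
  by rewrite rmorph_sum.
- move=> s f us hf e k ks.
  have /choice [g hg] : forall k, exists a, adeg A k a /\ f k = qpi S a.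
    by move=> i; have [a ha ->] := hf i; exists a.
  have he : ideal_gen S (\sum_(i <- s) g i).
    rewrite -[X in ideal_gen S X]subr0; apply/qpi_eq.
    rewrite rmorph_sum rmorph0 -[RHS]e; apply: eq_bigr => i _.
    by case: (hg i).
  have [_ ->] := hg k; rewrite -[RHS](rmorph0 (qpi S)); apply/qpi_eq.
  rewrite subr0; apply: homogeneous_component he us _ erefl k ks => i.
  by case: (hg i).
Qed.

Lemma qstr_central r x :
  (qpi S \o str A) r * x = x * (qpi S \o str A) r.
Proof.
by have [a ->] := qpi_surj x; rewrite /= -!rmorphM str_central.
Qed.

Lemma qdeg_str r : qdeg 0 ((qpi S \o str A) r).
Proof. by exists (str A r) => //; apply: adeg_str. Qed.

Lemma qdegM i j x y : qdeg i x -> qdeg j y -> qdeg (i + j) (x * y).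
Proof.
case=> a ha -> [b hb ->]; exists (a * b); last by rewrite rmorphM.
exact: adegM.
Qed.

Lemma qdegN i x : i < 0 -> qdeg i x -> x = 0.
Proof. by move=> hi [a ha ->]; rewrite (adegN hi ha) rmorph0. Qed.

Definition gquot : gralg R :=
  @GrAlg R (qring S) (qpi S \o str A) qdeg
    qstr_central qdegP qdeg_str qdegM qdegN.

End GradedQuotient.

Lemma homogeneous_set1 (R : comPzRingType) (A : gralg R) k (z : A) :
  adeg A k z -> homogeneous_set (eq z).
Proof. by move=> hz _ <-; exists k. Qed.

(* A / (z) for a homogeneous element z *)
Definition gquot1 (R : comPzRingType) (A : gralg R) k (z : A)
    (hz : adeg A k z) : gralg R := gquot (homogeneous_set1 hz).

Definition gquot1_proj (R : comPzRingType) (A : gralg R) k (z : A)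
    (hz : adeg A k z) (a : A) : gquot1 hz := qpi (eq z) a.

(** * The tensor algebra of V = K^n and the algebras A(w), D_x *)

(* TV is the free algebra on the standard basis of V, i.e. the monoid algebra
   of words in 'I_n. *)
Section TensorAlgebra.
Context (K : fieldType) (n : nat).
Local Notation T := {malg K[{fmonom 'I_n}]}.

Definition tdeg (k : int) (a : T) : Prop :=
  forall u : {fmonom 'I_n}, u \in msupp a -> (size u)%:Z = k.

Lemma tdegU c (u : {fmonom 'I_n}) : tdeg (size u)%:Z (<< c *g u >> : T).
Proof. by move=> v /(fsubsetP msuppU_le); rewrite inE => /eqP ->. Qed.

Lemma tdegP : grading tdeg.
Proof.
have d0 k : tdeg k 0 by move=> u; rewrite msupp0 inE.
have dB k a b : tdeg k a -> tdeg k b -> tdeg k (a - b).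
  move=> ha hb u; rewrite -mcoeff_neq0 mcoeffB => hu.
  have [/ha //|/mcoeff_outdom au] := boolP (u \in msupp a).
  have [/hb //|/mcoeff_outdom bu] := boolP (u \in msupp b).
  by move: hu; rewrite au bu subrr eqxx.
have dD k a b : tdeg k a -> tdeg k b -> tdeg k (a + b).
  by move=> ha hb; rewrite -[b]opprK; apply: (dB) => //; rewrite -sub0r; apply: dB.
split=> //.
- move=> a; pose l := [seq (size (fmonom_val u))%:Z | u <- msupp a].
  exists (undup l).
  exists (fun k => \sum_(u <- msupp a | (size u)%:Z == k) << (mcoeff u a) *g u >>).
  split; first exact: undup_uniq.
    move=> k; elim/big_rec: _ => [|u b /eqP <- hb]; first exact: d0.
    by apply: dD => //; apply: tdegU.
  rewrite {1}[a]monalgE (exchange_big_dep predT) //= big_seq [RHS]big_seq.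
  apply: eq_bigr => u hu.
  have -> : \sum_(k <- undup l | (size u)%:Z == k) << (mcoeff u a) *g u >> =
            \sum_(k <- undup l | k == (size u)%:Z) << (mcoeff u a) *g u >>.
    by apply: eq_bigl => k; rewrite eq_sym.
  rewrite -big_filter filter_pred1_uniq ?undup_uniq ?big_seq1 //.
  by rewrite mem_undup; apply/mapP; exists u.
- move=> s f us hf e k ks; apply/malgP => u; rewrite mcoeff0.
  have [uf|/mcoeff_outdom //] := boolP (u \in msupp (f k)).
  have uk := hf _ _ uf.
  have := congr1 (mcoeff u) e; rewrite raddf_sum mcoeff0 (bigD1_seq k) //=.
  rewrite big1 ?addr0 // => j jk; apply: mcoeff_outdom; apply/negP => /hf.
  by rewrite uk => kj; rewrite kj eqxx in jk.
Qed.

Lemma tdegM i j a b : tdeg i a -> tdeg j b -> tdeg (i + j) (a * b).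
Proof.
move=> ha hb u /msuppM_le [v [w [/ha <- /hb <- ->]]].
by rewrite fmM size_cat PoszD.
Qed.

Lemma tstr_central (c : K) (a : T) : (malgC c) * a = a * (malgC c).
Proof.
rewrite mul_malgC; apply/malgP => u; rewrite mcoeffZ.
rewrite malgM_def fgmulgU raddf_sum /= [in LHS](monalgE a) raddf_sum mulr_sumr.
by apply: eq_bigr => v _; rewrite mulm1 /= !mcoeffU mulrnAr mulrC.
Qed.

Lemma tdeg_str (c : K) : tdeg 0 (malgC c : T).
Proof. by move=> u /(fsubsetP msuppU_le); rewrite inE => /eqP ->; rewrite fm1. Qed.

Lemma tdegN i (a : T) : i < 0 -> tdeg i a -> a = 0.
Proof.
move=> hi ha; apply/malgP => u; rewrite mcoeff0.
by have [/ha iu|/mcoeff_outdom //] := boolP (u \in msupp a); rewrite -iu in hi.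
Qed.

Definition TV : gralg K :=
  @GrAlg K T (@malgC {fmonom 'I_n} K) tdeg
    tstr_central tdegP tdeg_str tdegM tdegN.

(* V^{(x) l}, by coordinates on the basis e_{t_1} (x) ... (x) e_{t_l} *)
Definition tensor (l : nat) := {ffun l.-tuple 'I_n -> K}.

Definition in_TV l (w : tensor l) : TV :=
  \sum_(t : l.-tuple 'I_n) << w t *g FMonom t >>.

Definition vec (y : 'rV[K]_n) : TV := \sum_(i < n) << y 0 i *g FMonom [:: i] >>.

(* v_1 (x) ... (x) v_l |-> v_l (x) v_1 (x) ... (x) v_{l-1}: the coefficient of
   the image at t is the coefficient of w at (t_2, ..., t_l, t_1). *)
Definition cyclic_shift l (w : tensor l) : tensor l :=
  [ffun t : l.-tuple 'I_n => w [tuple of rot 1 t]].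

Definition superpotential l (w : tensor l) : Prop := cyclic_shift w = w.

(* Elements of V^* are column vectors, paired with V by the row-column
   product. *)
Definition pairing (psi : 'cV[K]_n) (x : 'rV[K]_n) : K := (x *m psi) 0 0.

Definition contract m (psi : 'cV[K]_n) (w : tensor m.+1) : tensor m :=
  [ffun t : m.-tuple 'I_n => \sum_(i < n) psi i 0 * w [tuple of i :: t]].

Lemma in_TV_deg l (w : tensor l) : adeg TV l%:Z (in_TV w).
Proof.
apply: (big_ind (fun a => adeg TV l%:Z a)).
- exact: deg_0 (adegP TV) _.
- exact: gradingD (adegP TV) _.
- by move=> t _; have := @tdegU (w t) (FMonom t); rewrite /= size_tuple.
Qed.

Lemma vec_deg y : adeg TV 1 (vec y).
Proof.
apply: (big_ind (fun a => adeg TV 1 a)).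
- exact: deg_0 (adegP TV) _.
- exact: gradingD (adegP TV) _.
- by move=> i _; apply: (@tdegU (y 0 i) (FMonom [:: i])).
Qed.

Section Relations.
Context (m : nat) (w : tensor m.+1).

Definition A_rel (a : TV) : Prop := exists psi, a = in_TV (contract psi w).

Definition D_rel (x : 'rV[K]_n) (a : TV) : Prop :=
  (exists2 psi, pairing psi x = 0 & a = in_TV (contract psi w)) \/
  (exists y psi, a = vec y * in_TV (contract psi w)
                   - in_TV (contract psi w) * vec y).

Lemma A_rel_homogeneous : homogeneous_set A_rel.
Proof. by move=> _ [psi ->]; exists m%:Z; apply: in_TV_deg. Qed.

Lemma D_rel_homogeneous x : homogeneous_set (D_rel x).
Proof.
move=> _ [[psi _ ->]|[y [psi ->]]]; first by exists m%:Z; apply: in_TV_deg.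
exists (1 + m%:Z); apply: deg_B (adegP TV) _ _ _ _ _.
  by apply: adegM; [apply: vec_deg | apply: in_TV_deg].
by rewrite addrC; apply: adegM; [apply: in_TV_deg | apply: vec_deg].
Qed.

Definition Aw : gralg K := gquot A_rel_homogeneous.
Definition Dw (x : 'rV[K]_n) : gralg K := gquot (D_rel_homogeneous (x := x)).

Definition A_proj (a : TV) : Aw := qpi A_rel a.
Definition D_proj (x : 'rV[K]_n) (a : TV) : Dw x := qpi (D_rel x) a.

End Relations.
End TensorAlgebra.

Arguments in_TV {K n l} w.
Arguments superpotential {K n l} w.

(** * Calabi-Yau algebras *)

(* The graded algebra A^e = A (x) A^o: tens is the universal K-balanced
   biadditive map, and the product is that of A on the left factor and of the
   opposite algebra on the right one.  Such an object exists and is unique up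
   to unique isomorphism. *)
Record envelope (K : fieldType) (A : gralg K) := Envelope {
  env :> gralg K;
  tens : A -> A -> env;
  tensDl : forall a a' b, tens (a + a') b = tens a b + tens a' b;
  tensDr : forall a b b', tens a (b + b') = tens a b + tens a b';
  tens_balanced : forall a c b, tens (a * str A c) b = tens a (str A c * b);
  tens_span : forall e : env, exists s : seq (A * A),
    e = \sum_(p <- s) tens p.1 p.2;
  tens_universal : forall (G : zmodType) (beta : A -> A -> G),
    (forall a a' b, beta (a + a') b = beta a b + beta a' b) ->
    (forall a b b', beta a (b + b') = beta a b + beta a b') ->
    (forall a c b, beta (a * str A c) b = beta a (str A c * b)) ->
    exists g : {additive env -> G}, forall a b, g (tens a b) = beta a b;
  tens1 : tens 1 1 = 1;
  tensM : forall a b a' b', tens a b * tens a' b' = tens (a * a') (b' * b);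
  tens_str : forall c, str env c = tens (str A c) 1;
  tens_deg : forall i j a b,
    adeg A i a -> adeg A j b -> adeg env (i + j) (tens a b) }.

(* graded left modules *)
Record grmod (K : fieldType) (E : gralg K) := GrMod {
  mcarrier :> lmodType E;
  grdeg : int -> mcarrier -> Prop;
  grdegP : grading grdeg;
  grdegZ : forall i k (e : E) (v : mcarrier),
    adeg E i e -> grdeg k v -> grdeg (i + k) (e *: v) }.

Arguments grdeg {K E} g _ _.

Definition finitely_generated (R : pzRingType) (P : lmodType R) : Prop :=
  exists s : seq P, forall v : P,
    exists c : nat -> R, v = \sum_(i < size s) c i *: s`_i.

Definition projective (R : pzRingType) (P : lmodType R) : Prop :=
  forall (M N : lmodType R) (g : {linear M -> N}) (h : {linear P -> N}),
    (forall y, exists x, g x = y) ->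
    exists k : {linear P -> M}, forall v, g (k v) = h v.

Section CalabiYau.
Context (K : fieldType) (A : gralg K) (E : envelope A).

(* Finite-length resolutions ... -> P_1 -> P_0 -> A -> 0 of the A^e-module A,
   where (a (x) b) . x = a x b, by finitely generated projective graded
   A^e-modules, with differentials of degree 0. *)
Record resolution := Resolution {
  rmod : nat -> grmod E;
  rdiff : forall i, {linear rmod i.+1 -> rmod i};
  raug : {additive rmod 0%N -> A};
  raug_lin : forall a b v, raug (tens E a b *: v) = a * raug v * b;
  rdiff_deg : forall i k v,
    grdeg (rmod i.+1) k v -> grdeg (rmod i) k (rdiff i v);
  raug_deg : forall k v, grdeg (rmod 0%N) k v -> adeg A k (raug v);
  raug_surj : forall a, exists v, raug v = a;
  rexact0 : forall v, raug v = 0 <-> exists u, v = rdiff 0%N u;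
  rexact : forall i v, rdiff i v = 0 <-> exists u, v = rdiff i.+1 u;
  rfg : forall i, finitely_generated (rmod i);
  rproj : forall i, projective (rmod i);
  rfinite : exists N, forall i, (N <= i)%N -> forall v : rmod i, v = 0 }.

Context (P : resolution).

(* The cochain complex Hom_{A^e}(P_i, A^e), whose cohomology is
   Ext^i_{A^e}(A, A^e). *)
Definition cochain i := {linear rmod P i -> E^o}.

Definition cocycle i (f : cochain i) : Prop := forall u, f (rdiff P i u) = 0.

Definition coboundary i : cochain i -> Prop :=
  match i return cochain i -> Prop with
  | 0%N => fun f => forall v, f v = 0
  | j.+1 => fun f => exists g : cochain j, forall v, f v = g (rdiff P j v)
  end.

Definition ext_zero i : Prop := forall f : cochain i, cocycle f -> coboundary f.

Definition cochain_deg i (k : int) (f : cochain i) : Prop :=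
  forall j v, grdeg (rmod P i) j v -> adeg E (j + k) (f v).

(* Ext^d_{A^e}(A, A^e) is isomorphic to A(l) as a graded bimodule, where
   A(l)_k = A_{k+l}: theta is an epimorphism from the cocycles with kernel the
   coboundaries.  The bimodule structure on Hom_{A^e}(P_d, A^e) comes from
   right multiplication in A^e: (a f b)(v) = f(v) (b (x) a). *)
Definition ext_iso_shift d (l : int) : Prop :=
  exists theta : cochain d -> A,
  [/\ [/\ forall f g h : cochain d, cocycle f -> cocycle g ->
            (forall v, h v = f v + g v) -> theta h = theta f + theta g,
          forall a b (f h : cochain d), cocycle f ->
            (forall v, h v = (f v : E) * tens E b a) ->
            theta h = a * theta f * b
        & forall k (f : cochain d), cocycle f ->
            cochain_deg k f -> adeg A (k + l) (theta f)],
      forall a, exists2 f, cocycle f & theta f = a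
    & forall f, cocycle f -> (theta f = 0 <-> coboundary f)].

End CalabiYau.

Definition calabi_yau (d : nat) (K : fieldType) (A : gralg K) : Prop :=
  exists (E : envelope A) (P : resolution E),
    (forall i, i <> d -> ext_zero P i) /\ exists l : int, ext_iso_shift P d l.

(** * The projective space of lines in V = K^n *)

Section Proj.
Context (K : fieldType) (n : nat).
Local Notation S := (mpoly.mpoly n K).
Local Notation L := {fraction S}.

(* P(V) is Proj of the symmetric algebra on the dual of V, i.e. of the
   polynomial ring in the n coordinates on V: its points are the homogeneous
   primes not containing the irrelevant ideal. *)
Record point := Point {
  pt_ideal :> S -> Prop;
  pt_0 : pt_ideal 0;
  pt_D : forall f g, pt_ideal f -> pt_ideal g -> pt_ideal (f + g);
  pt_M : forall f g, pt_ideal g -> pt_ideal (f * g);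
  pt_1 : ~ pt_ideal 1;
  pt_prime : forall f g, pt_ideal (f * g) -> pt_ideal f \/ pt_ideal g;
  pt_homog : forall f d, pt_ideal f -> pt_ideal (pihomog mpoly.mdeg d f);
  pt_relevant : exists i : 'I_n, ~ pt_ideal 'X_i }.

(* Closed sets are the zero loci V(E).  As points are homogeneous ideals,
   E may be any set of polynomials. *)
Definition is_open (U : point -> Prop) : Prop :=
  exists E : S -> Prop, forall p : point, U p <-> exists2 f, E f & ~ p f.

Record opens := Opens {
  in_open :> point -> Prop;
  in_openP : is_open in_open }.

Lemma is_open_basic (f : S) : is_open (fun p : point => ~ p f).
Proof. by exists (eq f) => p; split=> [h|[_ <-]] //; exists f. Qed.

(* D_+(f) for f homogeneous *)
Definition basic_open (f : S) : opens := Opens (is_open_basic f).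

(* P(V) is integral, so its local rings and rings of sections are subrings of
   Frac K[X]: O_p consists of the a/b with a, b homogeneous of the same degree
   and b not in p, and O(U) is the intersection of the O_p for p in U.
   (At U = set0 this gives Frac K[X] instead of 0, which is immaterial since
   sheaves vanish there.) *)
Definition regular_at (p : point) (z : L) : Prop :=
  exists d (a b : S), [/\ a \is d.-homog, b \is d.-homog, ~ p b
                        & z = tofrac a / tofrac b].

Section RegularFunctions.
Variable U : point -> Prop.

Definition regular_pred : {pred L} :=
  fun z => `[< forall p, U p -> regular_at p z >].

Lemma pt_nz (p : point) b : ~ p b -> tofrac b != 0 :> L.
Proof.
by move=> hb; rewrite tofrac_eq0; apply/eqP => b0; apply: hb; rewrite b0; apply: pt_0.
Qed.

Lemma regular_pred_subring_closed : subring_closed regular_pred.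
Proof.
split.
- apply/asboolP => p _; exists 0%N, 1, 1; split; rewrite ?dhomog1 //.
    exact: pt_1.
  by rewrite tofrac1 divr1.
- move=> x y /asboolP hx /asboolP hy; apply/asboolP => p hp.
  have [d [a [b [ha hb pb ->]]]] := hx p hp.
  have [e [a' [b' [ha' hb' pb' ->]]]] := hy p hp.
  exists (d + e)%N, (a * b' - a' * b), (b * b'); split.
  + by rewrite rpredB ?[a' * b]mulrC ?dhomogM.
  + exact: dhomogM.
  + by case/pt_prime.
  + rewrite tofracB !tofracM -mulNr addf_div ?(pt_nz pb) ?(pt_nz pb') //.
    by rewrite mulNr.
- move=> x y /asboolP hx /asboolP hy; apply/asboolP => p hp.
  have [d [a [b [ha hb pb ->]]]] := hx p hp.
  have [e [a' [b' [ha' hb' pb' ->]]]] := hy p hp.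
  exists (d + e)%N, (a * a'), (b * b'); split; rewrite ?dhomogM //.
    by case/pt_prime.
  by rewrite !tofracM mulf_div.
Qed.

HB.instance Definition _ :=
  GRing.isSubringClosed.Build L regular_pred regular_pred_subring_closed.

Definition regring := {z : L | z \in regular_pred}.
HB.instance Definition _ := SubChoice.on regring.
HB.instance Definition _ := [SubChoice_isSubComNzRing of regring by <:].

Lemma const_regular (c : K) : tofrac (mpolyC n c) \in regular_pred.
Proof.
apply/asboolP => p _; exists 0%N, (mpolyC n c), 1; split.
- by rewrite -[mpolyC n c]mulr1 mul_mpolyC dhomogZ // dhomog1.
- exact: dhomog1.
- exact: pt_1.
- by rewrite tofrac1 divr1.
Qed.

Definition const (c : K) : regring := Sub (tofrac (mpolyC n c)) (const_regular c).

Lemma const_zmod_morphism : zmod_morphism const.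
Proof. by move=> a b; apply: val_inj; rewrite /= mpolyCB tofracB. Qed.

Lemma const_monoid_morphism : monoid_morphism const.
Proof.
by split=> [|a b]; apply: val_inj; rewrite /= ?mpolyC1 ?tofrac1 ?mpoly.mpolyCM ?tofracM.
Qed.

HB.instance Definition _ :=
  GRing.isZmodMorphism.Build K regring const const_zmod_morphism.
HB.instance Definition _ :=
  GRing.isMonoidMorphism.Build K regring const const_monoid_morphism.

End RegularFunctions.

Definition local_ring (p : point) := regring (eq p).

(** ** Sheaves of graded O-algebras *)

(* As P(V) is noetherian, the sections over U of a direct sum of sheaves of
   abelian groups are the direct sum of the sections. *)
Record gr_sheaf := GrSheaf {
  sec : forall U : opens, gralg (regring U);
  res : forall U W : opens, (forall p, W p -> U p) -> {rmorphism sec U -> sec W};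
  res_str : forall (U W : opens) (h : forall p, W p -> U p)
      (f : regring U) (g : regring W),
    val f = val g -> res h (str (sec U) f) = str (sec W) g;
  res_deg : forall (U W : opens) (h : forall p, W p -> U p) k s,
    adeg (sec U) k s -> adeg (sec W) k (res h s);
  res_id : forall (U : opens) (h : forall p, U p -> U p) s, res h s = s;
  res_comp : forall (U W Z : opens) (h : forall p, W p -> U p)
      (h' : forall p, Z p -> W p)
      (h'' : forall p, Z p -> U p) s,
    res h' (res h s) = res h'' s;
  sheaf_sep : forall (U : opens) (I : Type) (C : I -> opens)
      (h : forall i p, C i p -> U p), (forall p, U p -> exists i, C i p) ->
    forall s t, (forall i, res (h i) s = res (h i) t) -> s = t;
  sheaf_glue : forall (U : opens) (I : Type) (C : I -> opens)
      (h : forall i p, C i p -> U p), (forall p, U p -> exists i, C i p) ->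
    forall s : (forall i, sec (C i)),
    (forall i j (W : opens) (hi : forall p, W p -> C i p)
        (hj : forall p, W p -> C j p), res hi (s i) = res hj (s j)) ->
    exists t, forall i, res (h i) t = s i }.

(* On each standard chart U_i = Spec R_i the sheaf is the one associated with
   the R_i-module M = F(U_i): for f = a/X_i^d in R_i, the restriction
   F(U_i) -> F(D(f)) is the localization M -> M_f. *)
Definition quasi_coherent (F : gr_sheaf) : Prop :=
  forall (i : 'I_n) d (a : S) (f : regring (basic_open 'X_i)),
    a \is d.-homog -> val f = tofrac a / tofrac ('X_i ^+ d) ->
  forall h : (forall p, basic_open ('X_i * a) p -> basic_open 'X_i p),
    (forall t : sec F (basic_open ('X_i * a)), exists k s,
       res F h (str (sec F _) f) ^+ k * t = res F h s) /\
    (forall s : sec F (basic_open 'X_i), res F h s = 0 ->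
       exists k, str (sec F _) f ^+ k * s = 0).

(* Locally, F is generated as an O-algebra by finitely many sections of degree
   one; its graded components are then coherent.  Without a finiteness
   condition, pushing forward Spec O_x -> P(V) at each closed point separately
   would produce flat quasi-coherent sheaves with arbitrary, unrelated
   fibers. *)
Definition locally_fg_in_degree_one (F : gr_sheaf) : Prop :=
  forall i : 'I_n, exists s : seq (sec F (basic_open 'X_i)),
    (forall y, y \in s -> adeg (sec F (basic_open 'X_i)) 1 y) /\
    generates (fun y : sec F (basic_open 'X_i) => y \in s).

(* the direct limit of F(U) over the open neighbourhoods U of p *)
Record stalk (F : gr_sheaf) (p : point) := Stalk {
  stalk_alg :> gralg (local_ring p);
  germ : forall U : opens, U p -> {rmorphism sec F U -> stalk_alg};
  germ_res : forall (U W : opens) (h : forall q, W q -> U q) (hU : U p)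
      (hW : W p) s, germ hW (res F h s) = germ hU s;
  germ_str : forall (U : opens) (hU : U p) (f : regring U) (g : local_ring p),
    val f = val g -> germ hU (str (sec F U) f) = str stalk_alg g;
  germ_deg : forall (U : opens) (hU : U p) k s,
    adeg (sec F U) k s -> adeg stalk_alg k (germ hU s);
  germ_surj : forall y, exists (U : opens) (hU : U p) s, y = germ hU s;
  germ_eq0 : forall (U : opens) (hU : U p) s, germ hU s = 0 ->
    exists2 W : opens, W p & exists h : (forall q, W q -> U q), res F h s = 0 }.

End Proj.

(** ** Flatness *)

Section Flat.
Context (R : comPzRingType) (M : gralg R).

(* \sum_(p <- s) p.1 (x) p.2 = 0 in N (x)_R M, where M is an R-module through
   its structure map: every R-balanced biadditive map kills the sum. *)
Definition tensor_eq0 (N : lmodType R) (s : seq (N * M)) : Prop :=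
  forall (G : zmodType) (beta : N -> M -> G),
    (forall u u' y, beta (u + u') y = beta u y + beta u' y) ->
    (forall u y y', beta u (y + y') = beta u y + beta u y') ->
    (forall r u y, beta (r *: u) y = beta u (str M r * y)) ->
    \sum_(p <- s) beta p.1 p.2 = 0.

Definition flat : Prop :=
  forall (N' N : lmodType R) (phi : {linear N' -> N}), injective phi ->
  forall s : seq (N' * M),
    tensor_eq0 [seq (phi p.1, p.2) | p <- s] -> tensor_eq0 s.

End Flat.

Definition flat_sheaf (K : fieldType) n (F : gr_sheaf K n) : Prop :=
  forall p : point K n, exists Fp : stalk F p, flat Fp.

(** ** K-rational points and fibers *)

Section RationalPoints.
Context (K : fieldType) (n : nat).
Local Notation S := (mpoly.mpoly n K).

(* The homogeneous ideal of the line Kx.  Homogeneous components are used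
   since over a finite field a polynomial may vanish at all points of Kx
   without belonging to this ideal. *)
Definition line_ideal (x : 'rV[K]_n) (f : S) : Prop :=
  forall d, (pihomog mpoly.mdeg d f).@[x 0] = 0.

(* f(T x), a polynomial in T *)
Definition on_line (x : 'rV[K]_n) (f : S) : {poly K} :=
  mpoly.mmap polyC (fun i => x 0 i *: 'X) f.

Lemma on_line_homog x d f : f \is d.-homog -> on_line x f = f.@[x 0] *: 'X^d.
Proof.
move=> /dhomogP hf; rewrite /on_line /meval /mpoly.mmap scaler_suml.
rewrite big_seq [RHS]big_seq; apply: eq_bigr => u /hf hu.
have {hu} -> : d = (\sum_(i < n) u i)%N by rewrite -hu; exact: mpoly.mdegE.
rewrite mul_polyC -scalerA; congr (_ *: _).
rewrite /mpoly.mmap1 -prodrXr -scaler_prod; apply: eq_bigr => i _.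
by rewrite exprZn.
Qed.

Lemma coef_on_line x f d : (on_line x f)`_d = (pihomog mpoly.mdeg d f).@[x 0].
Proof.
pose k := maxn (mpoly.mmeasure mpoly.mdeg f) d.+1.
rewrite {1}(pihomog_partitionE (leq_maxl _ d.+1 : (_ <= k)%N)).
rewrite [on_line _ _]raddf_sum coef_sum.
rewrite (bigD1 (Ordinal (leq_maxr _ _ : (d < k)%N))) //= big1 => [|j jd].
  by rewrite [mpoly.mmap _ _ _](on_line_homog x (pihomogP _ _ _)) coefZ coefXn eqxx mulr1 addr0.
rewrite [mpoly.mmap _ _ _](on_line_homog x (pihomogP _ _ _)) coefZ coefXn.
case: eqP => [dj|_]; last by rewrite mulr0.
by case/eqP: jd; apply: val_inj.
Qed.

Lemma line_idealE x f : line_ideal x f <-> on_line x f = 0.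
Proof.
split=> [h|h d]; last by rewrite -coef_on_line h coef0.
by apply/polyP => d; rewrite coef_on_line coef0.
Qed.

Lemma on_lineD x f g : on_line x (f + g) = on_line x f + on_line x g.
Proof. exact: raddfD. Qed.

Lemma on_lineM x f g : on_line x (f * g) = on_line x f * on_line x g.
Proof. exact: rmorphM. Qed.

Section KPoint.
Context (x : 'rV[K]_n) (x_neq0 : x != 0).

Lemma line_0 : line_ideal x 0.
Proof. by apply/line_idealE; exact: raddf0. Qed.

Lemma line_D f g : line_ideal x f -> line_ideal x g -> line_ideal x (f + g).
Proof.
move=> /line_idealE hf /line_idealE hg; apply/line_idealE.
by rewrite on_lineD hf hg addr0.
Qed.

Lemma line_M f g : line_ideal x g -> line_ideal x (f * g).
Proof.
by move=> /line_idealE hg; apply/line_idealE; rewrite on_lineM hg mulr0.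
Qed.

Lemma line_1 : ~ line_ideal x 1.
Proof.
move=> /line_idealE; rewrite [on_line _ _]rmorph1 => /eqP.
by rewrite oner_eq0.
Qed.

Lemma line_prime f g :
  line_ideal x (f * g) -> line_ideal x f \/ line_ideal x g.
Proof.
move=> /line_idealE; rewrite on_lineM => /eqP; rewrite mulf_eq0.
by case/orP => /eqP h; [left | right]; apply/line_idealE.
Qed.

Lemma line_homog f d : line_ideal x f -> line_ideal x (pihomog mpoly.mdeg d f).
Proof.
move=> hf; apply/line_idealE; rewrite (on_line_homog x (pihomogP _ _ _)).
by rewrite hf scale0r.
Qed.

Lemma line_relevant : exists i : 'I_n, ~ line_ideal x 'X_i.
Proof.
have /existsP [i xi] : [exists i, x 0 i != 0].
  apply: contraNT x_neq0 => /existsPn h; apply/eqP/rowP => i.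
  by rewrite mxE; apply/eqP; rewrite -[_ == _]negbK h.
exists i => /(_ 1%N); rewrite pihomog_dE; last first.
  by rewrite dhomogX; apply/eqP; exact: mpoly.mdeg1.
by rewrite mevalXU => /eqP; apply/negP.
Qed.

Definition kpoint : point K n :=
  Point line_0 line_D line_M line_1 line_prime line_homog line_relevant.

End KPoint.

(* The fiber F_p / m_p F_p at the K-rational point Kx, as a K-algebra; m_p is
   the set of non-units of O_p. *)
Section Fiber.
Context (F : gr_sheaf K n) (p : point K n) (Fp : stalk F p).

Definition max_ideal (f : local_ring p) : Prop := ~ exists g, f * g = 1.

Definition max_ideal_image (y : Fp) : Prop :=
  exists2 f, max_ideal f & y = str Fp f.

Lemma max_ideal_image_homogeneous : homogeneous_set max_ideal_image.
Proof. by move=> _ [f _ ->]; exists 0; apply: adeg_str. Qed.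

Definition fiber : gralg K :=
  restrict_scalars (@const K n (eq p)) (gquot max_ideal_image_homogeneous).

End Fiber.

Definition has_fiber (F : gr_sheaf K n) (p : point K n) (D : gralg K) : Prop :=
  exists Fp : stalk F p, gralg_iso (fiber Fp) D.

End RationalPoints.

(* Main.v *)
(** Write f_j = <e_j^*, w>, so that A(w) = TV/(f_j), while D_x is obtained by imposing
    f_j = x_j Omega with Omega central.

    Comparing the given resolution of A with the standard one in low degrees, the
    Calabi-Yau hypothesis gives exactness at the left end of
    A^e -> (A^e)^n -> (A^e)^n -> A^e, whose middle map is the noncommutative Hessian of w,
    symmetric because w is a superpotential.  The same exactness kills the obstruction to
    deforming, one power of Omega at a time, the action of the letters on A to operators on
    A[[Omega]] satisfying f_j = x_j Omega; the action obtained in this way shows that Omega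
    is regular in D_x, over any extension of the base field.

    Modulo the regular sequence Omega (x) 1, 1 (x) Omega, the algebra D_x^e becomes A^e.
    With z = Omega (x) 1 - 1 (x) Omega, the complex of ranks 1, 1+n, n+n, n+1, 1 built from
    the differentials of A, the vector x and z is therefore exact, by induction on the
    degree, and it is its own dual under the flip of D_x^e.

    For the converse, lifting the generators to D' gives f_j = x_j Omega' for some x; since
    Omega' is regular, an element of the kernel of D_x -> D' is divisible by all powers of
    Omega, hence is 0.

    The flat family consists of the elements of the extension attached to the generic point
    X over the function field that lie, at each point p, in the O_p-span of the words.
    Where X_i is a unit this O_p-module is free on the elements f_i^k t, the words t running
    over a basis of A; flatness and the description of the fibers follow.
    Quasi-coherence holds because a homogeneous ideal of denominators containing no power
    of X_i a lies in a point of D_+(X_i a). *)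

From HB Require Import structures.
Require Import Defs.
From mathcomp Require Import all_boot all_order all_algebra.
From mathcomp.classical Require Import boolp functions.
From mathcomp.finmap Require Import finmap.
From mathcomp.multinomials Require Import mpoly.
From mathcomp.multinomials Require Import monalg.

Set Implicit Arguments.
Unset Strict Implicit.
Unset Printing Implicit Defensive.

Import Order.TTheory GRing.Theory Num.Theory.
Local Open Scope ring_scope.

(** * Free algebras and quotient maps *)

(** The presentation of D_x gives no lower bound on its size, so regularity of Omega needs a module
    on which Omega visibly acts injectively. Only a left action of the letters is deformed, not the
    product of A, so associativity imposes nothing. If operators X_j solve f_j = x_j Omega up to
    some order with defects R_j, cyclic invariance of w gives sum X_j f_j(X) = sum f_j(X) X_j, hence
    sum [X_j, R_j] = 0: the leading coefficients of the defects form a cocycle, and exactness makes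
    it a coboundary. No limit is taken: an element killed by Omega is shown to be divisible by each
    power of Omega with a solution of finite order.

    Over D_x^e the lifted differentials of A no longer compose to 0, since d2 d1 is z times the
    vector x; the resolution is a cone of z corrected by this defect.

    All sections of the sheaf live in one algebra over the function field, so restrictions to
    non-empty open sets are inclusions and gluing is formal. The content moves to the stalks, where
    the fibers are found by running one rewriting procedure at the generic and at the rational point
    simultaneously. *)

Lemma rmorphism_of (A B : pzRingType) (f : A -> B) :
  zmod_morphism f -> monoid_morphism f -> exists g : {rmorphism A -> B}, g =1 f.
Proof.
move=> fB fM.
pose fa := GRing.isZmodMorphism.Build A B f fB.
pose fm := GRing.isMonoidMorphism.Build A B f fM.
pose g : {rmorphism A -> B} := HB.pack f fa fm.
by exists g.
Qed.

Lemma additive_of (A B : zmodType) (f : A -> B) :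
  zmod_morphism f -> exists g : {additive A -> B}, g =1 f.
Proof.
move=> fB; pose fa := GRing.isZmodMorphism.Build A B f fB.
by exists (HB.pack_for {additive A -> B} f fa).
Qed.

Lemma linear_of (R : pzRingType) (A B : lmodType R) (f : A -> B) :
  zmod_morphism f -> scalable f -> exists g : {linear A -> B}, g =1 f.
Proof.
move=> fB fZ; pose fa := GRing.isZmodMorphism.Build A B f fB.
pose fs := GRing.isScalable.Build R A B *:%R f fZ.
by exists (HB.pack_for {linear A -> B} f fa fs).
Qed.

Section SubgroupQuotient.
Context (V : zmodType) (N : V -> Prop) (N0 : N 0)
  (NB : forall u v, N u -> N v -> N (u - v)).

(** The closure proofs are arguments, so that the subgroup structure can be attached to the
    predicate itself. *)
Definition subgroup_pred of N 0 & (forall u v, N u -> N v -> N (u - v)) :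
  {pred V} := fun v => `[< N v >].
Local Notation P := (subgroup_pred N0 NB).

Lemma subgroup_pred_zmod_closed : zmod_closed P.
Proof. by split=> [|u v /asboolP hu /asboolP hv]; apply/asboolP; auto. Qed.

HB.instance Definition _ :=
  GRing.isZmodClosed.Build V P subgroup_pred_zmod_closed.

Lemma subgroup_quotient : exists (G : zmodType) (p : {additive V -> G}),
  (forall u, p u = 0 <-> N u) /\ (forall y, exists u, y = p u).
Proof.
pose G : zmodType := Quotient.quot P.
have pB : zmod_morphism (fun u : V => \pi_(Quotient.quot P)%qT u : G).
  by move=> u v; rewrite raddfB.
have [p hp] := additive_of pB.
exists G, p; split=> [u|y]; last by exists (repr y); rewrite hp reprK.
rewrite -(raddf0 p) !hp; split=> [/eqP|h].
  by rewrite -Quotient.idealrBE subr0 => /asboolP.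
by apply/eqP; rewrite -Quotient.idealrBE subr0; apply/asboolP.
Qed.

End SubgroupQuotient.

Lemma str_mul (R : comPzRingType) (A : gralg R) c d (a b : A) :
  str A c * a * (str A d * b) = str A (c * d) * (a * b).
Proof. by rewrite rmorphM !mulrA -[str A c * a * _]mulrA -(str_central d a) !mulrA. Qed.

(** A presentation up to graded isomorphism. The algebras [Aw] and [Dw], their analogues over an
    extension field and an arbitrary central extension all enter the proof through such a map. *)
Record quotient_map (K : comPzRingType) (A B : gralg K) (S : A -> Prop)
    (p : {rmorphism A -> B}) : Prop := QuotientMap {
  quotient_str : forall c, p (str A c) = str B c;
  quotient_surj : forall x, exists a, x = p a;
  quotient_ker : forall a, p a = 0 <-> ideal_gen S a;
  quotient_deg : forall k a, adeg A k a -> adeg B k (p a);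
  quotient_deg_lift : forall k x, adeg B k x -> exists2 a, adeg A k a & x = p a }.

Lemma gquot_quotient_map (K : comPzRingType) (A : gralg K) (S : A -> Prop)
    (hS : homogeneous_set S) :
  exists p : {rmorphism A -> gquot hS}, p =1 qpi S /\ quotient_map S p.
Proof.
exists (qpi S : {rmorphism A -> qring S}); split=> //.
split=> //=; first exact: qpi_surj.
  by move=> a; rewrite -(rmorph0 (qpi S)) qpi_eq subr0.
by move=> k a ha; exists a.
Qed.

Lemma quotient_map_lift (K : comPzRingType) (A B : gralg K) (S : A -> Prop)
    (p : {rmorphism A -> B}) (C : pzRingType) (g : {rmorphism A -> C}) :
  quotient_map S p -> (forall s, S s -> g s = 0) ->
  exists h : {rmorphism B -> C}, forall a, h (p a) = g a.
Proof.
move=> hp gS.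
have gI a : ideal_gen S a -> g a = 0.
  elim=> [|b s c x hs _ ih]; first exact: rmorph0.
  by rewrite rmorphD !rmorphM (gS _ hs) mulr0 mul0r add0r.
have /choice [r rE] := quotient_surj hp.
have gE a : g (r (p a)) = g a.
  apply/eqP; rewrite -subr_eq0 -rmorphB; apply/eqP/gI/(quotient_ker hp).
  by rewrite rmorphB -rE subrr.
have hB : zmod_morphism (fun x : B => g (r x)).
  move=> x y; have [a ->] := quotient_surj hp x.
  by have [b ->] := quotient_surj hp y; rewrite -rmorphB !gE rmorphB.
have hM : monoid_morphism (fun x : B => g (r x)).
  split; first by rewrite -(rmorph1 p) gE rmorph1.
  move=> x y; have [a ->] := quotient_surj hp x.
  by have [b ->] := quotient_surj hp y; rewrite -rmorphM !gE rmorphM.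
by have [h hE] := rmorphism_of hB hM; exists h => a; rewrite hE gE.
Qed.

(* Working with an arbitrary T with the properties of TV keeps unification from
   unfolding the monoid algebra. *)
Record free_algebra (K : fieldType) n (T : gralg K) (word : seq 'I_n -> T) :
    Prop := FreeAlgebra {
  word_nil : word [::] = 1;
  word_cat : forall u v, word (u ++ v) = word u * word v;
  word_deg : forall u, adeg T (size u)%:Z (word u);
  word_span : forall P : T -> Prop, P 0 ->
    (forall a b, P a -> P b -> P (a + b)) ->
    (forall c u, P (str T c * word u)) -> forall a, P a;
  word_deg_span : forall (k : nat) (P : T -> Prop), P 0 ->
    (forall a b, P a -> P b -> P (a + b)) ->
    (forall c u, size u = k -> P (str T c * word u)) ->
    forall a, adeg T k%:Z a -> P a;
  word_ext : forall (M : zmodType) (phi : K -> seq 'I_n -> M),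
    (forall u, zmod_morphism (phi^~ u)) ->
    exists f : {additive T -> M}, forall c u, f (str T c * word u) = phi c u }.

Section Words.
Context (K : fieldType) (n : nat).
Local Notation T := (TV K n).

Definition tv_word (u : seq 'I_n) : T := << FMonom u >>.

Lemma tv_word_nil : tv_word [::] = 1.
Proof. by rewrite /tv_word -fmoneE. Qed.

Lemma tv_word_cat u v : tv_word (u ++ v) = tv_word u * tv_word v.
Proof.
rewrite /tv_word [RHS]malgM_def fgmulUU mulr1; congr (<< _ >>).
exact: (esym (fmmulE (FMonom u) (FMonom v))).
Qed.

Lemma monom_word c u : << c *g u >> = str T c * tv_word (fmonom_val u) :> T.
Proof.
by rewrite [RHS]malgM_def fgmulUU mulr1 mul1m fmK.
Qed.

Lemma tv_word_deg u : adeg T (size u)%:Z (tv_word u).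
Proof. exact: tdegU. Qed.

Lemma TV_ind (P : T -> Prop) : P 0 -> (forall a b, P a -> P b -> P (a + b)) ->
  (forall c u, P (str T c * tv_word u)) -> forall a, P a.
Proof.
move=> P0 PD PU a; rewrite [a]monalgE.
by apply: (big_ind P) => // u _; rewrite monom_word.
Qed.

Section Extension.
Context (M : zmodType) (phi : K -> seq 'I_n -> M).

Definition tv_ext (a : T) : M := \sum_(u <- msupp a) phi (mcoeff u a) u.

Context (phiB : forall u, zmod_morphism (phi^~ u)).

Let phi0 u : phi 0 u = 0.
Proof. by have := phiB u 0 0; rewrite !subrr. Qed.

Lemma tv_extEw (d : {fset {fmonom 'I_n}}) (a : T) : (msupp a `<=` d)%fset ->
  tv_ext a = \sum_(u <- d) phi (mcoeff u a) u.
Proof.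
move=> le; rewrite /tv_ext (big_fset_incl _ le) => //= u _ /mcoeff_outdom ->.
exact: phi0.
Qed.

Lemma tv_extB : zmod_morphism tv_ext.
Proof.
move=> a b /=; pose d := (msupp a `|` msupp b)%fset.
rewrite !(@tv_extEw d) ?fsubsetUl ?fsubsetUr ?msuppB_le //.
  by rewrite -sumrB; apply: eq_bigr => u _; rewrite mcoeffB phiB.
Qed.

Lemma tv_extU c u : tv_ext (str T c * tv_word u) = phi c u.
Proof.
have -> : str T c * tv_word u = << c *g FMonom u >> by rewrite monom_word.
by rewrite (tv_extEw msuppU_le) big_seq_fset1 mcoeffUU.
Qed.

End Extension.

Lemma TV_extension (M : zmodType) (phi : K -> seq 'I_n -> M) :
  (forall u, zmod_morphism (phi^~ u)) ->
  exists f : {additive T -> M}, forall c u, f (str T c * tv_word u) = phi c u.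
Proof.
move=> phiB; have [f hf] := additive_of (tv_extB phiB).
by exists f => c u; rewrite hf tv_extU.
Qed.

Lemma TV_free : free_algebra tv_word.
Proof.
split.
- exact: tv_word_nil.
- exact: tv_word_cat.
- exact: tv_word_deg.
- exact: TV_ind.
- move=> k P P0 PD PU a ha; rewrite [a]monalgE big_seq.
  by apply: (big_ind P) => // u /ha [hu]; rewrite monom_word; apply: PU.
- exact: TV_extension.
Qed.

End Words.

Section FreeAlgebraTheory.
Context (K : fieldType) (n : nat) (T : gralg K) (word : seq 'I_n -> T).
Context (hT : free_algebra word).

Lemma word_cons i u : word (i :: u) = word [:: i] * word u.
Proof. by rewrite -(word_cat hT). Qed.

Lemma free_additive_eq (M : zmodType) (f g : {additive T -> M}) :
  (forall c u, f (str T c * word u) = g (str T c * word u)) -> f =1 g.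
Proof.
move=> h; apply: (word_span hT) => [|a b ha hb|//]; first by rewrite !raddf0.
by rewrite !raddfD ha hb.
Qed.

(** The scalars act on [S] through any [s] commuting with the images of the letters; this covers
    algebras over an extension field as well as rings of operators. *)
Lemma free_eval (S : pzRingType) (s : {rmorphism K -> S}) (x : 'I_n -> S) :
  (forall c i, s c * x i = x i * s c) ->
  exists f : {rmorphism T -> S},
    (forall c, f (str T c) = s c) /\ (forall i, f (word [:: i]) = x i).
Proof.
move=> sx; pose phi c u := s c * \prod_(i <- u) x i.
have phiB u : zmod_morphism (phi^~ u).
  by move=> a b /=; rewrite /phi rmorphB mulrBl.
have sxs c u : s c * (\prod_(i <- u) x i) = (\prod_(i <- u) x i) * s c.
  elim: u => [|i u ih]; first by rewrite big_nil mulr1 mul1r.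
  by rewrite big_cons mulrA sx -!mulrA ih.
have [f fE] := word_ext hT phiB.
have f1 : f 1 = 1.
  rewrite -[1]mul1r -{1}(rmorph1 (str T)) -(word_nil hT) fE /phi rmorph1.
  by rewrite big_nil mulr1.
have fM : {morph f : a b / a * b}.
  move=> a b; elim/(word_span hT): a => [|a a' ha ha'|c u].
  - by rewrite mul0r raddf0 mul0r.
  - by rewrite mulrDl !raddfD ha ha' mulrDl.
  elim/(word_span hT): b => [|b b' hb hb'|d v].
  - by rewrite mulr0 raddf0 mulr0.
  - by rewrite mulrDr !raddfD hb hb' mulrDr.
  have -> : str T c * word u * (str T d * word v) = str T (c * d) * word (u ++ v).
    rewrite (mulrA (_ * _) (str T d)) -(mulrA (str T c)) -(str_central d).
    by rewrite rmorphM (word_cat hT) !mulrA.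
  rewrite !fE /phi rmorphM big_cat /=.
  by rewrite -!mulrA; congr (_ * _); rewrite mulrA sxs mulrA.
have [g gE] := rmorphism_of (raddfB f) (conj f1 fM).
exists g; split=> [c|i]; rewrite gE.
  by rewrite -[str T c]mulr1 -(word_nil hT) fE /phi big_nil mulr1.
by rewrite -[word _]mul1r -(rmorph1 (str T)) fE /phi rmorph1 mul1r big_seq1.
Qed.

Lemma free_rmorphism_eq (S : pzRingType) (f g : {rmorphism T -> S}) :
  (forall c, f (str T c) = g (str T c)) ->
  (forall i, f (word [:: i]) = g (word [:: i])) -> f =1 g.
Proof.
move=> hc hi; apply: free_additive_eq => c u.
rewrite [LHS](rmorphM f) [RHS](rmorphM g) hc; congr (_ * _).
elim: u => [|i u ih]; first by rewrite (word_nil hT) !rmorph1.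
by rewrite word_cons (rmorphM f) (rmorphM g) hi ih.
Qed.

End FreeAlgebraTheory.

(** * Enveloping algebras and derivations *)

Lemma homogeneous_part (V : zmodType) (deg : int -> V -> Prop)
    (hdeg : grading deg) k (l : seq (int * V)) :
  deg k (\sum_(q <- l) q.2) -> (forall q, q \in l -> deg q.1 q.2) ->
  \sum_(q <- l) q.2 = \sum_(q <- l | q.1 == k) q.2.
Proof.
set v := \sum_(q <- l) q.2 => hv hl.
pose g j := \sum_(q <- l | q.1 == j) q.2.
have hg j : deg j (g j).
  rewrite /g big_seq_cond; apply: (big_ind (deg j)).
  - exact: deg_0 hdeg _.
  - exact: gradingD hdeg _.
  by move=> q /andP[/hl hq /eqP <-].
pose s := undup (map fst l).
have vs : v = \sum_(j <- s) g j.
  rewrite /g (exchange_big_dep predT) //= /v big_seq [RHS]big_seq.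
  apply: eq_bigr => q hq.
  have -> : \sum_(j <- s | q.1 == j) q.2 = \sum_(j <- s | j == q.1) q.2.
    by apply: eq_bigl => j; rewrite eq_sym.
  rewrite -big_filter filter_pred1_uniq ?undup_uniq ?big_seq1 //.
  by rewrite mem_undup; apply: map_f.
pose f j := if j == k then v else 0.
have hf j : deg j (f j).
  by rewrite /f; case: eqP => [->|_]; [|apply: deg_0 hdeg _].
have e : \sum_(j <- [:: k]) f j = \sum_(j <- s) g j.
  by rewrite big_seq1 /f eqxx vs.
have := grading_uniq hdeg (isT : uniq [:: k]) (undup_uniq _) hf hg e k.
rewrite mem_seq1 eqxx /f eqxx => ->; case: ifP => // hk.
rewrite big_seq_cond big1 // => q /andP[hq /eqP qk].
by move: hk; rewrite mem_undup -qk map_f.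
Qed.

Lemma grading_component (V : zmodType) (deg : int -> V -> Prop) (hdeg : grading deg) :
  exists c : int -> {additive V -> V},
  [/\ forall k v, deg k (c k v), forall k v, deg k v -> c k v = v,
      forall j k v, deg j v -> j != k -> c k v = 0 &
      forall v, (forall k, c k v = 0) -> v = 0].
Proof.
have dec v : exists sf : seq int * (int -> V),
    [/\ uniq sf.1, forall k, deg k (sf.2 k) & v = \sum_(k <- sf.1) sf.2 k].
  by have [s [f h]] := deg_sum hdeg v; exists (s, f).
have [sf hsf] := choice dec.
pose c k v := if k \in (sf v).1 then (sf v).2 k else 0.
have cE v (l : seq (int * V)) k : v = \sum_(q <- l) q.2 ->
    (forall q, q \in l -> deg q.1 q.2) -> c k v = \sum_(q <- l | q.1 == k) q.2.
  move=> vE hl; have [us hf vs] := hsf v.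
  pose g j := \sum_(q <- l | q.1 == j) q.2.
  have hg j : deg j (g j).
    rewrite /g big_seq_cond; apply: (big_ind (deg j)).
    - exact: deg_0 hdeg _.
    - exact: gradingD hdeg _.
    by move=> q /andP[/hl hq /eqP <-].
  have e : \sum_(j <- (sf v).1) (sf v).2 j = \sum_(j <- undup (map fst l)) g j.
    rewrite -vs vE /g (exchange_big_dep predT) //= big_seq [RHS]big_seq.
    apply: eq_bigr => q hq.
    have -> : \sum_(j <- undup (map fst l) | q.1 == j) q.2 =
        \sum_(j <- undup (map fst l) | j == q.1) q.2.
      by apply: eq_bigl => j; rewrite eq_sym.
    rewrite -big_filter filter_pred1_uniq ?undup_uniq ?big_seq1 //.
    by rewrite mem_undup; apply: map_f.
  rewrite /c (grading_uniq hdeg us (undup_uniq _) hf hg e).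
  case: ifP => // hk; rewrite big_seq_cond big1 // => q /andP[hq /eqP qk].
  by move: hk; rewrite mem_undup -qk map_f.
have cdeg k v : deg k (c k v).
  by have [_ hf _] := hsf v; rewrite /c; case: ifP => // _; apply: deg_0 hdeg _.
have csum v : v = \sum_(k <- (sf v).1) c k v.
  have [_ _ vs] := hsf v; rewrite {1}vs; apply: eq_big_seq => k ks.
  by rewrite /c ks.
have cB k : zmod_morphism (c k).
  (* Decompositions of [u] and [- v], concatenated, form one of [u - v], and [cE] computes a
     component from any homogeneous decomposition. *)
  move=> u v; pose l := [seq (j, c j u) | j <- (sf u).1] ++
    [seq (j, - c j v) | j <- (sf v).1].
  rewrite (cE _ l) /l; last 2 first.
  - by rewrite big_cat !big_map /= sumrN -!csum.
  - move=> q; rewrite mem_cat => /orP[] /mapP [j _ ->] //=.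
    exact: gradingN hdeg _ _ (cdeg _ _).
  rewrite big_cat !big_map /= sumrN.
  have cs x : \sum_(j <- (sf x).1 | j == k) c j x = c k x.
    rewrite (cE x [seq (j, c j x) | j <- (sf x).1]) ?big_map //.
    by move=> q /mapP [j _ ->] /=.
  by rewrite !cs.
have /choice [c' c'E] := fun k => additive_of (cB k).
exists c'; split=> [k v|k v hv|j k v hv jk|v h0]; rewrite ?c'E //.
- rewrite (cE v [:: (k, v)]) ?big_seq1 ?big_cons ?big_nil ?eqxx ?addr0 //.
  by move=> q; rewrite inE => /eqP ->.
- rewrite (cE v [:: (j, v)]) ?big_seq1 ?big_cons ?big_nil ?(negbTE jk) //.
  by move=> q; rewrite inE => /eqP ->.
- by rewrite (csum v) big1 // => k _; rewrite -c'E h0.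
Qed.

Section Envelope.
Context (K : fieldType) (A : gralg K) (E : envelope A).
Implicit Types (a b : A) (e : E).

Lemma env_ind (P : E -> Prop) : P 0 -> (forall e e', P e -> P e' -> P (e + e')) ->
  (forall a b, P (tens E a b)) -> forall e, P e.
Proof.
by move=> P0 PD Pt e; have [s ->] := tens_span e; apply: (big_ind P).
Qed.

Lemma tens0l b : tens E 0 b = 0.
Proof. by apply: (addrI (tens E 0 b)); rewrite -tensDl !addr0. Qed.

Lemma tens0r a : tens E a 0 = 0.
Proof. by apply: (addrI (tens E a 0)); rewrite -tensDr !addr0. Qed.

Lemma tensBl a a' b : tens E (a - a') b = tens E a b - tens E a' b.
Proof. by apply: (addIr (tens E a' b)); rewrite -tensDl !subrK. Qed.

Lemma tensBr a b b' : tens E a (b - b') = tens E a b - tens E a b'.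
Proof. by apply: (addIr (tens E a b')); rewrite -tensDr !subrK. Qed.

Lemma tens_splitC a b : tens E a b = tens E 1 b * tens E a 1.
Proof. by rewrite tensM mul1r mul1r. Qed.

Lemma tens_str1 c : tens E (str A c) 1 = tens E 1 (str A c).
Proof. by rewrite -{1}[str A c]mul1r tens_balanced mulr1. Qed.

Lemma tens_suml (r : seq int) f b :
  tens E (\sum_(i <- r) f i) b = \sum_(i <- r) tens E (f i) b.
Proof.
elim: r => [|i r ih]; first by rewrite !big_nil tens0l.
by rewrite !big_cons tensDl ih.
Qed.

Lemma tens_sumr (r : seq int) f a :
  tens E a (\sum_(i <- r) f i) = \sum_(i <- r) tens E a (f i).
Proof.
elim: r => [|i r ih]; first by rewrite !big_nil tens0r.
by rewrite !big_cons tensDr ih.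
Qed.

Lemma env_graded (G : zmodType) (deg : int -> G -> Prop) (t : {additive E -> G})
    (d : int) : grading deg ->
  (forall i j a b, adeg A i a -> adeg A j b -> deg (i + j + d) (t (tens E a b))) ->
  forall k e, adeg E k e -> deg (k + d) (t e).
Proof.
move=> hdeg ht k e.
have [l [-> hl]] : exists l : seq (int * E), e = \sum_(q <- l) q.2 /\
    forall q, q \in l -> adeg E q.1 q.2 /\ deg (q.1 + d) (t q.2).
  elim/env_ind: e => [|e e' [s [-> hs]] [s' [-> hs']]|a b].
  - by exists [::]; rewrite big_nil.
  - exists (s ++ s'); rewrite big_cat; split=> // q.
    by rewrite mem_cat => /orP[/hs|/hs'].
  have [sa [fa [_ ha ->]]] := deg_sum (adegP A) a.
  have [sb [fb [_ hb ->]]] := deg_sum (adegP A) b.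
  exists [seq (i + j, tens E (fa i) (fb j)) | i <- sa, j <- sb]; split.
    rewrite big_allpairs_dep /= tens_suml.
    by apply: eq_bigr => i _; rewrite tens_sumr.
  move=> q /allpairsPdep [i [j [hi hj ->]]] /=.
  by split; [apply: tens_deg | apply: ht].
move=> he; rewrite (homogeneous_part (adegP E) he (fun q hq => proj1 (hl q hq))).
rewrite raddf_sum big_seq_cond; apply: (big_ind (fun g => deg (k + d) g)).
- exact: deg_0 hdeg _.
- exact: gradingD hdeg _.
by move=> q /andP[/hl [_ hq] /eqP <-].
Qed.

(** Transposing a matrix and flipping its entries reverses products. This is how statements on
    columns, in which Ext is computed, become statements on rows, in which resolutions are
    written. *)
Lemma env_flip : exists t : {additive E -> E},
  [/\ forall a b, t (tens E a b) = tens E b a, forall e e', t (e * e') = t e' * t e,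
      forall e, t (t e) = e & forall k e, adeg E k e -> adeg E k (t e)].
Proof.
have [|||t ht] := @tens_universal _ _ E E (fun a b => tens E b a).
- by move=> a a' b; rewrite tensDr.
- by move=> a b b'; rewrite tensDl.
- by move=> a c b; rewrite -str_central -tens_balanced -str_central.
have tD e e' : t (e + e') = t e + t e' by rewrite raddfD.
exists t; split=> //.
- move=> e e'; elim/env_ind: e => [|e1 e2 h1 h2|a b].
  + by rewrite mul0r !raddf0 mulr0.
  + by rewrite mulrDl !tD h1 h2 mulrDr.
  elim/env_ind: e' => [|e1 e2 h1 h2|a' b'].
  + by rewrite mulr0 !raddf0 mul0r.
  + by rewrite mulrDr !tD h1 h2 mulrDl.
  by rewrite tensM !ht tensM.
- apply: env_ind => [|e e' h h'|a b]; first by rewrite !raddf0.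
  + by rewrite !tD h h'.
  + by rewrite !ht.
move=> k e he; rewrite -[k]addr0; apply: (env_graded (adegP E)) he.
by move=> i j a b ha hb; rewrite ht addr0 addrC; apply: tens_deg.
Qed.

End Envelope.

Section UniversalDerivation.
Context (K : fieldType) (n : nat) (T : gralg K) (word : seq 'I_n -> T).
Context (hT : free_algebra word).
Context (A : gralg K) (p : {rmorphism T -> A}).
Context (pstr : forall c, p (str T c) = str A c).
Context (E : envelope A).
Local Notation x i := (p (word [:: i])).

(** The noncommutative partial derivatives: entry i sums, over the occurrences of the letter i, the
    part of the word before it tensored with the part after it. *)
Fixpoint word_der (u : seq 'I_n) : 'rV[E]_n :=
  if u is i :: v then
    tens E 1 (p (word v)) *: delta_mx 0 i + tens E (x i) 1 *: word_der v
  else 0.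

Definition is_der (du : {additive T -> 'rV[E]_n}) : Prop :=
  forall c u, du (str T c * word u) = tens E (str A c) 1 *: word_der u.

Lemma der_exists : exists du, is_der du.
Proof.
apply: (word_ext hT) => u c d /=.
by rewrite rmorphB tensBl scalerBl.
Qed.

Context (du : {additive T -> 'rV[E]_n}) (duE : is_der du).

Lemma der_word u : du (word u) = word_der u.
Proof. by rewrite -[word u]mul1r -(rmorph1 (str T)) duE rmorph1 tens1 scale1r. Qed.

Lemma word_der_cat u v : word_der (u ++ v) =
  tens E 1 (p (word v)) *: word_der u + tens E (p (word u)) 1 *: word_der v.
Proof.
elim: u => [|i u ih] /=.
  by rewrite scaler0 add0r (word_nil hT) rmorph1 tens1 scale1r.
rewrite ih (word_cat hT) (word_cons hT i u) !rmorphM !scalerDr !scalerA addrA !tensM.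
by rewrite !mulr1 !mul1r.
Qed.

Lemma derM a b :
  du (a * b) = tens E 1 (p b) *: du a + tens E (p a) 1 *: du b.
Proof.
elim/(word_span hT): a => [|a a' ha ha'|c u].
- by rewrite mul0r (raddf0 du) (rmorph0 p) tens0l scaler0 scale0r addr0.
- rewrite mulrDl (raddfD du) ha ha' (raddfD du) (rmorphD p) tensDl scalerDr scalerDl.
  by rewrite addrACA.
elim/(word_span hT): b => [|b b' hb hb'|d v].
- by rewrite mulr0 (raddf0 du) (rmorph0 p) tens0r scaler0 scale0r addr0.
- rewrite mulrDr (raddfD du) hb hb' (raddfD du) (rmorphD p) tensDr scalerDr scalerDl.
  by rewrite addrACA.
have -> : str T c * word u * (str T d * word v) = str T (c * d) * word (u ++ v).
  rewrite (mulrA (_ * _) (str T d)) -(mulrA (str T c)) -(str_central d).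
  by rewrite rmorphM (word_cat hT) !mulrA.
rewrite !duE word_der_cat scalerDr !scalerA !rmorphM !pstr /=.
rewrite !tensM !mulr1 !mul1r -tens_balanced.
by rewrite -[str A c * p (word u) * _]mulrA -(str_central d (p _)) mulrA.
Qed.

Lemma der_str c : du (str T c) = 0.
Proof. by rewrite -[str T c]mulr1 -(word_nil hT) duE scaler0. Qed.

Lemma der_letter i : du (word [:: i]) = delta_mx 0 i.
Proof. by rewrite der_word /= (word_nil hT) rmorph1 tens1 scale1r scaler0 addr0. Qed.

Definition koszul1 : 'cV[E]_n := \col_i (tens E (x i) 1 - tens E 1 (x i)).

(** The fundamental formula of free differential calculus: along a word the terms telescope. *)
Lemma der_koszul1 a : du a *m koszul1 = (tens E (p a) 1 - tens E 1 (p a))%:M.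
Proof.
elim/(word_span hT): a => [|a b ha hb|c u].
- by rewrite (raddf0 du) (rmorph0 p) tens0l tens0r subrr mul0mx raddf0.
- rewrite (raddfD du) mulmxDl ha hb -raddfD (rmorphD p) tensDl tensDr opprD.
  by congr (_%:M); exact: addrACA.
have word_d1 v : word_der v *m koszul1 =
    (tens E (p (word v)) 1 - tens E 1 (p (word v)))%:M.
  elim: v => [|i v ih] /=.
    by rewrite (word_nil hT) rmorph1 subrr mul0mx raddf0.
  rewrite mulmxDl -!scalemxAl ih -rowE scale_scalar_mx.
  rewrite (word_cons hT i v) rmorphM.
  apply/matrixP => j k; rewrite !ord1 !mxE eqxx !mulr1n !mulrBr !tensM.
  by rewrite !mulr1 !mul1r addrC addrA subrK.
rewrite duE -scalemxAl word_d1 scale_scalar_mx rmorphM pstr mulrBr !tensM !mul1r.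
by rewrite !mulr1 -tens_balanced mul1r.
Qed.

(* The map [a (x) b |-> (a (x) 1) du b] is well defined modulo [N], and [- id] is
   a homotopy between its composite with [koszul1] and 0. *)
Lemma ker_koszul1 (N : 'rV[E]_n -> Prop) :
  (forall y, exists a, y = p a) -> N 0 ->
  (forall u v, N u -> N v -> N (u + v)) -> (forall e u, N u -> N (e *: u)) ->
  (forall a, p a = 0 -> N (du a)) ->
  forall u, u *m koszul1 = 0 -> N u.
Proof.
move=> psurj N0 ND NZ Nker u.
have NB v v' : N v -> N v' -> N (v - v').
  by move=> hv hv'; apply: ND => //; rewrite -scaleN1r; apply: NZ.
have [G [q [qN _]]] := subgroup_quotient N0 NB.
have /choice [s sE] := psurj.
pose beta a b := q (tens E a 1 *: du (s b)).
have qE v v' : N (v - v') -> q v = q v'.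
  by move=> /qN; rewrite raddfB => /eqP; rewrite subr_eq0 => /eqP.
have [|||g gE] := @tens_universal _ _ E G beta.
- by move=> a a' b; rewrite /beta tensDl scalerDl raddfD.
- move=> a b b'; rewrite /beta -raddfD -scalerDr -raddfD; apply: qE.
  rewrite -scalerBr; apply: NZ; rewrite -raddfB; apply: Nker.
  by rewrite rmorphB rmorphD -!sE subrr.
- move=> a c b; rewrite /beta; apply: qE.
  have -> : tens E (a * str A c) 1 *: du (s b) = tens E a 1 *: du (str T c * s b).
    by rewrite derM der_str scaler0 add0r scalerA tensM mulr1 pstr.
  rewrite -scalerBr; apply: NZ; rewrite -raddfB; apply: Nker.
  by rewrite rmorphB rmorphM pstr -!sE subrr.
have gZ a b i : g ((tens E a b *: (delta_mx 0 i : 'rV[E]_n) *m koszul1) 0 0) =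
    - q (tens E a b *: delta_mx 0 i).
  have -> : (tens E a b *: (delta_mx 0 i : 'rV[E]_n) *m koszul1) 0 0 =
      tens E (a * x i) b - tens E a (x i * b).
    by rewrite -scalemxAl -rowE !mxE mulrBr !tensM !mulr1 !mul1r.
  rewrite raddfB !gE /beta -raddfB -raddfN; apply: qE.
  have -> : tens E (a * x i) 1 *: du (s b) - tens E a 1 *: du (s (x i * b)) -
      - (tens E a b *: delta_mx 0 i) =
      tens E a 1 *: du (word [:: i] * s b - s (x i * b)).
    rewrite raddfB derM der_letter -sE opprK scalerBr scalerDr !scalerA !tensM.
    by rewrite !mulr1 addrAC [X in X - _]addrC.
  by apply: NZ; apply: Nker; rewrite rmorphB rmorphM -!sE subrr.
have gE' v : g ((v *m koszul1) 0 0) = - q v.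
  rewrite [v]row_sum_delta mulmx_suml summxE (raddf_sum g) (raddf_sum q) -sumrN.
  apply: eq_bigr => i _; elim/env_ind: (v 0 i) => [|e e' he he'|a b].
  - by rewrite scale0r mul0mx mxE (raddf0 g) (raddf0 q) oppr0.
  - by rewrite scalerDl mulmxDl mxE (raddfD g) (raddfD q) he he' opprD.
  - exact: gZ.
move=> hu; apply/qN; apply/eqP; rewrite -oppr_eq0 -gE' hu mxE raddf0 //.
Qed.

End UniversalDerivation.

(** * The bimodule complex of a superpotential *)

Section CyclicSums.
Context (K : fieldType) (n m : nat) (w : tensor K n m.+1).
Context (w_sup : superpotential w).

Lemma superpotential_rot k (t : m.+1.-tuple 'I_n) : w [tuple of rot k t] = w t.
Proof.
have w1 (t' : m.+1.-tuple 'I_n) : w [tuple of rot 1 t'] = w t'.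
  by move/ffunP: w_sup => /(_ t'); rewrite ffunE.
elim: k => [|k ih]; first by congr (w _); apply: val_inj; rewrite /= rot0.
have [lt_k|le_k] := ltnP k (size t).
  by rewrite -[RHS]ih -[RHS]w1; congr (w _); apply: val_inj; rewrite /= rotS.
by congr (w _); apply: val_inj; rewrite /= rot_oversize // ltnW.
Qed.

Context (M : zmodType) (g : K -> seq 'I_n -> seq 'I_n -> M).

(** Rotates a cyclic word so that its marked letter, in position k+1, comes first; the old first
    letter lands in position m-k and becomes the marked one. *)
Let h (q : m.+1.-tuple 'I_n * 'I_m) : m.+1.-tuple 'I_n * 'I_m :=
  ([tuple of rot q.2.+1 q.1], rev_ord q.2).

Let hK : involutive h.
Proof.
case=> t k; rewrite /h /=; congr (_, _); last exact: rev_ordK.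
apply: val_inj => /=; have -> : (m - k.+1).+1 = (size (rot k.+1 t) - k.+1)%N.
  by rewrite size_rot size_tuple subSn.
by rewrite -[RHS](rotK k.+1 t).
Qed.

Lemma sum_cons_tuple j (f : m.+1.-tuple 'I_n -> M) :
  \sum_(t : m.-tuple 'I_n) f [tuple of j :: t] =
  \sum_(t : m.+1.-tuple 'I_n | thead t == j) f t.
Proof.
rewrite (reindex_onto (fun t : m.-tuple 'I_n => [tuple of j :: t])
  (fun t => [tuple of behead t])) /=; last first.
  by move=> t /eqP <-; rewrite [RHS]tuple_eta; apply: val_inj.
apply: eq_bigl => t; rewrite theadE eqxx /=; apply/esym/eqP.
by apply: val_inj.
Qed.

(** An occurrence of i in f_j is a pair of letters j, i of a cyclic word, which cut it into two
    arcs. Rotating the word to start at i keeps its coefficient and exchanges the arcs. *)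
Lemma cyclic_hessian i j :
  \sum_(t : m.-tuple 'I_n) \sum_(k < m | tnth t k == i)
     g (w [tuple of j :: t]) (take k t) (drop k.+1 t) =
  \sum_(t : m.-tuple 'I_n) \sum_(k < m | tnth t k == j)
     g (w [tuple of i :: t]) (drop k.+1 t) (take k t).
Proof.
pose f1 i (t : m.+1.-tuple 'I_n) := \sum_(k < m | nth i t k.+1 == i)
  g (w t) (take k (behead t)) (drop k.+1 (behead t)).
pose f2 i (t : m.+1.-tuple 'I_n) := \sum_(k < m | nth i t k.+1 == i)
  g (w t) (drop k.+1 (behead t)) (take k (behead t)).
have -> : \sum_(t : m.-tuple 'I_n) \sum_(k < m | tnth t k == i)
     g (w [tuple of j :: t]) (take k t) (drop k.+1 t) =
    \sum_(t : m.-tuple 'I_n) f1 i [tuple of j :: t].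
  by apply: eq_bigr => t _; apply: eq_bigl => k; rewrite /= (tnth_nth i).
have -> : \sum_(t : m.-tuple 'I_n) \sum_(k < m | tnth t k == j)
     g (w [tuple of i :: t]) (drop k.+1 t) (take k t) =
    \sum_(t : m.-tuple 'I_n) f2 j [tuple of i :: t].
  by apply: eq_bigr => t _; apply: eq_bigl => k; rewrite /= (tnth_nth j).
rewrite !sum_cons_tuple /f1 /f2 !pair_big_dep /=.
rewrite (reindex_inj (inv_inj hK)) /=.
have thE (t : m.+1.-tuple 'I_n) (d : 'I_n) : thead t = nth d t 0.
  by rewrite /thead (tnth_nth d).
apply: eq_big => [[t k]|[t k] _] /=.
  have szt : size t = m.+1 := size_tuple t.
  rewrite andbC (thE _ i) (thE _ j) /=; congr (_ && _).
    rewrite /rot nth_cat size_drop szt subSS subnSK // ltnn subnn.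
    by rewrite nth_take // (set_nth_default j) ?szt.
  rewrite /rot nth_cat size_drop szt subSS subn_gt0 ltn_ord nth_drop addn0.
  by rewrite (set_nth_default j) ?szt ?ltnS.
have [a [tl [et ltl]]] : exists a tl, val t = a :: tl /\ size tl = m.
  by case: t => -[//|a tl] /= stl; exists a, tl; split=> //; case/eqP: stl.
have ltk : (k < size tl)%N by rewrite ltl.
have [b etl] : exists b, tl = take k tl ++ b :: drop k.+1 tl.
  by exists (nth a tl k); rewrite -drop_nth ?cat_take_drop.
rewrite superpotential_rot et /rot /=.
have sk : size (take k tl) = k by rewrite size_takel // ltl ltnW.
have sd : size (drop k.+1 tl) = (m - k.+1)%N by rewrite size_drop ltl.
have -> : behead (drop k tl ++ a :: take k tl) = drop k.+1 tl ++ a :: take k tl.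
  by rewrite {1}etl drop_cat sk ltnn subnn.
congr g; first by rewrite take_cat sd ltnn subnn take0 cats0.
by rewrite drop_cat sd ltnNge leqnSn /= subSnn /= drop0.
Qed.

End CyclicSums.

(** * Projective modules and the comparison of resolutions in low degrees *)

Section LinearAlgebra.
Context (R : pzRingType).

Lemma projective_row k : projective ('rV[R]_k : lmodType R).
Proof.
move=> M N g h gsurj.
have /choice [b bE] : forall i, exists x, g x = h (delta_mx 0 i) by move=> i.
have [||f fE] := @linear_of R 'rV[R]_k M (fun v => \sum_i v 0 i *: b i).
- by move=> u v; rewrite -sumrB; apply: eq_bigr => i _; rewrite !mxE scalerBl.
- by move=> c v; rewrite scaler_sumr; apply: eq_bigr => i _; rewrite mxE scalerA.
exists f => v; rewrite fE linear_sum [v in RHS]row_sum_delta linear_sum.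
by apply: eq_bigr => i _; rewrite !linearZ bE.
Qed.

Lemma mulmxr_linear k l (A : 'M[R]_(k, l)) :
  exists f : {linear 'rV[R]_k -> 'rV[R]_l}, forall v, f v = v *m A.
Proof.
apply: linear_of.
  by move=> u v; exact: mulmxBl.
by move=> c v; rewrite -scalemxAl.
Qed.

Section Image.
Context (X Y : lmodType R) (a : {linear X -> Y}).

Definition image_pred : {pred Y} := fun y => `[< exists x, y = a x >].

Lemma image_submod_closed : submod_closed image_pred.
Proof.
split; first by apply/asboolP; exists 0; rewrite raddf0.
move=> c _ _ /asboolP [x ->] /asboolP [y ->]; apply/asboolP.
by exists (c *: x + y); rewrite linearP.
Qed.

HB.instance Definition _ := GRing.isSubmodClosed.Build R Y image_pred
  image_submod_closed.

Definition image_type := {y : Y | y \in image_pred}.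
HB.instance Definition _ := SubChoice.on image_type.
HB.instance Definition _ := [SubChoice_isSubLmodule of image_type by <:].

(** [projective] lifts along surjections, so [a] is first corestricted to its image. *)
Lemma projective_lift (P : lmodType R) (h : {linear P -> Y}) : projective P ->
  (forall v, exists x, h v = a x) -> exists k : {linear P -> X}, forall v, a (k v) = h v.
Proof.
move=> projP ha.
have ai x : a x \in image_pred by apply/asboolP; exists x.
have hi v : h v \in image_pred by apply/asboolP.
have [||a' a'E] := @linear_of R X image_type (fun x => Sub (a x) (ai x)).
- by move=> u v; apply: val_inj; rewrite /= raddfB.
- by move=> c v; apply: val_inj; rewrite /= linearZ.
have [||h' h'E] := @linear_of R P image_type (fun x => Sub (h x) (hi x)).
- by move=> u v; apply: val_inj; rewrite /= raddfB.
- by move=> c v; apply: val_inj; rewrite /= linearZ.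
have [|k kE] := projP X image_type a' h'.
  by move=> [y yP]; have /asboolP [x e] := yP; exists x; apply: val_inj; rewrite a'E.
by exists k => v; have := congr1 val (kE v); rewrite a'E h'E.
Qed.

End Image.

Lemma linear_combination (X Y : lmodType R) (f g : {linear X -> Y}) :
  exists h : {linear X -> Y}, forall v, h v = f v - g v.
Proof.
have [||h hE] := @linear_of R X Y (fun v => f v - g v); last by exists h.
  by move=> u v /=; rewrite (linearB f) (linearB g) !opprD !opprK addrACA.
by move=> c v; rewrite (linearZ_LR f) (linearZ_LR g) scalerBr.
Qed.

Lemma linear_comp (X Y Z : lmodType R) (f : {linear Y -> Z}) (g : {linear X -> Y}) :
  exists h : {linear X -> Z}, forall v, h v = f (g v).
Proof. by exists (f \o g : {linear X -> Z}). Qed.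

End LinearAlgebra.

Section LowDegreeComparison.
Context (R : pzRingType) (N P0 P1 P2 C0 C1 C2 G : lmodType R).
Context (pe : {linear P0 -> N}) (p1 : {linear P1 -> P0}) (p2 : {linear P2 -> P1}).
Context (ce : {linear C0 -> N}) (c1 : {linear C1 -> C0}) (c2 : {linear C2 -> C1}).
Context (pe_surj : forall y, exists x, y = pe x) (ce_surj : forall y, exists x, y = ce x).
Context (p_exact0 : forall v, pe v = 0 <-> exists u, v = p1 u)
  (c_exact0 : forall v, ce v = 0 <-> exists u, v = c1 u).
Context (p_complex : forall v, p1 (p2 v) = 0)
  (c_exact1 : forall v, c1 v = 0 -> exists u, v = c2 u).
Context (P0_proj : projective P0) (P1_proj : projective P1)
  (C0_proj : projective C0) (C1_proj : projective C1).

(** The comparison theorem is carried out by hand in degrees 0 and 1, because the complex C is known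
    to be exact only at its right end. *)
Lemma comparison_ext0 :
  (forall f : {linear P0 -> G}, (forall u, f (p1 u) = 0) -> forall v, f v = 0) ->
  forall f : {linear C0 -> G}, (forall u, f (c1 u) = 0) -> forall v, f v = 0.
Proof.
move=> ext0 f fc v.
have [phi phiE] := projective_lift P0_proj (fun v => ce_surj (pe v)).
have [psi psiE] := projective_lift C0_proj (fun v => pe_surj (ce v)).
have f_ce u u' : ce u = ce u' -> f u = f u'.
  move=> e; have /c_exact0 [x ex] : ce (u - u') = 0 by rewrite linearB e subrr.
  by apply/eqP; rewrite -subr_eq0 -linearB ex fc.
rewrite (f_ce v (phi (psi v))) ?phiE ?psiE //.
have [fphi fphiE] := linear_comp f phi; rewrite -fphiE; apply: ext0 => u.
rewrite fphiE (f_ce _ 0) ?linear0 // phiE; apply/p_exact0; by exists u.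
Qed.

Lemma comparison_ext1 :
  (forall f : {linear P1 -> G}, (forall u, f (p2 u) = 0) ->
     exists g : {linear P0 -> G}, forall v, f v = g (p1 v)) ->
  forall f : {linear C1 -> G}, (forall u, f (c2 u) = 0) ->
     exists g : {linear C0 -> G}, forall v, f v = g (c1 v).
Proof.
move=> ext1 f fc.
have pep u : pe (p1 u) = 0 by apply/p_exact0; exists u.
have cec u : ce (c1 u) = 0 by apply/c_exact0; exists u.
have [phi0 phi0E] := projective_lift P0_proj (fun v => ce_surj (pe v)).
have [psi0 psi0E] := projective_lift C0_proj (fun v => pe_surj (ce v)).
have [phi0p phi0pE] := linear_comp phi0 p1.
have [psi0c psi0cE] := linear_comp psi0 c1.
have [v|phi1 phi1E] := @projective_lift _ _ _ c1 _ phi0p P1_proj.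
  by apply/c_exact0; rewrite phi0pE phi0E pep.
have [v|psi1 psi1E] := @projective_lift _ _ _ p1 _ psi0c C1_proj.
  by apply/p_exact0; rewrite psi0cE psi0E cec.
have [phipsi phipsiE] := linear_comp phi0 psi0.
have [k kE] := linear_combination phipsi idfun.
have [v|h hE] := @projective_lift _ _ _ c1 _ k C0_proj.
  by apply/c_exact0; rewrite kE linearB phipsiE phi0E psi0E subrr.
have f_c1 u u' : c1 u = c1 u' -> f u = f u'.
  move=> e; have [|x ex] := @c_exact1 (u - u'); first by rewrite linearB e subrr.
  by apply/eqP; rewrite -subr_eq0 -linearB ex fc.
have [fphi fphiE] := linear_comp f phi1.
have [u|g gE] := ext1 fphi.
  rewrite fphiE (f_c1 _ 0) ?linear0 // phi1E phi0pE p_complex linear0 //.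
have [gpsi gpsiE] := linear_comp g psi0.
have [fh fhE] := linear_comp f h.
(* Since [phi0 psi0 - id] is [c1 h], the elements [v] and [phi1 (psi1 v) - h (c1 v)] have the same
   image under [c1], and [f] takes equal values on such elements. The first term is transported
   through P by [g]; the second already factors through [c1]. *)
have [r rE] := linear_combination gpsi fh.
exists r => v; rewrite rE gpsiE fhE -psi0cE -psi1E -gE fphiE -linearB; apply: f_c1.
by rewrite linearB phi1E hE phi0pE psi1E psi0cE kE phipsiE opprB addrCA subrr addr0.
Qed.

End LowDegreeComparison.

Lemma map_scalar_mx_additive (R S : pzRingType) (f : {additive R -> S}) k (a : R) :
  map_mx f (a%:M : 'M_k) = (f a)%:M.
Proof. by apply/matrixP => i j; rewrite !mxE raddfMn. Qed.

Section Multiplication.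
Context (K : fieldType) (A : gralg K) (E : envelope A).

Lemma env_mult : exists mu : {additive E -> A},
  [/\ forall a b, mu (tens E a b) = a * b,
      forall a b e, mu (tens E a b * e) = a * mu e * b &
      forall k e, adeg E k e -> adeg A k (mu e)].
Proof.
have [|||mu muE] := @tens_universal _ _ E A (fun a b => a * b).
- by move=> a a' b; rewrite mulrDl.
- by move=> a b b'; rewrite mulrDr.
- by move=> a c b; rewrite mulrA.
exists mu; split=> // [a b e|k e he].
  elim/env_ind: e => [|e e' he he'|a' b'].
  - by rewrite mulr0 raddf0 mulr0 mul0r.
  - by rewrite mulrDr !raddfD /= he he' mulrDr mulrDl.
  - by rewrite tensM !muE !mulrA.
rewrite -[k]addr0; apply: (env_graded (adegP A)) he => i j a b ha hb.
by rewrite muE addr0; apply: adegM.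
Qed.

Context (mu : {additive E -> A}) (muE : forall a b, mu (tens E a b) = a * b)
  (mu_lin : forall a b e, mu (tens E a b * e) = a * mu e * b).

Let act (e : E) (a : A) : A := mu (e * tens E a 1).

Let actA e e' a : act e (act e' a) = act (e * e') a.
Proof.
rewrite /act -mulrA; move: (e' * _) => y.
elim/env_ind: e => [|e1 e2 h1 h2|b c]; first by rewrite !mul0r.
  by rewrite !mulrDl !raddfD /= h1 h2.
by rewrite !mu_lin muE mulr1.
Qed.

Let act1 : left_id 1 act.
Proof. by move=> a; rewrite /act mul1r muE mulr1. Qed.

Let actDr : right_distributive act +%R.
Proof. by move=> e a b; rewrite /act tensDl mulrDr raddfD. Qed.

Let actDl a : {morph act^~ a : e e' / e + e'}.
Proof. by move=> e e'; rewrite /act mulrDl raddfD. Qed.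

(** The augmentation of a [resolution] is additive and satisfies a bimodule rule. Making A a left
    A^e-module turns it into a linear map, as the comparison lemmas require. *)
Lemma bimodule_exists : exists (N : lmodType E) (f : A -> N) (g : N -> A),
  [/\ cancel f g, cancel g f, zmod_morphism f, zmod_morphism g &
      forall a b y, f (a * y * b) = tens E a b *: f y].
Proof.
pose N : lmodType E := HB.pack_for (lmodType E) (A : Type)
  (GRing.Zmodule.class (A : zmodType))
  (GRing.Zmodule_isLmodule.Build E A actA act1 actDr actDl).
exists N, id, id; split=> // a b y; rewrite /GRing.scale /= /act.
by rewrite mu_lin muE mulr1.
Qed.

End Multiplication.

Section PotentialComplex.
Context (K : fieldType) (n m : nat) (T : gralg K) (word : seq 'I_n -> T).
Context (hT : free_algebra word) (w : tensor K n m.+1).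

Definition potential_rel (j : 'I_n) : T :=
  \sum_(t : m.-tuple 'I_n) str T (w [tuple of j :: t]) * word t.

Definition potential_span (r : T) : Prop :=
  exists c : 'I_n -> K, r = \sum_j str T (c j) * potential_rel j.

Lemma potential_rel_deg j : adeg T m%:Z (potential_rel j).
Proof.
apply: (big_ind (adeg T m%:Z)) => [||t _].
- exact: deg_0 (adegP T) _.
- exact: gradingD (adegP T) _.
- rewrite -[m%:Z]add0r; apply: adegM; first exact: adeg_str.
  by have := word_deg hT t; rewrite size_tuple.
Qed.

Context (A : gralg K) (p : {rmorphism T -> A}).
Context (pstr : forall c, p (str T c) = str A c).
Context (E : envelope A) (du : {additive T -> 'rV[E]_n}) (duE : is_der word p du).

Definition hessian : 'M[E]_n := \matrix_(j, i) du (potential_rel j) 0 i.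

Lemma row_hessian j : row j hessian = du (potential_rel j).
Proof. by apply/rowP => i; rewrite !mxE. Qed.

Lemma hessian_koszul1 : hessian *m koszul1 word p E =
  \col_j (tens E (p (potential_rel j)) 1 - tens E 1 (p (potential_rel j))).
Proof.
apply/colP => j; rewrite [RHS]mxE.
have -> : (hessian *m koszul1 word p E) j 0 =
    row j (hessian *m koszul1 word p E) 0 0 by rewrite [RHS]mxE.
by rewrite row_mul row_hessian (der_koszul1 hT pstr duE) mxE eqxx mulr1n.
Qed.

Lemma word_derE u i : word_der word p E u 0 i =
  \sum_(k < size u | nth i u k == i)
     tens E (p (word (take k u))) (p (word (drop k.+1 u))).
Proof.
elim: u => [|j u ih]; first by rewrite big_ord0 mxE.
rewrite [RHS]big_mkcond [RHS]big_ord_recl /= !mxE ih drop0 (word_nil hT) rmorph1.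
congr (_ + _); first by rewrite eq_sym /=; case: eqP; rewrite ?mulr1 ?mulr0.
rewrite big_mkcond mulr_sumr; apply: eq_bigr => k _ /=.
case: ifP => _; last exact: mulr0.
by rewrite tensM mulr1 -rmorphM -(word_cons hT).
Qed.

Lemma hessianE j i : hessian j i =
  \sum_(t : m.-tuple 'I_n) \sum_(k < m | tnth t k == i)
    tens E (str A (w [tuple of j :: t]) * p (word (take k t)))
           (p (word (drop k.+1 t))).
Proof.
rewrite mxE /potential_rel raddf_sum summxE; apply: eq_bigr => t _.
rewrite duE mxE word_derE mulr_sumr size_tuple.
apply: eq_big => [k|k _]; first by rewrite (tnth_nth i).
by rewrite tensM mulr1.
Qed.

Context (flip : {additive E -> E}) (flipE : forall a b, flip (tens E a b) = tens E b a)
  (flipM : forall e e', flip (e * e') = flip e' * flip e)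
  (flipK : forall e, flip (flip e) = e).

Lemma hessian_sym (w_sup : superpotential w) i j : flip (hessian i j) = hessian j i.
Proof.
pose g c a b := tens E (str A c * p (word a)) (p (word b)).
rewrite !hessianE raddf_sum (cyclic_hessian w_sup g i j).
apply: eq_bigr => t _; rewrite raddf_sum; apply: eq_bigr => k _ /=.
by rewrite flipE /g -tens_balanced -str_central.
Qed.

Lemma flip_mulmx a b c (M : 'M[E]_(a, b)) (N : 'M[E]_(b, c)) :
  map_mx flip (M *m N)^T = map_mx flip N^T *m map_mx flip M^T.
Proof.
apply/matrixP => i j; rewrite !mxE raddf_sum; apply: eq_bigr => k _ /=.
by rewrite flipM !mxE.
Qed.

Lemma flip_mx_inj a b (M N : 'M[E]_(a, b)) : map_mx flip M = map_mx flip N -> M = N.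
Proof.
move=> e; apply/matrixP => i j; have := congr1 (fun M : 'M_(_, _) => M i j) e.
by rewrite !mxE => /(congr1 flip); rewrite !flipK.
Qed.

Lemma flip_koszul1 : map_mx flip (koszul1 word p E)^T = - (koszul1 word p E)^T.
Proof. by apply/rowP => i; rewrite !mxE raddfB /= !flipE opprB. Qed.

Lemma flip_hessian (w_sup : superpotential w) : map_mx flip hessian^T = hessian.
Proof. by apply/matrixP => i j; rewrite mxE [X in flip X]mxE (hessian_sym w_sup). Qed.

Context (mu : {additive E -> A}) (muE : forall a b, mu (tens E a b) = a * b).

Lemma mult_koszul1 (v : 'rV[E]_n) : mu ((v *m koszul1 word p E) 0 0) = 0.
Proof.
rewrite mxE raddf_sum big1 // => i _; rewrite mxE mulrBr.
elim/env_ind: (v 0 i) => [|e e' he he'|a b].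
- by rewrite !mul0r subrr raddf0.
- by rewrite !mulrDl opprD addrACA raddfD /= he he' addr0.
- by rewrite !tensM raddfB /= !muE mulr1 mul1r mulrA subrr.
Qed.

(** The difference of [a (x) b] and [ab (x) 1] is [-(a (x) 1)(b (x) 1 - 1 (x) b)], whose last factor
    is the derivative of a lift of [b] times [koszul1]. *)
Lemma ker_mult (psurj : forall a, exists b, a = p b) e :
  mu e = 0 -> exists v : 'rV_n, e%:M = v *m koszul1 word p E.
Proof.
have [v] : exists v, (e - tens E (mu e) 1)%:M = v *m koszul1 word p E.
  elim/env_ind: e => [|e e' [v hv] [v' hv']|a b].
  - by exists 0; rewrite raddf0 tens0l subrr raddf0 mul0mx.
  - exists (v + v'); rewrite mulmxDl -hv -hv' -raddfD; congr (_%:M).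
    by rewrite raddfD /= tensDl opprD addrACA.
  have [b' bE] := psurj b; exists (- (tens E a 1 *: du b')).
  rewrite mulNmx -scalemxAl (der_koszul1 hT pstr duE) -bE scale_scalar_mx -raddfN.
  by rewrite mulrBr !tensM !mulr1 opprB muE.
by move=> hv e0; exists v; rewrite -hv e0 tens0l subr0.
Qed.

(** By the Leibniz rule the derivative of [b r c] is [b (x) c] times that of [r], the other terms
    containing [p r = 0]; and the derivative of [r] is a combination of rows of the Hessian. *)
Lemma hessian_ideal
    (pker : forall a, p a = 0 -> ideal_gen potential_span a)
    (prel : forall j, p (potential_rel j) = 0) a :
  p a = 0 -> exists v, du a = v *m hessian.
Proof.
move=> /pker; elim=> [|b _ c y [d ->] _ [v hv]]; first by exists 0; rewrite raddf0 mul0mx.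
have der_rel : exists v, du (\sum_j str T (d j) * potential_rel j) = v *m hessian.
  exists (\row_j tens E (str A (d j)) 1); rewrite raddf_sum mulmx_sum_row.
  apply: eq_bigr => j _ /=; rewrite (derM hT pstr duE) (der_str hT duE) scaler0 add0r.
  by rewrite mxE row_hessian pstr.
have p_rel : p (\sum_j str T (d j) * potential_rel j) = 0.
  by rewrite rmorph_sum big1 // => j _; rewrite rmorphM prel mulr0.
move: der_rel p_rel; set r := \sum_j _ => -[v' hv'] r0.
exists (tens E (p b) (p c) *: v' + v); rewrite mulmxDl -hv -scalemxAl -hv' raddfD /=.
congr (_ + _); rewrite !(derM hT pstr duE) rmorphM r0 mulr0 tens0l scale0r addr0.
by rewrite tens0r scale0r add0r scalerA -tens_splitC.
Qed.

End PotentialComplex.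

(** * Exactness at the left end from the Calabi-Yau condition *)

Section CalabiYauExactness.
Context (K : fieldType) (n m : nat) (T : gralg K) (word : seq 'I_n -> T).
Context (hT : free_algebra word) (w : tensor K n m.+1) (w_sup : superpotential w).
Context (A : gralg K) (p : {rmorphism T -> A}).
Context (pstr : forall c, p (str T c) = str A c).
Context (psurj : forall a, exists b, a = p b)
    (pker : forall a, p a = 0 -> ideal_gen (potential_span word w) a)
    (prel : forall j, p (potential_rel word w j) = 0).
Context (E : envelope A) (du : {additive T -> 'rV[E]_n}) (duE : is_der word p du).
Context (P : resolution E) (ext0 : ext_zero P 0) (ext1 : ext_zero P 1).
Local Notation d1 := (koszul1 word p E).
Local Notation d2 := (hessian word w du).

(** By comparison, the vanishing of Ext^0 and Ext^1 holds for [d1], [d2] too. On columns it says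
    that [d1] times a scalar vanishes only for the scalar 0 and that the kernel of [d2] consists of
    multiples of [d1]. Transposition and flip send [d1] to [- d1^T] and fix [d2], because w is a
    superpotential; this gives the two statements on rows. *)
Lemma calabi_yau_exact :
  (forall e : E, e *: d1^T = 0 -> e = 0) /\
  (forall v : 'rV[E]_n, v *m d2 = 0 -> exists e : E, v = e *: d1^T).
Proof.
have [flip [flipE flipM flipK _]] := env_flip E.
have [mu [muE mu_lin _]] := env_mult E.
have [N [nf [ng [nfK ngK nfB ngB nf_lin]]]] := bimodule_exists muE mu_lin.
have [nfa nfaE] := additive_of nfB; have [nga ngaE] := additive_of ngB.
have mu1 a : mu (tens E a 1) = a by rewrite muE mulr1.
have nf0 : nf 0 = 0 by rewrite -nfaE raddf0.
have nf_eq0 a : nf a = 0 -> a = 0 by rewrite -nf0 => /(can_inj nfK).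
have nfD a b : nf (a + b) = nf a + nf b by rewrite -!nfaE raddfD.
have N_lin (X : lmodType E) (f : X -> A) : zmod_morphism f ->
    (forall a b v, f (tens E a b *: v) = a * f v * b) ->
    exists g : {linear X -> N}, forall v, g v = nf (f v).
  move=> fB flin; have [fa faE] := additive_of fB.
  apply: linear_of => [u v /=|e v]; first by rewrite fB nfB.
  elim/env_ind: e => [|e e' he he'|a b].
  - by rewrite !scale0r -faE raddf0.
  - by rewrite !scalerDl -he -he' -nfD -!faE raddfD.
  - by rewrite flin nf_lin.
have [pe peE] := N_lin _ _ (raddfB (raug P)) (@raug_lin _ _ _ P).
have [||ce ceE] := N_lin 'rV[E]_1 (fun v => mu (v 0 0)).
- by move=> u v /=; rewrite !mxE raddfB.
- by move=> a b v; rewrite mxE mu_lin.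
have [c1 c1E] := mulmxr_linear d1; have [c2 c2E] := mulmxr_linear d2.
have scalE (v : 'rV[E]_1) : v = (v 0 0)%:M by rewrite -mx11_scalar.
have pe_surj y : exists x, y = pe x.
  by have [v hv] := raug_surj P (ng y); exists v; rewrite peE hv ngK.
have ce_surj y : exists x, y = ce x.
  by exists (tens E (ng y) 1)%:M; rewrite ceE mxE eqxx mulr1n mu1 ngK.
have p_exact0 v : pe v = 0 <-> exists u, v = rdiff P 0 u.
  rewrite -rexact0 peE; split=> [/nf_eq0|->] //.
have c_exact0 v : ce v = 0 <-> exists u, v = c1 u.
  rewrite ceE; split=> [/nf_eq0 /(ker_mult hT pstr duE muE psurj) [u hu]|[u ->]].
    by exists u; rewrite c1E -hu.
  by rewrite c1E mult_koszul1.
have p_complex v : rdiff P 0 (rdiff P 1 v) = 0 by apply/rexact; exists v.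
have c_complex : d2 *m d1 = 0.
  rewrite (hessian_koszul1 hT w pstr duE); apply/colP => j.
  by rewrite !mxE prel tens0l tens0r subrr.
have c_exact1 v : c1 v = 0 -> exists u, v = c2 u.
  rewrite c1E; apply: (ker_koszul1 hT pstr duE (N := fun u => exists x, u = c2 x) psurj).
  - by exists 0; rewrite raddf0.
  - by move=> u u' [x ->] [y ->]; exists (x + y); rewrite raddfD.
  - by move=> e u [x ->]; exists (e *: x); rewrite linearZ.
  move=> a /(hessian_ideal hT pstr duE pker prel) [u hu].
  by exists u; rewrite c2E.
have H0 := comparison_ext0 (G := E^o) pe_surj ce_surj p_exact0 c_exact0
  (@rproj _ _ _ P 0) (@projective_row E 1) ext0.
have H1 := comparison_ext1 (G := E^o) pe_surj ce_surj p_exact0 c_exact0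
  p_complex c_exact1 (@rproj _ _ _ P 0) (@rproj _ _ _ P 1) (@projective_row E 1)
  (@projective_row E n) ext1.
have fl1 : map_mx flip d1^T = - d1^T by apply: flip_koszul1.
have fl2 : map_mx flip d2^T = d2 by apply: flip_hessian flipE w_sup.
have fmap a b (M : 'M[E]_(a, b)) : map_mx flip (map_mx flip M) = M.
  by apply/matrixP => i j; rewrite !mxE flipK.
split=> [e he|v hv].
  have he' : d1 *m (flip e)%:M = 0.
    apply: (can_inj (@trmxK _ _ _)); apply: (flip_mx_inj flipK).
    rewrite (flip_mulmx flipM) fl1 tr_scalar_mx map_scalar_mx_additive /= flipK.
    by rewrite mulmxN mul_scalar_mx he oppr0 trmx0 map_mx0.
  have [f fE] := mulmxr_linear ((flip e)%:M : 'M[E]_1).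
  have [||g gE] := @linear_of _ 'rV[E]_1 E^o (fun v => f v 0 0).
  - by move=> u v; rewrite raddfB !mxE.
  - by move=> c v; rewrite linearZ mxE.
  have := H0 g; rewrite -(flipK e) => /(_ _ (1%:M)).
  rewrite gE fE mul1mx mxE eqxx mulr1n => ->; first exact: raddf0.
  by move=> u; rewrite gE fE c1E -mulmxA he' mulmx0 mxE.
have hv' : d2 *m map_mx flip v^T = 0.
  apply: (can_inj (@trmxK _ _ _)); apply: (flip_mx_inj flipK).
  by rewrite (flip_mulmx flipM) fl2 map_trmx trmxK fmap hv trmx0 map_mx0.
have [f fE] := mulmxr_linear (map_mx flip v^T).
have [||g gE] := @linear_of _ 'rV[E]_n E^o (fun v => f v 0 0).
- by move=> u u'; rewrite raddfB !mxE.
- by move=> c u; rewrite linearZ mxE.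
have [u|k kE] := H1 g; first by rewrite gE fE c2E -mulmxA hv' mulmx0 mxE.
have vE : map_mx flip v^T = d1 *m (k 1%:M)%:M.
  apply/colP => i; have := kE (delta_mx 0 i).
  rewrite gE fE -rowE c1E -rowE [LHS]mxE => ->.
  have -> : row i d1 = d1 i 0 *: (1%:M : 'rV[E]_1).
    by rewrite scalemx1 [LHS]mx11_scalar mxE.
  by rewrite linearZ [RHS]mxE big_ord1 [(k _)%:M 0 0]mxE eqxx mulr1n.
exists (- flip (k 1%:M)); rewrite scaleNr -scalerN -fl1 -mul_scalar_mx.
have -> : (flip (k 1%:M))%:M = map_mx flip ((k 1%:M)%:M : 'M_1)^T.
  by rewrite tr_scalar_mx map_scalar_mx_additive.
rewrite -(flip_mulmx flipM) -vE map_trmx trmxK fmap.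
by [].
Qed.

End CalabiYauExactness.

(** * Normal forms and deformations *)

Section NormalForms.
Context (K : fieldType) (n : nat) (T : gralg K) (word : seq 'I_n -> T).
Context (hT : free_algebra word) (A : gralg K) (S : T -> Prop)
  (p : {rmorphism T -> A}) (hp : quotient_map S p).
Local Notation wd u := (p (word u)).

Lemma independent_words (l : seq (seq 'I_n)) : exists b : seq (seq 'I_n),
  [/\ uniq b, {subset b <= l},
      forall c, \sum_(t <- b) str A (c t) * wd t = 0 -> forall t, t \in b -> c t = 0 &
      forall u, u \in l -> exists c, wd u = \sum_(t <- b) str A (c t) * wd t].
Proof.
elim: l => [|u l [b [ub sb ib gb]]]; first by exists [::].
have [[c hc]|nspan] := pselect (exists c, wd u = \sum_(t <- b) str A (c t) * wd t).
  exists b; split=> // [t /sb tl|v]; first by rewrite inE tl orbT.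
  by rewrite inE => /orP[/eqP ->|/gb //]; exists c.
have uNb : u \notin b.
  apply/negP => hu; apply: nspan; exists (fun t => (t == u)%:R).
  rewrite (bigD1_seq u) //= eqxx rmorph1 mul1r big1 ?addr0 // => t /negbTE ->.
  by rewrite rmorph0 mul0r.
exists (u :: b); split=> [||c|v].
- by rewrite /= uNb.
- by move=> t; rewrite !inE => /orP[->//|/sb ->]; rewrite orbT.
- rewrite big_cons => hc; have cu : c u = 0.
    apply/eqP/negP => /negP cu; apply: nspan; exists (fun t => - (c u)^-1 * c t).
    have -> : wd u = str A (c u)^-1 * (str A (c u) * wd u).
      by rewrite mulrA -rmorphM mulVf // rmorph1 mul1r.
    move/eqP: hc; rewrite addr_eq0 => /eqP ->; rewrite mulrN mulr_sumr -sumrN.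
    by apply: eq_bigr => t _; rewrite rmorphM rmorphN mulNr mulrA mulNr.
  move: hc; rewrite cu rmorph0 mul0r add0r => /ib hc t.
  by rewrite inE => /orP[/eqP ->|/hc].
- rewrite inE => /orP[/eqP ->|/gb [c hc]].
    exists (fun t => (t == u)%:R); rewrite big_cons eqxx rmorph1 mul1r.
    rewrite big_seq big1 ?addr0 // => t tb; case: eqP => [tu|_]; last by rewrite rmorph0 mul0r.
    by rewrite -tu tb in uNb.
  exists (fun t => if t == u then 0 else c t).
  rewrite big_cons eqxx rmorph0 mul0r add0r hc; apply: eq_big_seq => t tb.
  by case: eqP => // tu; rewrite -tu tb in uNb.
Qed.

Lemma ker_homogeneous (P : T -> Prop) : P 0 -> (forall a b, P a -> P b -> P (a + b)) ->
  (forall (k : nat) a, adeg T k%:Z a -> p a = 0 -> P a) -> forall a, p a = 0 -> P a.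
Proof.
move=> P0 PD Ph a; have [s [f [us hf ->]]] := deg_sum (adegP T) a.
rewrite rmorph_sum => h0; rewrite big_seq; apply: big_ind => // k ks.
have pf0 := deg_free (adegP A) us (fun k => quotient_deg hp (hf k)) h0 ks.
by case: k (hf k) ks pf0 => [k|k] hk _ pf; [apply: Ph hk pf | rewrite (adegN _ hk)].
Qed.

(** [e t u] is the coefficient of [t] in the normal form of [u]. Independence is expressed by
    coordinate functionals on the free algebra that vanish on the ideal, a form that passes to an
    extension field at once. *)
Definition is_basis (b : nat -> seq (seq 'I_n)) (e : seq 'I_n -> seq 'I_n -> K) : Prop :=
  [/\ forall q t, t \in b q -> size t = q,
      forall u, wd u = \sum_(t <- b (size u)) str A (e t u) * wd t,
      forall t u, t \notin b (size u) -> e t u = 0 &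
      forall t, exists f : {additive T -> K},
        (forall c u, f (str T c * word u) = c * e t u) /\ (forall a, p a = 0 -> f a = 0)].

Lemma basis_exists : exists b e,
  is_basis b e /\ (forall q, uniq (b q)) /\
  (forall q t t', t \in b q -> t' \in b q -> e t t' = (t == t')%:R).
Proof.
have /choice [b hb] : forall q, exists b : seq (seq 'I_n),
    [/\ uniq b, {subset b <= [seq val t | t : q.-tuple 'I_n]},
      forall c, \sum_(t <- b) str A (c t) * wd t = 0 -> forall t, t \in b -> c t = 0 &
      forall u, u \in [seq val t | t : q.-tuple 'I_n] ->
        exists c, wd u = \sum_(t <- b) str A (c t) * wd t].
  by move=> q; apply: independent_words.
have words_q u : u \in [seq val t | t : (size u).-tuple 'I_n].
  by apply/mapP; exists (in_tuple u); rewrite ?mem_enum.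
have bsize q t : t \in b q -> size t = q.
  by have [_ sb _ _] := hb q => /sb /mapP [t' _ ->]; rewrite size_tuple.
have ind q c : \sum_(t <- b q) str A (c t) * wd t = 0 ->
  forall t, t \in b q -> c t = 0 by have [_ _ ib _] := hb q; apply: ib.
have /choice [c hc] : forall u, exists c,
    wd u = \sum_(t <- b (size u)) str A (c t) * wd t.
  by move=> u; have [_ _ _] := hb (size u); apply.
pose e t u := if t \in b (size u) then c u t else 0.
have he u : wd u = \sum_(t <- b (size u)) str A (e t u) * wd t.
  by rewrite hc; apply: eq_big_seq => t tb; rewrite /e tb.
have e0 t u : t \notin b (size u) -> e t u = 0 by rewrite /e => /negbTE ->.
have ext t : exists f : {additive T -> K}, forall d u, f (str T d * word u) = d * e t u.
  by apply: (word_ext hT) => u x y /=; rewrite mulrBl.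
exists b, e; split; [split=> // t | split=> [q|q t t' tb tb']]; last 2 first.
- by have [] := hb q.
- have h0 : \sum_(s <- b q) str A (e s t' - (s == t')%:R) * wd s = 0.
    under eq_bigr => s _ do rewrite rmorphB mulrBl.
    rewrite sumrB -{1}(bsize _ _ tb') -he.
    have [ub _ _ _] := hb q; rewrite (bigD1_seq t') //= eqxx rmorph1 mul1r.
    by rewrite big1 ?addr0 ?subrr // => s /negbTE ->; rewrite rmorph0 mul0r.
  by apply/eqP; rewrite -subr_eq0; apply/eqP; apply: ind h0 t tb.
have [f fE] := ext t; exists f; split=> //.
apply: ker_homogeneous => [|a a' ha ha'|q a ha pa]; first exact: raddf0.
  by rewrite raddfD /= ha ha' addr0.
have [tb|tb] := boolP (t \in b q); last first.
  elim/(word_deg_span hT): _ / ha => [|a1 a2 h1 h2|d u hu]; first exact: raddf0.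
    by rewrite raddfD /= h1 h2 addr0.
  by rewrite fE e0 ?mulr0 // hu.
have /choice [g gE] := ext.
have : p a = \sum_(s <- b q) str A (g s a) * wd s.
  elim/(word_deg_span hT): _ / ha {pa} => [|a1 a2 h1 h2|d u hu].
  - by rewrite rmorph0 big1 // => s _; rewrite raddf0 rmorph0 mul0r.
  - rewrite rmorphD h1 h2 -big_split; apply: eq_bigr => s _.
    by rewrite raddfD rmorphD mulrDl.
  - rewrite rmorphM (quotient_str hp) he mulr_sumr hu; apply: eq_bigr => s _.
    by rewrite gE rmorphM mulrA.
rewrite pa => /esym /ind /(_ t tb) <-.
suff h : f =1 g t by rewrite h.
by apply: (free_additive_eq hT) => d u; rewrite fE gE.
Qed.

Lemma basis_section b e : is_basis b e -> exists s : {additive A -> T},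
  [/\ forall c x, s (str A c * x) = str T c * s x, forall x, p (s x) = x &
      forall u, s (p (word u)) = \sum_(t <- b (size u)) str T (e t u) * word t].
Proof.
case=> bsize be e0 /choice [g hg].
have [nf nfE] : exists nf : {additive T -> T}, forall c u,
    nf (str T c * word u) = \sum_(t <- b (size u)) str T (c * e t u) * word t.
  apply: (word_ext hT) => u c d /=; rewrite -sumrB; apply: eq_bigr => t _.
  by rewrite mulrBl rmorphB mulrBl.
have nfZ c a : nf (str T c * a) = str T c * nf a.
  elim/(word_span hT): a => [|a a' h h'|d u].
  - by rewrite mulr0 !raddf0 mulr0.
  - by rewrite mulrDr !(raddfD nf) h h' mulrDr.
  rewrite mulrA -rmorphM !nfE mulr_sumr; apply: eq_bigr => t _.
  by rewrite mulrA -rmorphM mulrA.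
have pnf a : p (nf a) = p a.
  elim/(word_span hT): a => [|a a' h h'|d u].
  - by rewrite raddf0.
  - by rewrite (raddfD nf) !rmorphD h h'.
  rewrite nfE rmorphM be rmorph_sum mulr_sumr; apply: eq_bigr => t _.
  by rewrite !rmorphM !(quotient_str hp) mulrA.
have nf_ker a : p a = 0 -> nf a = 0.
  apply: (ker_homogeneous (P := fun a => nf a = 0)) => {a} [|a a' h h'|q a ha pa]; first exact: raddf0.
    by rewrite raddfD /= h h' addr0.
  have -> : nf a = \sum_(t <- b q) str T (g t a) * word t.
    elim/(word_deg_span hT): _ / ha {pa} => [|x x' h h'|c u <-].
    - by rewrite raddf0 big1 // => t _; rewrite raddf0 rmorph0 mul0r.
    - rewrite raddfD /= h h' -big_split; apply: eq_bigr => t _.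
      by rewrite (raddfD (g t)) rmorphD mulrDl.
    - by rewrite nfE; apply: eq_bigr => t _; rewrite (proj1 (hg t)).
  by rewrite big1 // => t _; rewrite (proj2 (hg t)) // rmorph0 mul0r.
have /choice [r rE] := quotient_surj hp.
have nf_eq a a' : p a = p a' -> nf a = nf a'.
  move=> h; apply/eqP; rewrite -subr_eq0 -raddfB nf_ker //.
  by rewrite rmorphB h subrr.
have [|s sE] := @additive_of A T (fun x => nf (r x)).
  move=> x y /=; rewrite -raddfB; apply: nf_eq.
  by rewrite rmorphB -!rE.
exists s; split=> [c x|x|u]; rewrite !sE.
- by rewrite -nfZ; apply: nf_eq; rewrite rmorphM (quotient_str hp) -!rE.
- by rewrite pnf -rE.
- rewrite -[RHS](_ : nf (word u) = _); first by apply: nf_eq; rewrite -rE.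
  rewrite -[word u]mul1r -(rmorph1 (str T)) nfE.
  by apply: eq_bigr => t _; rewrite mul1r.
Qed.

End NormalForms.

Section PotentialIdeal.
Context (K : fieldType) (n m : nat) (T : gralg K) (word : seq 'I_n -> T).
Context (hT : free_algebra word) (w : tensor K n m.+1).
Local Notation f := (potential_rel word w).

Definition rel_term (q : K * (seq 'I_n * 'I_n * seq 'I_n)) : T :=
  str T q.1 * (word q.2.1.1 * f q.2.1.2 * word q.2.2).

Lemma rel_term_deg q : adeg T (size q.2.1.1 + m + size q.2.2)%:Z (rel_term q).
Proof.
rewrite -[_%:Z]add0r !PoszD; apply: adegM; first exact: adeg_str.
by apply: adegM; [apply: adegM; [apply: word_deg | apply: potential_rel_deg]
  | apply: word_deg].
Qed.

Lemma ideal_rel_terms a : ideal_gen (potential_span word w) a ->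
  exists l, a = \sum_(q <- l) rel_term q.
Proof.
elim=> {a} [|x _ y z [c ->] _ [l ->]]; first by exists [::]; rewrite big_nil.
suff [l' ->] : exists l', x * (\sum_j str T (c j) * f j) * y = \sum_(q <- l') rel_term q.
  by exists (l' ++ l); rewrite big_cat.
have add a b : (exists l, a = \sum_(q <- l) rel_term q) ->
    (exists l, b = \sum_(q <- l) rel_term q) ->
    exists l, a + b = \sum_(q <- l) rel_term q.
  by move=> [l1 ->] [l2 ->]; exists (l1 ++ l2); rewrite big_cat.
have nul : exists l, 0 = \sum_(q <- l) rel_term q by exists [::]; rewrite big_nil.
elim/(word_span hT): x => [|x x' h h'|d u]; first by rewrite !mul0r.
  by rewrite !mulrDl; apply: add.
elim/(word_span hT): y => [|y y' h h'|d' v]; first by rewrite mulr0.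
  by rewrite mulrDr; apply: add.
exists [seq (d * d' * c j, (u, j, v)) | j <- enum 'I_n].
rewrite big_map big_enum /= mulr_sumr mulr_suml; apply: eq_bigr => j _.
by rewrite str_mul str_mul /rel_term /= mulrAC.
Qed.

End PotentialIdeal.

(** * Solving the cocycle equation by exactness *)

Section LeftModuleDerivations.
Context (K : fieldType) (n m : nat) (T : gralg K) (word : seq 'I_n -> T).
Context (hT : free_algebra word) (w : tensor K n m.+1).
Context (A : gralg K) (p : {rmorphism T -> A})
  (hp : quotient_map (potential_span word w) p).
Context (E : envelope A) (du : {additive T -> 'rV[E]_n}) (duE : is_der word p du).
Context (exact2 : forall v : 'rV[E]_n, v *m hessian word w du = 0 ->
  exists e : E, v = e *: (koszul1 word p E)^T).
Context (B : pzRingType) (iota : {rmorphism A -> B}).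
Local Notation x i := (p (word [:: i])).
Local Notation f := (potential_rel word w).
Local Notation rel_term := (rel_term word w).

Lemma potential_rel0 j : p (f j) = 0.
Proof.
apply/(quotient_ker hp); apply: ideal_gen_sub; exists (fun i => (i == j)%:R).
rewrite (bigD1 j) //= eqxx rmorph1 mul1r big1 ?addr0 // => i /negbTE ->.
by rewrite rmorph0 mul0r.
Qed.

Section Cocycle.
Context (phi : 'I_n -> A -> B).
Hypotheses (phiB : forall j, zmod_morphism (phi j))
  (phiZ : forall j c a, phi j (str A c * a) = iota (str A c) * phi j a)
  (phi_cocycle : forall a,
     \sum_j iota (x j) * phi j a = \sum_j phi j (x j * a)).

Let term (q : K * (seq 'I_n * 'I_n * seq 'I_n)) : B :=
  iota (str A q.1 * p (word q.2.1.1)) * phi q.2.1.2 (p (word q.2.2)).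

(** A relation among the elements [u f_j v] of the free algebra has derivative 0, so the row with
    entries [u (x) v] is killed by the Hessian. By exactness it is a multiple of the transpose of
    [koszul1], and on such rows the claim is the cocycle identity. *)
Lemma syzygy_term l : \sum_(q <- l) rel_term q = 0 -> \sum_(q <- l) term q = 0.
Proof.
move=> l0; pose v := \sum_(q <- l) tens E (str A q.1 * p (word q.2.1.1)) (p (word q.2.2))
  *: (delta_mx 0 q.2.1.2 : 'rV[E]_n).
have /exact2 [e ve] : v *m hessian word w du = 0.
  transitivity (du (\sum_(q <- l) rel_term q)); last by rewrite l0 raddf0.
  rewrite mulmx_suml raddf_sum; apply: eq_bigr => q _ /=.
  rewrite -scalemxAl -rowE row_hessian /rel_term.
  rewrite !(derM hT (quotient_str hp) duE) (der_str hT duE) scaler0 add0r.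
  rewrite rmorphM potential_rel0 mulr0 tens0l tens0r !scale0r add0r addr0 !scalerA.
  by rewrite !tensM (quotient_str hp) !mul1r !mulr1.
have /choice [th thE] : forall j, exists g : {additive E -> B},
    forall a b, g (tens E a b) = iota a * phi j b.
  move=> j; apply: tens_universal.
  - by move=> a a' b; rewrite rmorphD mulrDl.
  - move=> a b b'; have [g gE] := additive_of (phiB j).
    by rewrite -!gE raddfD mulrDr.
  - by move=> a c b; rewrite rmorphM phiZ mulrA.
pose Th (u : 'rV[E]_n) := \sum_j th j (u 0 j).
have -> : \sum_(q <- l) term q = Th v.
  rewrite /Th; under [RHS]eq_bigr do rewrite summxE raddf_sum.
  rewrite exchange_big; apply: eq_bigr => q _ /=.
  rewrite (bigD1 q.2.1.2) //= !mxE !eqxx mulr1 thE big1 ?addr0 // => j jq.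
  by rewrite !mxE (negbTE jq) andbF mulr0 raddf0.
rewrite /Th ve; elim/env_ind: e {ve} => [|e e' he he'|a b].
- by rewrite big1 // => j _; rewrite scale0r mxE raddf0.
- under eq_bigr do rewrite scalerDl mxE raddfD.
  by rewrite big_split /= he he' addr0.
under eq_bigr do rewrite !mxE mulrBr !tensM mulr1 mul1r raddfB /= !thE rmorphM -mulrA.
by rewrite sumrB -!mulr_sumr phi_cocycle subrr.
Qed.

(** The letters are to act on the sum of A and B by triangular operators, with [Y] off the diagonal;
    [D u] is then the off-diagonal entry of the word [u], and f_j must have the entry [phi j].
    Sending [u f_j v] to [u phi_j(v)] defines [Th] on the ideal of relations, and [Y] is [Th] of the
    failure of the section [s] to commute with the letters. *)
Lemma left_derivation_exists (s : {additive A -> T}) :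
  (forall c a, s (str A c * a) = str T c * s a) -> (forall a, p (s a) = a) ->
  exists Y : 'I_n -> A -> B,
  [/\ forall i, zmod_morphism (Y i),
      forall i c a, Y i (str A c * a) = iota (str A c) * Y i a &
      forall D : seq 'I_n -> A -> B, (forall a, D [::] a = 0) ->
        (forall i u a, D (i :: u) a = iota (x i) * D u a + Y i (p (word u) * a)) ->
      forall j a, \sum_(t : m.-tuple 'I_n) iota (str A (w [tuple of j :: t])) * D t a
        = phi j a].
Proof.
move=> sZ sK.
(* Two expressions of [a] differ by a syzygy, so the value is well defined on the ideal; elsewhere
   it is set to 0. *)
have exTh a : exists y, forall l, a = \sum_(q <- l) rel_term q -> y = \sum_(q <- l) term q.
  have [[l hl]|nl] := pselect (exists l, a = \sum_(q <- l) rel_term q); last first.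
    by exists 0 => l hl; case: nl; exists l.
  exists (\sum_(q <- l) term q) => l' hl'; apply/eqP; rewrite -subr_eq0; apply/eqP.
  pose neg (q : K * (seq 'I_n * 'I_n * seq 'I_n)) := (- q.1, q.2).
  have e1 : \sum_(q <- l') rel_term (neg q) = - a.
    by rewrite hl' -sumrN; apply: eq_bigr => q _; rewrite /rel_term rmorphN mulNr.
  have e2 : \sum_(q <- l') term (neg q) = - \sum_(q <- l') term q.
    rewrite -sumrN; apply: eq_bigr => q _.
    by rewrite /term (rmorphN (str A)) mulNr (rmorphN iota) mulNr.
  have := @syzygy_term (l ++ map neg l'); rewrite !big_cat !big_map /= e1 e2.
  by rewrite -hl; apply; rewrite subrr.
have [Th ThE] := choice exTh.
have rel a : p a = 0 -> exists l, a = \sum_(q <- l) rel_term q.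
  by move=> /(quotient_ker hp) /(ideal_rel_terms hT).
have ThD a b : p a = 0 -> p b = 0 -> Th (a + b) = Th a + Th b.
  move=> /rel [l hl] /rel [l' hl']; rewrite (ThE _ (l ++ l')).
    by rewrite big_cat /= -(ThE _ _ hl) -(ThE _ _ hl').
  by rewrite big_cat /= -hl -hl'.
have Th0 : Th 0 = 0 by rewrite (ThE _ [::]) ?big_nil.
have ThN a : p a = 0 -> Th (- a) = - Th a.
  move=> pa; apply: (addrI (Th a)); rewrite -ThD ?subrr ?Th0 //.
  by rewrite rmorphN pa oppr0.
have Thl c u a : p a = 0 ->
    Th (str T c * word u * a) = iota (str A c * p (word u)) * Th a.
  move=> /rel [l hl].
  rewrite (ThE _ [seq (c * q.1, (u ++ q.2.1.1, q.2.1.2, q.2.2)) | q <- l]).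
    rewrite big_map (ThE _ _ hl) mulr_sumr; apply: eq_bigr => q _.
    by rewrite /term /= mulrA -(rmorphM iota) str_mul (word_cat hT) (rmorphM p).
  rewrite big_map hl mulr_sumr; apply: eq_bigr => q _.
  by rewrite /rel_term /= str_mul (word_cat hT) !mulrA.
have ThZ c a : p a = 0 -> Th (str T c * a) = iota (str A c) * Th a.
  by move=> /(Thl c [::]); rewrite (word_nil hT) rmorph1 !mulr1.
have Thw u a : p a = 0 -> Th (word u * a) = iota (p (word u)) * Th a.
  by move=> /(Thl 1 u); rewrite !rmorph1 !mul1r.
pose Y i a := Th (word [:: i] * s a - s (x i * a)).
have kerY u a : p (word u * s a - s (p (word u) * a)) = 0.
  by rewrite rmorphB rmorphM !sK subrr.
exists Y; split.
- move=> i a b; rewrite /Y -ThN ?kerY // -ThD ?kerY //; last first.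
    by rewrite rmorphN kerY oppr0.
  congr Th; rewrite raddfB mulrBr raddfB /= mulrBr raddfB /= !opprD !opprK.
  by rewrite addrACA.
- move=> i c a; rewrite /Y -ThZ ?kerY //; congr Th.
  rewrite mulrBr sZ !mulrA -!(str_central c) -!mulrA sZ //.
move=> D D0 DS j a.
(* The defects of [s] along the successive letters telescope to its defect along the whole word. *)
have DE u : D u a = Th (word u * s a - s (p (word u) * a)).
  elim: u => [|i u ih]; first by rewrite D0 (word_nil hT) rmorph1 !mul1r subrr Th0.
  rewrite DS ih -Thw ?kerY // /Y -ThD ?kerY //; last by rewrite rmorphM kerY mulr0.
  congr Th; rewrite (word_cons hT i u) rmorphM mulrBr addrA mulrA subrK.
  by rewrite mulrA.
have -> : phi j a = Th (f j * s a).
  have {1}-> : a = p (s a) by rewrite sK.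
  elim/(word_span hT): (s a) => [|b b' hb hb'|c v].
  - have [g gE] := additive_of (phiB j).
    by rewrite rmorph0 mulr0 Th0 -gE raddf0.
  - have [g gE] := additive_of (phiB j).
    rewrite mulrDr rmorphD -gE raddfD !gE hb hb' ThD //.
      by rewrite rmorphM potential_rel0 mul0r.
    by rewrite rmorphM potential_rel0 mul0r.
  rewrite (ThE _ [:: (c, ([::], j, v))]) big_seq1.
    by rewrite /term /= (word_nil hT) rmorph1 mulr1 rmorphM (quotient_str hp) phiZ.
  by rewrite /rel_term /= (word_nil hT) mul1r mulrA -str_central mulrA.
have -> : f j * s a = \sum_(t : m.-tuple 'I_n)
    str T (w [tuple of j :: t]) * (word t * s a - s (p (word t) * a)).
  under [RHS]eq_bigr do rewrite mulrBr -sZ !mulrA.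
  rewrite sumrB -mulr_suml [X in _ - X](_ : _ = 0) ?subr0 //.
  rewrite -raddf_sum -mulr_suml /= [X in X * a](_ : _ = p (f j)).
    by rewrite potential_rel0 mul0r raddf0.
  by rewrite rmorph_sum; apply: eq_bigr => t _; rewrite rmorphM (quotient_str hp).
have ThSum (I : finType) (F : I -> T) : (forall i, p (F i) = 0) ->
    Th (\sum_i F i) = \sum_i Th (F i).
  move=> F0; suff [] : Th (\sum_i F i) = \sum_i Th (F i) /\ p (\sum_i F i) = 0 by [].
  elim/big_ind2: _ => [|y z y' z' [h1 h2] [h3 h4]|i _]; rewrite ?rmorph0 //.
  by rewrite ThD // rmorphD h1 h2 h3 h4 addr0.
rewrite ThSum => [|t]; last by rewrite rmorphM kerY mulr0.
by apply: eq_bigr => t _; rewrite DE ThZ ?kerY.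
Qed.

End Cocycle.
End LeftModuleDerivations.

Section AdditiveEndomorphisms.
Context (G : zmodType).

(** All additive endomorphisms of [G] form the ring in which the free algebra will be evaluated at
    the deformed operators. *)
Record endo := Endo { endo_fun :> G -> G; endoB : zmod_morphism endo_fun }.

HB.instance Definition _ (f : endo) := GRing.isZmodMorphism.Build G G f (endoB f).
HB.instance Definition _ := gen_eqMixin endo.
HB.instance Definition _ := gen_choiceMixin endo.

Implicit Types f g h : endo.

Lemma endo_eq f g : f =1 g -> f = g.
Proof.
case: f g => [f fB] [g gB] /= /funext e; subst g.
by congr Endo; apply: Prop_irrelevance.
Qed.

Lemma endo_zeroB : zmod_morphism (fun _ : G => 0 : G).
Proof. by move=> x y; rewrite subrr. Qed.

Lemma endo_addB f g : zmod_morphism (fun x => f x + g x).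
Proof. by move=> x y /=; rewrite !raddfB opprD addrACA. Qed.

Lemma endo_oppB f : zmod_morphism (fun x => - f x).
Proof. by move=> x y /=; rewrite raddfB opprD. Qed.

Lemma endo_compB f g : zmod_morphism (fun x => f (g x)).
Proof. by move=> x y /=; rewrite !raddfB. Qed.

Lemma endo_idB : zmod_morphism (fun x : G => x).
Proof. by []. Qed.

Definition endo_add f g := Endo (endo_addB f g).
Definition endo_mul f g := Endo (endo_compB f g).

Fact endo_addA : associative endo_add.
Proof. by move=> f g h; apply: endo_eq => x /=; rewrite addrA. Qed.

Fact endo_addC : commutative endo_add.
Proof. by move=> f g; apply: endo_eq => x /=; rewrite addrC. Qed.

Fact endo_add0 : left_id (Endo endo_zeroB) endo_add.
Proof. by move=> f; apply: endo_eq => x /=; rewrite add0r. Qed.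

Fact endo_addN : left_inverse (Endo endo_zeroB) (fun f => Endo (endo_oppB f)) endo_add.
Proof. by move=> f; apply: endo_eq => x /=; rewrite addNr. Qed.

HB.instance Definition _ :=
  GRing.isZmodule.Build endo endo_addA endo_addC endo_add0 endo_addN.

Fact endo_mulA : associative endo_mul.
Proof. by move=> f g h; apply: endo_eq. Qed.

Fact endo_mul1 : left_id (Endo endo_idB) endo_mul.
Proof. by move=> f; apply: endo_eq. Qed.

Fact endo_1mul : right_id (Endo endo_idB) endo_mul.
Proof. by move=> f; apply: endo_eq. Qed.

Fact endo_mulDl : left_distributive endo_mul +%R.
Proof. by move=> f g h; apply: endo_eq. Qed.

Fact endo_mulDr : right_distributive endo_mul +%R.
Proof. by move=> f g h; apply: endo_eq => x /=; rewrite raddfD. Qed.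

HB.instance Definition _ := GRing.Zmodule_isPzRing.Build endo
  endo_mulA endo_mul1 endo_1mul endo_mulDl endo_mulDr.

Lemma endo_sum (I : Type) (r : seq I) (F : I -> endo) x :
  (\sum_(i <- r) F i) x = \sum_(i <- r) F i x.
Proof. by elim: r => [|i r ih]; rewrite ?big_nil // !big_cons -ih. Qed.

End AdditiveEndomorphisms.

Lemma quotient_map_lift_additive (K : comPzRingType) (A B : gralg K) (S : A -> Prop)
    (p : {rmorphism A -> B}) (M : zmodType) (g : {additive A -> M}) :
  quotient_map S p -> (forall a, p a = 0 -> g a = 0) ->
  exists h : {additive B -> M}, forall a, h (p a) = g a.
Proof.
move=> hp g0; have /choice [r rE] := quotient_surj hp.
have gE a b : p a = p b -> g a = g b.
  move=> e; apply/eqP; rewrite -subr_eq0 -raddfB; apply/eqP/g0.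
  by rewrite rmorphB e subrr.
have [|h hE] := @additive_of B M (fun x => g (r x)).
  by move=> x y /=; rewrite -raddfB; apply: gE; rewrite rmorphB -!rE.
by exists h => a; rewrite hE; apply: gE; rewrite -rE.
Qed.

(** * Extension of the base field *)

Section BaseChange.
Context (K L : fieldType) (j0 : {rmorphism K -> L}) (n m : nat).
Context (T : gralg K) (word : seq 'I_n -> T) (hT : free_algebra word).
Context (TL : gralg L) (wordL : seq 'I_n -> TL) (hTL : free_algebra wordL).
Context (w : tensor K n m.+1) (wL : tensor L n m.+1) (wLE : forall t, wL t = j0 (w t)).
Context (A : gralg K) (p : {rmorphism T -> A})
  (hp : quotient_map (potential_span word w) p).
Context (AL : gralg L) (pL : {rmorphism TL -> AL})
  (hpL : quotient_map (potential_span wordL wL) pL).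

Lemma base_change_algebra : exists iota : {rmorphism A -> AL},
  (forall u, iota (p (word u)) = pL (wordL u)) /\
  (forall c, iota (str A c) = str AL (j0 c)).
Proof.
have [|g [gc gi]] := free_eval hT (s := str AL \o j0) (x := fun i => pL (wordL [:: i])).
  by move=> c i /=; rewrite str_central.
have gw u : g (word u) = pL (wordL u).
  elim: u => [|i u ih]; first by rewrite (word_nil hT) (word_nil hTL) !rmorph1.
  by rewrite (word_cons hT) (word_cons hTL) !rmorphM ih gi.
have [|iota iotaE] := quotient_map_lift hp (g := g).
  move=> _ [c ->]; rewrite rmorph_sum big1 // => j _.
  suff e : g (potential_rel word w j) = pL (potential_rel wordL wL j).
    by rewrite rmorphM e (potential_rel0 hpL) mulr0.
  rewrite !rmorph_sum; apply: eq_bigr => t _.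
  by rewrite !rmorphM gc gw (quotient_str hpL) wLE.
exists iota; split=> [u|c]; first by rewrite iotaE gw.
by rewrite -(quotient_str hp) iotaE gc.
Qed.

Context (iota : {rmorphism A -> AL}) (iota_word : forall u, iota (p (word u)) = pL (wordL u))
  (iota_str : forall c, iota (str A c) = str AL (j0 c)).

Lemma base_change_span (P : AL -> Prop) : P 0 -> (forall a b, P a -> P b -> P (a + b)) ->
  (forall c a, P (str AL c * iota a)) -> forall a, P a.
Proof.
move=> P0 PD PU y; have [a ->] := quotient_surj hpL y.
elim/(word_span hTL): a => [|a b ha hb|c u]; first by rewrite rmorph0.
  by rewrite rmorphD; apply: PD.
by rewrite rmorphM (quotient_str hpL) -iota_word.
Qed.

(** In effect [AL] is the tensor product of L and A. The map is prescribed on the free algebra over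
    L and kills every [u f_j v], because w has its coefficients in K and [phi] vanishes at
    [p (u f_j v) = 0]. *)
Lemma base_change_map (B : pzRingType) (sB : {rmorphism L -> B}) (phi : A -> B) :
  zmod_morphism phi -> (forall c a, phi (str A c * a) = sB (j0 c) * phi a) ->
  exists phiL : {additive AL -> B},
    (forall c y, phiL (str AL c * y) = sB c * phiL y) /\
    (forall a, phiL (iota a) = phi a).
Proof.
move=> phiB phiZ; have [fi fiE] := additive_of phiB.
have [g gE] : exists g : {additive TL -> B}, forall c u,
    g (str TL c * wordL u) = sB c * phi (p (word u)).
  by apply: (word_ext hTL) => u c d /=; rewrite rmorphB mulrBl.
have gker a : pL a = 0 -> g a = 0.
  move=> /(quotient_ker hpL) /(ideal_rel_terms hTL) [l ->].
  rewrite raddf_sum big1 // => -[c [[u j] v]] _ /=.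
  rewrite /rel_term /=; transitivity
    (sB c * phi (p (word u * potential_rel word w j * word v))).
    rewrite mulr_sumr mulr_suml mulr_sumr raddf_sum.
    rewrite mulr_sumr mulr_suml rmorph_sum -fiE raddf_sum mulr_sumr.
    apply: eq_bigr => t _ /=; rewrite fiE.
    rewrite !mulrA -[str TL c * wordL u * _]mulrA -(str_central _ (wordL u)).
    rewrite !mulrA -rmorphM -!mulrA -!(word_cat hTL) mulrA gE wLE (rmorphM sB).
    rewrite -mulrA -phiZ -(quotient_str hp) -!(rmorphM p); congr (_ * phi (p _)).
    by rewrite !(word_cat hT) !mulrA str_central.
  by rewrite !rmorphM (potential_rel0 hp) mulr0 mul0r -fiE raddf0 mulr0.
have [phiL phiLE] := quotient_map_lift_additive hpL gker.
have phiLZ c y : phiL (str AL c * y) = sB c * phiL y.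
  have [a ->] := quotient_surj hpL y.
  rewrite -(quotient_str hpL) -rmorphM !phiLE.
  elim/(word_span hTL): a => [|a b ha hb|d u]; first by rewrite mulr0 !raddf0 mulr0.
    by rewrite mulrDr !(raddfD g) ha hb mulrDr.
  by rewrite mulrA -rmorphM !gE rmorphM mulrA.
exists phiL; split=> // a; have [b ->] := quotient_surj hp a.
elim/(word_span hT): b => [|b b' hb hb'|d u].
- by rewrite !rmorph0 !raddf0 -fiE raddf0.
- by rewrite !rmorphD !raddfD /= hb hb' -!fiE raddfD.
rewrite rmorphM (quotient_str hp) rmorphM iota_str phiLZ iota_word phiLE phiZ.
by rewrite -[wordL u]mul1r -(rmorph1 (str TL)) gE rmorph1 mul1r.
Qed.

End BaseChange.

(** * Power series in Omega and deformed actions *)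

Section Shift.
Context (V : zmodType).
Local Notation G := (nat -> V).

(** A sequence [g] stands for the power series with coefficients [g r] in Omega. Thus [shift] is
    multiplication by Omega, and [vanish k] is divisibility by Omega^k. *)
Definition shift (g : G) : G := fun r => if r is r'.+1 then g r' else 0.
Definition shiftn k (g : G) : G := fun r => if (r < k)%N then 0 else g (r - k)%N.
Definition vanish k (g : G) : Prop := forall r, (r < k)%N -> g r = 0.

Lemma shiftn0 g : shiftn 0 g = g.
Proof. by apply/funext => r; rewrite /shiftn subn0. Qed.

Lemma shiftnS k g : shiftn k.+1 g = shift (shiftn k g).
Proof. by apply/funext => -[|r]. Qed.

Lemma vanish_shiftn k g : vanish k g -> g = shiftn k (fun r => g (r + k)%N).
Proof.
move=> hg; apply/funext => r; rewrite /shiftn; case: ltnP => [/hg //|le].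
by rewrite subnK.
Qed.

Lemma vanishD k g h : vanish k g -> vanish k h -> vanish k (g + h).
Proof. by move=> hg hh r lt; rewrite addrfctE hg ?hh ?addr0. Qed.

Context (P : G -> G) (P_shift : forall g, P (shift g) = shift (P g)).

Lemma comm_shiftn k g : P (shiftn k g) = shiftn k (P g).
Proof.
by elim: k => [|k ih]; rewrite ?shiftn0 // !shiftnS P_shift ih.
Qed.

Lemma vanish_comm k g : vanish k g -> vanish k (P g).
Proof.
by move=> /vanish_shiftn -> r lt; rewrite comm_shiftn /shiftn lt.
Qed.

Lemma lead_comm k g : vanish k g -> P g k = P (fun r => g (r + k)%N) 0.
Proof.
by move=> /vanish_shiftn {1}->; rewrite comm_shiftn /shiftn ltnn subnn.
Qed.

End Shift.

Section Deformation.
Context (K L : fieldType) (j0 : {rmorphism K -> L}) (n m : nat).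
Context (T : gralg K) (word : seq 'I_n -> T) (hT : free_algebra word).
Context (TL : gralg L) (wordL : seq 'I_n -> TL) (hTL : free_algebra wordL).
Context (w : tensor K n m.+1) (wL : tensor L n m.+1) (wLE : forall t, wL t = j0 (w t)).
Context (w_sup : superpotential w).
Context (A : gralg K) (p : {rmorphism T -> A})
  (hp : quotient_map (potential_span word w) p).
Context (AL : gralg L) (pL : {rmorphism TL -> AL})
  (hpL : quotient_map (potential_span wordL wL) pL).
Context (E : envelope A) (du : {additive T -> 'rV[E]_n}) (duE : is_der word p du).
Context (exact2 : forall v : 'rV[E]_n, v *m hessian word w du = 0 ->
  exists e : E, v = e *: (koszul1 word p E)^T).
Context (c : 'I_n -> L).
Local Notation G := (nat -> AL).
Local Notation x i := (pL (wordL [:: i])).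

Definition scale_seq (a : L) (g : G) : G := fun r => str AL a * g r.

Definition act (X : 'I_n -> endo G) (u : seq 'I_n) (g : G) : G := foldr (fun i h => X i h) g u.

Definition act_rel (X : 'I_n -> endo G) (j : 'I_n) (g : G) : G :=
  \sum_(t : m.-tuple 'I_n) scale_seq (wL [tuple of j :: t]) (act X t g).

(** A solution modulo Omega^k of f_j = c_j Omega, by operators that commute with Omega and the
    scalars and reduce modulo Omega to the left multiplications on [AL]. *)
Definition deformation k (X : 'I_n -> endo G) : Prop :=
  [/\ forall i g, X i (shift g) = shift (X i g),
      forall i a g, X i (scale_seq a g) = scale_seq a (X i g),
      forall i g, X i g 0 = x i * g 0 &
      forall j g r, (r < k)%N -> act_rel X j g r = scale_seq (c j) (shift g) r].

Lemma act_cat X u v g : act X (u ++ v) g = act X u (act X v g).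
Proof. exact: foldr_cat. Qed.

Section ActTheory.
Context (X : 'I_n -> endo G) (X_shift : forall i g, X i (shift g) = shift (X i g))
  (X_scale : forall i a g, X i (scale_seq a g) = scale_seq a (X i g))
  (X_0 : forall i g, X i g 0 = x i * g 0).

Lemma act_shift u g : act X u (shift g) = shift (act X u g).
Proof. by elim: u => //= i u ->. Qed.

Lemma act_scale u a g : act X u (scale_seq a g) = scale_seq a (act X u g).
Proof. by elim: u => //= i u ->. Qed.

Lemma act_B u g h : act X u (g - h) = act X u g - act X u h.
Proof. by elim: u => //= i u ->; rewrite raddfB. Qed.

Lemma act_0 u g : act X u g 0 = pL (wordL u) * g 0.
Proof.
elim: u => [|i u ih] /=; first by rewrite (word_nil hTL) rmorph1 mul1r.
by rewrite X_0 ih mulrA -rmorphM -(word_cons hTL).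
Qed.

Lemma scale_seq_shift a g : scale_seq a (shift g) = shift (scale_seq a g).
Proof. by apply/funext => -[|r] //; rewrite /scale_seq /= mulr0. Qed.

Lemma scale_seqB a g h : scale_seq a (g - h) = scale_seq a g - scale_seq a h.
Proof. by apply/funext => r; rewrite /scale_seq !fctE mulrBr. Qed.

Lemma scale_seqC a b g : scale_seq a (scale_seq b g) = scale_seq b (scale_seq a g).
Proof. by apply/funext => r; rewrite /scale_seq !mulrA -!rmorphM mulrC. Qed.

Lemma shift_sum (I : finType) (F : I -> G) : shift (\sum_i F i) = \sum_i shift (F i).
Proof.
by apply/funext => -[|r]; rewrite fct_sumE /= ?fct_sumE // big1.
Qed.

Lemma scale_seq_sum (I : finType) a (F : I -> G) :
  scale_seq a (\sum_i F i) = \sum_i scale_seq a (F i).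
Proof. by apply/funext => r; rewrite /scale_seq !fct_sumE mulr_sumr. Qed.

Lemma act_rel_shift j g : act_rel X j (shift g) = shift (act_rel X j g).
Proof.
rewrite shift_sum; apply: eq_bigr => t _.
by rewrite act_shift scale_seq_shift.
Qed.

Lemma act_rel_scale j a g : act_rel X j (scale_seq a g) = scale_seq a (act_rel X j g).
Proof.
by rewrite scale_seq_sum; apply: eq_bigr => t _; rewrite act_scale scale_seqC.
Qed.

Lemma act_relB j g h : act_rel X j (g - h) = act_rel X j g - act_rel X j h.
Proof. by rewrite -sumrB; apply: eq_bigr => t _; rewrite act_B scale_seqB. Qed.

(** Both sides are w evaluated at the operators, up to a rotation of the words. This identity makes
    the obstruction a cocycle. *)
Lemma act_rel_cyclic g : \sum_j X j (act_rel X j g) = \sum_j act_rel X j (X j g).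
Proof.
have wE (t : m.+1.-tuple 'I_n) : wL [tuple of rot 1 t] = wL t.
  by rewrite !wLE (superpotential_rot w_sup).
have hl j : X j (act_rel X j g) = \sum_(t : m.-tuple 'I_n)
    scale_seq (wL [tuple of j :: t]) (act X (j :: t) g).
  by rewrite raddf_sum; apply: eq_bigr => t _; rewrite /= X_scale.
have hr j : act_rel X j (X j g) = \sum_(t : m.-tuple 'I_n)
    scale_seq (wL [tuple of j :: t]) (act X (rot 1 (j :: t)) g).
  by apply: eq_bigr => t _; rewrite rot1_cons -cats1 act_cat.
under eq_bigr do rewrite hl; under [RHS]eq_bigr do rewrite hr.
have sumE (F : m.+1.-tuple 'I_n -> G) :
    \sum_j \sum_(t : m.-tuple 'I_n) F [tuple of j :: t] = \sum_t F t.
  under eq_bigr => j _ do rewrite sum_cons_tuple.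
  rewrite (exchange_big_dep predT) //=; apply: eq_bigr => t _.
  by rewrite (big_pred1 (thead t)) // => j; rewrite eq_sym.
rewrite (sumE (fun t => scale_seq (wL t) (act X t g))).
rewrite (sumE (fun t => scale_seq (wL t) (act X (rot 1 t) g))).
rewrite [LHS](reindex_inj (h := fun t : m.+1.-tuple 'I_n => [tuple of rot 1 t])) /=.
  by apply: eq_bigr => t _; rewrite wE.
by move=> t t' /(congr1 val) /rot_inj e; apply: val_inj.
Qed.

End ActTheory.

Fixpoint act_der (Y : 'I_n -> AL -> AL) (u : seq 'I_n) (y : AL) : AL :=
  if u is i :: v then x i * act_der Y v y + Y i (pL (wordL v) * y) else 0.

(** In degree k only the terms with a single factor [Y] survive, and the other letters of the word
    act through their reductions modulo Omega; as k > 0 these are the same for [X] and [X']. *)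
Lemma act_perturb k (X X' : 'I_n -> endo G) (Y : 'I_n -> AL -> AL) : (0 < k)%N ->
  (forall i g, X i (shift g) = shift (X i g)) -> (forall i g, X i g 0 = x i * g 0) ->
  (forall i g, X' i g = X i g + shiftn k (fun r => Y i (g r))) ->
  forall u g, vanish k (act X' u g - act X u g) /\
    (act X' u g - act X u g) k = act_der Y u (g 0).
Proof.
move=> k0 X_shift X_0 X'E; have X'_0 i g : X' i g 0 = x i * g 0.
  by rewrite X'E addrfctE X_0 /shiftn k0 addr0.
elim=> [|i u ih] g /=; first by rewrite subrr.
have [hv hk] := ih g; set h' := act X' u g in hv hk *; set h := act X u g in hv hk *.
have -> : X' i h' - X i h = X i (h' - h) + shiftn k (fun r => Y i (h' r)).
  by rewrite X'E raddfB addrAC.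
split.
  apply: vanishD; first exact: vanish_comm (X_shift i) _ _ hv.
  by move=> r lt; rewrite /shiftn lt.
rewrite -[LHS]/(X i (h' - h) k + shiftn k (fun r => Y i (h' r)) k).
rewrite (lead_comm (X_shift i) hv) X_0 add0n hk; congr (_ + _).
by rewrite /shiftn ltnn subnn /h' (act_0 X'_0).
Qed.

Lemma deformation_step (s : {additive A -> T}) :
  (forall d a, s (str A d * a) = str T d * s a) -> (forall a, p (s a) = a) ->
  forall k X, deformation k.+1 X -> exists X', deformation k.+2 X'.
Proof.
move=> sZ sK k X [X_shift X_scale X_0 X_rel].
have [iota [iota_word iota_str]] := base_change_algebra hT hTL wLE hp hpL.
(* The defect of the relation f_j. It is divisible by Omega^(k+1) and commutes with Omega, so its
   leading coefficient depends on [g 0] only; this coefficient is the obstruction [phi]. *)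
pose R j g := scale_seq (c j) (shift g) - act_rel X j g.
have R_van j g : vanish k.+1 (R j g).
  by move=> r /X_rel h; rewrite /R !fctE h subrr.
have R_shift j g : R j (shift g) = shift (R j g).
  rewrite /R (act_rel_shift X_shift) scale_seq_shift.
  by apply/funext => -[|r] //; rewrite !fctE /= subrr.
have R_scale j a g : R j (scale_seq a g) = scale_seq a (R j g).
  by rewrite /R (act_rel_scale X_scale) scale_seqB -(scale_seq_shift a) scale_seqC.
have shiftB (g h : G) : shift (g - h) = shift g - shift h.
  by apply/funext => -[|r] //; rewrite !fctE /= subrr.
have R_B j g h : R j (g - h) = R j g - R j h.
  rewrite /R act_relB shiftB scale_seqB !opprD !opprK.
  by rewrite addrACA.
pose delta (y : AL) : G := fun r => if r is 0%N then y else 0.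
have deltaB y z : delta (y - z) = delta y - delta z.
  by apply/funext => -[|r] //; rewrite !fctE /= subrr.
have deltaZ a y : delta (str AL a * y) = scale_seq a (delta y).
  by apply/funext => -[|r] //; rewrite /scale_seq /= mulr0.
have R_lead j g : R j g k.+1 = R j (delta (g 0)) k.+1.
  apply/eqP; rewrite -subr_eq0; apply/eqP.
  have <- : (R j g - R j (delta (g 0))) k.+1 = R j g k.+1 - R j (delta (g 0)) k.+1 by [].
  have gE : g - delta (g 0) = shift (fun r => g r.+1).
    by apply/funext => -[|r]; rewrite !fctE /= ?subrr ?subr0.
  by rewrite -R_B gE R_shift /= R_van.
pose phi j a := R j (delta (iota a)) k.+1.
have phiB j : zmod_morphism (phi j).
  by move=> a b; rewrite /phi rmorphB deltaB R_B.
have phiZ j d a : phi j (str A d * a) = iota (str A d) * phi j a.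
  by rewrite /phi rmorphM iota_str deltaZ R_scale.
have R_cyclic g : \sum_j X j (R j g) = \sum_j R j (X j g).
  rewrite /R; under eq_bigr do rewrite raddfB /= X_scale X_shift.
  by rewrite !sumrB (act_rel_cyclic X_scale).
have cocycle a : \sum_j iota (p (word [:: j])) * phi j a =
    \sum_j phi j (p (word [:: j]) * a).
  have := congr1 (fun g => g k.+1) (R_cyclic (delta (iota a))).
  rewrite !fct_sumE => e; transitivity (\sum_j X j (R j (delta (iota a))) k.+1).
    apply: eq_bigr => j _; rewrite (lead_comm (X_shift j) (R_van j _)) X_0 add0n.
    by rewrite iota_word.
  rewrite e; apply: eq_bigr => j _; rewrite R_lead X_0 /= /phi rmorphM iota_word //.
(* Exactness is available for A over K, whereas the operators act over L. The correction is found on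
   A with values in [AL] and then extended by L-linearity. *)
have [Y0 [Y0B Y0Z Y0E]] := left_derivation_exists hT hp duE exact2 phiB phiZ cocycle sZ sK.
have /choice [Y YE] : forall i, exists phiL : {additive AL -> AL},
    (forall d y, phiL (str AL d * y) = str AL d * phiL y) /\
    (forall a, phiL (iota a) = Y0 i a).
  move=> i; apply: (base_change_map hT hTL wLE hp hpL iota_word iota_str (Y0B i)).
  by move=> d a; rewrite Y0Z iota_str.
have X'B i : zmod_morphism (fun g : G => X i g + shiftn k.+1 (fun r => Y i (g r))).
  move=> g h /=; rewrite raddfB opprD addrACA; congr (_ + _); apply/funext => r.
  by rewrite !fctE /shiftn; case: ifP => _; rewrite ?subrr // raddfB.
pose X' i := Endo (X'B i).
have X'_shift i g : X' i (shift g) = shift (X' i g).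
  rewrite /= X_shift; apply/funext => -[|r] //=; first by rewrite !fctE addr0.
  rewrite !fctE; congr (_ + _); rewrite /shiftn ltnS subSS [(r < k.+1)%N]ltnS.
  have [lt|lt|->] := ltngtP r k; rewrite ?subnn ?raddf0 //.
  by rewrite subnS -[(r - k)%N]prednK ?subn_gt0.
have X'_scale i a g : X' i (scale_seq a g) = scale_seq a (X' i g).
  rewrite /= X_scale; apply/funext => r; rewrite /scale_seq !fctE mulrDr /shiftn.
  by case: ifP => _; rewrite ?mulr0 // (proj1 (YE i)).
exists X'; split=> // [i g|j g r].
  by rewrite /= !fctE X_0 addr0.
rewrite ltnS => ler.
have X'E i h : X' i h = X i h + shiftn k.+1 (fun q => Y i (h q)) by [].
have pert := act_perturb (Y := Y) (ltn0Sn k) X_shift X_0 X'E.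
have act_relE : act_rel X' j g r = act_rel X j g r +
    \sum_(t : m.-tuple 'I_n) str AL (wL [tuple of j :: t]) * (act X' t g - act X t g) r.
  rewrite /act_rel !fct_sumE -big_split; apply: eq_bigr => t _ /=.
  by rewrite /scale_seq -mulrDr !fctE addrCA subrr addr0.
move: ler; rewrite leq_eqVlt => /orP[/eqP e|lt]; last first.
  rewrite act_relE X_rel // big1 ?addr0 // => t _.
  by rewrite (proj1 (pert t g) _ lt) mulr0.
rewrite act_relE e.
suff -> : \sum_(t : m.-tuple 'I_n) str AL (wL [tuple of j :: t]) *
    (act X' t g - act X t g) k.+1 = R j g k.+1.
  by rewrite /R !fctE addrCA subrr addr0.
under eq_bigr do rewrite (proj2 (pert _ _)).
rewrite R_lead; move: (g 0) => y.
have derB t : zmod_morphism (act_der Y t).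
  elim: t => [|i t ih] y1 y2 /=; first by rewrite subrr.
  by rewrite ih !mulrBr raddfB /= opprD addrACA.
have derZ t a y1 : act_der Y t (str AL a * y1) = str AL a * act_der Y t y1.
  elim: t => [|i t ih] /=; first by rewrite mulr0.
  rewrite ih mulrDr mulrA -str_central -mulrA; congr (_ + _).
  by rewrite mulrA -str_central -mulrA (proj1 (YE i)).
have Rd : zmod_morphism (fun y => R j (delta y) k.+1).
  by move=> z1 z2; rewrite deltaB R_B.
have zeroE (f : AL -> AL) : zmod_morphism f -> f 0 = 0.
  by move=> /additive_of [f' f'E]; rewrite -f'E raddf0.
have addE (f : AL -> AL) y1 y2 : zmod_morphism f -> f (y1 + y2) = f y1 + f y2.
  by move=> /additive_of [f' f'E]; rewrite -!f'E raddfD.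
elim/(base_change_span hTL hpL iota_word): y => [|y1 y2 h1 h2|d a].
- rewrite [RHS](zeroE _ Rd) big1 // => t _.
  by rewrite (zeroE _ (derB _)) mulr0.
- under eq_bigr do rewrite (addE _ _ _ (derB _)) mulrDr.
  by rewrite big_split /= h1 h2 [RHS](addE _ _ _ Rd).
rewrite deltaZ R_scale /scale_seq -/(phi j a) -(Y0E (fun t a => act_der Y t (iota a))) //.
  rewrite mulr_sumr; apply: eq_bigr => t _.
  by rewrite derZ iota_str wLE !mulrA -!rmorphM mulrC.
by move=> i u b /=; rewrite -(proj2 (YE i)) (rmorphM iota) !iota_word.
Qed.

End Deformation.

(** As z has positive degree m, a multiple of z^k has no component of degree q once km > q. *)
Lemma divisible_eq0 (R : comPzRingType) (A : gralg R) (z : A) m : (0 < m)%N ->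
  adeg A m%:Z z -> forall a, (forall k, exists b, a = z ^+ k * b) -> a = 0.
Proof.
move=> m0 hz a ha; have [c [cdeg cid c0 call]] := grading_component (adegP A).
apply: call => q.
have zk k : adeg A (k * m)%:Z (z ^+ k).
  elim: k => [|k ih]; first by rewrite mul0n expr0 -(rmorph1 (str A)); apply: adeg_str.
  by rewrite exprS mulSn PoszD; apply: adegM.
have [b ->] := ha `|q|.+1; have [s [f [us hf ->]]] := deg_sum (adegP A) b.
rewrite mulr_sumr raddf_sum big1 // => k _ /=.
have [k0|k0] := ltrP k 0; first by rewrite (adegN k0 (hf k)) mulr0 raddf0.
apply: c0 (adegM (zk _) (hf k)) _; apply/negP => /eqP e.
have : ((`|q|.+1 * m)%:Z <= q) by rewrite -[leRHS]e lerDl.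
apply/negP; rewrite -ltNge; apply: le_lt_trans (ler_norm q) _.
by rewrite -abszE ltz_nat leq_pmulr.
Qed.

(** * The element Omega of D_x and its regularity *)

Section CentralExtension.
Context (L : fieldType) (n m : nat).
Context (T : gralg L) (word : seq 'I_n -> T) (hT : free_algebra word).
Context (w : tensor L n m.+1) (c : 'I_n -> L).
Local Notation f := (potential_rel word w).

Definition extension_span (r : T) : Prop :=
  (exists2 psi : 'I_n -> L, \sum_j c j * psi j = 0 & r = \sum_j str T (psi j) * f j) \/
  (exists y psi : 'I_n -> L,
     r = (\sum_i str T (y i) * word [:: i]) * (\sum_j str T (psi j) * f j)
         - (\sum_j str T (psi j) * f j) * (\sum_i str T (y i) * word [:: i])).

Context (A : gralg L) (p : {rmorphism T -> A}) (hp : quotient_map (potential_span word w) p).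
Context (D : gralg L) (pD : {rmorphism T -> D}) (hpD : quotient_map extension_span pD).

Lemma extension_proj : exists q : {rmorphism D -> A}, forall a, q (pD a) = p a.
Proof.
apply: (quotient_map_lift hpD) => r.
have p0 (psi : 'I_n -> L) : p (\sum_j str T (psi j) * f j) = 0.
  by rewrite rmorph_sum big1 // => j _; rewrite rmorphM (potential_rel0 hp) mulr0.
by case=> [[psi _ ->] //|[y [psi ->]]]; rewrite rmorphB !rmorphM p0 mulr0 mul0r subrr.
Qed.

Context (j1 : 'I_n) (c_j1 : c j1 != 0).

(** Any relation f_j with c_j non-zero determines Omega; by [omegaE] they all determine the same
    element. *)
Definition omega : D := str D (c j1)^-1 * pD (f j1).

Lemma omega_deg : adeg D m%:Z omega.
Proof.
rewrite -[m%:Z]add0r; apply: adegM; first exact: adeg_str.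
exact: quotient_deg hpD _ _ (potential_rel_deg hT w j1).
Qed.

Lemma sum_delta (F : 'I_n -> T) j (a : L) :
  \sum_i str T (if i == j then a else 0) * F i = str T a * F j.
Proof.
rewrite (bigD1 j) //= eqxx big1 ?addr0 // => i /negbTE ->.
by rewrite rmorph0 mul0r.
Qed.

Lemma omegaE j : pD (f j) = str D (c j) * omega.
Proof.
rewrite /omega mulrA -rmorphM.
(* The functional e_j^* - (c_j / c_j1) e_j1^* annihilates c. It is written as a difference so that
   the case j = j1 is included. *)
have : pD (\sum_i str T ((if i == j then 1 else 0) - (if i == j1 then c j / c j1 else 0))
    * f i) = 0.
  apply/(quotient_ker hpD)/ideal_gen_sub; left; eexists; last by [].
  under eq_bigr do rewrite mulrBr.
  rewrite sumrB (bigD1 j) //= eqxx mulr1 big1 ?addr0 => [|i /negbTE ->]; last exact: mulr0.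
  rewrite (bigD1 j1) //= eqxx big1 ?addr0 => [|i /negbTE ->]; last exact: mulr0.
  by rewrite mulrCA divff // mulr1 subrr.
under eq_bigr do rewrite rmorphB mulrBl.
rewrite sumrB !sum_delta rmorph1 mul1r rmorphB rmorphM (quotient_str hpD).
by move/eqP; rewrite subr_eq0 => /eqP.
Qed.

Lemma omega_central : central omega.
Proof.
have f1 i : pD (f j1) * pD (word [:: i]) = pD (word [:: i]) * pD (f j1).
  apply/esym/eqP; rewrite -subr_eq0 -!rmorphM -rmorphB; apply/eqP.
  apply/(quotient_ker hpD)/ideal_gen_sub; right.
  exists (fun k => if k == i then 1 else 0), (fun k => if k == j1 then 1 else 0).
  by rewrite !sum_delta rmorph1 !mul1r.
have f1a a : pD (f j1) * pD a = pD a * pD (f j1).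
  elim/(word_span hT): a => [|a b ha hb|d u].
  - by rewrite rmorph0 mulr0 mul0r.
  - by rewrite rmorphD mulrDr mulrDl ha hb.
  rewrite rmorphM mulrA (quotient_str hpD) -str_central -!mulrA; congr (_ * _).
  elim: u => [|i u ih]; first by rewrite (word_nil hT) rmorph1 mulr1 mul1r.
  by rewrite (word_cons hT) rmorphM mulrA f1 -mulrA ih mulrA.
move=> x; have [a ->] := quotient_surj hpD x.
by rewrite /omega -mulrA f1a !mulrA str_central.
Qed.

Lemma extension_ker a : p a = 0 -> exists b, pD a = omega * b.
Proof.
move=> /(quotient_ker hp) /(ideal_rel_terms hT) [l ->].
have := omega_central; have := omegaE; move: omega => z zE zC.
exists (\sum_(q <- l) str D q.1 * (pD (word q.2.1.1) * str D (c q.2.1.2) * pD (word q.2.2))).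
rewrite rmorph_sum mulr_sumr; apply: eq_bigr => q _.
rewrite /rel_term !rmorphM (quotient_str hpD) zE !mulrA.
by rewrite -(zC (str D q.1 * pD (word q.2.1.1) * str D (c q.2.1.2))) !mulrA.
Qed.

End CentralExtension.

Section Regularity.
Context (K L : fieldType) (j0 : {rmorphism K -> L}) (n m : nat).
Context (T : gralg K) (word : seq 'I_n -> T) (hT : free_algebra word).
Context (TL : gralg L) (wordL : seq 'I_n -> TL) (hTL : free_algebra wordL).
Context (w : tensor K n m.+1) (wL : tensor L n m.+1) (wLE : forall t, wL t = j0 (w t)).
Context (w_sup : superpotential w) (m_gt0 : (0 < m)%N).
Context (A : gralg K) (p : {rmorphism T -> A})
  (hp : quotient_map (potential_span word w) p).
Context (AL : gralg L) (pL : {rmorphism TL -> AL})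
  (hpL : quotient_map (potential_span wordL wL) pL).
Context (E : envelope A) (du : {additive T -> 'rV[E]_n}) (duE : is_der word p du).
Context (exact2 : forall v : 'rV[E]_n, v *m hessian word w du = 0 ->
  exists e : E, v = e *: (koszul1 word p E)^T).
Context (c : 'I_n -> L).
Context (D : gralg L) (pD : {rmorphism TL -> D})
  (hpD : quotient_map (extension_span wordL wL c) pD).
Local Notation G := (nat -> AL).
Local Notation f := (potential_rel wordL wL).

Lemma deformation_exists k : exists X, deformation wordL wL pL c k.+1 X.
Proof.
have [b [e [be _]]] := basis_exists hT hp.
have [s [sZ sK _]] := basis_section hT hp be.
elim: k => [|k [X hX]]; last first.
  exact: (deformation_step hT hTL wLE w_sup hp hpL duE exact2 sZ sK hX).
have XB i : zmod_morphism (fun (g : G) r => pL (wordL [:: i]) * g r).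
  by move=> g h; apply/funext => r; rewrite /= !fctE mulrBr.
pose X i := Endo (XB i); exists X.
have actE u g r : act X u g r = pL (wordL u) * g r.
  elim: u => [|i u ih] /=; first by rewrite (word_nil hTL) rmorph1 mul1r.
  by rewrite ih mulrA -rmorphM -(word_cons hTL).
split=> //.
- by move=> i g; apply/funext => -[|r] //=; rewrite mulr0.
- by move=> i a g; apply/funext => r; rewrite /scale_seq /= mulrA -str_central mulrA.
move=> j g [|//] _; rewrite /act_rel fct_sumE /scale_seq /= mulr0.
transitivity (pL (f j) * g 0%N); last by rewrite (potential_rel0 hpL) mul0r.
rewrite rmorph_sum mulr_suml; apply: eq_bigr => t _; rewrite actE rmorphM (quotient_str hpL).
by rewrite mulrA.
Qed.

Lemma scale_seq_endoB (a : L) : zmod_morphism (scale_seq (AL := AL) a).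
Proof. by move=> g h; apply/funext => r; rewrite /scale_seq !fctE mulrBr. Qed.

(** The evaluation makes D act on power series modulo Omega^N. *)
Lemma deformation_eval N X : deformation wordL wL pL c N X ->
  exists Phi : {rmorphism TL -> endo G},
  [/\ forall a g, Phi a g 0 = pL a * g 0,
      forall a, pD a = 0 -> forall g, vanish N (Phi a g) &
      forall j g r, (r < N)%N -> Phi (f j) g r = str AL (c j) * shift g r].
Proof.
case=> X_shift X_scale X_0 X_rel.
have [||sc scE] := @rmorphism_of L (endo G) (fun a => Endo (scale_seq_endoB a)).
- move=> a b; apply: endo_eq => g; apply/funext => r.
  by rewrite /= /scale_seq !fctE rmorphB mulrBl.
- split=> [|a b]; apply: endo_eq => g; apply/funext => r; rewrite /= /scale_seq.
    by rewrite rmorph1 mul1r.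
  by rewrite rmorphM mulrA.
have [|Phi [Phi_str Phi_let]] := free_eval hTL (s := sc) (x := X).
  by move=> a i; apply: endo_eq => g; rewrite scE /= X_scale.
have PhiM a b g : Phi (a * b) g = Phi a (Phi b g) by rewrite rmorphM.
have PhiD a b g : Phi (a + b) g = Phi a g + Phi b g by rewrite rmorphD.
have PhiS a g : Phi (str TL a) g = scale_seq a g by rewrite Phi_str scE.
have Phi_word u g : Phi (wordL u) g = act X u g.
  elim: u => [|i u ih]; first by rewrite (word_nil hTL) rmorph1.
  by rewrite (word_cons hTL) PhiM ih Phi_let.
have Phi0 g : Phi 0 g = 0 by rewrite rmorph0.
have Phi_shift a g : Phi a (shift g) = shift (Phi a g).
  elim/(word_span hTL): a => [|a b ha hb|d u].
  - by rewrite !Phi0; apply/funext => -[|r].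
  - by rewrite !PhiD ha hb; apply/funext => -[|r] //=; rewrite !fctE /= addr0.
  by rewrite !PhiM !Phi_word !PhiS (act_shift X_shift) scale_seq_shift.
have Phi_scale a d g : Phi a (scale_seq d g) = scale_seq d (Phi a g).
  by rewrite -PhiS -PhiM -str_central PhiM PhiS.
have Phi_van a g : vanish N g -> vanish N (Phi a g).
  exact: vanish_comm (Phi_shift a) _ _.
have Phi_rel j g : Phi (f j) g = act_rel wL X j g.
  rewrite rmorph_sum endo_sum; apply: eq_bigr => t _.
  by rewrite PhiM PhiS Phi_word.
have Phi_f (psi : 'I_n -> L) g : vanish N (Phi (\sum_j str TL (psi j) * f j) g
    - scale_seq (\sum_j c j * psi j) (shift g)).
  move=> r lt; rewrite rmorph_sum endo_sum !fctE fct_sumE /scale_seq rmorph_sum mulr_suml.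
  rewrite -sumrB big1 // => j _; rewrite PhiM PhiS Phi_rel /scale_seq X_rel //.
  by rewrite /scale_seq mulrA -rmorphM mulrC subrr.
exists Phi; split.
- move=> a g; elim/(word_span hTL): a => [|a b ha hb|d u].
  + by rewrite Phi0 rmorph0 mul0r.
  + by rewrite PhiD rmorphD mulrDl -ha -hb.
  by rewrite PhiM PhiS Phi_word /scale_seq (act_0 hTL X_0) rmorphM (quotient_str hpL) mulrA.
- move=> a /(quotient_ker hpD); elim=> [|x r y z hr _ ih] g; first by rewrite Phi0.
  rewrite PhiD; apply: vanishD => //; rewrite !PhiM; apply: (Phi_van).
  move: (Phi y g) => {}g; case: hr => [[psi hpsi ->]|[v [psi ->]]].
    move=> k lt; have := Phi_f psi g k lt; rewrite hpsi !fctE /scale_seq rmorph0 mul0r.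
    by rewrite subr0.
  set F := \sum_j str TL (psi j) * f j; set Y := \sum_i str TL (v i) * wordL [:: i].
  set k := \sum_j c j * psi j.
  have -> : Phi (Y * F - F * Y) g = Phi Y (Phi F g - scale_seq k (shift g))
      - (Phi F (Phi Y g) - scale_seq k (shift (Phi Y g))).
    rewrite (endoB (Phi Y)) Phi_scale Phi_shift opprB addrA subrK rmorphB.
    by rewrite -PhiM -[Phi F _]PhiM.
  move=> i lt; rewrite !fctE.
  have h1 := Phi_van Y _ (Phi_f psi g) i lt; have h2 := Phi_f psi (Phi Y g) i lt.
  by rewrite h1; move: h2; rewrite !fctE => ->; rewrite subrr.
- by move=> j g r lt; rewrite Phi_rel X_rel.
Qed.

Context (j1 : 'I_n) (c_j1 : c j1 != 0).
Local Notation om := (omega wordL wL c pD j1).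

(** If d is killed by Omega and d = Omega^k b, a deformation of sufficient order shows that b is
    again a multiple of Omega; so d is divisible by all powers of Omega. *)
Lemma omega_regular d : om * d = 0 -> d = 0.
Proof.
move=> h0; apply: (divisible_eq0 m_gt0 (omega_deg hTL hpD j1)).
have omC := omega_central hTL hpD j1.
elim=> [|k [b dE]]; first by exists d; rewrite expr0 mul1r.
have [t tE] := quotient_surj hpD b.
have pt : pD (f j1 ^+ k.+1 * t) = 0.
  have pf l : pD (f j1 ^+ l) = str D (c j1 ^+ l) * om ^+ l.
    elim: l => [|l ih]; first by rewrite !expr0 !rmorph1 mul1r.
    by rewrite !exprS rmorphM ih (omegaE hpD c_j1) str_mul.
  by rewrite rmorphM pf -tE -mulrA (exprS om) -mulrA -dE h0 mulr0.
have [X hX] := deformation_exists k.+1.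
have [Phi [Phi0 Phi_ker Phi_f]] := deformation_eval hX.
have Phi_pow l g : (l < k.+2)%N -> Phi (f j1 ^+ l) g l = str AL (c j1 ^+ l) * g 0%N.
  elim: l => [|l ih] lt; first by rewrite !expr0 !rmorph1 mul1r.
  rewrite !exprS rmorphM -[LHS]/(Phi (f j1) (Phi (f j1 ^+ l) g) l.+1) Phi_f //=.
  by rewrite ih ?(ltnW lt) // mulrA -rmorphM.
have [|b' b'E] := extension_ker hTL hpL hpD c_j1 (a := t).
  (* Coefficient k+1 of [f_j1 ^+ k.+1 * t] applied to a series with constant term 1 is
     [c_j1 ^+ k.+1] times the image of [t] in [AL]; it vanishes because the element is 0 in D. *)
  have := Phi_ker _ pt (fun _ => 1) k.+1 (ltnSn _).
  rewrite rmorphM -[LHS]/(Phi (f j1 ^+ k.+1) (Phi t (fun _ => 1)) k.+1) Phi_pow //.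
  rewrite Phi0 mulr1 => /(congr1 (fun y => str AL (c j1 ^+ k.+1)^-1 * y)).
  by rewrite mulrA -rmorphM mulVf ?expf_neq0 // rmorph1 mul1r mulr0.
by exists b'; rewrite dE tE b'E exprSr mulrA.
Qed.

End Regularity.

(** * The enveloping algebra of a quotient of a free algebra *)

Section EnvelopeExistence.
Context (K : fieldType) (n : nat).
Context (T : gralg K) (word : seq 'I_n -> T) (hT : free_algebra word).
Context (S : T -> Prop) (hS : homogeneous_set S).
Context (D : gralg K) (p : {rmorphism T -> D}) (hp : quotient_map S p).
Context (T2 : gralg K) (word2 : seq 'I_(n + n) -> T2) (hT2 : free_algebra word2).
Context (lx : {rmorphism T -> T2}) (lx_str : forall c, lx (str T c) = str T2 c)
  (lx_word : forall u, lx (word u) = word2 (map (@lshift n n) u)).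
Context (ly : {additive T -> T2})
  (ly_word : forall c u, ly (str T c * word u) = str T2 c * word2 (rev (map (@rshift n n) u))).

(** D^e is presented on two copies of the letters, by the relations of D read forwards in the first
    copy and backwards in the second, and by the commutation of the two copies. *)
Definition env_rel (r : T2) : Prop :=
  [\/ exists2 s, S s & r = lx s, exists2 s, S s & r = ly s |
      exists i j, r = word2 [:: lshift n i] * word2 [:: rshift n j]
        - word2 [:: rshift n j] * word2 [:: lshift n i]].

Let lyZ c a : ly (str T c * a) = str T2 c * ly a.
Proof.
elim/(word_span hT): a => [|a b ha hb|d u]; first by rewrite mulr0 !raddf0 mulr0.
  by rewrite mulrDr !(raddfD ly) ha hb mulrDr.
by rewrite mulrA -rmorphM !ly_word rmorphM mulrA.
Qed.

Let ly_w u : ly (word u) = word2 (rev (map (@rshift n n) u)).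
Proof. by rewrite -[word u]mul1r -(rmorph1 (str T)) ly_word rmorph1 mul1r. Qed.

Let lyM a b : ly (a * b) = ly b * ly a.
Proof.
elim/(word_span hT): a => [|a a' h h'|c u].
- by rewrite mul0r !raddf0 mulr0.
- by rewrite mulrDl !(raddfD ly) h h' mulrDr.
elim/(word_span hT): b => [|b b' h h'|d v].
- by rewrite mulr0 !raddf0 mul0r.
- by rewrite mulrDr !(raddfD ly) h h' mulrDl.
by rewrite str_mul -(word_cat hT) !ly_word str_mul mulrC map_cat rev_cat (word_cat hT2).
Qed.

Lemma lx_deg k a : adeg T k a -> adeg T2 k (lx a).
Proof.
case: k => [k|k] ha; last by rewrite (adegN _ ha) ?rmorph0 //; apply: deg_0 (adegP T2) _.
elim/(word_deg_span hT): _ / ha => [|x y hx hy|c u <-].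
- by rewrite rmorph0; apply: deg_0 (adegP T2) _.
- by rewrite rmorphD; apply: gradingD (adegP T2) _ _ _ hx hy.
rewrite rmorphM lx_str lx_word -[_%:Z]add0r; apply: adegM; first exact: adeg_str.
by have := word_deg hT2 (map (@lshift n n) u); rewrite size_map.
Qed.

Lemma ly_deg k a : adeg T k a -> adeg T2 k (ly a).
Proof.
case: k => [k|k] ha; last by rewrite (adegN _ ha) ?raddf0 //; apply: deg_0 (adegP T2) _.
elim/(word_deg_span hT): _ / ha => [|x y hx hy|c u <-].
- by rewrite raddf0; apply: deg_0 (adegP T2) _.
- by rewrite raddfD; apply: gradingD (adegP T2) _ _ _ hx hy.
rewrite ly_word -[_%:Z]add0r; apply: adegM; first exact: adeg_str.
by have := word_deg hT2 (rev (map (@rshift n n) u)); rewrite size_rev size_map.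
Qed.

Lemma env_rel_homogeneous : homogeneous_set env_rel.
Proof.
move=> r [[s /hS [k hk] ->]|[s /hS [k hk] ->]|[i [j ->]]].
- by exists k; apply: lx_deg.
- by exists k; apply: ly_deg.
exists (1 + 1); apply: (deg_B (adegP T2)); apply: adegM; exact: (word_deg hT2 [:: _]).
Qed.

Context (Env : gralg K) (q : {rmorphism T2 -> Env}) (hq : quotient_map env_rel q).

Let xs (v : seq 'I_(n + n)) : seq 'I_n :=
  pmap (fun k => if fintype.split k is inl i then Some i else None) v.
Let ys (v : seq 'I_(n + n)) : seq 'I_n :=
  pmap (fun k => if fintype.split k is inr i then Some i else None) v.

Let xs_lshift u : xs (map (@lshift n n) u) = u.
Proof. by elim: u => //= i u ih; rewrite (unsplitK (inl _ i)) /= ih. Qed.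
Let xs_rshift u : xs (map (@rshift n n) u) = [::].
Proof. by elim: u => //= i u ih; rewrite (unsplitK (inr _ i)) /=. Qed.
Let ys_lshift u : ys (map (@lshift n n) u) = [::].
Proof. by elim: u => //= i u ih; rewrite (unsplitK (inl _ i)) /=. Qed.
Let ys_rshift u : ys (map (@rshift n n) u) = u.
Proof. by elim: u => //= i u ih; rewrite (unsplitK (inr _ i)) /= ih. Qed.
Let xs_cat u v : xs (u ++ v) = xs u ++ xs v. Proof. exact: pmap_cat. Qed.
Let ys_cat u v : ys (u ++ v) = ys u ++ ys v. Proof. exact: pmap_cat. Qed.

Let px v : D := p (word (xs v)).
Let py v : D := p (word (rev (ys v))).

Let px_cat u v : px (u ++ v) = px u * px v.
Proof. by rewrite /px xs_cat (word_cat hT) rmorphM. Qed.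
Let py_cat u v : py (u ++ v) = py v * py u.
Proof. by rewrite /py ys_cat rev_cat (word_cat hT) rmorphM. Qed.

Let px_l u : px (map (@lshift n n) u) = p (word u).
Proof. by rewrite /px xs_lshift. Qed.
Let py_l u : py (map (@lshift n n) u) = 1.
Proof. by rewrite /py ys_lshift (word_nil hT) rmorph1. Qed.
Let px_r u : px (rev (map (@rshift n n) u)) = 1.
Proof. by rewrite /px -map_rev xs_rshift (word_nil hT) rmorph1. Qed.
Let py_r u : py (rev (map (@rshift n n) u)) = p (word u).
Proof. by rewrite /py -map_rev ys_rshift revK. Qed.

Lemma envelope_maps : exists (X : {rmorphism D -> Env}) (Y : {additive D -> Env}),
  (forall a, X (p a) = q (lx a)) /\ (forall a, Y (p a) = q (ly a)).
Proof.
have q0 r : env_rel r -> q r = 0 by move=> hr; apply/(quotient_ker hq)/ideal_gen_sub.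
have [|X XE] := quotient_map_lift hp (g := (q \o lx : {rmorphism T -> Env})).
  by move=> s hs; apply: q0; apply: Or31; exists s.
have [|Y YE] := quotient_map_lift_additive hp (g := (q \o ly : {additive T -> Env})).
  move=> a /(quotient_ker hp) /=; elim=> [|x s y z hs _ ih]; first by rewrite !raddf0.
  rewrite raddfD rmorphD ih addr0 !lyM !rmorphM (q0 (ly s)) ?mul0r ?mulr0 //.
  by apply: Or32; exists s.
by exists X, Y.
Qed.

Context (X : {rmorphism D -> Env}) (Y : {additive D -> Env})
  (XE : forall a, X (p a) = q (lx a)) (YE : forall a, Y (p a) = q (ly a)).

Let X_str c : X (str D c) = str Env c.
Proof. by rewrite -(quotient_str hp) XE lx_str (quotient_str hq). Qed.

Let YZ c b : Y (str D c * b) = str Env c * Y b.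
Proof.
have [b' ->] := quotient_surj hp b.
by rewrite -(quotient_str hp) -rmorphM !YE lyZ rmorphM (quotient_str hq).
Qed.

Let YM a b : Y (a * b) = Y b * Y a.
Proof.
have [a' ->] := quotient_surj hp a; have [b' ->] := quotient_surj hp b.
by rewrite -rmorphM !YE lyM rmorphM.
Qed.

Let Y1 : Y 1 = 1.
Proof.
by rewrite -(rmorph1 p) YE -(word_nil hT) ly_w /= (word_nil hT2) rmorph1.
Qed.

Let XY a b : X a * Y b = Y b * X a.
Proof.
have [a' ->] := quotient_surj hp a; have [b' ->] := quotient_surj hp b.
have letters i j : X (p (word [:: i])) * Y (p (word [:: j])) =
    Y (p (word [:: j])) * X (p (word [:: i])).
  rewrite XE YE lx_word ly_w -!rmorphM; apply/eqP; rewrite -subr_eq0 -rmorphB.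
  apply/eqP/(quotient_ker hq)/ideal_gen_sub; apply: Or33.
  by exists i, j.
have xw i v : X (p (word [:: i])) * Y (p (word v)) =
    Y (p (word v)) * X (p (word [:: i])).
  elim: v => [|j v ih]; first by rewrite (word_nil hT) rmorph1 Y1 mulr1 mul1r.
  by rewrite (word_cons hT j v) (rmorphM p) YM mulrA ih -mulrA letters mulrA.
have ww u v : X (p (word u)) * Y (p (word v)) = Y (p (word v)) * X (p (word u)).
  elim: u => [|i u ih]; first by rewrite (word_nil hT) !rmorph1 mulr1 mul1r.
  by rewrite (word_cons hT i u) !rmorphM -mulrA ih mulrA xw mulrA.
elim/(word_span hT): a' => [|a1 a2 h h'|c u].
- by rewrite !rmorph0 mulr0 mul0r.
- by rewrite !rmorphD mulrDl mulrDr h h'.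
elim/(word_span hT): b' => [|b1 b2 h h'|d v].
- by rewrite (rmorph0 p) raddf0 mulr0 mul0r.
- by rewrite (rmorphD p) (raddfD Y) mulrDl mulrDr h h'.
rewrite !(rmorphM p) !(quotient_str hp) YZ rmorphM X_str !str_mul ww.
by rewrite mulrC.
Qed.

Let tn a b : Env := X a * Y b.

Let q_word v : q (word2 v) = tn (px v) (py v).
Proof.
elim: v => [|k v ih].
  by rewrite /tn /px /py /= (word_nil hT) (word_nil hT2) !rmorph1 Y1 mulr1.
have -> : px (k :: v) = px [:: k] * px v by rewrite -px_cat.
have -> : py (k :: v) = py v * py [:: k] by rewrite -py_cat.
rewrite (word_cons hT2 k v) rmorphM ih /tn rmorphM YM.
have qk : q (word2 [:: k]) = X (px [:: k]) * Y (py [:: k]).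
  rewrite XE YE lx_word ly_w -rmorphM -(word_cat hT2) /xs /ys /=.
  by case: fintype.splitP => i ki /=; rewrite ?cats0; congr (q (word2 [:: _])); apply: val_inj.
by rewrite qk -!mulrA; congr (_ * _); rewrite !mulrA XY.
Qed.

(** The map is defined on words in both kinds of letters by separating the two kinds. [g2x] and
    [g2y] compute it around an inserted relation of D, which shows that it vanishes on the ideal. *)
Lemma tn_universal (G : zmodType) (beta : D -> D -> G) :
  (forall a a' b, beta (a + a') b = beta a b + beta a' b) ->
  (forall a b b', beta a (b + b') = beta a b + beta a b') ->
  (forall a c b, beta (a * str D c) b = beta a (str D c * b)) ->
  exists g : {additive Env -> G}, forall a b, g (tn a b) = beta a b.
Proof.
move=> bDl bDr bbal.
have b0l b : beta 0 b = 0 by apply: (addrI (beta 0 b)); rewrite -bDl !addr0.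
have b0r a : beta a 0 = 0 by apply: (addrI (beta a 0)); rewrite -bDr !addr0.
have [g2 g2E] : exists g2 : {additive T2 -> G}, forall c v,
    g2 (str T2 c * word2 v) = beta (str D c * px v) (py v).
  apply: (word_ext hT2) => v c d /=.
  by apply: (addIr (beta (str D d * px v) (py v))); rewrite -bDl subrK -mulrDl -rmorphD subrK.
have g2x c u s v : g2 (str T2 c * (word2 u * lx s * word2 v)) =
    beta (str D c * (px u * p s * px v)) (py v * py u).
  elim/(word_span hT): s => [|s s' h h'|d t].
  - by rewrite !rmorph0 !mulr0 !mul0r !mulr0 raddf0 b0l.
  - by rewrite !rmorphD !mulrDr !mulrDl !mulrDr raddfD h h' bDl.
  rewrite !rmorphM lx_str lx_word (quotient_str hp).
  rewrite -[word2 u]mul1r -(rmorph1 (str T2)) str_mul -[word2 v]mul1r -(rmorph1 (str T2)).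
  rewrite str_mul mulrA -rmorphM -!(word_cat hT2) g2E mul1r mulr1.
  rewrite !px_cat !py_cat px_l py_l ?mulr1 ?mul1r.
  rewrite rmorphM -!mulrA; congr (beta (_ * _) _).
  by rewrite !mulrA -str_central.
have g2y c u s v : g2 (str T2 c * (word2 u * ly s * word2 v)) =
    beta (str D c * (px u * px v)) (py v * p s * py u).
  elim/(word_span hT): s => [|s s' h h'|d t].
  - by rewrite (rmorph0 p) (raddf0 ly) !mulr0 !mul0r !mulr0 raddf0 b0r.
  - by rewrite (rmorphD p) (raddfD ly) !mulrDr !mulrDl !mulrDr raddfD h h' bDr.
  rewrite !rmorphM ly_word (quotient_str hp).
  rewrite -[word2 u]mul1r -(rmorph1 (str T2)) str_mul -[word2 v]mul1r -(rmorph1 (str T2)).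
  rewrite str_mul mulrA -rmorphM -!(word_cat hT2) g2E mul1r mulr1.
  rewrite !px_cat !py_cat px_r py_r ?mulr1 ?mul1r.
  rewrite (mulrA _ (str D d)) -(str_central d (py v)) -!mulrA -bbal -str_central.
  by rewrite !mulrA -rmorphM mulrC.
have g2ker r : q r = 0 -> g2 r = 0.
  move=> /(quotient_ker hq); elim=> [|x s y z hs _ ih]; first exact: raddf0.
  rewrite raddfD ih addr0.
  elim/(word_span hT2): x => [|x x' h h'|c u]; first by rewrite !mul0r raddf0.
    by rewrite !mulrDl raddfD /= h h' addr0.
  elim/(word_span hT2): y => [|y y' h h'|d v]; first by rewrite !mulr0 raddf0.
    by rewrite !mulrDr raddfD /= h h' addr0.
  have -> : str T2 c * word2 u * s * (str T2 d * word2 v) =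
      str T2 (c * d) * (word2 u * s * word2 v) by rewrite -[_ * word2 u * s]mulrA str_mul.
  have ps0 t : S t -> p t = 0 by move=> ht; apply/(quotient_ker hp)/ideal_gen_sub.
  case: hs => [[t /ps0 pt ->]|[t /ps0 pt ->]|[i [j ->]]].
  - by rewrite g2x pt mulr0 mul0r mulr0 b0l.
  - by rewrite g2y pt mulr0 mul0r b0r.
  rewrite mulrBr mulrBl mulrBr raddfB /= -!(word_cat hT2) !g2E !px_cat !py_cat.
  have xl k : px [:: rshift n k] = 1 by rewrite /px (xs_rshift [:: k]) (word_nil hT) rmorph1.
  have yl k : py [:: lshift n k] = 1 by rewrite /py (ys_lshift [:: k]) (word_nil hT) rmorph1.
  by rewrite !xl !yl !mulr1 !mul1r subrr.
have [g gE] := quotient_map_lift_additive hq g2ker.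
exists g => a b; have [a' ->] := quotient_surj hp a; have [b' ->] := quotient_surj hp b.
have := g2y 1 [::] b' [::].
elim/(word_span hT): a' => [|a1 a2 h h'|c u]; first by rewrite !rmorph0 /tn rmorph0 mul0r raddf0 b0l.
  by move=> hy; rewrite rmorphD /tn rmorphD mulrDl raddfD /= h // h' // bDl.
move=> _; have := g2y c (map (@lshift n n) u) b' [::].
rewrite /tn XE YE -rmorphM gE !rmorphM lx_str lx_word (word_nil hT2) mulr1 mulrA => ->.
rewrite px_l py_l /px /py /= (word_nil hT) rmorph1 !mulr1 mul1r.
by rewrite (quotient_str hp).
Qed.

Lemma envelope_exists : exists E : envelope D, True.
Proof.
have Xdeg k a : adeg D k a -> adeg Env k (X a).
  by move=> /(quotient_deg_lift hp) [b hb ->]; rewrite XE; apply/(quotient_deg hq)/lx_deg.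
have Ydeg k a : adeg D k a -> adeg Env k (Y a).
  by move=> /(quotient_deg_lift hp) [b hb ->]; rewrite YE; apply/(quotient_deg hq)/ly_deg.
unshelve eexists (@Envelope K D Env tn _ _ _ _ tn_universal _ _ _ _) => //.
- by move=> a a' b; rewrite /tn rmorphD mulrDl.
- by move=> a b b'; rewrite /tn raddfD mulrDr.
- by move=> a c b; rewrite /tn rmorphM YZ X_str mulrA.
- move=> e; have [r ->] := quotient_surj hq e.
  elim/(word_span hT2): r => [|r r' [s hs] [s' hs']|c v].
  + by exists [::]; rewrite rmorph0 big_nil.
  + by exists (s ++ s'); rewrite rmorphD big_cat hs hs'.
  exists [:: (str D c * px v, py v)]; rewrite big_seq1 /= rmorphM (quotient_str hq) q_word.
  by rewrite /tn rmorphM X_str mulrA.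
- by rewrite /tn rmorph1 Y1 mulr1.
- move=> a b a' b'; rewrite /tn rmorphM YM -!mulrA; congr (_ * _).
  by rewrite !mulrA -XY.
- by move=> c; rewrite /tn X_str Y1 mulr1.
- by move=> i j a b ha hb; apply: adegM; [apply: Xdeg | apply: Ydeg].
Qed.

End EnvelopeExistence.

Lemma gquot_envelope (K : fieldType) n (T : gralg K) (word : seq 'I_n -> T)
    (hT : free_algebra word) (S : T -> Prop) (hS : homogeneous_set S)
    (D : gralg K) (p : {rmorphism T -> D}) (hp : quotient_map S p) :
  exists E : envelope D, True.
Proof.
have hT2 := TV_free K (n + n); move: (@tv_word K (n + n)) hT2.
move: (TV K (n + n)) => T2 word2 hT2.
have [|lx [lx_str lx_let]] := free_eval hT (s := str T2) (x := fun i => word2 [:: lshift n i]).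
  by move=> c i; rewrite str_central.
have lx_word u : lx (word u) = word2 (map (@lshift n n) u).
  elim: u => [|i u ih]; first by rewrite (word_nil hT) rmorph1 /= (word_nil hT2).
  by rewrite (word_cons hT) rmorphM lx_let ih -(word_cat hT2).
have [ly lyE] : exists ly : {additive T -> T2}, forall c u,
    ly (str T c * word u) = str T2 c * word2 (rev (map (@rshift n n) u)).
  by apply: (word_ext hT) => u c d /=; rewrite rmorphB mulrBl.
have hR := env_rel_homogeneous hT hS hT2 lx_str lx_word lyE.
have [q [_ hq]] := gquot_quotient_map hR.
have [X [Y [XE YE]]] := envelope_maps hT hp hT2 lyE hq.
exact: (envelope_exists hT hp hT2 lx_str lx_word lyE hq XE YE).
Qed.

(** * The resolution of a central extension *)

Section GradedRows.
Context (K : fieldType) (E : gralg K).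

Definition row_deg k (sh : 'I_k -> int) (q : int) (v : 'rV[E]_k) : Prop :=
  forall i, adeg E (q - sh i) (v 0 i).

Definition mx_deg k l (sh : 'I_k -> int) (sh' : 'I_l -> int) (M : 'M[E]_(k, l)) : Prop :=
  forall i j, adeg E (sh i - sh' j) (M i j).

Lemma row_grading k (sh : 'I_k -> int) : grading (row_deg sh).
Proof.
have [c [cdeg cid c0 call]] := grading_component (adegP E).
split.
- by move=> q i; rewrite mxE; apply: deg_0 (adegP E) _.
- move=> q u v hu hv i; rewrite !mxE; exact: deg_B (adegP E) _ _ _ (hu i) (hv i).
- move=> v; rewrite [v]row_sum_delta.
  suff [l [lE hl]] : exists l : seq (int * 'rV[E]_k),
      \sum_j v 0 j *: delta_mx 0 j = \sum_(q <- l) q.2 /\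
      forall q, q \in l -> row_deg sh q.1 q.2.
    exists (undup (map fst l)), (fun j => \sum_(q <- l | q.1 == j) q.2).
    split; first exact: undup_uniq.
      move=> j i; rewrite summxE big_seq_cond; apply: (big_ind (adeg E (j - sh i))).
      - exact: deg_0 (adegP E) _.
      - exact: gradingD (adegP E) _.
      by move=> q /andP[/hl hq /eqP <-].
    rewrite lE (exchange_big_dep predT) //= big_seq [RHS]big_seq; apply: eq_bigr => q hq.
    rewrite (eq_bigl (fun j => j == q.1)); last by move=> j; rewrite eq_sym.
    rewrite -big_filter filter_pred1_uniq ?undup_uniq ?big_seq1 //.
    by rewrite mem_undup; apply: map_f.
  apply: (big_ind (fun x => exists l : seq (int * 'rV[E]_k), x = \sum_(q <- l) q.2 /\
      forall q, q \in l -> row_deg sh q.1 q.2)).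
  + by exists [::]; rewrite big_nil.
  + move=> x y [l [-> hl]] [l' [-> hl']]; exists (l ++ l'); rewrite big_cat; split=> // q.
    by rewrite mem_cat => /orP[/hl|/hl'].
  move=> j _; have [s [f [us hf ->]]] := deg_sum (adegP E) (v 0 j).
  exists [seq (q + sh j, f q *: delta_mx 0 j) | q <- s]; split.
    by rewrite big_map scaler_suml.
  move=> _ /mapP [q _ ->] i /=; rewrite !mxE eqxx /=; case: eqP => [->|_].
    by rewrite mulr1 addrK.
  by rewrite mulr0; apply: deg_0 (adegP E) _.
move=> s f us hf e q qs; apply/rowP => i; rewrite [RHS]mxE.
have := @deg_free _ _ (adegP E) (map (fun q => q - sh i) s)
  (fun q => f (q + sh i) 0 i) _ _ _ (q - sh i); rewrite subrK; apply.
- by rewrite map_inj_uniq // => x y /addIr.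
- by move=> x; have := hf (x + sh i) i; rewrite addrK.
- rewrite big_map; transitivity ((\sum_(q <- s) f q) 0 i); last by rewrite e mxE.
  by rewrite summxE; apply: eq_bigr => x _; rewrite subrK.
- exact: map_f.
Qed.

Lemma row_deg_mulmx k l (sh : 'I_k -> int) (sh' : 'I_l -> int) (M : 'M[E]_(k, l)) q v :
  mx_deg sh sh' M -> row_deg sh q v -> row_deg sh' q (v *m M).
Proof.
move=> hM hv j; rewrite mxE; apply: (big_ind (adeg E (q - sh' j))).
- exact: deg_0 (adegP E) _.
- exact: gradingD (adegP E) _.
by move=> i _; have := adegM (hv i) (hM i j); rewrite addrA subrK.
Qed.

Lemma row_deg_scale k (sh : 'I_k -> int) e d q v :
  adeg E d e -> row_deg sh q v -> row_deg sh (d + q) (e *: v).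
Proof. by move=> he hv i; rewrite mxE -addrA; apply: adegM. Qed.

Definition free_grmod k (sh : 'I_k -> int) : grmod E :=
  @GrMod K E 'rV[E]_k (row_deg sh) (row_grading sh)
    (fun i q e v he hv => row_deg_scale he hv).

Lemma free_grmod_fg k (sh : 'I_k -> int) : finitely_generated (free_grmod sh).
Proof.
exists [seq (delta_mx 0 i : 'rV[E]_k) | i <- enum 'I_k] => v.
have sz : size [seq (delta_mx 0 i : 'rV[E]_k) | i <- enum 'I_k] = k.
  by rewrite size_map size_enum_ord.
exists (fun j => if insub j is Some i then v 0 i else 0).
rewrite -(big_mkord xpredT (fun j : nat => (if insub j is Some i then v 0 i else 0) *:
   [seq (delta_mx 0 i : 'rV[E]_k) | i <- enum 'I_k]`_j)) sz big_mkord.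
rewrite {1}[v]row_sum_delta; apply: eq_bigr => i _.
rewrite valK (nth_map i) ?size_enum_ord //; congr (_ *: delta_mx 0 _).
by apply: val_inj; rewrite /= nth_enum_ord.
Qed.

(* Exactness modulo the central element [om] implies exactness, by induction on the
   degree; all is relative to an ideal [I]. *)
Section Reduction.
Context (I : E -> Prop) (I0 : I 0) (ID : forall x y, I x -> I y -> I (x + y))
  (IMl : forall x y, I y -> I (x * y)) (IMr : forall x y, I x -> I (x * y)).
Context (comp : int -> {additive E -> E})
  (comp_deg : forall k x, adeg E k (comp k x))
  (comp_id : forall k x, adeg E k x -> comp k x = x)
  (comp_0 : forall j k x, adeg E j x -> j != k -> comp k x = 0)
  (I_comp : forall k x, I x -> I (comp k x)).
Context (om : E) (om_central : central om) (d : int) (d_gt0 : 0 < d) (om_deg : adeg E d om)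
  (om_reg : forall x, I (om * x) -> I x).

Let compM k e x y : adeg E e y -> comp (k + e) (x * y) = comp k x * y.
Proof.
move=> hy; have [s [f [_ hf ->]]] := deg_sum (adegP E) x.
rewrite mulr_suml !raddf_sum mulr_suml; apply: eq_bigr => j _ /=.
have [->|jk] := eqVneq j k; first by rewrite !comp_id //; apply: adegM.
rewrite (comp_0 (hf j) jk) mul0r; apply: comp_0 (adegM (hf j) hy) _.
by apply: contraNneq jk => /addIr ->.
Qed.

Definition in_rows k (v : 'rV[E]_k) : Prop := forall i, I (v 0 i).

Let in_rowsD k (u v : 'rV[E]_k) : in_rows u -> in_rows v -> in_rows (u + v).
Proof. by move=> hu hv i; rewrite mxE; apply: ID. Qed.

Let in_rows_mul k l (v : 'rV[E]_k) (M : 'M[E]_(k, l)) : in_rows v -> in_rows (v *m M).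
Proof. by move=> hv j; rewrite mxE; apply: (big_ind I) => // i _; apply: IMr. Qed.

Let in_rowsN k (v : 'rV[E]_k) : in_rows v -> in_rows (- v).
Proof. by move=> hv i; rewrite mxE -mulN1r; apply: IMl. Qed.

Let in_rowsZ k x (v : 'rV[E]_k) : in_rows v -> in_rows (x *: v).
Proof. by move=> hv i; rewrite mxE; apply: IMl. Qed.

Let rcomp k (sh : 'I_k -> int) q (v : 'rV[E]_k) : 'rV[E]_k := \row_i comp (q - sh i) (v 0 i).

Let rcomp_mul k l (sh : 'I_k -> int) (sh' : 'I_l -> int) (M : 'M[E]_(k, l)) q v :
  mx_deg sh sh' M -> rcomp sh' q (v *m M) = rcomp sh q v *m M.
Proof.
move=> hM; apply/rowP => j; rewrite !mxE raddf_sum; apply: eq_bigr => i _ /=.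
by rewrite !mxE -(compM _ _ (hM i j)) addrA subrK.
Qed.

Context (k1 k2 k3 : nat) (sh1 : 'I_k1 -> int) (sh2 : 'I_k2 -> int) (sh3 : 'I_k3 -> int).
Context (sh2_ge0 : forall i, 0 <= sh2 i).
Context (M1 : 'M[E]_(k1, k2)) (M2 : 'M[E]_(k2, k3)).
Context (hM1 : mx_deg sh1 sh2 M1) (hM2 : mx_deg sh2 sh3 M2) (M12 : M1 *m M2 = 0).

Lemma reduction_exact :
  (forall v, (exists y, in_rows (v *m M2 - om *: y)) ->
     exists u y, in_rows (v - u *m M1 - om *: y)) ->
  forall v, in_rows (v *m M2) -> exists u, in_rows (v - u *m M1).
Proof.
move=> H.
have step (k : nat) : forall q v, q < k%:Z -> row_deg sh2 q v -> in_rows (v *m M2) ->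
    exists u, in_rows (v - u *m M1).
  elim: k => [|k ih] q v qk hv vI.
    have -> : v = 0.
      apply/rowP => i; rewrite mxE; apply: adegN (hv i).
      by rewrite subr_lt0; apply: lt_le_trans qk _.
    by exists 0; rewrite mul0mx subrr => i; rewrite mxE.
  have [|u [y huy]] := H v; first by exists 0; rewrite scaler0 subr0.
  (* [u] and [y] need not be homogeneous; since the matrices and [om] are, the components in degrees
     q and q - d satisfy the same relation. *)
  pose u' := rcomp sh1 q u; pose y' := rcomp sh2 (q - d) y.
  have huy' : in_rows (v - u' *m M1 - om *: y').
    have -> : v - u' *m M1 - om *: y' = rcomp sh2 q (v - u *m M1 - om *: y).
      apply/rowP => i; rewrite [in RHS]mxE !mxE !raddfB /= (comp_id (hv i)).
      have := congr1 (fun M : 'rV_k2 => M 0 i) (rcomp_mul q u hM1).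
      rewrite !mxE => ->; congr (_ - _ - _).
      rewrite !om_central -(compM _ _ om_deg); congr (comp _ _).
      by rewrite [q - d - _ + d]addrAC subrK.
    by move=> i; rewrite mxE; apply: I_comp.
  have [|||u'' hu''] := ih (q - d) y'.
  - by rewrite ltrBlDr; apply: lt_le_trans qk _; rewrite -addn1 PoszD lerD2l -gtz0_ge1.
  - by move=> i; rewrite mxE; apply: comp_deg.
  - move=> j; apply: om_reg.
    have /(_ j) := in_rowsD (in_rows_mul M2 huy') (in_rowsN vI).
    rewrite !mulmxBl -mulmxA M12 mulmx0 subr0 addrAC subrr add0r -scalemxAl.
    move=> /(IMl (-1)); by rewrite mxE mulN1r opprK mxE.
  exists (u' + om *: u''); rewrite mulmxDl opprD addrA.
  have -> : v - u' *m M1 - (om *: u'') *m M1 =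
      (v - u' *m M1 - om *: y') + om *: (y' - u'' *m M1).
    by rewrite scalerBr addrA subrK -scalemxAl.
  by apply: in_rowsD => //; apply: in_rowsZ.
move=> v vI; have [s [f [us hf vE]]] := deg_sum (row_grading sh2) v.
have fI q : q \in s -> in_rows (f q *m M2).
  move=> qs; have -> : f q *m M2 = rcomp sh3 q (v *m M2).
    rewrite (rcomp_mul _ _ hM2) vE; congr (_ *m _); apply/rowP => i.
    rewrite mxE summxE raddf_sum (bigD1_seq q) //= (comp_id (hf q i)) big1 ?addr0 // => j jq.
    apply: comp_0 (hf j i) _; by apply: contraNneq jq => /addIr ->.
  by move=> i; rewrite mxE; apply: I_comp.
have {}step q : q \in s -> exists u, in_rows (f q - u *m M1).
  move=> qs; apply: (step `|q|.+1 q) (hf q) (fI q qs).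
  by apply: le_lt_trans (ler_norm q) _; rewrite -abszE ltz_nat.
rewrite vE; elim: (s) step => [|q r ih] h.
  by exists 0; rewrite big_nil mul0mx subrr => i; rewrite mxE.
have [u hu] := h q (mem_head _ _).
have [|u' hu'] := ih; first by move=> j jr; apply: h; rewrite inE jr orbT.
exists (u + u'); rewrite big_cons mulmxDl opprD addrACA; exact: in_rowsD.
Qed.

End Reduction.
End GradedRows.

Section EnvelopeMaps.
Context (K : fieldType) (D A : gralg K) (E : envelope D) (F : envelope A).

Lemma env_map (g h : D -> A) : zmod_morphism g -> zmod_morphism h ->
  (forall c x, g (str D c * x) = str A c * g x) ->
  (forall c x, h (str D c * x) = str A c * h x) ->
  exists t : {additive E -> F}, forall a b, t (tens E a b) = tens F (g a) (h b).
Proof.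
move=> /additive_of [g' gE] /additive_of [h' hE] gZ hZ; apply: tens_universal.
- by move=> a a' b; rewrite -!gE raddfD tensDl.
- by move=> a b b'; rewrite -!hE raddfD tensDr.
- by move=> a c b; rewrite -str_central gZ hZ str_central tens_balanced.
Qed.

Lemma env_rmorphism (g : {rmorphism D -> A}) : (forall c, g (str D c) = str A c) ->
  exists t : {rmorphism E -> F}, (forall a b, t (tens E a b) = tens F (g a) (g b)) /\
    (forall c, t (str E c) = str F c).
Proof.
move=> gstr; have [||||t0 tE] := env_map (g := g) (h := g).
- exact: raddfB.
- exact: raddfB.
- by move=> c x; rewrite rmorphM gstr.
- by move=> c x; rewrite rmorphM gstr.
have tM : monoid_morphism t0.
  split; first by rewrite -(tens1 E) tE rmorph1 tens1.
  move=> e e'; elim/env_ind: e => [|e1 e2 h h'|a b].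
  - by rewrite mul0r !raddf0 mul0r.
  - by rewrite mulrDl !(raddfD t0) h h' mulrDl.
  elim/env_ind: e' => [|e1 e2 h h'|a' b'].
  - by rewrite mulr0 !raddf0 mulr0.
  - by rewrite mulrDr !(raddfD t0) h h' mulrDr.
  by rewrite tensM !tE tensM !rmorphM.
have [t tt0] := rmorphism_of (raddfB t0) tM.
exists t; split=> [a b|c]; rewrite tt0 ?tE //.
by rewrite !tens_str tE gstr rmorph1.
Qed.

End EnvelopeMaps.

(** * Omega (x) 1 and 1 (x) Omega in the enveloping algebra *)

Section ExtensionComplex.
Context (K : fieldType) (n m : nat) (m_gt0 : (0 < m)%N).
Context (T : gralg K) (word : seq 'I_n -> T) (hT : free_algebra word).
Context (w : tensor K n m.+1) (w_sup : superpotential w) (c : 'I_n -> K).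
Context (A : gralg K) (p : {rmorphism T -> A})
  (hp : quotient_map (potential_span word w) p).
Context (D : gralg K) (pD : {rmorphism T -> D})
  (hpD : quotient_map (extension_span word w c) pD).
Context (EA : envelope A) (duA : {additive T -> 'rV[EA]_n}) (duAE : is_der word p duA).
Context (exact2 : forall v : 'rV[EA]_n, v *m hessian word w duA = 0 ->
  exists e : EA, v = e *: (koszul1 word p EA)^T).
Context (j1 : 'I_n) (c_j1 : c j1 != 0).
Local Notation om := (omega word w c pD j1).

(** As a vector space D is the direct sum of [s(A)] and Omega D; [pd] is the projection onto the
    first summand and [r] divides the remainder by Omega. Tensor products of these linear maps
    replace a choice of bases in D^e. *)
Lemma omega_retraction : exists (pd r : {additive D -> D}) (s : {additive A -> D})
    (q : {rmorphism D -> A}),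
  [/\ forall a, q (pD a) = p a, forall x, x = pd x + om * r x,
      forall x, r (om * x) = x, forall x, pd (om * x) = 0 & forall x, pd x = s (q x)] /\
  [/\ forall d x, pd (str D d * x) = str D d * pd x,
      forall d x, r (str D d * x) = str D d * r x,
      forall d x, s (str A d * x) = str D d * s x & forall x, q (s x) = x].
Proof.
have reg x : om * x = 0 -> x = 0.
  exact: (@omega_regular K K idfun n m T word hT T word hT w w (fun _ => erefl)
    w_sup m_gt0 A p hp A p hp EA duA duAE exact2 c D pD hpD j1 c_j1).
have [b [e [be _]]] := basis_exists hT hp.
have [s0 [sZ sK _]] := basis_section hT hp be.
have [q qE] := extension_proj hp hpD.
pose s : {additive A -> D} := pD \o s0.
have sE x : s x = pD (s0 x) by [].
pose pd : {additive D -> D} := s \o q.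
have pdE x : pd x = s (q x) by [].
have qs x : q (s x) = x by rewrite sE qE sK.
have ker_q x : q x = 0 -> exists y, x = om * y.
  by have [a ->] := quotient_surj hpD x; rewrite qE; apply: (extension_ker hT hp hpD c_j1).
have q_om x : q (om * x) = 0.
  have [a ->] := quotient_surj hpD x.
  by rewrite /omega !rmorphM !qE (potential_rel0 hp) mulr0 mul0r.
have /choice [r rE] : forall x, exists y, x = pd x + om * y.
  move=> x; have [|y hy] := ker_q (x - pd x); first by rewrite rmorphB pdE qs subrr.
  by exists y; rewrite -hy addrC subrK.
have inj x y : om * x = om * y -> x = y.
  by move=> h; apply/eqP; rewrite -subr_eq0; apply/eqP/reg; rewrite mulrBr h subrr.
have rU x y : x = pd x + om * y -> r x = y.
  by rewrite {1}[x]rE => /addrI /inj.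
have strq d : q (str D d) = str A d.
  by rewrite -(quotient_str hpD) qE (quotient_str hp).
have sZ' d x : s (str A d * x) = str D d * s x.
  by rewrite !sE sZ rmorphM (quotient_str hpD).
have pdZ d x : pd (str D d * x) = str D d * pd x by rewrite !pdE rmorphM strq sZ'.
have [|ra raE] := @additive_of D D r.
  move=> x y; apply: rU; rewrite {1}[x]rE {1}[y]rE raddfB mulrBr opprD addrACA //.
exists pd, ra, s, q; split; split=> //.
- by move=> x; rewrite raE.
- by move=> x; rewrite raE; apply: rU; rewrite pdE q_om raddf0 add0r.
- by move=> x; rewrite pdE q_om raddf0.
move=> d x; rewrite !raE; apply: rU.
by rewrite {1}[x]rE mulrDr pdZ (mulrA (str D d)) (str_central d om) -(mulrA om).
Qed.

Context (E : envelope D) (du : {additive T -> 'rV[E]_n}) (duE : is_der word pD du).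
Local Notation d1 := (koszul1 word pD E).
Local Notation d2 := (hessian word w du).
Local Notation O1 := (tens E om 1).
Local Notation O2 := (tens E 1 om).
Local Notation z := (O1 - O2).

Let omC : central om := omega_central hT hpD j1.

Lemma tens_central1 : central O1.
Proof.
apply: env_ind => [|e e' h h'|a b]; first by rewrite mulr0 mul0r.
  by rewrite mulrDr mulrDl h h'.
by rewrite !tensM omC mulr1 mul1r.
Qed.

Lemma tens_central2 : central O2.
Proof.
apply: env_ind => [|e e' h h'|a b]; first by rewrite mulr0 mul0r.
  by rewrite mulrDr mulrDl h h'.
by rewrite !tensM omC mulr1 mul1r.
Qed.

Lemma O1_regular e : O1 * e = 0 -> e = 0.
Proof.
have [pd [r [s [q [[_ _ rK _ _] [_ rZ _ _]]]]]] := omega_retraction.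
have [|t tE] := env_map E E (raddfB r) (raddfB idfun) rZ; first by [].
have tO e' : t (O1 * e') = e'.
  elim/env_ind: e' => [|e1 e2 h h'|a b]; first by rewrite mulr0 raddf0.
    by rewrite mulrDr raddfD /= h h'.
  by rewrite tensM tE rK mulr1.
by move=> h; rewrite -(tO e) h raddf0.
Qed.

(** Apply [pd (x) r]: it kills multiples of O1 and sends [O2 * e] to the image of [e] under
    [pd (x) id]. That image is therefore 0, and [e] differs from it by a multiple of O1. *)
Lemma O2_regular e : (exists e', O2 * e = O1 * e') -> exists e', e = O1 * e'.
Proof.
have [pd [r [s [q [[_ pdE rK pd0 _] [pdZ rZ _ _]]]]]] := omega_retraction.
move=> [e' h].
have [|t tE] := env_map E E (raddfB pd) (raddfB idfun) pdZ; first by [].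
have [|u uE] := env_map E E (raddfB r) (raddfB idfun) rZ; first by [].
have [v vE] := env_map E E (raddfB pd) (raddfB r) pdZ rZ.
have v2 x : v (O2 * x) = t x.
  elim/env_ind: x => [|e1 e2 h1 h2|a b]; first by rewrite mulr0 !raddf0.
    by rewrite mulrDr !raddfD /= h1 h2.
  by rewrite tens_central2 tensM vE tE mulr1 rK.
have v1 x : v (O1 * x) = 0.
  elim/env_ind: x => [|e1 e2 h1 h2|a b]; first by rewrite mulr0 raddf0.
    by rewrite mulrDr raddfD /= h1 h2 addr0.
  by rewrite tensM vE pd0 tens0l.
have dec x : x = t x + O1 * u x.
  elim/env_ind: x => [|e1 e2 h1 h2|a b]; first by rewrite !raddf0 mulr0 addr0.
    by rewrite !raddfD /= mulrDr addrACA -h1 -h2.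
  by rewrite tE uE tensM mulr1 -tensDl -pdE.
by exists (u e); rewrite {1}[e]dec -v2 h v1 add0r.
Qed.

(** For the kernel: [pd (x) pd] factors through [pi] by means of the section [s], and it differs
    from the identity by combinations of O1 and O2. *)
Lemma env_reduction : exists pi : {rmorphism E -> EA},
  [/\ forall i, pi (d1 i 0) = koszul1 word p EA i 0,
      forall i j, pi (d2 i j) = hessian word w duA i j,
      pi O1 = 0 /\ pi O2 = 0, forall d, pi (str E d) = str EA d &
      (forall y, exists x, y = pi x) /\
      (forall e, pi e = 0 -> exists e1 e2, e = O1 * e1 + O2 * e2)].
Proof.
have [pd [r [s [q [[qE pdE rK pd0 pds] [pdZ rZ sZ qs]]]]]] := omega_retraction.
have strq d : q (str D d) = str A d.
  by rewrite -(quotient_str hpD) qE (quotient_str hp).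
have [pi [piE pi_str]] := env_rmorphism E EA strq.
have q_om : q om = 0 by rewrite -(qs (q om)) -pds -(mulr1 om) pd0 rmorph0.
exists pi; split.
- by move=> i; rewrite !mxE rmorphB !piE !qE rmorph1.
- move=> i j; rewrite (hessianE hT w duE) (hessianE hT w duAE).
  rewrite rmorph_sum; apply: eq_bigr => t _; rewrite rmorph_sum; apply: eq_bigr => k _.
  by rewrite piE rmorphM strq !qE.
- by rewrite !piE q_om tens0l tens0r.
- exact: pi_str.
split=> [y|e pe].
  elim/env_ind: y => [|y y' [x ->] [x' ->]|a b]; first by exists 0; rewrite rmorph0.
    by exists (x + x'); rewrite rmorphD.
  by exists (tens E (s a) (s b)); rewrite piE !qs.
have [t tE] := env_map E E (raddfB pd) (raddfB pd) pdZ pdZ.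
have [u uE] := env_map EA E (raddfB s) (raddfB s) sZ sZ.
have tu x : t x = u (pi x).
  elim/env_ind: x => [|x y h h'|a b]; first by rewrite rmorph0 !raddf0.
    by rewrite rmorphD !raddfD /= h h'.
  by rewrite tE piE uE !pds.
suff [e1 [e2 h]] : exists e1 e2, e - t e = O1 * e1 + O2 * e2.
  by exists e1, e2; rewrite -h tu pe raddf0 subr0.
elim/env_ind: e {pe} => [|x y [e1 [e2 h]] [e3 [e4 h']]|a b].
- by exists 0, 0; rewrite !mulr0 raddf0 subr0 addr0.
- exists (e1 + e3), (e2 + e4); rewrite !mulrDr addrACA -h -h' raddfD /= opprD.
  by rewrite addrACA.
exists (tens E (r a) b), (tens E (pd a) (r b)).
rewrite tE tensM mulr1 tens_central2 tensM mulr1.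
have -> : tens E a b = tens E (pd a) b + tens E (om * r a) b by rewrite -tensDl -pdE.
rewrite [X in X - _]addrC -addrA -tensBr; congr (_ + tens E _ _).
by rewrite {1}[b]pdE addrC addKr.
Qed.

End ExtensionComplex.

Lemma mul_mx_central (R : pzRingType) (z : R) k l (M : 'M[R]_(k, l)) : central z ->
  M *m z%:M = z *: M.
Proof.
move=> zC; apply/matrixP => i j; rewrite !mxE (bigD1 j) //= mxE eqxx mulr1n.
rewrite big1 ?addr0 => [|k' /negbTE h]; first by rewrite zC.
by rewrite mxE h mulr0n mulr0.
Qed.

Section JoinedShifts.
Context (K : fieldType) (E : gralg K).

Definition join_shift k l (s : 'I_k -> int) (t : 'I_l -> int) (i : 'I_(k + l)) : int :=
  match fintype.split i with inl j => s j | inr j => t j end.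

Lemma mx_deg_row k l1 l2 (s : 'I_k -> int) (t1 : 'I_l1 -> int) (t2 : 'I_l2 -> int)
    (M1 : 'M[E]_(k, l1)) (M2 : 'M[E]_(k, l2)) :
  mx_deg s t1 M1 -> mx_deg s t2 M2 -> mx_deg s (join_shift t1 t2) (row_mx M1 M2).
Proof. by move=> h1 h2 i j; rewrite mxE /join_shift; case: fintype.split. Qed.

Lemma mx_deg_col k1 k2 l (s1 : 'I_k1 -> int) (s2 : 'I_k2 -> int) (t : 'I_l -> int)
    (M1 : 'M[E]_(k1, l)) (M2 : 'M[E]_(k2, l)) :
  mx_deg s1 t M1 -> mx_deg s2 t M2 -> mx_deg (join_shift s1 s2) t (col_mx M1 M2).
Proof. by move=> h1 h2 i j; rewrite mxE /join_shift; case: fintype.split. Qed.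

Lemma mx_degN k l (s : 'I_k -> int) (t : 'I_l -> int) (M : 'M[E]_(k, l)) :
  mx_deg s t M -> mx_deg s t (- M).
Proof. by move=> h i j; rewrite mxE; apply: gradingN (adegP E) _ _ (h i j). Qed.

Lemma mx_deg_scalar k (s t : 'I_k -> int) (z : E) d : adeg E d z ->
  (forall i, s i - t i = d) -> mx_deg s t (z%:M).
Proof.
move=> hz st i j; rewrite mxE; case: eqP => [<-|_].
  by rewrite mulr1n st.
by rewrite mulr0n; apply: deg_0 (adegP E) _.
Qed.

End JoinedShifts.

(** * The complex over D^e and its exactness on the left *)

Section ExtensionResolution.
Context (K : fieldType) (n m : nat) (m_gt0 : (0 < m)%N).
Context (T : gralg K) (word : seq 'I_n -> T) (hT : free_algebra word).
Context (w : tensor K n m.+1) (w_sup : superpotential w) (c : 'I_n -> K).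
Context (A : gralg K) (p : {rmorphism T -> A})
  (hp : quotient_map (potential_span word w) p).
Context (D : gralg K) (pD : {rmorphism T -> D})
  (hpD : quotient_map (extension_span word w c) pD).
Context (EA : envelope A) (duA : {additive T -> 'rV[EA]_n}) (duAE : is_der word p duA).
Context (exact3 : forall e : EA, e *: (koszul1 word p EA)^T = 0 -> e = 0)
  (exact2 : forall v : 'rV[EA]_n, v *m hessian word w duA = 0 ->
  exists e : EA, v = e *: (koszul1 word p EA)^T).
Context (j1 : 'I_n) (c_j1 : c j1 != 0).
Local Notation om := (omega word w c pD j1).
Context (E : envelope D) (du : {additive T -> 'rV[E]_n}) (duE : is_der word pD du).

Definition ext_z : E := tens E om 1 - tens E 1 om.
Definition ext_c : 'cV[E]_n := \col_i str E (c i).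
Local Notation d1 := (koszul1 word pD E).
Local Notation d2 := (hessian word w du).
Local Notation z := ext_z.
Local Notation C := ext_c.

(** These matrices form a cone of multiplication by z on the sequence [d1^T], [d2], [d1]. Over D^e
    its composites are z times [C] and z times [C^T] rather than 0, as f_j = c_j Omega; the blocks
    [- C] and [- C^T] cancel these defects. *)
Definition ext_d1 : 'M[E]_(n + 1, 1) := col_mx d1 z%:M.
Definition ext_d2 : 'M[E]_(n + n, n + 1) := block_mx d2 (- C) z%:M (- d1).
Definition ext_d3 : 'M[E]_(1 + n, n + n) := block_mx d1^T (- C^T) z%:M (- d2).
Definition ext_d4 : 'M[E]_(1, 1 + n) := row_mx z%:M (- d1^T).

Lemma ext_z_central : central z.
Proof.
move=> e; rewrite /ext_z mulrBl mulrBr (tens_central1 hT hpD j1).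
by rewrite (tens_central2 hT hpD j1).
Qed.
Local Notation zC := ext_z_central.

Lemma ext_d21 : d2 *m d1 = z *: C.
Proof.
rewrite (hessian_koszul1 hT w (quotient_str hpD) duE); apply/colP => j; rewrite !mxE.
rewrite (omegaE hpD c_j1) /ext_z mulrBl tens_str !tensM !mulr1 !mul1r str_central.
by rewrite -[in tens E 1 _]str_central -tens_balanced mul1r.
Qed.

Lemma ext_dT12 : d1^T *m d2 = z *: C^T.
Proof.
have [flip [flipE flipM flipK _]] := env_flip E.
apply: (can_inj (@trmxK _ _ _)); apply: (flip_mx_inj flipK).
rewrite (flip_mulmx flipM) trmxK (flip_hessian hT duE flipE w_sup).
have -> : map_mx flip d1 = - d1.
  by apply/colP => i; rewrite !mxE raddfB /= !flipE opprB.
rewrite mulmxN ext_d21; apply/colP => i; rewrite !mxE /ext_z.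
rewrite flipM tens_str flipE raddfB /= !flipE -tens_str1.
by rewrite -[tens E 1 om - _]opprB mulrN -tens_str str_central.
Qed.

Lemma ext_dTC : d1^T *m C = C^T *m d1.
Proof.
apply/matrixP => i j; rewrite !mxE; apply: eq_bigr => k _.
by rewrite !mxE str_central.
Qed.

Lemma ext_complex1 : ext_d2 *m ext_d1 = 0.
Proof.
rewrite /ext_d1 /ext_d2 mul_block_col ext_d21 !mulNmx !(mul_mx_central _ zC).
by rewrite mul_scalar_mx !subrr col_mx0.
Qed.

Lemma ext_complex2 : ext_d3 *m ext_d2 = 0.
Proof.
rewrite /ext_d3 /ext_d2 mulmx_block !mulNmx !mulmxN !(mul_mx_central _ zC) !mul_scalar_mx.
rewrite ext_dT12 ext_d21 ext_dTC !subrr.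
by rewrite /block_mx !row_mx0 col_mx0.
Qed.

Lemma ext_complex3 : ext_d4 *m ext_d3 = 0.
Proof.
rewrite /ext_d4 /ext_d3 mul_row_block !mulNmx !mulmxN !(mul_mx_central _ zC) !mul_scalar_mx.
by rewrite ext_dT12 !subrr row_mx0.
Qed.

Lemma om_deg_int : adeg D m%:Z om.
Proof. exact (omega_deg hT hpD j1). Qed.

Lemma letter_deg i : adeg D 1 (pD (word [:: i])).
Proof. exact (quotient_deg hpD (word_deg hT [:: i])). Qed.

Lemma adeg1 (B : gralg K) : adeg B 0 1.
Proof. by rewrite -(rmorph1 (str B)); apply: adeg_str. Qed.

Lemma O1_deg : adeg E m%:Z (tens E om 1).
Proof. by rewrite -[m%:Z]addr0; apply: tens_deg om_deg_int (adeg1 D). Qed.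

Lemma O2_deg : adeg E m%:Z (tens E 1 om).
Proof. by rewrite -[m%:Z]add0r; apply: tens_deg (adeg1 D) om_deg_int. Qed.

Lemma z_deg : adeg E m%:Z z.
Proof. exact: deg_B (adegP E) _ _ _ O1_deg O2_deg. Qed.

Lemma d1_deg i j : adeg E 1 (d1 i j).
Proof.
rewrite ord1 mxE; apply: (deg_B (adegP E)).
  by rewrite -[1]addr0; apply: tens_deg (letter_deg i) (adeg1 D).
by rewrite -[1]add0r; apply: tens_deg (adeg1 D) (letter_deg i).
Qed.

Lemma c_deg i j : adeg E 0 (C i j).
Proof. by rewrite mxE; apply: adeg_str. Qed.

Lemma d2_deg i j : adeg E (m%:Z - 1) (d2 i j).
Proof.
rewrite (hessianE hT w duE).
apply: (big_ind (adeg E _)); [exact: deg_0 (adegP E) _|exact: gradingD (adegP E) _|].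
move=> t _; apply: (big_ind (adeg E _)); [exact: deg_0 (adegP E) _|exact: gradingD (adegP E) _|].
move=> k _; have -> : m%:Z - 1 = (0 + (size (take k t))%:Z) + (size (drop k.+1 t))%:Z.
  have -> : size (take k t) = k by rewrite size_takel // size_tuple ltnW.
  have -> : size (drop k.+1 t) = (m - k.+1)%N by rewrite size_drop size_tuple.
  rewrite add0r -PoszD; apply/eqP; rewrite subr_eq -[1]/(1%:Z) -PoszD eqz_nat.
  by rewrite -addnA addn1 -subSn // subSS subnKC // ltnW.
apply: tens_deg; last exact (quotient_deg hpD (word_deg hT _)).
by apply: adegM; [apply: adeg_str | exact (quotient_deg hpD (word_deg hT _))].
Qed.

(** The degrees of the generators are forced by those of the blocks: 1 for [d1], m - 1 for [d2], m
    for z and 0 for [C]. *)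
Definition ext_sh1 : 'I_(n + 1) -> int := join_shift (fun=> 1) (fun=> m%:Z).
Definition ext_sh2 : 'I_(n + n) -> int := join_shift (fun=> m%:Z) (fun=> m%:Z + 1).
Definition ext_sh3 : 'I_(1 + n) -> int := join_shift (fun=> m%:Z + 1) (fun=> m%:Z + m%:Z).
Definition ext_sh4 : 'I_1 -> int := fun=> m%:Z + m%:Z + 1.

Lemma ext_d1_deg : mx_deg ext_sh1 (fun=> 0) ext_d1.
Proof.
apply: mx_deg_col; last by apply: (mx_deg_scalar z_deg) => i; rewrite subr0.
by move=> i j; rewrite subr0; apply: d1_deg.
Qed.

Lemma ext_d2_deg : mx_deg ext_sh2 ext_sh1 ext_d2.
Proof.
apply: mx_deg_col; apply: mx_deg_row.
- by move=> i j; apply: d2_deg.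
- by apply: mx_degN => i j; rewrite subrr; apply: c_deg.
- by apply: (mx_deg_scalar z_deg) => i; rewrite addrK.
- by apply: mx_degN => i j; rewrite addrAC subrr add0r; apply: d1_deg.
Qed.

Lemma ext_d3_deg : mx_deg ext_sh3 ext_sh2 ext_d3.
Proof.
apply: mx_deg_col; apply: mx_deg_row.
- by move=> i j; rewrite mxE addrAC subrr add0r; apply: d1_deg.
- by apply: mx_degN => i j; rewrite mxE subrr; apply: c_deg.
- by apply: (mx_deg_scalar z_deg) => i; rewrite addrK.
- by apply: mx_degN => i j; rewrite opprD addrA addrK; apply: d2_deg.
Qed.

Lemma ext_d4_deg : mx_deg ext_sh4 ext_sh3 ext_d4.
Proof.
apply: mx_deg_row.
- by apply: (mx_deg_scalar z_deg) => i; rewrite /ext_sh4 -[m%:Z + _ + 1]addrA addrK.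
- by apply: mx_degN => i j; rewrite mxE /ext_sh4 addrAC subrr add0r; apply: d1_deg.
Qed.

(** The reduction is applied twice: exactness over A^e is lifted along 1 (x) Omega to exactness
    modulo the ideal I of Omega (x) 1, and then along Omega (x) 1 with the zero ideal J. *)
Lemma ext_reduce (pi : {rmorphism E -> EA}) k1 k2 k3 (s1 : 'I_k1 -> int)
    (s2 : 'I_k2 -> int) (s3 : 'I_k3 -> int) (M1 : 'M[E]_(k1, k2)) (M2 : 'M[E]_(k2, k3)) :
  pi (tens E om 1) = 0 /\ pi (tens E 1 om) = 0 -> (forall y, exists x, y = pi x) ->
  (forall e, pi e = 0 -> exists e1 e2, e = tens E om 1 * e1 + tens E 1 om * e2) ->
  (forall i, 0 <= s2 i) -> mx_deg s1 s2 M1 -> mx_deg s2 s3 M2 -> M1 *m M2 = 0 ->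
  (forall v : 'rV_k2, v *m map_mx pi M2 = 0 -> exists u, v = u *m map_mx pi M1) ->
  forall v : 'rV_k2, v *m M2 = 0 -> exists u, v = u *m M1.
Proof.
move=> [pi1 pi2] pi_surj pi_ker s2_ge0 hM1 hM2 M12 exA.
have [comp [comp_deg comp_id comp_0 _]] := grading_component (adegP E).
have O1C : central (tens E om 1) by exact (tens_central1 hT hpD j1 (E:=E)).
have O2C : central (tens E 1 om) by exact (tens_central2 hT hpD j1 (E:=E)).
have comp_O1 k x : comp k (tens E om 1 * x) = tens E om 1 * comp (k - m%:Z) x.
  have [s [f [_ hf ->]]] := deg_sum (adegP E) x.
  rewrite mulr_sumr !raddf_sum mulr_sumr; apply: eq_bigr => j _ /=.
  have hj := adegM O1_deg (hf j).
  have [<-|jk] := eqVneq (m%:Z + j) k.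
    by rewrite (comp_id _ _ hj) addrAC subrr add0r comp_id.
  rewrite (comp_0 _ _ _ hj jk) (comp_0 _ _ _ (hf j)) ?mulr0 //.
  by apply: contraNneq jk => ->; rewrite addrC subrK.
pose I x := exists y, x = tens E om 1 * y.
have I0 : I 0 by exists 0; rewrite mulr0.
have ID x y : I x -> I y -> I (x + y) by move=> [a ->] [b ->]; exists (a + b); rewrite mulrDr.
have IMl x y : I y -> I (x * y).
  by move=> [b ->]; exists (x * b); rewrite !mulrA O1C.
have IMr x y : I x -> I (x * y) by move=> [b ->]; exists (b * y); rewrite mulrA.
have I_comp k x : I x -> I (comp k x) by move=> [y ->]; rewrite comp_O1; eexists.
have m_gt : 0 < m%:Z by rewrite ltz_nat.
have stage1 (v : 'rV_k2) : (exists y, v *m M2 = tens E om 1 *: y) ->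
    exists u y, v = u *m M1 + tens E om 1 *: y.
  move=> [y hy].
  have [|||u hu] := @reduction_exact _ E I I0 ID IMl IMr comp comp_deg comp_id comp_0 I_comp
    _ O2C _ m_gt O2_deg _ _ _ _ s1 s2 s3 s2_ge0 M1 M2 hM1 hM2 M12 _ v.
  - by move=> x [x' hx]; apply: (O2_regular m_gt0 hT w_sup hp hpD duAE exact2 c_j1); exists x'.
  - move=> v' [y' hy'].
    have [|u hu] := exA (map_mx pi v').
      rewrite -map_mxM; apply/rowP => i; rewrite !mxE.
      have [x hx] := hy' i; move: hx; rewrite !mxE => /eqP.
      rewrite subr_eq => /eqP ->.
      by rewrite rmorphD !rmorphM pi1 pi2 !mul0r addr0.
    have /choice [g gE] := fun i => pi_surj (u 0 i).
    pose u' := \row_i g i.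
    have /choice [e12 e12E] : forall i, exists e12 : E * E,
        (v' - u' *m M1) 0 i = tens E om 1 * e12.1 + tens E 1 om * e12.2.
      move=> i; have [|e1 [e2 h]] := pi_ker ((v' - u' *m M1) 0 i); last by exists (e1, e2).
      have -> : pi ((v' - u' *m M1) 0 i) = (map_mx pi (v' - u' *m M1)) 0 i by rewrite [RHS]mxE.
      rewrite map_mxB map_mxM hu (_ : map_mx pi u' = u) ?subrr ?mxE //.
      by apply/rowP => k; rewrite !mxE gE.
    exists u', (\row_i (e12 i).2) => i; exists (e12 i).1.
    by have := e12E i; rewrite !mxE => ->; rewrite addrK.
  - by move=> i; exists (y 0 i); rewrite hy mxE.
  have /choice [g gE] := hu; exists u, (\row_i g i); apply/rowP => i.
  have := gE i; rewrite !mxE => /eqP; rewrite subr_eq => /eqP ->.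
  by rewrite addrC.
pose J (x : E) := x = 0.
have JD x y : J x -> J y -> J (x + y) by move=> -> ->; rewrite /J addr0.
have JMl x y : J y -> J (x * y) by move=> ->; rewrite /J mulr0.
have JMr x y : J x -> J (x * y) by move=> ->; rewrite /J mul0r.
have J_comp k x : J x -> J (comp k x) by move=> ->; rewrite /J raddf0.
move=> v hv.
have [|||u hu] := @reduction_exact _ E J erefl JD JMl JMr comp comp_deg comp_id comp_0 J_comp
    _ O1C _ m_gt O1_deg _ _ _ _ s1 s2 s3 s2_ge0 M1 M2 hM1 hM2 M12 _ v.
- by move=> x; apply: (O1_regular m_gt0 hT w_sup hp hpD duAE exact2 c_j1).
- move=> v' [y' hy']; have [|u [y ->]] := stage1 v'.
    exists y'; apply/rowP => i; have := hy' i; rewrite /J !mxE => /eqP.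
    by rewrite subr_eq0 => /eqP.
  by exists u, y => i; rewrite addrAC addrK subrr mxE.
- by move=> i; rewrite hv mxE.
exists u; apply/eqP; rewrite -subr_eq0; apply/eqP/rowP => i; rewrite hu mxE //.
Qed.

Lemma ext_reduction : exists pi : {rmorphism E -> EA},
  [/\ map_mx pi d1 = koszul1 word p EA, map_mx pi d2 = hessian word w duA,
      map_mx pi C = \col_i str EA (c i), pi z = 0 &
      forall k1 k2 k3 (s1 : 'I_k1 -> int) (s2 : 'I_k2 -> int) (s3 : 'I_k3 -> int)
        (M1 : 'M[E]_(k1, k2)) (M2 : 'M[E]_(k2, k3)),
      (forall i, 0 <= s2 i) -> mx_deg s1 s2 M1 -> mx_deg s2 s3 M2 -> M1 *m M2 = 0 ->
      (forall v : 'rV_k2, v *m map_mx pi M2 = 0 -> exists u, v = u *m map_mx pi M1) ->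
      forall v : 'rV_k2, v *m M2 = 0 -> exists u, v = u *m M1].
Proof.
have [pi [pi1 pi2 [pO1 pO2] pi_str [pi_surj pi_ker]]] :=
  env_reduction m_gt0 hT w_sup hp hpD duAE exact2 c_j1 duE.
exists pi; split.
- by apply/colP => i; rewrite mxE pi1.
- by apply/matrixP => i j; rewrite mxE pi2.
- by apply/colP => i; rewrite !mxE pi_str.
- by rewrite /ext_z (rmorphB pi) pO1 pO2 subrr.
move=> k1 k2 k3 s1 s2 s3 M1 M2; exact (ext_reduce (conj pO1 pO2) pi_surj pi_ker).
Qed.

Lemma potential_exact1 (v : 'rV[EA]_n) : v *m koszul1 word p EA = 0 ->
  exists u, v = u *m hessian word w duA.
Proof.
apply: (ker_koszul1 hT (quotient_str hp) duAE (N := fun v => exists u, v = u *m hessian word w duA)).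
- exact: quotient_surj hp.
- by exists 0; rewrite mul0mx.
- by move=> v1 v2 [u1 ->] [u2 ->]; exists (u1 + u2); rewrite mulmxDl.
- by move=> e v' [u ->]; exists (e *: u); rewrite scalemxAl.
apply: (hessian_ideal hT (quotient_str hp) duAE).
  by move=> a; apply: (proj1 (quotient_ker hp a)).
by move=> j; apply: (potential_rel0 hp).
Qed.

Let cA : 'cV[EA]_n := \col_i str EA (c i).
Let d1A := koszul1 word p EA.

Let dTCA : d1A^T *m cA = cA^T *m d1A.
Proof.
apply/matrixP => i j; rewrite !mxE; apply: eq_bigr => k _.
by rewrite !mxE str_central.
Qed.

Let sh_ge0 : [/\ forall i, 0 <= ext_sh2 i, forall i, 0 <= ext_sh3 i & forall i, 0 <= ext_sh4 i].
Proof.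
by split=> i; rewrite /ext_sh2 /ext_sh3 /ext_sh4 /join_shift; try case: fintype.split.
Qed.

Lemma ext_exact2 (v : 'rV[E]_(n + n)) : v *m ext_d2 = 0 -> exists u, v = u *m ext_d3.
Proof.
have [pi [pi1 pi2 pic piz red]] := ext_reduction.
have [sh2_ge0 _ _] := sh_ge0.
apply: (red _ _ _ _ _ _ _ _ sh2_ge0 ext_d3_deg ext_d2_deg ext_complex2) => {}v.
rewrite /ext_d2 /ext_d3 !map_block_mx !map_mxN !map_scalar_mx -!map_trmx pi1 pi2 pic piz.
(* Over A^e the element z is 0, so the equations are [a d2 = 0] and [a C + u d1 = 0]. The first
   gives [a = e d1^T]; then [e C^T + u] is killed by [d1], hence equals [v' d2]. *)
rewrite -[v]hsubmxK; set a := lsubmx v; set u := rsubmx v => /eqP.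
rewrite mul_row_block raddf0 !mulmx0 addr0 row_mx_eq0 => /andP [/eqP /exact2 [e ae] /eqP].
rewrite !mulmxN ae -opprD -scalemxAl -/d1A -/cA dTCA scalemxAl -mulmxDl => /eqP.
rewrite oppr_eq0 => /eqP /potential_exact1 [v' hv'].
exists (row_mx e%:M (- v')); rewrite mul_row_block mulmx0 addr0 mul_scalar_mx.
rewrite -/d1A mulNmx !mulmxN opprK -hv' mul_scalar_mx; congr row_mx.
by rewrite addrA addNr add0r.
Qed.

Lemma ext_exact3 (v : 'rV[E]_(1 + n)) : v *m ext_d3 = 0 -> exists u, v = u *m ext_d4.
Proof.
have [pi [pi1 pi2 pic piz red]] := ext_reduction.
have [_ sh3_ge0 _] := sh_ge0.
apply: (red _ _ _ _ _ _ _ _ sh3_ge0 ext_d4_deg ext_d3_deg ext_complex3) => {}v.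
rewrite /ext_d3 /ext_d4 !map_block_mx map_row_mx !map_mxN !map_scalar_mx -!map_trmx.
rewrite pi1 pi2 pic piz -[v]hsubmxK; set a := lsubmx v; set u := rsubmx v => /eqP.
rewrite mul_row_block raddf0 !mulmx0 addr0 row_mx_eq0 => /andP [/eqP].
rewrite [a]mx11_scalar mul_scalar_mx => /exact3 -> /eqP.
rewrite raddf0 mul0mx add0r mulmxN => /eqP; rewrite oppr_eq0 => /eqP /exact2 [e ->].
exists (- e)%:M; rewrite mul_mx_row mulmx0 mul_scalar_mx scaleNr scalerN opprK //.
Qed.

Lemma ext_exact4 (v : 'rV[E]_1) : v *m ext_d4 = 0 -> v = 0.
Proof.
have [pi [pi1 pi2 pic piz red]] := ext_reduction.
have [_ _ sh4_ge0] := sh_ge0 => hv.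
(* Injectivity is exactness with a matrix without rows on the left. *)
have [|||u ->] := red 0 1 (1 + n)%N (fun=> 0) _ _ 0 _ sh4_ge0 _ ext_d4_deg _ _ v hv.
- by case.
- by rewrite mul0mx.
- move=> {hv}v; rewrite /ext_d4 map_row_mx map_mxN map_scalar_mx -map_trmx pi1 piz.
  rewrite mul_mx_row => /eqP; rewrite row_mx_eq0 => /andP [_].
  rewrite mulmxN oppr_eq0 [v]mx11_scalar mul_scalar_mx => /eqP /exact3 ->.
  by exists 0; rewrite mul0mx raddf0.
by rewrite mulmx0.
Qed.

End ExtensionResolution.

(** * The right end of the complex, its dual, and the Calabi-Yau property *)

Section FreeCochains.
Context (R : pzRingType).

Lemma row_functional k (f : {linear 'rV[R]_k -> R^o}) :
  exists phi : 'cV[R]_k, forall v, f v = (v *m phi) 0 0.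
Proof.
exists (\col_i f (delta_mx 0 i)) => v; rewrite {1}[v]row_sum_delta linear_sum mxE.
by apply: eq_bigr => i _; rewrite linearZ mxE.
Qed.

Lemma functional_of k (phi : 'cV[R]_k) :
  exists f : {linear 'rV[R]_k -> R^o}, forall v, f v = (v *m phi) 0 0.
Proof.
have [||f fE] := @linear_of R 'rV[R]_k R^o (fun v => (v *m phi) 0 0).
- by move=> u v; rewrite mulmxBl !mxE.
- by move=> a v; rewrite -scalemxAl mxE.
by exists f.
Qed.

Lemma functional_mul k l (M : 'M[R]_(k, l)) (phi : 'cV[R]_l) :
  (forall u : 'rV_k, (u *m M *m phi) 0 0 = 0) <-> M *m phi = 0.
Proof.
split=> [h|h u]; last by rewrite -mulmxA h mulmx0 mxE.
by apply/colP => i; have := h (delta_mx 0 i); rewrite -mulmxA -rowE !mxE.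
Qed.

End FreeCochains.

Section ExtensionStart.
Context (K : fieldType) (n m : nat).
Context (T : gralg K) (word : seq 'I_n -> T) (hT : free_algebra word).
Context (w : tensor K n m.+1) (c : 'I_n -> K).
Context (D : gralg K) (pD : {rmorphism T -> D})
  (hpD : quotient_map (extension_span word w c) pD).
Context (j1 : 'I_n) (c_j1 : c j1 != 0).
Local Notation om := (omega word w c pD j1).
Context (E : envelope D) (du : {additive T -> 'rV[E]_n}) (duE : is_der word pD du).
Local Notation d1 := (koszul1 word pD E).
Local Notation d2 := (hessian word w du).
Local Notation z := (ext_z word w c pD j1 E).
Local Notation C := (ext_c c E).
Local Notation D1 := (ext_d1 word w c pD j1 E).
Local Notation D2 := (ext_d2 word w c pD j1 du).
Let zC : central z := ext_z_central hT hpD j1 (E := E).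

Context (mu : {additive E -> D}) (muE : forall a b, mu (tens E a b) = a * b)
  (mu_lin : forall a b e, mu (tens E a b * e) = a * mu e * b).

Lemma ext_exact0 (v : 'rV[E]_1) : mu (v 0 0) = 0 <-> exists u, v = u *m D1.
Proof.
split=> [|[u ->]].
  move=> /(ker_mult hT (quotient_str hpD) duE muE (quotient_surj hpD)) [u hu].
  exists (row_mx u 0); rewrite /ext_d1 mul_row_col mul0mx addr0 -hu.
  by rewrite [LHS]mx11_scalar.
rewrite /ext_d1 -[u]hsubmxK mul_row_col mxE raddfD /= (mult_koszul1 word pD muE) add0r.
rewrite (mul_mx_central _ zC) mxE /ext_z mulrBl raddfB !mu_lin mulr1 mul1r.
by rewrite (omega_central hT hpD j1) subrr.
Qed.

Let sumE (psi : 'I_n -> K) : du (\sum_j str T (psi j) * potential_rel word w j) =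
  (\row_j str E (psi j)) *m d2.
Proof.
rewrite raddf_sum mulmx_sum_row; apply: eq_bigr => j _.
rewrite (derM hT (quotient_str hpD) duE) (der_str hT duE) scaler0 add0r mxE row_hessian.
by rewrite (quotient_str hpD) tens_str.
Qed.

Let letterE (y : 'I_n -> K) : du (\sum_i str T (y i) * word [:: i]) = \row_j str E (y j).
Proof.
rewrite raddf_sum; apply/rowP => j; rewrite summxE mxE (bigD1 j) //= big1 ?addr0 => [|i ij].
  by rewrite (derM hT (quotient_str hpD) duE) (der_str hT duE) scaler0 add0r
    (quotient_str hpD) -tens_str (der_letter hT duE) !mxE !eqxx mulr1.
rewrite (derM hT (quotient_str hpD) duE) (der_str hT duE) scaler0 add0r.
by rewrite (der_letter hT duE) !mxE eq_sym (negbTE ij) mulr0.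
Qed.

Let relE (psi : 'I_n -> K) : pD (\sum_j str T (psi j) * potential_rel word w j) =
  str D (\sum_j psi j * c j) * om.
Proof.
rewrite rmorph_sum (rmorph_sum (str D)) mulr_suml; apply: eq_bigr => j _.
by rewrite rmorphM (quotient_str hpD) (omegaE hpD c_j1) mulrA -rmorphM.
Qed.

Let rowC (psi : 'I_n -> K) : (\row_j str E (psi j)) *m C = (str E (\sum_j psi j * c j))%:M.
Proof.
apply/matrixP => i k; rewrite !ord1 !mxE mulr1n rmorph_sum; apply: eq_bigr => j _.
by rewrite !mxE rmorphM.
Qed.

(** This place is settled by the presentation of D. As c_j1 is invertible, the block [- C] serves to
    clear the last coordinate of [v]; the kernel of [koszul1] is then generated by the derivatives
    of the relations of D, and for each of these a preimage is written down. *)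
Lemma ext_exact1 (v : 'rV[E]_(n + 1)) : v *m D1 = 0 -> exists u, v = u *m D2.
Proof.
suff red (u : 'rV[E]_n) : u *m d1 = 0 -> exists x, row_mx u 0 = x *m D2.
  move=> hv; pose a := rsubmx v.
  pose y : 'rV[E]_(n + n) :=
    row_mx (a 0 0 *: (\row_j str E (if j == j1 then (c j1)^-1 else 0))) 0.
  have yE : rsubmx (y *m D2) = - a.
    rewrite /y /ext_d2 mul_row_block mul0mx addr0 row_mxKr mulmxN -scalemxAl rowC.
    rewrite mul0mx addr0 (bigD1 j1) //= eqxx mulVf // big1 => [|j /negbTE ->]; last first.
      by rewrite mul0r.
    by rewrite addr0 rmorph1 scale_scalar_mx mulr1 [in RHS](mx11_scalar a).
  have [|x hx] := red (lsubmx (v + y *m D2)).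
    have : (v + y *m D2) *m D1 = 0.
      by rewrite mulmxDl hv -mulmxA (ext_complex1 hT hpD c_j1 duE) mulmx0 addr0.
    rewrite -{1}[v + _]hsubmxK /ext_d1 mul_row_col [rsubmx _]raddfD /= yE /a subrr mul0mx addr0.
    exact.
  exists (x - y); rewrite mulmxBl -hx; apply/eqP; rewrite -subr_eq opprK; apply/eqP.
  by rewrite -[LHS]hsubmxK (raddfD rsubmx) /= yE subrr.
apply: (ker_koszul1 hT (quotient_str hpD) duE (N := fun u => exists x, row_mx u 0 = x *m D2)).
- exact: quotient_surj hpD.
- by exists 0; rewrite mul0mx row_mx0.
- by move=> u1 u2 [x1 h1] [x2 h2]; exists (x1 + x2); rewrite mulmxDl -h1 -h2 add_row_mx addr0.
- by move=> e u' [x hx]; exists (e *: x); rewrite -scalemxAl -hx scale_row_mx scaler0.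
move=> a /(quotient_ker hpD); elim=> [|b s d x hs _ [y hy]].
  by exists 0; rewrite (raddf0 du) mul0mx row_mx0.
have ps : pD s = 0 by apply/(quotient_ker hpD)/ideal_gen_sub.
suff [y' hy'] : exists x, row_mx (du s) 0 = x *m D2.
  exists (tens E (pD b) (pD d) *: y' + y); rewrite mulmxDl -scalemxAl -hy -hy'.
  rewrite scale_row_mx scaler0 add_row_mx addr0 (raddfD du); congr (row_mx (_ + _) _).
  rewrite !(derM hT (quotient_str hpD) duE) (rmorphM pD) ps mulr0 tens0l scale0r addr0.
  by rewrite tens0r scale0r add0r scalerA tensM mul1r mul1r.
case: hs => [[psi hpsi ->]|[yy [psi sE]]].
  exists (row_mx (\row_j str E (psi j)) 0).
  rewrite /ext_d2 mul_row_block !mul0mx !addr0 sumE mulmxN rowC.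
  rewrite (eq_bigr (fun j => c j * psi j)); last by move=> j _; rewrite mulrC.
  by rewrite hpsi rmorph0 raddf0 oppr0.
pose Y := \sum_i str T (yy i) * word [:: i].
pose a0 := \sum_j psi j * c j.
(* The derivative of [Y, r] is (Y (x) 1 - 1 (x) Y) dr - (r (x) 1 - 1 (x) r) dY, and r = a0 Omega in
   D makes the second coefficient a0 z. In the last coordinate the blocks [- C] and [- d1] cancel by
   [der_koszul1]. *)
exists (row_mx ((tens E (pD Y) 1 - tens E 1 (pD Y)) *: \row_j str E (psi j))
  (- str E a0 *: \row_j str E (yy j))).
rewrite /ext_d2 mul_row_block (mul_mx_central _ zC); congr row_mx.
  rewrite sE raddfB /= !(derM hT (quotient_str hpD) duE) sumE letterE relE -/a0 -/Y.
  rewrite -scalemxAl scalerBl !scalerA /ext_z !mulrBl mulrN.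
  have -> : tens E (str D a0 * om) 1 = tens E om 1 * str E a0.
    by rewrite tens_str tensM mulr1 -str_central.
  have -> : tens E 1 (str D a0 * om) = tens E 1 om * str E a0.
    by rewrite tens_str tens_str1 [RHS]tensM mul1r.
  rewrite mulrN opprK scalerDl scaleNr opprD addrA [X in X - _ - _]addrC.
  by rewrite -!addrA; congr (_ + _); rewrite addrC -addrA.
rewrite mulmxN -scalemxAl rowC -/a0 mulmxN -scalemxAl -letterE.
rewrite (der_koszul1 hT (quotient_str hpD) duE) !scale_scalar_mx mulNr raddfN /= opprK.
by rewrite -/Y str_central addNr.
Qed.

End ExtensionStart.

Section MatrixResolution.
Context (K : fieldType) (A : gralg K) (E : envelope A).
Context (rk : nat -> nat) (sh : forall i, 'I_(rk i) -> int)
  (M : forall i, 'M[E]_(rk i.+1, rk i)) (aug : {additive 'rV[E]_(rk 0) -> A}).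
Context (M_deg : forall i, mx_deg (@sh i.+1) (@sh i) (M i))
  (aug_lin : forall a b v, aug (tens E a b *: v) = a * aug v * b)
  (aug_deg : forall k v, row_deg (@sh 0) k v -> adeg A k (aug v))
  (aug_surj : forall a, exists v, aug v = a)
  (exact0 : forall v, aug v = 0 <-> exists u, v = u *m M 0)
  (exactS : forall i (v : 'rV_(rk i.+1)), v *m M i = 0 <-> exists u, v = u *m M i.+1)
  (rk_fin : exists N, forall i, (N <= i)%N -> rk i = 0).

Let diff i : {linear 'rV[E]_(rk i.+1) -> 'rV[E]_(rk i)} := projT1 (cid (mulmxr_linear (M i))).
Let diffE i v : diff i v = v *m M i := projT2 (cid (mulmxr_linear (M i))) v.

Lemma diff_deg i k (v : free_grmod E (@sh i.+1)) :
  grdeg (free_grmod E (@sh i.+1)) k v -> grdeg (free_grmod E (@sh i)) k (diff i v).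
Proof. by move=> hv; rewrite diffE; exact (row_deg_mulmx (@M_deg i) hv). Qed.

Lemma diff_exact0 (v : free_grmod E (@sh 0)) : aug v = 0 <-> exists u, v = diff 0%N u.
Proof. by rewrite exact0; split=> -[u hu]; exists u; rewrite hu diffE. Qed.

Lemma diff_exact i (v : free_grmod E (@sh i.+1)) :
  diff i v = 0 <-> exists u, v = diff i.+1 u.
Proof. by rewrite diffE exactS; split=> -[u hu]; exists u; rewrite hu diffE. Qed.

Lemma free_finite : exists N, forall i, (N <= i)%N -> forall v : free_grmod E (@sh i), v = 0.
Proof.
have [N hN] := rk_fin; exists N => i /hN ri v; apply/rowP => j; exfalso.
by have := ltn_ord j; rewrite {2}ri.
Qed.

Definition matrix_resolution : resolution E :=
  @Resolution K A E (fun i => free_grmod E (@sh i)) diff aug aug_lin diff_deg aug_deg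
    aug_surj diff_exact0 diff_exact (fun i => free_grmod_fg E (@sh i))
    (fun i => @projective_row _ (rk i)) free_finite.
Local Notation P := matrix_resolution.

Lemma cochainE i (f : cochain P i) : exists phi : 'cV[E]_(rk i),
  (forall v : 'rV_(rk i), f v = (v *m phi) 0 0).
Proof. exact (row_functional f). Qed.

Lemma cochain_of i (phi : 'cV[E]_(rk i)) : exists f : cochain P i,
  (forall v : 'rV_(rk i), f v = (v *m phi) 0 0).
Proof. exact (functional_of phi). Qed.

Lemma cocycleE i (f : cochain P i) (phi : 'cV[E]_(rk i)) :
  (forall v : 'rV_(rk i), f v = (v *m phi) 0 0) -> cocycle f <-> M i *m phi = 0.
Proof.
move=> fE; rewrite -functional_mul; split=> h u.
  by rewrite -diffE -fE; apply: h.
by rewrite fE -[RHS](h u) -diffE.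
Qed.

Lemma coboundaryE i (f : cochain P i.+1) (phi : 'cV[E]_(rk i.+1)) :
  (forall v : 'rV_(rk i.+1), f v = (v *m phi) 0 0) ->
  coboundary f <-> exists phi', phi = M i *m phi'.
Proof.
move=> fE; split=> [[g gE]|[phi' h]].
  have [phi' hphi] := cochainE g; exists phi'; apply/eqP; rewrite -subr_eq0; apply/eqP.
  rewrite -[LHS]mul1mx; apply/functional_mul => u.
  rewrite mulmx1 mulmxBr mxE [X in _ + X]mxE -fE gE mulmxA -diffE -hphi.
  exact: subrr.
have [g gE] := cochain_of phi'; exists g => v; rewrite fE gE h mulmxA.
by rewrite [rdiff _ _ _]diffE.
Qed.

Lemma ext_zero_0 : (forall phi : 'cV[E]_(rk 0), M 0 *m phi = 0 -> phi = 0) -> ext_zero P 0.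
Proof.
move=> h f; have [phi fE] := cochainE f => /(cocycleE fE) /h phi0 v.
by rewrite fE phi0 mulmx0 mxE.
Qed.

Lemma ext_zero_S i : (forall phi : 'cV[E]_(rk i.+1), M i.+1 *m phi = 0 ->
  exists phi', phi = M i *m phi') -> ext_zero P i.+1.
Proof.
move=> h f; have [phi fE] := cochainE f => /(cocycleE fE) /h phi0.
exact/(coboundaryE fE).
Qed.

End MatrixResolution.
Section ExtensionCalabiYau.
Context (K : fieldType) (n m : nat) (m_gt0 : (0 < m)%N).
Context (T : gralg K) (word : seq 'I_n -> T) (hT : free_algebra word).
Context (w : tensor K n m.+1) (w_sup : superpotential w) (c : 'I_n -> K).
Context (A : gralg K) (p : {rmorphism T -> A})
  (hp : quotient_map (potential_span word w) p).
Context (D : gralg K) (pD : {rmorphism T -> D})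
  (hpD : quotient_map (extension_span word w c) pD).
Context (EA : envelope A) (duA : {additive T -> 'rV[EA]_n}) (duAE : is_der word p duA).
Context (exact3 : forall e : EA, e *: (koszul1 word p EA)^T = 0 -> e = 0)
  (exact2 : forall v : 'rV[EA]_n, v *m hessian word w duA = 0 ->
  exists e : EA, v = e *: (koszul1 word p EA)^T).
Context (j1 : 'I_n) (c_j1 : c j1 != 0).
Local Notation om := (omega word w c pD j1).
Context (E : envelope D) (du : {additive T -> 'rV[E]_n}) (duE : is_der word pD du).
Local Notation d1 := (koszul1 word pD E).
Local Notation d2 := (hessian word w du).
Local Notation z := (ext_z word w c pD j1 E).
Local Notation C := (ext_c c E).
Local Notation D1 := (ext_d1 word w c pD j1 E).
Local Notation D2 := (ext_d2 word w c pD j1 du).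
Local Notation D3 := (ext_d3 word w c pD j1 du).
Local Notation D4 := (ext_d4 word w c pD j1 E).
Let exact_at2 := ext_exact2 m_gt0 hT w_sup hp hpD duAE exact2 c_j1 duE.
Let exact_at3 := ext_exact3 m_gt0 hT w_sup hp hpD duAE exact3 exact2 c_j1 duE.
Let exact_at4 := ext_exact4 m_gt0 hT w_sup hp hpD duAE exact3 exact2 c_j1 duE.

Context (mu : {additive E -> D}) (muE : forall a b, mu (tens E a b) = a * b)
  (mu_lin : forall a b e, mu (tens E a b * e) = a * mu e * b)
  (mu_deg : forall k e, adeg E k e -> adeg D k (mu e)).

Definition ext_rk (i : nat) : nat :=
  match i with 0 => 1 | 1 => n + 1 | 2 => n + n | 3 => 1 + n | 4 => 1 | _ => 0 end%N.

Definition ext_sh i : 'I_(ext_rk i) -> int :=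
  match i return 'I_(ext_rk i) -> int with
  | 0%N => fun=> 0 | 1%N => @ext_sh1 n m | 2%N => @ext_sh2 n m | 3%N => @ext_sh3 n m
  | 4%N => @ext_sh4 m | _ => fun=> 0 end.

Definition ext_diff i : 'M[E]_(ext_rk i.+1, ext_rk i) :=
  match i return 'M[E]_(ext_rk i.+1, ext_rk i) with
  | 0%N => D1 | 1%N => D2 | 2%N => D3 | 3%N => D4 | _ => 0 end.

Lemma ext_diff_deg i : mx_deg (@ext_sh i.+1) (@ext_sh i) (ext_diff i).
Proof.
case: i => [|[|[|[|i]]]].
- exact (ext_d1_deg hT hpD j1 E).
- exact (ext_d2_deg hT hpD j1 duE).
- exact (ext_d3_deg hT hpD j1 duE).
- exact (ext_d4_deg hT hpD j1 E).
by case.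
Qed.

Lemma ext_diff_exact i (v : 'rV_(ext_rk i.+1)) :
  v *m ext_diff i = 0 <-> exists u, v = u *m ext_diff i.+1.
Proof.
case: i v => [|[|[|[|i]]]] v.
- split=> [|[u ->]]; first exact (@ext_exact1 _ _ _ _ _ hT _ _ _ _ hpD _ c_j1 _ _ duE v).
  by rewrite -mulmxA (ext_complex1 hT hpD c_j1 duE) mulmx0.
- split=> [|[u ->]]; first exact: exact_at2.
  by rewrite -mulmxA (ext_complex2 hT w_sup hpD c_j1 duE) mulmx0.
- split=> [|[u ->]]; first exact: exact_at3.
  by rewrite -mulmxA (ext_complex3 hT w_sup hpD c_j1 duE) mulmx0.
- split=> [/exact_at4 ->|[u ->]]; first by exists 0; rewrite mul0mx.
  by rewrite mulmx0 mul0mx.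
by split=> _; [exists 0; apply/rowP; case | rewrite mulmx0].
Qed.

Context (flip : {additive E -> E}) (flipE : forall a b, flip (tens E a b) = tens E b a)
  (flipM : forall e e', flip (e * e') = flip e' * flip e)
  (flipK : forall e, flip (flip e) = e)
  (flip_deg : forall k e, adeg E k e -> adeg E k (flip e)).

Let dual k l (M : 'M[E]_(k, l)) : 'M[E]_(l, k) := map_mx flip M^T.

Let dualK k l (M : 'M[E]_(k, l)) : dual (dual M) = M.
Proof. by apply/matrixP => i j; rewrite !mxE flipK. Qed.

Let dualM k l r (M : 'M[E]_(k, l)) (N : 'M[E]_(l, r)) : dual (M *m N) = dual N *m dual M.
Proof. exact (flip_mulmx flipM M N). Qed.

Let dual0 k l : dual (0 : 'M[E]_(k, l)) = 0.
Proof. by apply/matrixP => i j; rewrite !mxE raddf0. Qed.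

Let flip_z : flip z = - z.
Proof. by rewrite /ext_z raddfB /= !flipE opprB. Qed.

Let dual_z k : map_mx flip (z%:M : 'M_k) = - z%:M.
Proof. by rewrite map_scalar_mx_additive flip_z raddfN. Qed.

Let dual_C : map_mx flip C = C.
Proof. by apply/matrixP => i j; rewrite !mxE tens_str flipE tens_str1. Qed.

Let dual_d1 : map_mx flip d1 = - d1.
Proof. by apply: trmx_inj; rewrite map_trmx (flip_koszul1 word pD flipE) linearN. Qed.

Let dual_D1 : dual D1 = row_mx (- d1^T) (- z%:M).
Proof.
by rewrite /dual /ext_d1 tr_col_mx map_row_mx tr_scalar_mx dual_z -map_trmx dual_d1 linearN.
Qed.

Let dual_D2 : dual D2 = block_mx d2 (- z%:M) (- C^T) d1^T.
Proof.
rewrite /dual /ext_d2 tr_block_mx map_block_mx tr_scalar_mx dual_z.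
rewrite (flip_hessian hT duE flipE w_sup) !linearN !map_mxN -!map_trmx dual_C dual_d1.
by rewrite linearN opprK.
Qed.

Let dual_D3 : dual D3 = block_mx (- d1) (- z%:M) (- C) (- d2).
Proof.
rewrite /dual /ext_d3 tr_block_mx map_block_mx tr_scalar_mx dual_z !linearN !map_mxN.
rewrite (flip_hessian hT duE flipE w_sup) !trmxK. by rewrite /= trmxK dual_C dual_d1.
Qed.

Let dual_D4 : dual D4 = col_mx (- z%:M) d1.
Proof.
rewrite /dual /ext_d4 tr_row_mx map_col_mx tr_scalar_mx dual_z linearN map_mxN /= trmxK.
by rewrite dual_d1 opprK.
Qed.

Let dual_exact k l r (M : 'M[E]_(k, l)) (N : 'M[E]_(r, k)) :
  (forall v : 'rV_k, v *m dual N = 0 -> exists u : 'rV_l, v = u *m dual M) ->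
  forall phi : 'cV_k, N *m phi = 0 -> exists phi' : 'cV_l, phi = M *m phi'.
Proof.
move=> h phi hphi; have [|u hu] := h (dual phi); first by rewrite -dualM hphi dual0.
by exists (dual u); rewrite -[LHS]dualK hu dualM dualK.
Qed.

(** Up to signs and the exchange of the two blocks, [dual] interchanges D1 with D4 and D2 with D3.
    This and the next three lemmas thus reduce to the exactness known on rows. *)
Lemma ext_dual_exact0 (phi : 'cV[E]_1) : D1 *m phi = 0 -> phi = 0.
Proof.
move=> h; rewrite -[LHS]dualK (exact_at4 (v := dual phi)) ?dual0 //.
have := congr1 (@dual _ _) h; rewrite dualM dual0 dual_D1 /ext_d4 !mul_mx_row.
move=> /eqP; rewrite row_mx_eq0 !mulmxN !oppr_eq0 => /andP [/eqP -> /eqP ->].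
by rewrite oppr0 row_mx0.
Qed.

Lemma ext_dual_exact1 (phi : 'cV[E]_(n + 1)) : D2 *m phi = 0 -> exists phi', phi = D1 *m phi'.
Proof.
move: phi; apply: dual_exact => v; rewrite dual_D1 dual_D2.
rewrite -[v]hsubmxK; set a := lsubmx v; set b := rsubmx v => /eqP.
rewrite mul_row_block row_mx_eq0 !mulmxN subr_eq0 addrC subr_eq0 => /andP [/eqP h1 /eqP h2].
have [|e] := exact_at3 (v := row_mx b (- a)).
  rewrite /ext_d3 mul_row_block !mulNmx !mulmxN opprK h1 h2 subrr addNr.
  by rewrite row_mx0.
rewrite /ext_d4 mul_mx_row => /eq_row_mx [-> ha]; exists (- e).
by rewrite mul_mx_row !mulNmx !mulmxN !opprK -[a]opprK ha mulmxN opprK.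
Qed.

Lemma ext_dual_exact2 (phi : 'cV[E]_(n + n)) : D3 *m phi = 0 -> exists phi', phi = D2 *m phi'.
Proof.
move: phi; apply: dual_exact => v; rewrite dual_D2 dual_D3.
rewrite -[v]hsubmxK; set a := lsubmx v; set b := rsubmx v => /eqP.
rewrite mul_row_block row_mx_eq0 !mulmxN -!opprD !oppr_eq0 => /andP [/eqP h1 /eqP h2].
have [|u] := exact_at2 (v := row_mx b a).
  by rewrite /ext_d2 mul_row_block !mulmxN -opprD (addrC (b *m C)) h1 addrC h2 oppr0 row_mx0.
rewrite -[u]hsubmxK; set e := lsubmx u; set y := rsubmx u.
rewrite /ext_d3 mul_row_block => /eq_row_mx [-> ->]; exists (row_mx (- y) e).
by rewrite mul_row_block !mulmxN !mulNmx opprK addrC (addrC (y *m _)).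
Qed.

Lemma ext_dual_exact3 (phi : 'cV[E]_(1 + n)) : D4 *m phi = 0 -> exists phi', phi = D3 *m phi'.
Proof.
move: phi; apply: dual_exact => v; rewrite dual_D3 dual_D4.
rewrite -[v]hsubmxK; set a := lsubmx v; set b := rsubmx v.
rewrite mul_row_col mulmxN => h.
have [|u] := ext_exact1 hT hpD c_j1 duE (v := row_mx b (- a)).
  by rewrite /ext_d1 mul_row_col mulNmx addrC h.
rewrite -[u]hsubmxK; set x := lsubmx u; set y := rsubmx u.
rewrite /ext_d2 mul_row_block => /eq_row_mx [-> ha]; exists (row_mx (- y) (- x)).
rewrite mul_row_block !mulmxN !mulNmx !opprK -[a]opprK ha !mulmxN opprD !opprK.
by rewrite (addrC (x *m C)) (addrC (x *m d2)).
Qed.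

Lemma ext_calabi_yau : calabi_yau 4 D.
Proof.
have augB : zmod_morphism (fun v : 'rV[E]_1 => mu (v 0 0)).
  by move=> u v; rewrite !mxE raddfB.
have [aug augE] := additive_of augB.
have aug_lin a b v : aug (tens E a b *: v) = a * aug v * b by rewrite !augE mxE mu_lin.
have aug_deg k v : row_deg (@ext_sh 0) k v -> adeg D k (aug v).
  by move=> hv; rewrite augE; apply: mu_deg; have := hv 0; rewrite subr0.
have aug_surj a : exists v, aug v = a.
  by exists (tens E a 1)%:M; rewrite augE mxE eqxx mulr1n muE mulr1.
have exact0 v : aug v = 0 <-> exists u, v = u *m ext_diff 0.
  by rewrite augE; apply: ext_exact0.
have fin : exists N, forall i, (N <= i)%N -> ext_rk i = 0%N.
  by exists 5%N; case=> [|[|[|[|[|i]]]]].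
pose P := matrix_resolution ext_diff_deg aug_lin aug_deg aug_surj exact0 ext_diff_exact fin.
exists E, P; split.
  case=> [|[|[|[|[|i]]]]] hi //.
  - by apply: ext_zero_0; exact ext_dual_exact0.
  - by apply: ext_zero_S; exact ext_dual_exact1.
  - by apply: ext_zero_S; exact ext_dual_exact2.
  - by apply: ext_zero_S; exact ext_dual_exact3.
  by apply: ext_zero_S => phi _; exists 0; apply/colP; case.
have cocycle4 (f : cochain P 4) : cocycle f.
  move=> u; have [phi fE] := cochainE f; rewrite fE.
  have -> : rdiff P 4 u = 0 by apply/rexact; exists 0; apply/rowP; case.
  by rewrite mul0mx mxE.
pose one : free_grmod E (@ext_sh 4) := (1%:M : 'rV[E]_1).
have onE (f : cochain P 4) (phi : 'cV[E]_1) :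
    (forall v : 'rV_1, f v = (v *m phi) 0 0) -> flip (f one) = (dual phi) 0 0.
  by move=> fE; rewrite fE mul1mx !mxE.
(* The generator of the last module has degree 2m + 1, whence the shift. The flip turns right
   multiplication in D^e, which gives the bimodule structure on cochains, into the outer action that
   [mu] respects. *)
exists (m%:Z + m%:Z + 1), (fun f => mu (flip (f one))); split; last first.
- move=> f _; have [phi fE] := cochainE f; rewrite (onE f phi fE).
  have cb : coboundary f <-> exists phi', phi = D4 *m phi' := coboundaryE (i := 3) (f := f) fE.
  rewrite -(augE (dual phi)) exact0; split=> [[u hu]|/cb [phi' ->]].
    apply/cb; exists (dual (row_mx (- rsubmx u) (lsubmx u))).
    rewrite -[LHS]dualK hu -[D4]dualK -dualM dual_D4 mul_row_col mulNmx mulmxN opprK.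
    by rewrite -{1}[u]hsubmxK /ext_d1 mul_row_col addrC.
  rewrite dualM dual_D4; exists (row_mx (rsubmx (dual phi')) (- lsubmx (dual phi'))).
  rewrite -{1}[dual phi']hsubmxK /ext_d1 !mul_row_col mulNmx mulmxN addrC //.
- move=> a; have [f fE] := cochain_of (ext_diff_deg) aug_lin aug_deg aug_surj exact0
    ext_diff_exact fin (i := 4) ((tens E 1 a)%:M : 'cV_1).
  exists f => //; rewrite (onE f _ fE) !mxE eqxx mulr1n flipE muE mulr1 //.
split=> [f g h _ _ hE|a b f h _ hE|k f _ hf].
- by rewrite hE !raddfD.
- by rewrite hE flipM flipE mu_lin.
have one_deg : row_deg (@ext_sh 4) (m%:Z + m%:Z + 1) one.
  move=> i; rewrite !mxE /= /ext_sh4 subrr; case: eqP => _; last exact: deg_0 (adegP E) _.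
  exact: adeg1.
by have /flip_deg/mu_deg := hf _ _ one_deg; rewrite addrC.
Qed.

End ExtensionCalabiYau.

Lemma extension_calabi_yau (K : fieldType) (n m : nat) (m_gt0 : (0 < m)%N)
    (T : gralg K) (word : seq 'I_n -> T) (hT : free_algebra word)
    (w : tensor K n m.+1) (w_sup : superpotential w) (c : 'I_n -> K)
    (A : gralg K) (p : {rmorphism T -> A}) (hp : quotient_map (potential_span word w) p)
    (D : gralg K) (pD : {rmorphism T -> D})
    (hpD : quotient_map (extension_span word w c) pD) (E : envelope D) j1 :
  c j1 != 0 -> calabi_yau 3 A -> calabi_yau 4 D.
Proof.
move=> c_j1 [EA [P [ext _]]].
have [duA duAE] := der_exists hT p EA.
have prel j : p (potential_rel word w j) = 0 by apply: (potential_rel0 hp).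
have ext0 : ext_zero P 0 by apply: ext.
have ext1 : ext_zero P 1 by apply: ext.
have [exact3 exact2] := calabi_yau_exact hT w_sup (quotient_str hp) (quotient_surj hp)
  (fun a => proj1 (quotient_ker hp a)) prel duAE ext0 ext1.
have [du duE] := der_exists hT pD E.
have [mu [muE mu_lin mu_deg]] := env_mult E.
have [flip [flipE flipM flipK flip_deg]] := env_flip E.
exact (ext_calabi_yau m_gt0 hT w_sup hp hpD duAE exact3 exact2 c_j1 duE muE mu_lin mu_deg
  flipE flipM flipK flip_deg).
Qed.

(** * Classification of central extensions *)

Lemma graded_lift (K : comPzRingType) (A B : gralg K) (f : {rmorphism A -> B}) :
  (forall k a, adeg A k a -> adeg B k (f a)) ->
  forall k a, adeg B k (f a) -> exists2 a', adeg A k a' & f a = f a'.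
Proof.
move=> f_deg k a hk; have [l [aE hl]] : exists l : seq (int * A), a = \sum_(q <- l) q.2 /\
    forall q, q \in l -> adeg A q.1 q.2.
  have [s [g [_ hg ->]]] := deg_sum (adegP A) a; exists [seq (j, g j) | j <- s].
  by rewrite big_map; split=> // _ /mapP [j _ ->].
exists (\sum_(q <- l | q.1 == k) q.2).
  rewrite big_seq_cond; apply: (big_ind (adeg A k)).
  - exact: deg_0 (adegP A) _.
  - exact: gradingD (adegP A) _.
  by move=> q /andP[/hl hq /eqP <-].
have fE : f a = \sum_(q <- [seq (q.1, f q.2) | q <- l]) q.2.
  by rewrite aE rmorph_sum big_map.
rewrite fE (homogeneous_part (adegP B) (k := k)) -?fE //; last first.
  by move=> _ /mapP [q /hl hq ->]; apply: f_deg.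
by rewrite big_map rmorph_sum.
Qed.

Lemma quotient_map_iso (K : comPzRingType) (T A B : gralg K) (S : T -> Prop)
    (p : {rmorphism T -> A}) (f : {rmorphism A -> B}) :
  quotient_map S p -> gralg_iso_map f ->
  exists p' : {rmorphism T -> B}, (forall a, p' a = f (p a)) /\ quotient_map S p'.
Proof.
move=> hp [[g fK gK] fstr fdeg]; exists (f \o p); split=> //; split=> /=.
- by move=> c; rewrite (quotient_str hp) fstr.
- by move=> y; have [a ga] := quotient_surj hp (g y); exists a; rewrite -ga gK.
- move=> a; rewrite -(quotient_ker hp); split=> [h|->]; last by rewrite rmorph0.
  by rewrite -(fK (p a)) h -(rmorph0 f) fK.
- by move=> k a /(quotient_deg hp) /fdeg.
move=> k y; rewrite -{1}(gK y) => /(graded_lift fdeg) [a' /(quotient_deg_lift hp) [a ha ->] h].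
by exists a => //; rewrite -h gK.
Qed.

Lemma quotient_map_unique (K : comPzRingType) (T A B : gralg K) (S : T -> Prop)
    (p : {rmorphism T -> A}) (p' : {rmorphism T -> B}) :
  quotient_map S p -> quotient_map S p' ->
  exists f : {rmorphism A -> B}, (forall a, f (p a) = p' a) /\ gralg_iso_map f.
Proof.
move=> hp hp'.
have [|f fE] := quotient_map_lift (g := p') hp.
  by move=> s hs; apply/(quotient_ker hp')/ideal_gen_sub.
have [|g gE] := quotient_map_lift (g := p) hp'.
  by move=> s hs; apply/(quotient_ker hp)/ideal_gen_sub.
exists f; split=> //; split.
- exists g => y; first by have [a ->] := quotient_surj hp y; rewrite fE gE.
  by have [a ->] := quotient_surj hp' y; rewrite gE fE.
- by move=> c; rewrite -(quotient_str hp) fE (quotient_str hp').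
move=> k y /(quotient_deg_lift hp) [a ha ->]; rewrite fE; exact: quotient_deg hp' _ _ ha.
Qed.

Lemma extension_span_homogeneous (K : fieldType) (n m : nat) (T : gralg K)
    (word : seq 'I_n -> T) (hT : free_algebra word) (w : tensor K n m.+1) (c : 'I_n -> K) :
  homogeneous_set (extension_span word w c).
Proof.
have sum_deg k (F : 'I_n -> T) (a : 'I_n -> K) : (forall j, adeg T k (F j)) ->
    adeg T k (\sum_j str T (a j) * F j).
  move=> hF; apply: (big_ind (adeg T k)).
  - exact: deg_0 (adegP T) _.
  - exact: gradingD (adegP T) _.
  by move=> j _; rewrite -[k]add0r; apply: adegM => //; apply: adeg_str.
have rel_deg psi := sum_deg m%:Z _ psi (potential_rel_deg hT w).
have letter_deg y := sum_deg 1 _ y (fun i => word_deg hT [:: i]).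
move=> _ [[psi _ ->]|[y [psi ->]]]; first by exists m%:Z; apply: rel_deg.
exists (1 + m%:Z); apply: deg_B (adegP T) _ _ _ _ _.
  by apply: adegM; [apply: letter_deg|apply: rel_deg].
by rewrite addrC; apply: adegM; [apply: rel_deg|apply: letter_deg].
Qed.

Section Classification.
Context (K : fieldType) (n m : nat) (m_ge2 : (2 <= m)%N).
Context (T : gralg K) (word : seq 'I_n -> T) (hT : free_algebra word) (w : tensor K n m.+1).
Context (A : gralg K) (p : {rmorphism T -> A})
  (hp : quotient_map (potential_span word w) p).
Context (D : gralg K) (om : D) (om_deg : adeg D m%:Z om) (D_conn : connected D)
  (D_gen : generated_in_degree_one D) (om_central : central om) (om_reg : regular om)
  (q : {rmorphism D -> A}) (hq : quotient_map (eq om) q).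

Let q_ker a : q a = 0 -> exists b, a = om * b.
Proof.
move=> /(quotient_ker hq); elim=> [|x s y b <- _ [b' ->]]; first by exists 0; rewrite mulr0.
by exists (x * y + b'); rewrite mulrDr -om_central mulrA.
Qed.

Let q_om : q om = 0.
Proof. by apply/(quotient_ker hq)/ideal_gen_sub. Qed.

Let q_ker_deg k a : adeg D k a -> q a = 0 -> exists2 b, adeg D (k - m%:Z) b & a = om * b.
Proof.
have [comp [comp_deg comp_id comp_0 _]] := grading_component (adegP D).
move=> ha /q_ker [b ab]; exists (comp (k - m%:Z) b); first exact: comp_deg.
rewrite -(comp_id _ _ ha) ab; have [s [f [_ hf ->]]] := deg_sum (adegP D) b.
rewrite mulr_sumr !raddf_sum mulr_sumr; apply: eq_bigr => j _ /=.
have hj := adegM om_deg (hf j).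
have [<-|jk] := eqVneq (m%:Z + j) k.
  by rewrite (comp_id _ _ hj) addrAC subrr add0r comp_id.
rewrite (comp_0 _ _ _ hj jk) (comp_0 _ _ _ (hf j)) ?mulr0 //.
by apply: contraNneq jk => ->; rewrite addrC subrK.
Qed.

Lemma central_extension_presentation : exists c : 'I_n -> K, (exists j, c j != 0) /\
  exists ev : {rmorphism T -> D}, quotient_map (extension_span word w c) ev.
Proof.
have /choice [x hx] : forall i, exists x, adeg D 1 x /\ q x = p (word [:: i]).
  move=> i; have [|x hx xE] := @quotient_deg_lift _ _ _ _ _ hq 1 (p (word [:: i])).
    exact (quotient_deg hp (word_deg hT [:: i])).
  by exists x.
have [|ev [ev_str ev_x]] := free_eval hT (s := str D) (x := x).
  by move=> c i; rewrite str_central.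
have qev : forall a, q (ev a) = p a.
  apply: (free_rmorphism_eq hT (f := q \o ev)) => [c|i] /=.
    by rewrite ev_str (quotient_str hq) (quotient_str hp).
  by rewrite ev_x; case: (hx i).
have ev_word u : adeg D (size u)%:Z (ev (word u)).
  elim: u => [|i u ih].
    by rewrite (word_nil hT) rmorph1 -(rmorph1 (str D)); apply: adeg_str.
  rewrite (word_cons hT i u) rmorphM ev_x /= -add1n PoszD.
  by apply: adegM => //; case: (hx i).
have ev_deg k a : adeg T k a -> adeg D k (ev a).
  case: k => [k|k] ha; last by rewrite (adegN _ ha) // rmorph0; apply: deg_0 (adegP D) _.
  apply: (word_deg_span hT (P := fun a => adeg D k%:Z (ev a))) ha.
  - by rewrite rmorph0; apply: deg_0 (adegP D) _.
  - by move=> a1 a2 h1 h2; rewrite rmorphD; apply: gradingD (adegP D) _ _ _ h1 h2.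
  move=> c u <-; rewrite rmorphM ev_str -[(size u)%:Z]add0r.
  by apply: adegM => //; apply: adeg_str.
have ev_surj y : exists a, y = ev a.
  elim/D_gen: y => [c|y hy|y z [a ->] [b ->]|y z [a ->] [b ->]].
  - by exists (str T c); rewrite ev_str.
  - have [a ha qa] := quotient_deg_lift hp (quotient_deg hq hy).
    exists a; apply/eqP; rewrite -subr_eq0; apply/eqP.
    (* In degree 1 the kernel of [q] is [om] times elements of degree 1 - m, which vanish because m
       is at least 2. *)
    have [||b hb ->] := @q_ker_deg 1 (y - ev a).
    + by apply: deg_B (adegP D) _ _ _ hy _; apply: ev_deg.
    + by rewrite rmorphB qev qa subrr.
    by rewrite (adegN _ hb) ?mulr0 // subr_lt0 ltz_nat.
  - by exists (a + b); rewrite rmorphD.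
  by exists (a * b); rewrite rmorphM.
(* Each f_j maps to an element of degree m in the kernel of [q], so to [om] times an element of
   degree 0, which is a scalar as D is connected. *)
have /choice [c cE] : forall j, exists c, ev (potential_rel word w j) = str D c * om.
  move=> j; have [||b] := @q_ker_deg m%:Z (ev (potential_rel word w j)).
  - exact/ev_deg/(potential_rel_deg hT w j).
  - by rewrite qev (potential_rel0 hp).
  rewrite subrr => /(proj2 D_conn) [c ->] ->; exists c; exact: om_central.
have om_neq0 : om <> 0.
  by move=> om0; apply: (proj1 D_conn); apply: (proj1 (om_reg 1)); rewrite om0 mul0r.
(* If all c_j were 0, evaluation would factor through A and provide an inverse of [q], forcing
   [om = 0]. *)
have [j c_j] : exists j, c j != 0.
  have [//|c0] := pselect (exists j, c j != 0); exfalso; apply: om_neq0.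
  have {}c0 j : c j = 0 by have [//|cj] := eqVneq (c j) 0; case: c0; exists j.
  have [|h hE] := quotient_map_lift (g := ev) hp.
    move=> s [a ->]; rewrite rmorph_sum big1 // => j _.
    by rewrite rmorphM cE c0 rmorph0 mul0r mulr0.
  have hq' y : h (q y) = y by have [a ->] := ev_surj y; rewrite qev hE.
  by rewrite -(hq' om) q_om rmorph0.
exists c; split; first by exists j.
exists ev.
have [D1 [pD hpD]] : exists (D1 : gralg K) (pD : {rmorphism T -> D1}),
    quotient_map (extension_span word w c) pD.
  exists (gquot (extension_span_homogeneous hT (w := w) (c := c))).
  by have [pD [_ hpD]] := gquot_quotient_map (extension_span_homogeneous hT (w := w) (c := c)); exists pD.
have ev0 s : extension_span word w c s -> ev s = 0.
  have sumE psi : ev (\sum_j str T (psi j) * potential_rel word w j) =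
      str D (\sum_j c j * psi j) * om.
    rewrite !rmorph_sum mulr_suml; apply: eq_bigr => i _.
    by rewrite rmorphM cE ev_str mulrA -rmorphM mulrC (mulrC (c i)).
  case=> [[psi h ->]|[y [psi ->]]]; first by rewrite sumE h rmorph0 mul0r.
  rewrite rmorphB !(rmorphM ev) sumE -(mulrA (str D _) om) om_central mulrA.
  by rewrite -str_central -(mulrA (str D _)) subrr.
have [h hE] := quotient_map_lift hpD ev0.
have [q1 q1E] := extension_proj hp hpD.
have h_om : h (omega word w c pD j) = om.
  rewrite rmorphM hE -(quotient_str hpD) hE ev_str cE mulrA -rmorphM mulVf //.
  by rewrite rmorph1 mul1r.
have h_inj d : h d = 0 -> d = 0.
  move=> hd; apply: (divisible_eq0 (ltnW m_ge2) (omega_deg hT hpD j)) => k.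
  suff [b [-> _]] : exists b, d = omega word w c pD j ^+ k * b /\ h b = 0 by exists b.
  elim: k => [|k [b [-> hb]]]; first by exists d; rewrite mul1r.
  have [a ba] := quotient_surj hpD b.
  have [|b' hb'] := extension_ker hT hp hpD c_j (a := a).
    by rewrite -qev -hE -ba hb rmorph0.
  exists b'; split; first by rewrite ba hb' mulrA -exprSr.
  by apply: (proj1 (om_reg _)); rewrite -h_om -rmorphM -hb' -ba.
split=> //.
- move=> a; split=> [ha|]; first by apply/(quotient_ker hpD)/h_inj; rewrite hE.
  by move/(quotient_ker hpD) => ha; rewrite -hE ha rmorph0.
move=> k y hy; have [a ya] := ev_surj y; move: hy; rewrite ya.
by move=> /(graded_lift ev_deg).
Qed.

End Classification.

Lemma sum_potential_rel (K : fieldType) n m (T : gralg K) (word : seq 'I_n -> T)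
    (w : tensor K n m.+1) (psi : 'I_n -> K) :
  \sum_(t : m.-tuple 'I_n) \sum_j str T (psi j * w [tuple of j :: t]) * word t =
  \sum_j str T (psi j) * potential_rel word w j.
Proof.
rewrite exchange_big; apply: eq_bigr => j _; rewrite mulr_sumr.
by apply: eq_bigr => t _; rewrite rmorphM mulrA.
Qed.

(** * The statements for [Aw] and [Dw] *)

Section TensorAlgebraPresentations.
Context (K : fieldType) (n m : nat) (w : tensor K n m.+1).
Local Notation T := (TV K n).
Local Notation word := (@tv_word K n).
Local Notation f := (potential_rel word w).

Lemma in_TV_contract (psi : 'cV[K]_n) :
  in_TV (contract psi w) = \sum_j str T (psi j 0) * f j :> T.
Proof.
rewrite /in_TV; transitivity (\sum_(t : m.-tuple 'I_n) \sum_j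
    str T (psi j 0 * w [tuple of j :: t]) * word t).
  apply: eq_bigr => t _; rewrite monom_word ffunE rmorph_sum mulr_suml.
  by apply: eq_bigr.
exact (sum_potential_rel word w (fun j => psi j 0)).
Qed.

Lemma vecE (y : 'rV[K]_n) : vec y = \sum_i str T (y 0 i) * word [:: i].
Proof. by apply: eq_bigr => i _; rewrite monom_word. Qed.

Lemma A_rel_span : A_rel w = potential_span word w.
Proof.
apply/funext => a; apply/propext; split=> [[psi ->]|[c ->]].
  by exists (fun j => psi j 0); apply: in_TV_contract.
exists (\col_j c j); rewrite in_TV_contract; apply: eq_bigr => j _.
by rewrite mxE.
Qed.

Lemma D_rel_span (x : 'rV[K]_n) : D_rel w x = extension_span word w (fun j => x 0 j).
Proof.
have colE (psi : 'I_n -> K) : \sum_j str T (psi j) * f j = in_TV (contract (\col_j psi j) w).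
  by rewrite in_TV_contract; apply: eq_bigr => j _; rewrite mxE.
have rowE (y : 'I_n -> K) : \sum_i str T (y i) * word [:: i] = vec (\row_i y i).
  by rewrite vecE; apply: eq_bigr => j _; rewrite mxE.
apply/funext => a; apply/propext; split=> [[[psi h ->]|[y [psi ->]]]|[[psi h ->]|[y [psi ->]]]].
- left; exists (fun j => psi j 0); last by rewrite in_TV_contract.
  by rewrite -[RHS]h /pairing mxE.
- by right; exists (fun i => y 0 i), (fun j => psi j 0); rewrite in_TV_contract vecE.
- left; exists (\col_j psi j); last by rewrite colE.
  by rewrite /pairing mxE -[RHS]h; apply: eq_bigr => j _; rewrite mxE.
right; exists (\row_i y i), (\col_j psi j).
exact (congr2 (fun u v : T => u * v - v * u) (rowE y) (colE psi)).
Qed.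

Lemma Aw_quotient : exists p : {rmorphism T -> Aw w}, p =1 A_proj w /\
  quotient_map (potential_span word w) p.
Proof. by rewrite -A_rel_span; apply: gquot_quotient_map. Qed.

Lemma Dw_quotient (x : 'rV[K]_n) : exists p : {rmorphism T -> Dw w x}, p =1 D_proj w x /\
  quotient_map (extension_span word w (fun j => x 0 j)) p.
Proof. by rewrite -D_rel_span; apply: gquot_quotient_map. Qed.

Lemma row_neq0 (x : 'rV[K]_n) : x != 0 -> exists j, x 0 j != 0.
Proof.
move=> x0; have [//|h] := pselect (exists j, x 0 j != 0); case/eqP: x0.
apply/rowP => j; rewrite mxE; apply/eqP; apply: contraT => xj; case: h; by exists j.
Qed.

Lemma D_rel0 a : ideal_gen (D_rel w 0) a <-> ideal_gen (A_rel w) a.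
Proof.
split; elim=> [|b s d y hs _ ih]; try exact: IdealGen0.
  apply: ideal_genD ih; apply/ideal_genMr/ideal_genMl.
  case: hs => [[psi _ ->]|[z [psi ->]]]; first by apply: ideal_gen_sub; exists psi.
  apply: ideal_genD; first by apply/ideal_genMl/ideal_gen_sub; exists psi.
  by apply/ideal_genN/ideal_genMr/ideal_gen_sub; exists psi.
apply: IdealGenS ih; case: hs => [psi ->]; left; exists psi => //.
by rewrite /pairing mul0mx mxE.
Qed.

Lemma D_rel_scale (c : K) (x : 'rV[K]_n) : c != 0 -> forall a,
  ideal_gen (D_rel w (c *: x)) a <-> ideal_gen (D_rel w x) a.
Proof.
move=> c0 a; suff -> : D_rel w (c *: x) = D_rel w x by [].
apply/funext => b; apply/propext.
suff h psi : pairing psi (c *: x) = 0 <-> pairing psi x = 0.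
  by split=> [[[psi /h]|]|[[psi /h]|]]; [left; exists psi|right|left; exists psi|right].
rewrite /pairing -scalemxAl mxE; split=> [/eqP|->]; last by rewrite mulr0.
by rewrite mulf_eq0 (negbTE c0) => /eqP.
Qed.

Context (m_ge2 : (2 <= m)%N) (w_sup : superpotential w) (A_3CY : calabi_yau 3 (Aw w)).

Lemma Dw_calabi_yau x : x != 0 -> calabi_yau 4 (Dw w x).
Proof.
move=> /row_neq0 [j xj]; have [p [_ hp]] := Aw_quotient; have [pD [_ hpD]] := Dw_quotient x.
have [E _] := gquot_envelope (TV_free K n)
  (extension_span_homogeneous (TV_free K n) (w := w) (c := fun j => x 0 j)) hpD.
exact (extension_calabi_yau (ltnW m_ge2) (TV_free K n) w_sup hp hpD E xj A_3CY).
Qed.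

Lemma Dw_central_extension x : x != 0 ->
  exists (Omega : Dw w x) (dOmega : adeg (Dw w x) m%:Z Omega),
    [/\ central Omega, regular Omega
      & exists2 g : {rmorphism gquot1 dOmega -> Aw w}, gralg_iso_map g &
          forall a : T, g (gquot1_proj dOmega (D_proj w x a)) = A_proj w a].
Proof.
move=> /row_neq0 [j xj]; have [p [pE hp]] := Aw_quotient.
have [pD [pDE hpD]] := Dw_quotient x.
have hT := TV_free K n; have [EA [P [ext _]]] := A_3CY.
have [duA duAE] := der_exists hT p EA.
have prel i : p (f i) = 0 by apply: (potential_rel0 hp).
have ext0 : ext_zero P 0 by apply: ext.
have ext1 : ext_zero P 1 by apply: ext.
have [_ exact2] := calabi_yau_exact hT w_sup (quotient_str hp) (quotient_surj hp)
  (fun a => proj1 (quotient_ker hp a)) prel duAE ext0 ext1.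
pose om := omega word w (fun j => x 0 j) pD j.
have om_central : central om := omega_central hT hpD j.
have om_deg : adeg (Dw w x) m%:Z om := omega_deg hT hpD j.
have reg a : om * a = 0 -> a = 0.
  exact: (@omega_regular K K idfun n m T word hT T word hT w w (fun _ => erefl)
    w_sup (ltnW m_ge2) (Aw w) p hp (Aw w) p hp EA duA duAE exact2 _ _ pD hpD j xj).
exists om, om_deg; split=> //.
  by move=> a; split; [apply: reg|rewrite -om_central; apply: reg].
have [q qE] := extension_proj hp hpD.
have [r [rE hr]] := gquot_quotient_map (homogeneous_set1 om_deg).
have [|g gE] := quotient_map_lift (g := q) hr.
  by move=> _ <-; rewrite rmorphM qE prel mulr0.
exists g; last by move=> a; rewrite /gquot1_proj -rE gE -pDE qE pE.
split=> [|c|k y].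
- have inj : injective g.
    move=> y z; have [b ->] := quotient_surj hr y; have [b' ->] := quotient_surj hr z.
    rewrite !gE => h; apply/eqP; rewrite -subr_eq0 -rmorphB; apply/eqP/(quotient_ker hr).
    have [a ea] := quotient_surj hpD (b - b').
    have [|b0 hb0] := extension_ker hT hp hpD xj (a := a).
      by rewrite -qE -ea rmorphB h subrr.
    rewrite ea hb0; exact (ideal_genMr b0 (ideal_gen_sub (erefl om))).
  have /choice [s sE] : forall y, exists z, g z = y.
    by move=> y; have [a ->] := quotient_surj hp y; exists (r (pD a)); rewrite gE qE.
  by exists s => // z; apply: inj; rewrite sE.
- by rewrite -(quotient_str hr) gE -(quotient_str hpD) qE (quotient_str hp).
move=> /(quotient_deg_lift hr) [b /(quotient_deg_lift hpD) [a ha ->] ->].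
by rewrite gE qE; apply: quotient_deg hp _ _ ha.
Qed.

Lemma central_extension_unique (D' : gralg K) (Omega' : D') (dOmega' : adeg D' m%:Z Omega') :
  connected D' -> generated_in_degree_one D' -> central Omega' -> regular Omega' ->
  gralg_iso (gquot1 dOmega') (Aw w) ->
  (exists x : 'rV[K]_n, x != 0 /\ gralg_iso D' (Dw w x)) /\ calabi_yau 4 D'.
Proof.
move=> conn gen cen reg [g giso]; have [p [_ hp]] := Aw_quotient.
have hT := TV_free K n.
have [r [_ hr]] := gquot_quotient_map (homogeneous_set1 dOmega').
have [q [_ hq]] := quotient_map_iso hr giso.
have [c [[j cj] [ev hev]]] := central_extension_presentation m_ge2 hT hp dOmega' conn gen
  cen reg hq.
pose x : 'rV[K]_n := \row_i c i.
have cE : c = (fun j => x 0 j) by apply/funext => i; rewrite mxE.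
split; last first.
  have [E _] := gquot_envelope hT (extension_span_homogeneous hT (w := w) (c := c)) hev.
  exact (extension_calabi_yau (ltnW m_ge2) hT w_sup hp hev E cj A_3CY).
exists x; split; first by apply: contraNneq cj => x0; rewrite cE x0 mxE.
have [pD [_ hpD]] := Dw_quotient x; rewrite -cE in hpD.
by have [h [_ hiso]] := quotient_map_unique hev hpD; exists h.
Qed.

End TensorAlgebraPresentations.

(** * Lattices and points *)

(** A graded subring. It will consist of the elements that lie, at every point of a given set, in
    the span of the words over the local ring. *)
Record lattice (L : fieldType) (D : gralg L) := Lattice {
  lat_in :> D -> Prop;
  lat_1 : lat_in 1;
  lat_B : forall x y, lat_in x -> lat_in y -> lat_in (x - y);
  lat_M : forall x y, lat_in x -> lat_in y -> lat_in (x * y);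
  lat_component : forall (s : seq int) (f : int -> D), uniq s -> (forall k, adeg D k (f k)) ->
    lat_in (\sum_(k <- s) f k) -> forall k, k \in s -> lat_in (f k) }.

(* The subring [X] of [D], made trivial when [ne] is false: sections over the empty
   set vanish.  In both cases the unit is the idempotent [sect_unit ne]. *)
Section SectionRing.
Context (L : fieldType) (D : gralg L) (X : lattice D) (ne : Prop).

Lemma lat_0 : X 0.
Proof. by rewrite -(subrr 1); apply: lat_B; apply: lat_1. Qed.

Definition sect_pred : {pred D} := fun z => `[< X z /\ (~ ne -> z = 0) >].

Lemma sect_predP z : reflect (X z /\ (~ ne -> z = 0)) (z \in sect_pred).
Proof. exact: asboolP. Qed.

Lemma sect_pred_zmod_closed : zmod_closed sect_pred.
Proof.
split=> [|x y /sect_predP [hx x0] /sect_predP [hy y0]]; apply/sect_predP.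
  by split=> //; apply: lat_0.
by split=> [|h]; [apply: lat_B | rewrite x0 // y0 // subrr].
Qed.

HB.instance Definition _ := GRing.isZmodClosed.Build D sect_pred sect_pred_zmod_closed.

Definition sect := {z : D | z \in sect_pred}.
HB.instance Definition _ := SubChoice.on sect.
HB.instance Definition _ := [SubChoice_isSubZmodule of sect by <:].

Definition sect_unit : D := if `[< ne >] then 1 else 0.

Lemma sect_unit_in : sect_unit \in sect_pred.
Proof.
apply/sect_predP; rewrite /sect_unit; case: asboolP => h; split=> //.
  exact: lat_1.
exact: lat_0.
Qed.

Lemma sect_unitC (a : D) : sect_unit * a = a * sect_unit.
Proof. by rewrite /sect_unit; case: asboolP; rewrite ?mul1r ?mulr1 ?mul0r ?mulr0. Qed.

Lemma sect_unitE (s : sect) : sect_unit * val s = val s.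
Proof.
have /sect_predP [_ h] := valP s; rewrite /sect_unit.
by case: asboolP => [_|/h ->]; rewrite ?mul1r ?mulr0.
Qed.

Lemma sect_mul_in (x y : sect) : val x * val y \in sect_pred.
Proof.
have /sect_predP [hx x0] := valP x; have /sect_predP [hy _] := valP y.
by apply/sect_predP; split=> [|h]; [apply: lat_M | rewrite x0 // mul0r].
Qed.

Definition sect_mul (x y : sect) : sect := Sub (val x * val y) (sect_mul_in x y).
Definition sect_one : sect := Sub sect_unit sect_unit_in.

Lemma sect_mulA : associative sect_mul.
Proof. by move=> x y z; apply: val_inj; rewrite /= mulrA. Qed.
Lemma sect_mul1 : left_id sect_one sect_mul.
Proof. by move=> x; apply: val_inj; rewrite /= sect_unitE. Qed.
Lemma sect_1mul : right_id sect_one sect_mul.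
Proof. by move=> x; apply: val_inj; rewrite /= -sect_unitC sect_unitE. Qed.
Lemma sect_mulDl : left_distributive sect_mul +%R.
Proof. by move=> x y z; apply: val_inj; rewrite /= mulrDl. Qed.
Lemma sect_mulDr : right_distributive sect_mul +%R.
Proof. by move=> x y z; apply: val_inj; rewrite /= mulrDr. Qed.

HB.instance Definition _ := GRing.Zmodule_isPzRing.Build sect
  sect_mulA sect_mul1 sect_1mul sect_mulDl sect_mulDr.

Definition sect_val (s : sect) : D := val s.

Lemma sect_valB : zmod_morphism sect_val.
Proof. by []. Qed.
HB.instance Definition _ := GRing.isZmodMorphism.Build sect D sect_val sect_valB.

Lemma sect_valM x y : sect_val (x * y) = sect_val x * sect_val y.
Proof. by []. Qed.

Lemma sect_val1 : sect_val 1 = sect_unit.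
Proof. by []. Qed.

Lemma sect_valU s : sect_unit * sect_val s = sect_val s.
Proof. exact: sect_unitE. Qed.

Lemma sect_val_inj : injective sect_val.
Proof. exact: val_inj. Qed.

Lemma sect_val_lat s : X (sect_val s).
Proof. by have /sect_predP [] := valP s. Qed.

Lemma sect_val_empty s : ~ ne -> sect_val s = 0.
Proof. by have /sect_predP [] := valP s. Qed.

Lemma sect_exists z : X z -> exists s : sect, sect_val s = sect_unit * z.
Proof.
move=> hz; have h : sect_unit * z \in sect_pred.
  apply/sect_predP; rewrite /sect_unit; case: asboolP => hn; rewrite ?mul1r ?mul0r.
    by split.
  by split=> //; apply: lat_0.
by exists (Sub (sect_unit * z) h : sect).
Qed.

Context (R : comPzRingType) (v : {rmorphism R -> L}) (v_lat : forall r, X (str D (v r))).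

Lemma sect_str_exists : exists f : {rmorphism R -> sect},
  forall r, sect_val (f r) = sect_unit * str D (v r).
Proof.
have /choice [f fE] := fun r => sect_exists (v_lat r).
have fB : zmod_morphism f.
  move=> r r'; apply: sect_val_inj; rewrite raddfB /= !fE -mulrBr.
  by congr (_ * _); rewrite !rmorphB.
have fM : monoid_morphism f.
  split=> [|r r']; apply: sect_val_inj; first by rewrite fE !rmorph1 mulr1.
  rewrite sect_valM !fE !rmorphM /=.
  by rewrite /sect_unit; case: asboolP; rewrite ?mul1r ?mul0r.
by have [g gE] := rmorphism_of fB fM; exists g => r; rewrite gE.
Qed.

Definition sect_str : {rmorphism R -> sect} := projT1 (cid sect_str_exists).
Lemma sect_strE r : sect_val (sect_str r) = sect_unit * str D (v r).
Proof. exact: (projT2 (cid sect_str_exists)). Qed.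

Definition sect_deg k (s : sect) : Prop := adeg D k (sect_val s).

Lemma sect_str_central r s : sect_str r * s = s * sect_str r.
Proof.
apply: sect_val_inj; rewrite !sect_valM sect_strE (mulrA (sect_val s)).
by rewrite -[sect_val s * sect_unit]sect_unitC -!mulrA str_central.
Qed.

Lemma sect_degP : grading sect_deg.
Proof.
split.
- by move=> k; rewrite /sect_deg raddf0; apply: deg_0 (adegP D) _.
- by move=> k x y hx hy; rewrite /sect_deg raddfB; apply: deg_B (adegP D) _ _ _ hx hy.
- move=> x; have [s [f [us hf xE]]] := deg_sum (adegP D) (sect_val x).
  have fX k : k \in s -> X (f k).
    by apply: lat_component us hf _ k; rewrite -xE; apply: sect_val_lat.
  have /choice [g gE] : forall k, exists y : sect,
      sect_val y = sect_unit * (if k \in s then f k else 0).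
    by move=> k; apply: sect_exists; case: ifP => [/fX|_] //; apply: lat_0.
  exists s, g; split=> // [k|].
    rewrite /sect_deg gE /sect_unit; case: asboolP => _.
      by rewrite mul1r; case: ifP => _ //; apply: deg_0 (adegP D) _.
    by rewrite mul0r; apply: deg_0 (adegP D) _.
  apply: sect_val_inj; rewrite raddf_sum /= -[LHS]sect_valU xE mulr_sumr.
  by apply: eq_big_seq => k ks; rewrite gE ks.
move=> s f us hf e k ks; apply: sect_val_inj; rewrite raddf0.
apply: (deg_free (adegP D) us (f := fun k => sect_val (f k)) hf _ ks).
by rewrite -(raddf_sum sect_val) e raddf0.
Qed.

Lemma sect_deg_str r : sect_deg 0 (sect_str r).
Proof.
rewrite /sect_deg sect_strE /sect_unit; case: asboolP => _; rewrite ?mul1r ?mul0r.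
  exact: adeg_str.
exact: deg_0 (adegP D) _.
Qed.

Lemma sect_degM i j x y : sect_deg i x -> sect_deg j y -> sect_deg (i + j) (x * y).
Proof. exact: adegM. Qed.

Lemma sect_degN i x : i < 0 -> sect_deg i x -> x = 0.
Proof. by move=> hi hx; apply: sect_val_inj; rewrite raddf0; apply: adegN hi hx. Qed.

Definition sect_alg : gralg R := @GrAlg R sect sect_str sect_deg
  sect_str_central sect_degP sect_deg_str sect_degM sect_degN.

End SectionRing.

Section Restriction.
Context (L : fieldType) (D : gralg L) (X Y : lattice D) (ne ne' : Prop).
Context (ne'_ne : ne' -> ne) (XY : ne -> forall z, X z -> Y z).

Lemma sect_res_exists : exists f : {rmorphism sect X ne -> sect Y ne'},
  forall s, sect_val (f s) = sect_unit D ne' * sect_val s.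
Proof.
have /choice [f fE] : forall s : sect X ne, exists s' : sect Y ne',
    sect_val s' = sect_unit D ne' * sect_val s.
  move=> s; have [h|h] := pselect ne; first exact/sect_exists/XY/sect_val_lat.
  by rewrite (sect_val_empty s h); apply/sect_exists/lat_0.
have uM a b : sect_unit D ne' * (a * b) = sect_unit D ne' * a * (sect_unit D ne' * b).
  by rewrite /sect_unit; case: asboolP => _; rewrite ?mul1r ?mul0r.
have [||g gE] := @rmorphism_of _ _ f.
- by move=> x y; apply: sect_val_inj; rewrite raddfB /= !fE raddfB mulrBr.
- split=> [|x y]; apply: sect_val_inj; last by rewrite sect_valM !fE sect_valM uM.
  rewrite fE !sect_val1 /sect_unit; case: asboolP => h; last by rewrite mul0r.
  by case: asboolP => [_|[]]; [rewrite mul1r | apply: ne'_ne].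
by exists g => s; rewrite gE.
Qed.

Definition sect_res : {rmorphism sect X ne -> sect Y ne'} := projT1 (cid sect_res_exists).
Lemma sect_resE s : sect_val (sect_res s) = sect_unit D ne' * sect_val s.
Proof. exact: (projT2 (cid sect_res_exists)). Qed.

Lemma sect_res_deg k s : sect_deg k s -> sect_deg k (sect_res s).
Proof.
move=> hs; rewrite /sect_deg sect_resE /sect_unit; case: asboolP => _; rewrite ?mul1r ?mul0r //.
exact: deg_0 (adegP D) _.
Qed.

End Restriction.

(** By Zorn's lemma: an ideal maximal among those that contain J and no power of g is prime, since
    adjoining an element outside it produces a power of g. *)
Lemma prime_avoiding (R : comPzRingType) (J : R -> Prop) (g : R) :
  J 0 -> (forall a b, J a -> J b -> J (a + b)) -> (forall a b, J b -> J (a * b)) ->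
  (forall k, ~ J (g ^+ k)) ->
  exists Q : R -> Prop, [/\ forall a, J a -> Q a,
    forall a b, Q a -> Q b -> Q (a + b), forall a b, Q b -> Q (a * b),
    forall a b, Q (a * b) -> Q a \/ Q b & ~ Q g].
Proof.
move=> J0 JD JM Jg.
pose ok (Q : R -> Prop) := [/\ forall a, J a -> Q a,
  forall a b, Q a -> Q b -> Q (a + b), forall a b, Q b -> Q (a * b) &
  forall k, ~ Q (g ^+ k)].
pose W := {Q : R -> Prop | ok Q}.
have okJ : ok J by [].
pose sub : rel W := fun Q Q' => `[< forall a, sval Q a -> sval Q' a >].
have [|||Q Qmax] := @classical_sets.ZL_preorder W (exist _ J okJ) sub.
- by move=> Q; apply/asboolP.
- by move=> Q Q' Q'' /asboolP h /asboolP h'; apply/asboolP => a /h /h'.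
- move=> C tot; pose U a := J a \/ exists2 Q : W, C Q & sval Q a.
  have inU (Q : W) a : C Q -> sval Q a -> U a by move=> hQ ha; right; exists Q.
  have okU : ok U.
    split=> [a ha|a b|a b|k].
    - by left.
    - move=> [ha|[Q hQ ha]] [hb|[Q' hQ' hb]].
      + by left; apply: JD.
      + by apply: (inU _ _ hQ'); have [h1 h2 _ _] := svalP Q'; apply: h2 => //; apply: h1.
      + by apply: (inU _ _ hQ); have [h1 h2 _ _] := svalP Q; apply: h2 => //; apply: h1.
      have [/asboolP h|/asboolP h] := tot _ _ hQ hQ'.
        by apply: (inU _ _ hQ'); have [_ h2 _ _] := svalP Q'; apply: h2 => //; apply: h.
      by apply: (inU _ _ hQ); have [_ h2 _ _] := svalP Q; apply: h2 => //; apply: h.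
    - move=> [hb|[Q hQ hb]]; first by left; apply: JM.
      by apply: (inU _ _ hQ); have [_ _ h3 _] := svalP Q; apply: h3.
    move=> [/Jg //|[Q hQ]]; have [_ _ _ h4] := svalP Q; exact: h4.
  by exists (exist _ U okU) => Q hQ; apply/asboolP => a; apply: inU.
have [QJ QD QM Qg] := svalP Q; exists (sval Q); split=> //; last exact: (Qg 1%N).
have grow a : ~ sval Q a -> exists k r b, sval Q b /\ g ^+ k = r * a + b.
  move=> na; have [//|h] := pselect (exists k r b, sval Q b /\ g ^+ k = r * a + b).
  pose Q' x := exists r b, sval Q b /\ x = r * a + b.
  have okQ' : ok Q'.
    split=> [x hx|x y [r [b [hb ->]]] [r' [b' [hb' ->]]]|x y [r [b [hb ->]]]|k [r [b hk]]].
    - by exists 0, x; rewrite mul0r add0r; split=> //; apply: QJ.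
    - by exists (r + r'), (b + b'); rewrite mulrDl addrACA; split=> //; apply: QD.
    - by exists (x * r), (x * b); rewrite mulrDr mulrA; split=> //; apply: QM.
    by apply: h; exists k, r, b.
  have /Qmax /asboolP hQ' : sub Q (exist _ Q' okQ').
    by apply/asboolP => x hx; exists 0, x; rewrite mul0r add0r.
  case: na; apply: hQ'; exists 1, 0; rewrite mul1r addr0; split=> //; exact/QJ.
move=> a b hab; have [|/grow [k [r [x [hx kE]]]]] := pselect (sval Q a); first by left.
have [|/grow [l [s [y [hy lE]]]]] := pselect (sval Q b); first by right.
case: (Qg (k + l)%N); rewrite exprD kE lE mulrDl !mulrDr.
have -> : r * a * (s * b) = r * s * (a * b) by rewrite mulrACA.
by apply: (QD); apply: (QD); first exact: QM; [apply: QM|rewrite mulrC; apply: QM|apply: QM].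
Qed.

Section ProjectiveSpace.
Context (K : fieldType) (n : nat).
Local Notation S := (mpoly.mpoly n K).
Local Notation hp d f := (pihomog mpoly.mdeg d f).

Lemma homogeneous_sum (f : S) : exists N, f = \sum_(d < N) hp d f.
Proof. by eexists; apply: pihomog_partitionE. Qed.

Lemma pihomogM_sum e (f g : S) : exists N M, hp e (f * g) =
  \sum_(i < N) \sum_(j < M | (i + j == e)%N) hp i f * hp j g.
Proof.
have [N fE] := homogeneous_sum f; have [M gE] := homogeneous_sum g; exists N, M.
rewrite {1}fE mulr_suml raddf_sum; apply: eq_bigr => i _ /=.
rewrite {1}gE mulr_sumr raddf_sum [RHS]big_mkcond; apply: eq_bigr => j _ /=.
have h := dhomogM (pihomogP mpoly.mdeg i f) (pihomogP mpoly.mdeg j g).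
by case: eqP => [<-|/eqP ij]; [apply: pihomog_dE | apply: pihomog_ne0 ij h].
Qed.

Lemma letter_neq0 (i : 'I_n) : 'X_i <> 0 :> S.
Proof.
move/(congr1 (mpoly.mcoeff U_(i)%MM))/eqP.
by rewrite mpoly.mcoeffX eqxx mpoly.mcoeff0 oner_eq0.
Qed.

(** The index [i] ensures n > 0, without which the zero ideal contains the irrelevant one. *)
Lemma generic_point (i : 'I_n) : exists eta : point K n, forall f, eta f <-> f = 0.
Proof.
pose Z (f : S) := f = 0.
have ZD f g : Z f -> Z g -> Z (f + g) by move=> -> ->; rewrite /Z addr0.
have ZM f g : Z g -> Z (f * g) by move=> ->; rewrite /Z mulr0.
have Z1 : ~ Z 1 by apply/eqP; rewrite oner_eq0.
have ZP f g : Z (f * g) -> Z f \/ Z g.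
  by move=> /eqP; rewrite mulf_eq0 => /orP [] /eqP; [left|right].
have Zh f d : Z f -> Z (hp d f) by move=> ->; apply: raddf0.
have ZX : exists i : 'I_n, ~ Z 'X_i by exists i; apply: letter_neq0.
by exists (Point erefl ZD ZM Z1 ZP Zh ZX).
Qed.

Lemma generic_in_open (eta : point K n) (U : opens K n) p :
  (forall f, eta f <-> f = 0) -> U p -> U eta.
Proof.
move=> hE; have [F UE] := in_openP U; rewrite !UE => -[f Ff pf].
by exists f => // /hE f0; apply: pf; rewrite f0; apply: pt_0.
Qed.

Lemma opens_inter (U V : opens K n) : exists W : opens K n, forall p, W p <-> U p /\ V p.
Proof.
have [F UE] := in_openP U; have [G VE] := in_openP V.
have h : is_open (fun p : point K n => U p /\ V p).
  exists (fun r => exists f g, [/\ F f, G g & r = f * g]) => p; rewrite UE VE; split.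
    move=> [[f Ff pf] [g Gg pg]]; exists (f * g); first by exists f, g.
    by case/pt_prime.
  move=> [_ [f [g [Ff Gg ->]]] pfg]; split; [exists f => // pf|exists g => // pg]; apply: pfg.
    by rewrite mulrC; apply: pt_M.
  exact: pt_M.
by exists (Opens h).
Qed.

Lemma point_avoiding (J : S -> Prop) (i : 'I_n) (a : S) :
  J 0 -> (forall f g, J f -> J g -> J (f + g)) -> (forall f g, J g -> J (f * g)) ->
  (forall f d, J f -> J (hp d f)) -> (forall k, ~ J (('X_i * a) ^+ k)) ->
  exists p : point K n, (forall f, J f -> p f) /\ basic_open ('X_i * a) p.
Proof.
move=> J0 JD JM Jh Jg; have [Q [QJ QD QM QP Qg]] := prime_avoiding J0 JD JM Jg.
have Q0 : Q 0 by apply: QJ.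
(* The largest homogeneous ideal inside [Q]. It still contains J, which is homogeneous; primality is
   tested on the highest components lying outside [Q]. *)
pose P f := forall d, Q (hp d f).
have P_Q f : P f -> Q f.
  have [N fE] := homogeneous_sum f => h; rewrite fE.
  by apply: (big_ind Q) => // j _; apply: h.
have PD f g : P f -> P g -> P (f + g) by move=> hf hg d; rewrite raddfD; apply: QD; [apply: hf | apply: hg].
have PM f g : P g -> P (f * g).
  move=> hg d; have [N [M ->]] := pihomogM_sum d f g.
  by do 2![apply: (big_ind Q) => // ? _]; apply: QM.
have Ph f d : P f -> P (hp d f).
  move=> hf e; have [<-|de] := eqVneq d e; first by rewrite pihomog_id.
  by rewrite (pihomog_ne0 de (pihomogP _ _ _)).
have Pg : ~ P ('X_i * a) by move/P_Q.
have P1 : ~ P 1 by move/(PM ('X_i * a)); rewrite mulr1.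
have PX : ~ P 'X_i by move/(PM a); rewrite mulrC.
have P0 : P 0 by move=> d; rewrite raddf0.
have top f : ~ P f -> exists e, ~ Q (hp e f) /\ forall d, (e < d)%N -> Q (hp d f).
  move=> nf; have [N fE] := homogeneous_sum f.
  have ex : exists d, `[< ~ Q (hp d f) >].
    apply: contrapT => h; apply: nf => d; apply: contrapT => hd.
    by apply: h; exists d; apply/asboolP.
  have bound d : `[< ~ Q (hp d f) >] -> (d <= N)%N.
    move=> /asboolP hd; rewrite leqNgt; apply/negP => Nd; apply: hd.
    rewrite fE raddf_sum big1 // => j _; apply: pihomog_ne0 (pihomogP _ _ _).
    by rewrite neq_ltn (ltn_trans (ltn_ord j) Nd).
  have [e /asboolP he emax] := ex_maxnP ex bound; exists e; split=> // d ed.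
  by apply: contrapT => hd; move: ed; rewrite ltnNge emax //; apply/asboolP.
have PP f g : P (f * g) -> P f \/ P g.
  move=> hfg; have [|/top [e [he emax]]] := pselect (P f); first by left.
  have [|/top [e' [he' emax']]] := pselect (P g); first by right.
  have Qsum F G : (forall i j, (i + j)%N = (e + e')%N -> Q (hp i F * hp j G)) ->
      Q (hp (e + e') (F * G)).
    move=> h; have [N [M ->]] := pihomogM_sum (e + e') F G.
    by apply: (big_ind Q) => // u _; apply: (big_ind Q) => // v /eqP; apply: h.
  have QN x : Q x -> Q (- x) by rewrite -mulN1r; apply: QM.
  have hp0 d F : hp d (F - hp d F) = 0 by rewrite raddfB /= pihomog_id subrr.
  have h0 d d1 F : d != d1 -> hp d (hp d1 F) = 0.
    by rewrite eq_sym => di; apply: pihomog_ne0 di (pihomogP _ _ _).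
  (* Modulo [Q], the component of degree e + e' of [f * g] is the product of these highest
     components: every other contribution has a factor of degree above e or e', which lies in
     [Q]. *)
  have E : hp e f * hp e' g = hp (e + e') (f * g) -
      hp (e + e') (hp e f * (g - hp e' g)) - hp (e + e') ((f - hp e f) * g).
    rewrite -!raddfB /= mulrBl mulrBr !opprB -addrA [X in _ + X]addrA subrK addrC subrK.
    by rewrite [RHS]pihomog_dE //; exact (dhomogM (pihomogP _ _ _) (pihomogP _ _ _)).
  have : Q (hp e f * hp e' g).
    rewrite E; apply: (QD); first apply: (QD); [exact: hfg|apply: QN|apply: QN]; apply: Qsum.
      move=> u v uv; have [ue|ue] := eqVneq u e; last by rewrite h0 // mul0r.
      by move: uv; rewrite ue => /addnI ->; rewrite hp0 mulr0.
    move=> u v uv; have [ue|eu|->] := ltngtP u e; last by rewrite hp0 mul0r.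
      apply: QM; apply: emax'; rewrite ltnNge; apply/negP => ve.
      have : (u + v < e + e')%N by rewrite -addSn leq_add.
      by rewrite uv ltnn.
    by rewrite mulrC raddfB /= h0 ?gtn_eqF // subr0; apply: QM; apply: emax.
  by case/QP.
by exists (Point P0 PD PM P1 PP Ph (ex_intro _ i PX)); split=> // f hf d; apply/QJ/Jh.
Qed.

End ProjectiveSpace.

Section SpanIn.
Context (L : fieldType) (n : nat) (T : gralg L) (word : seq 'I_n -> T)
  (hT : free_algebra word).

Inductive span_in (R : L -> Prop) : T -> Prop :=
| SpanIn0 : span_in R 0
| SpanInD a b : span_in R a -> span_in R b -> span_in R (a + b)
| SpanInU c u : R c -> span_in R (str T c * word u).

Context (R : L -> Prop) (R1 : R 1) (RB : forall a b, R a -> R b -> R (a - b))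
  (RM : forall a b, R a -> R b -> R (a * b)).

Lemma span_inZ c t : R c -> span_in R t -> span_in R (str T c * t).
Proof.
move=> hc; elim=> [|a b _ ha _ hb|d u hd].
- by rewrite mulr0; apply: SpanIn0.
- by rewrite mulrDr; apply: SpanInD.
by rewrite mulrA -rmorphM; apply: SpanInU; apply: RM.
Qed.

Lemma span_inB a b : span_in R a -> span_in R b -> span_in R (a - b).
Proof.
move=> ha hb; apply: SpanInD => //.
rewrite -mulN1r -(rmorph1 (str T)) -rmorphN; apply: span_inZ hb.
by rewrite -sub0r; apply: (RB) => //; rewrite -(subrr 1); apply: RB.
Qed.

Lemma span_in_word u : span_in R (word u).
Proof. by rewrite -[word u]mul1r -(rmorph1 (str T)); apply: SpanInU. Qed.

Lemma span_in1 : span_in R 1.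
Proof. by rewrite -(word_nil hT); apply: span_in_word. Qed.

Lemma span_inM a b : span_in R a -> span_in R b -> span_in R (a * b).
Proof.
move=> ha hb; elim: ha => [|a1 a2 _ h1 _ h2|c u hc].
- by rewrite mul0r; apply: SpanIn0.
- by rewrite mulrDl; apply: SpanInD.
elim: hb => [|b1 b2 _ h1 _ h2|d v hd].
- by rewrite mulr0; apply: SpanIn0.
- by rewrite mulrDr; apply: SpanInD.
by rewrite str_mul -(word_cat hT); apply: SpanInU; apply: RM.
Qed.

Lemma span_in_homogeneous t : span_in R t -> exists l : seq (int * T),
  t = \sum_(q <- l) q.2 /\ forall q, q \in l -> adeg T q.1 q.2 /\ span_in R q.2.
Proof.
elim=> [|a b _ [l [-> hl]] _ [l' [-> hl']]|c u hc].
- by exists [::]; rewrite big_nil.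
- exists (l ++ l'); rewrite big_cat; split=> // q.
  by rewrite mem_cat => /orP [/hl|/hl'].
exists [:: ((size u)%:Z, str T c * word u)]; rewrite big_seq1; split=> // q.
rewrite inE => /eqP -> /=; split; last exact: SpanInU.
by rewrite -[(size u)%:Z]add0r; apply: adegM; [apply: adeg_str | apply: (word_deg hT)].
Qed.

End SpanIn.

Lemma span_in_mono (L : fieldType) n (T : gralg L) (word : seq 'I_n -> T) (R R' : L -> Prop) :
  (forall c, R c -> R' c) -> forall t, span_in word R t -> span_in word R' t.
Proof.
move=> RR' t; elim=> [|a b _ ha _ hb|c u hc]; first exact: SpanIn0.
  exact: SpanInD.
exact/SpanInU/RR'.
Qed.

Section PointLattices.
Context (L : fieldType) (n : nat) (T : gralg L) (word : seq 'I_n -> T)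
  (hT : free_algebra word) (D : gralg L) (p : {rmorphism T -> D})
  (pstr : forall c, p (str T c) = str D c)
  (pdeg : forall k a, adeg T k a -> adeg D k (p a)).

Definition span_image (R : L -> Prop) (z : D) : Prop := exists2 t, span_in word R t & z = p t.

Context (Pt : Type) (R : Pt -> L -> Prop) (R1 : forall x, R x 1)
  (RB : forall x a b, R x a -> R x b -> R x (a - b))
  (RM : forall x a b, R x a -> R x b -> R x (a * b)).

Definition lat_on_pred (U : Pt -> Prop) (z : D) : Prop := forall x, U x -> span_image (R x) z.

Lemma lat_on_1 U : lat_on_pred U 1.
Proof. by move=> x _; exists 1; [apply: (span_in1 hT) | rewrite rmorph1]. Qed.

Lemma lat_on_B U y z : lat_on_pred U y -> lat_on_pred U z -> lat_on_pred U (y - z).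
Proof.
move=> hy hz x Ux; have [a ha ->] := hy x Ux; have [b hb ->] := hz x Ux.
by exists (a - b); [apply: span_inB (R1 x) (@RB x) (@RM x) _ _ ha hb | rewrite rmorphB].
Qed.

Lemma lat_on_M U y z : lat_on_pred U y -> lat_on_pred U z -> lat_on_pred U (y * z).
Proof.
move=> hy hz x Ux; have [a ha ->] := hy x Ux; have [b hb ->] := hz x Ux.
by exists (a * b); [exact (span_inM hT (@RM x) ha hb) | rewrite rmorphM].
Qed.

Lemma lat_on_component U (s : seq int) (f : int -> D) : uniq s ->
  (forall k, adeg D k (f k)) -> lat_on_pred U (\sum_(k <- s) f k) ->
  forall k, k \in s -> lat_on_pred U (f k).
Proof.
move=> us hf h k ks x Ux; have [t ht e] := h x Ux.
have [l [tE hl]] := span_in_homogeneous hT ht.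
pose P z := span_image (R x) z.
have P0 : P 0 by exists 0; [apply: SpanIn0 | rewrite rmorph0].
have PD y z : P y -> P z -> P (y + z).
  by move=> [a ha ->] [b hb ->]; exists (a + b); [apply: SpanInD | rewrite rmorphD].
have hl' q : q \in [seq (q.1, p q.2) | q <- l] -> adeg D q.1 q.2 /\ P q.2.
  by move=> /mapP [r /hl [r1 r2] ->]; split; [apply: pdeg | exists r.2].
have [s' [g [us' hg Pg eg]]] := grading_regroup (adegP D) P0 PD hl'.
have := grading_uniq (adegP D) us us' hf hg; rewrite e tE -eg big_map rmorph_sum.
by move=> /(_ erefl k); rewrite ks => ->; case: ifP => _; [apply: Pg | apply: P0].
Qed.

Definition lat_on (U : Pt -> Prop) : lattice D :=
  Lattice (@lat_on_1 U) (@lat_on_B U) (@lat_on_M U) (@lat_on_component U).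

Lemma lat_on_str U c : (forall x, U x -> R x c) -> lat_on U (str D c).
Proof.
move=> hc x Ux; exists (str T c); last by rewrite pstr.
by rewrite -[str T c]mulr1 -(word_nil hT); apply/SpanInU/hc.
Qed.

Lemma lat_on_word U u : lat_on U (p (word u)).
Proof. by move=> x _; exists (word u) => //; apply: span_in_word. Qed.

End PointLattices.

(** * Regular functions and the extension of sections from principal open sets *)

Section RegularAt.
Context (K : fieldType) (n : nat).
Local Notation S := (mpoly.mpoly n K).
Local Notation hp d f := (pihomog mpoly.mdeg d f).
Context (L : fieldType) (toL : {rmorphism S -> L}) (toL_inj : forall f, toL f = 0 -> f = 0).

Definition reg (x : point K n) (z : L) : Prop := exists d (a b : S),
  [/\ a \is d.-homog, b \is d.-homog, ~ x b & z = toL a / toL b].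

Lemma reg_nz (x : point K n) b : ~ x b -> toL b != 0.
Proof.
by move=> hb; apply/eqP => /toL_inj b0; apply: hb; rewrite b0; apply: pt_0.
Qed.

Lemma reg_const x c : reg x (toL (mpolyC n c)).
Proof.
exists 0%N, (mpolyC n c), 1; split.
- by rewrite -[mpolyC n c]mulr1 mul_mpolyC dhomogZ // dhomog1.
- exact: dhomog1.
- exact: pt_1.
by rewrite rmorph1 divr1.
Qed.

Lemma reg1 x : reg x 1.
Proof. by rewrite -(rmorph1 toL) -(mpolyC1 n); apply: reg_const. Qed.

Lemma regB x y z : reg x y -> reg x z -> reg x (y - z).
Proof.
move=> [d [a [b [ha hb pb ->]]]] [e [a' [b' [ha' hb' pb' ->]]]].
exists (d + e)%N, (a * b' - a' * b), (b * b'); split.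
- by rewrite rpredB ?[a' * b]mulrC ?dhomogM.
- exact: dhomogM.
- by case/pt_prime.
rewrite -[- (toL a' / _)]mulNr addf_div ?(reg_nz pb) ?(reg_nz pb') //.
by rewrite rmorphB !(rmorphM toL) mulNr.
Qed.

Lemma regM x y z : reg x y -> reg x z -> reg x (y * z).
Proof.
move=> [d [a [b [ha hb pb ->]]]] [e [a' [b' [ha' hb' pb' ->]]]].
exists (d + e)%N, (a * a'), (b * b'); split; rewrite ?dhomogM //.
  by case/pt_prime.
by rewrite !rmorphM mulf_div.
Qed.

Lemma homogX (i : 'I_n) : ('X_i : S) \is 1.-homog.
Proof. by rewrite dhomogX; apply/eqP; exact: mpoly.mdeg1. Qed.

Lemma reg_ratio (x : point K n) i j : ~ x 'X_i -> reg x (toL 'X_j / toL 'X_i).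
Proof. by move=> xi; exists 1%N, 'X_j, 'X_i; split=> //; apply: homogX. Qed.

Lemma reg_open x z : reg x z -> exists W : opens K n, W x /\ forall y, W y -> reg y z.
Proof.
move=> [d [a [b [ha hb xb ->]]]]; exists (basic_open b); split=> // y yb.
by exists d, a, b.
Qed.

(** The coordinate ring of the chart where X_i does not vanish, inside [L]. *)
Definition chart_reg (i : 'I_n) (z : L) : Prop :=
  exists e (a : S), a \is e.-homog /\ z = toL a / toL ('X_i ^+ e).

Lemma chart_regM i y z : chart_reg i y -> chart_reg i z -> chart_reg i (y * z).
Proof.
move=> [e [a [ha ->]]] [e' [a' [ha' ->]]]; exists (e + e')%N, (a * a').
by rewrite dhomogM // exprD !rmorphM mulf_div.
Qed.

Lemma chart_reg_at i z (x : point K n) : ~ x 'X_i -> chart_reg i z -> reg x z.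
Proof.
move=> xi [e [a [ha ->]]]; exists e, a, ('X_i ^+ e); split=> //.
  by have := dhomogMn e (homogX i); rewrite mul1n.
elim: e {a ha} => [|e ih]; first by rewrite expr0; apply: pt_1.
by rewrite exprS => /pt_prime [].
Qed.

Context (T : gralg L) (word : seq 'I_n -> T) (D : gralg L) (p : {rmorphism T -> D})
  (pstr : forall c, p (str T c) = str D c).
Let ratio i e f := toL f / toL ('X_i ^+ e).

Let ratioM i e e' f g : ratio i (e + e') (f * g) = ratio i e f * ratio i e' g.
Proof. by rewrite /ratio exprD !rmorphM mulf_div. Qed.

Let chart_ratio i e f : f \is e.-homog -> chart_reg i (ratio i e f).
Proof. by move=> hf; exists e, f. Qed.

Lemma chart_denominator i (x : point K n) t : span_in word (reg x) t ->
  exists e b, [/\ b \is e.-homog, ~ x b & span_in word (chart_reg i) (str T (ratio i e b) * t)].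
Proof.
elim=> [|t1 t2 _ [e1 [b1 [hb1 xb1 h1]]] _ [e2 [b2 [hb2 xb2 h2]]]|c u [d [a [b [ha hb xb ->]]]]].
- by exists 0%N, 1; split; [exact: dhomog1|exact: pt_1|rewrite mulr0; apply: SpanIn0].
- exists (e1 + e2)%N, (b1 * b2); split; [exact: dhomogM | by case/pt_prime|].
  rewrite mulrDr; apply: SpanInD.
    rewrite ratioM mulrC rmorphM -mulrA; apply: span_inZ h1; first exact: chart_regM.
    exact: chart_ratio.
  rewrite ratioM rmorphM -mulrA; apply: span_inZ h2; first exact: chart_regM.
  exact: chart_ratio.
exists d, b; split=> //; rewrite mulrA -rmorphM; apply: SpanInU.
suff -> : ratio i d b * (toL a / toL b) = ratio i d a by apply: chart_ratio.
by rewrite /ratio mulrAC [toL a / toL b]mulrC mulrA divff ?mul1r // (reg_nz xb).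
Qed.

Lemma chart_extension i d (a : S) (z : D) : a \is d.-homog ->
  (forall x : point K n, basic_open ('X_i * a) x -> span_image word p (reg x) z) ->
  exists k, span_image word p (chart_reg i) (str D (ratio i d a) ^+ k * z).
Proof.
(* The denominators of z over the chart. Requiring the condition for every component makes J a
   homogeneous ideal. *)
move=> ha hz; pose J f := forall e, span_image word p (chart_reg i) (str D (ratio i e (hp e f)) * z).
have imD y y' : span_image word p (chart_reg i) y -> span_image word p (chart_reg i) y' ->
    span_image word p (chart_reg i) (y + y').
  by move=> [t ht ->] [t' ht' ->]; exists (t + t'); [apply: SpanInD | rewrite rmorphD].
have im0 : span_image word p (chart_reg i) 0.
  by exists 0; [apply: SpanIn0 | rewrite rmorph0].
have imZ c y : chart_reg i c -> span_image word p (chart_reg i) y ->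
    span_image word p (chart_reg i) (str D c * y).
  move=> hc [t ht ->]; exists (str T c * t); last by rewrite rmorphM pstr.
  by apply: span_inZ ht; first exact: chart_regM.
have ratio_sum (I : finType) (P : pred I) (F : I -> S) e :
    ratio i e (\sum_(j | P j) F j) = \sum_(j | P j) ratio i e (F j).
  by rewrite /ratio rmorph_sum mulr_suml.
have J0 : J 0 by move=> e; rewrite raddf0 /ratio rmorph0 mul0r rmorph0 mul0r.
have JD f g : J f -> J g -> J (f + g).
  move=> hf hg e; rewrite raddfD /ratio rmorphD mulrDl rmorphD mulrDl.
  by apply: imD; [apply: hf | apply: hg].
have JM f g : J g -> J (f * g).
  move=> hg e; have [N [M ->]] := pihomogM_sum e f g.
  rewrite ratio_sum rmorph_sum mulr_suml; apply: (big_ind (span_image word p (chart_reg i))) => //.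
  move=> u _; rewrite ratio_sum rmorph_sum mulr_suml.
  apply: (big_ind (span_image word p (chart_reg i))) => // v /eqP <-.
  rewrite ratioM rmorphM -mulrA; apply: imZ; last exact: hg.
  exact/chart_ratio/pihomogP.
have Jh f e : J f -> J (hp e f).
  move=> hf e'; have [->|ee] := eqVneq e e'; first by rewrite pihomog_id.
  by rewrite (pihomog_ne0 ee (pihomogP _ _ _)) /ratio rmorph0 mul0r rmorph0 mul0r.
have [[k hk]|hJ] := pselect (exists k, J (('X_i * a) ^+ k)).
  exists k; have Xnz : toL 'X_i != 0 by apply/eqP => /toL_inj; apply: letter_neq0.
  have := hk ((1 + d) * k)%N; rewrite pihomog_dE; last first.
    exact (dhomogMn k (dhomogM (homogX i) ha)).
  suff -> : ratio i ((1 + d) * k) (('X_i * a) ^+ k) = ratio i d a ^+ k by rewrite rmorphXn.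
  have <- : ratio i (1 + d) ('X_i * a) = ratio i d a.
    by rewrite ratioM {1}/ratio expr1 divff // mul1r.
  by rewrite /ratio exprM !rmorphXn expr_div_n.
have Jg k : ~ J (('X_i * a) ^+ k) by move=> h; apply: hJ; exists k.
(* At this point z is integral, so clearing the denominators of its coefficients yields a
   homogeneous element of J that does not vanish there: a contradiction. *)
have [x [Jx xU]] := point_avoiding J0 JD JM Jh Jg.
have [t /(chart_denominator i) [e [b [hb xb h]]] zE] := hz x xU.
case: xb; apply: Jx => e'; have [<-|ee] := eqVneq e e'.
  by rewrite pihomog_dE // zE; exists (str T (ratio i e b) * t); [exact: h | rewrite (rmorphM p) pstr].
by rewrite (pihomog_ne0 ee hb) /ratio rmorph0 mul0r rmorph0 mul0r.
Qed.

End RegularAt.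

(** * Bases of the lattices, flatness and fibers *)

Lemma base_ring_map (K L : fieldType) (j0 : {rmorphism K -> L}) n
    (T : gralg K) (word : seq 'I_n -> T) (hT : free_algebra word)
    (TL : gralg L) (wordL : seq 'I_n -> TL) (hTL : free_algebra wordL) :
  exists f : {rmorphism T -> TL}, (forall u, f (word u) = wordL u) /\
    (forall c, f (str T c) = str TL (j0 c)).
Proof.
have [|f [fstr fx]] := free_eval hT (s := str TL \o j0) (x := fun i => wordL [:: i]).
  by move=> c i /=; apply: str_central.
exists f; split=> //; elim=> [|i u ih]; first by rewrite (word_nil hT) (word_nil hTL) rmorph1.
by rewrite (word_cons hT i u) (word_cons hTL i u) rmorphM fx ih.
Qed.

Lemma mul_central_mid (R : comPzRingType) (D : gralg R) (z : D) d (a b : D) : central z ->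
  a * (str D d * z) * b = str D d * (z * (a * b)).
Proof. by move=> zC; rewrite mulrA -str_central -!mulrA (mulrA a z) -zC -mulrA. Qed.

Lemma mul_central_str (R : comPzRingType) (D : gralg R) (z : D) k d (a : D) : central z ->
  z * (str D d * (z ^+ k * a)) = str D d * (z ^+ k.+1 * a).
Proof. by move=> zC; rewrite zC -!mulrA -(zC a) exprSr -(mulrA (z ^+ k)). Qed.

Section Rewriting.
Context (K : fieldType) (n m : nat).
Context (T : gralg K) (word : seq 'I_n -> T) (hT : free_algebra word) (w : tensor K n m.+1).
Context (A : gralg K) (p : {rmorphism T -> A})
  (hp : quotient_map (potential_span word w) p).
Context (b : nat -> seq (seq 'I_n)) (e : seq 'I_n -> seq 'I_n -> K) (be : is_basis word p b e).

(** [rl u] records how [u] differs from its normal form in the free algebra. As its terms have the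
    length of [u], replacing f_j by a multiple of Omega leaves words shorter by m; this is the
    measure of the later inductions. *)
Definition rewriting (rl : seq 'I_n -> seq (K * (seq 'I_n * 'I_n * seq 'I_n))) : Prop :=
  forall u, word u = \sum_(t <- b (size u)) str T (e t u) * word t
      + \sum_(q <- rl u) rel_term word w q /\
    forall q, q \in rl u -> (size q.2.1.1 + m + size q.2.2)%N = size u.

Lemma rewriting_exists : exists rl, rewriting rl.
Proof.
suff /choice [rl h] : forall u, exists l,
    word u = \sum_(t <- b (size u)) str T (e t u) * word t
      + \sum_(q <- l) rel_term word w q /\
    forall q, q \in l -> (size q.2.1.1 + m + size q.2.2)%N = size u by exists rl.
move=> u; have [bsize bE _ _] := be.
pose r := word u - \sum_(t <- b (size u)) str T (e t u) * word t.
have [l lE] : exists l, r = \sum_(q <- l) rel_term word w q.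
  apply: (ideal_rel_terms hT); apply/(quotient_ker hp).
  rewrite rmorphB rmorph_sum bE -sumrB big1 // => t _.
  by rewrite rmorphM (quotient_str hp) subrr.
have r_deg : adeg T (size u)%:Z r.
  apply: deg_B (adegP T) _ _ _ (word_deg hT u) _; rewrite big_seq.
  apply: (big_ind (adeg T (size u)%:Z)).
  - exact: deg_0 (adegP T) _.
  - exact: gradingD (adegP T) _.
  move=> t /bsize <-; rewrite -[(size t)%:Z]add0r.
  by apply: adegM; [apply: adeg_str | apply: (word_deg hT)].
pose sz (q : K * (seq 'I_n * 'I_n * seq 'I_n)) := (size q.2.1.1 + m + size q.2.2)%N.
exists [seq q <- l | sz q == size u]; split; last first.
  by move=> q; rewrite mem_filter => /andP [/eqP].
have := homogeneous_part (adegP T) (k := (size u)%:Z)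
  (l := [seq ((sz q)%:Z, rel_term word w q) | q <- l]).
rewrite big_map -lE => /(_ r_deg) h.
have -> : word u = \sum_(t <- b (size u)) str T (e t u) * word t + r.
  by rewrite addrC subrK.
congr (_ + _); rewrite h; last by move=> _ /mapP [q _ ->]; apply: (rel_term_deg hT).
by rewrite big_map big_filter.
Qed.

End Rewriting.

(* [basis_expand] says that the elements F^k t, for t in [b], form a free basis of [D] with
   coordinate functions [lam t \o rho^k]; these preserve [R0]-lattices by the last two fields. *)
Record extension_basis (L : fieldType) n (T : gralg L) (word : seq 'I_n -> T) (D : gralg L)
    (p : {rmorphism T -> D}) (b : nat -> seq (seq 'I_n)) (F : D) (R0 : L -> Prop)
    (lam : seq 'I_n -> {additive D -> L}) (rho : {additive D -> D}) : Prop := ExtensionBasis {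
  lam_linear : forall t d y, lam t (str D d * y) = d * lam t y;
  rho_linear : forall d y, rho (str D d * y) = str D d * rho y;
  basis_expand : forall y, exists N, forall M, (N <= M)%N -> y =
    \sum_(k < M) \sum_(q < M) \sum_(t <- b q)
      str D (lam t (iter k rho y)) * (F ^+ k * p (word t));
  lam_word : forall t u, R0 (lam t (p (word u)));
  rho_word : forall u, span_image word p R0 (rho (p (word u))) }.

Section ExtensionBasis.
Context (K L : fieldType) (j0 : {rmorphism K -> L}) (n m : nat) (m_gt0 : (0 < m)%N).
Context (T : gralg K) (word : seq 'I_n -> T) (hT : free_algebra word).
Context (TL : gralg L) (wordL : seq 'I_n -> TL) (hTL : free_algebra wordL).
Context (w : tensor K n m.+1) (wL : tensor L n m.+1) (wLE : forall t, wL t = j0 (w t)).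
Context (A : gralg K) (p : {rmorphism T -> A})
  (hp : quotient_map (potential_span word w) p).
Context (AL : gralg L) (pL : {rmorphism TL -> AL})
  (hpL : quotient_map (potential_span wordL wL) pL).
Context (b : nat -> seq (seq 'I_n)) (e : seq 'I_n -> seq 'I_n -> K) (be : is_basis word p b e)
  (rl : seq 'I_n -> seq (K * (seq 'I_n * 'I_n * seq 'I_n))) (hrl : rewriting word w b e rl).
Context (c : 'I_n -> L) (j1 : 'I_n) (c_j1 : c j1 != 0).
Context (D : gralg L) (pD : {rmorphism TL -> D})
  (hpD : quotient_map (extension_span wordL wL c) pD).
Local Notation om := (omega wordL wL c pD j1).
Context (om_reg : forall d, om * d = 0 -> d = 0).
Local Notation F := (pD (potential_rel wordL wL j1)).

(** The span of the words of length less than N, given by its induction principle. *)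
Definition short N (a : TL) : Prop := forall P : TL -> Prop, P 0 ->
  (forall x y, P x -> P y -> P (x + y)) ->
  (forall d u, (size u < N)%N -> P (str TL d * wordL u)) -> P a.

Lemma short_mono N N' a : (N <= N')%N -> short N a -> short N' a.
Proof. by move=> NN h P P0 PD PU; apply: h => // d u hu; apply: PU; apply: leq_trans hu NN. Qed.

Lemma shortD N x y : short N x -> short N y -> short N (x + y).
Proof. by move=> hx hy P P0 PD PU; apply: (PD); [apply: hx | apply: hy]. Qed.

Lemma short_exists a : exists N, short N a.
Proof.
elim/(word_span hTL): a => [|x y [N hx] [M hy]|d u].
- by exists 0%N => P.
- exists (maxn N M); apply: shortD; [apply: short_mono hx|apply: short_mono hy].
    exact: leq_maxl.
  exact: leq_maxr.
by exists (size u).+1 => P P0 PD PU; apply: PU.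
Qed.

Let F_om : F = str D (c j1) * om. Proof. exact (omegaE hpD c_j1 j1). Qed.

Let F_central : central F.
Proof.
move=> a; rewrite F_om -(mulrA (str D _)) (omega_central hTL hpD j1) mulrA str_central.
by rewrite -mulrA.
Qed.

Let F_reg d : F * d = 0 -> d = 0.
Proof.
rewrite F_om -(mulrA (str D _)) => h; apply: om_reg.
by rewrite -[LHS]mul1r -(rmorph1 (str D)) -(mulVf c_j1) rmorphM -mulrA h mulr0.
Qed.

(** In D one has f_j = (c_j / c_j1) F with F central, so the relation terms of a word add up to F
    times this combination of shorter words. *)
Lemma reduce_exists : exists red : {additive TL -> TL}, forall d u,
  red (str TL d * wordL u) =
    str TL d * \sum_(q <- rl u) str TL (j0 q.1 * (c q.2.1.2 / c j1)) * wordL (q.2.1.1 ++ q.2.2).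
Proof.
by apply: (word_ext hTL) => u d d' /=; rewrite rmorphB mulrBl.
Qed.

Lemma coordinate_exists t : exists lam : {additive AL -> L},
  (forall d y, lam (str AL d * y) = d * lam y) /\
  (forall d u, lam (pL (str TL d * wordL u)) = d * j0 (e t u)).
Proof.
have [iota [iota_word iota_str]] := base_change_algebra hT hTL wLE hp hpL.
have [_ _ _ /(_ t) [f [fE f0]]] := be.
have [g gE] := quotient_map_lift_additive hp f0.
have [||lam [lamZ lamE]] := base_change_map hT hTL wLE hp hpL iota_word iota_str (sB := idfun)
  (phi := fun a => j0 (g a)).
- by move=> x y; rewrite !raddfB.
- move=> d y; have [a ->] := quotient_surj hp y.
  rewrite -(quotient_str hp) -rmorphM !gE /= -rmorphM; congr (j0 _).
  elim/(word_span hT): a => [|x z hx hz|d' u]; first by rewrite mulr0 raddf0 mulr0.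
    by rewrite mulrDr !raddfD /= hx hz mulrDr.
  by rewrite mulrA -rmorphM !fE mulrA.
exists lam; split=> [d y|d u]; first exact: lamZ.
rewrite rmorphM (quotient_str hpL) lamZ -iota_word lamE gE -[word u]mul1r.
by rewrite -(rmorph1 (str T)) fE mul1r.
Qed.

Context (red : {additive TL -> TL}) (redE : forall d u, red (str TL d * wordL u) =
    str TL d * \sum_(q <- rl u) str TL (j0 q.1 * (c q.2.1.2 / c j1)) * wordL (q.2.1.1 ++ q.2.2)).
Context (lam : seq 'I_n -> {additive AL -> L})
  (lamZ : forall t d y, lam t (str AL d * y) = d * lam t y)
  (lamE : forall t d u, lam t (pL (str TL d * wordL u)) = d * j0 (e t u)).

Lemma red_short N a : short N.+1 a -> short N (red a).
Proof.
move=> h; apply: (h (fun a => short N (red a))) => [|x y hx hy|d u hu].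
    by rewrite raddf0 => P.
  by rewrite raddfD; apply: shortD.
rewrite redE => P P0 PD PU; rewrite mulr_sumr big_seq; apply: (big_ind P) => // q hq.
rewrite mulrA -rmorphM; apply: PU; have [_ /(_ q hq)] := hrl u.
move=> sz; apply: leq_trans (_ : (size u <= N)%N) => //.
by rewrite -sz size_cat -addnA ltn_add2l -addn1 addnC leq_add2r.
Qed.

Lemma red_expand N a : short N a -> pD a =
  \sum_(q < N) \sum_(t <- b q) str D (lam t (pL a)) * pD (wordL t) + F * pD (red a).
Proof.
have [fL [fL_word fL_str]] := base_ring_map j0 hT hTL.
have fL_rel j : fL (potential_rel word w j) = potential_rel wordL wL j.
  by rewrite rmorph_sum; apply: eq_bigr => t _; rewrite rmorphM fL_str fL_word wLE.
have [_ _ e0 _] := be.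
move=> h; apply: (h (fun a => pD a =
    \sum_(q < N) \sum_(t <- b q) str D (lam t (pL a)) * pD (wordL t) + F * pD (red a)))
  => [|x y hx hy|d u hu].
- rewrite !raddf0 mulr0 addr0 big1 // => q _; rewrite big1 // => t _.
  by rewrite raddf0 rmorph0 mul0r.
- rewrite (rmorphD pD) (raddfD red) (rmorphD pD) mulrDr hx hy addrACA; congr (_ + _).
  rewrite -big_split; apply: eq_bigr => q _; rewrite -big_split; apply: eq_bigr => t _ /=.
  by rewrite (rmorphD pL) (raddfD (lam t)) rmorphD mulrDl.
have [/(congr1 fL) uE _] := hrl u; rewrite fL_word rmorphD !(rmorph_sum fL) in uE.
rewrite redE !(rmorphM pD) !(quotient_str hpD) [in pD (wordL u)]uE (rmorphD pD) mulrDr.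
move: F_om; move: F => f1 f1E; rewrite !(rmorph_sum pD) !mulr_sumr.
congr (_ + _).
  rewrite (bigD1 (Ordinal hu)) //= [X in _ + X]big1 ?addr0 => [|q qu].
    apply: eq_bigr => t _; rewrite lamE (rmorphM fL) fL_str fL_word (rmorphM pD).
    by rewrite (quotient_str hpD) mulrA -rmorphM.
  rewrite big_seq big1 // => t ht; rewrite lamE e0 ?rmorph0 ?mulr0 ?rmorph0 ?mul0r //.
  apply: contraNN qu => tu; have [bsize _ _ _] := be; apply/eqP/val_inj => /=.
  by rewrite -(bsize _ _ tu) -(bsize _ _ ht).
apply: eq_bigr => q _; rewrite /rel_term !(rmorphM fL) fL_str !fL_word fL_rel.
rewrite !(rmorphM pD) !(quotient_str hpD) (omegaE hpD c_j1 q.2.1.2) f1E (word_cat hTL).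
rewrite (rmorphM pD) [in RHS](mulrA (str D d) (str D _)) -[in RHS](rmorphM (str D)) str_mul.
rewrite (mul_central_mid _ _ _ (omega_central hTL hpD j1)).
rewrite [LHS]mulrA -(rmorphM (str D)) [LHS]mulrA -(rmorphM (str D)); congr (str D _ * _).
by rewrite [RHS]mulrC -!mulrA mulVf // mulr1.
Qed.

(** If [pD a = 0], the coordinates of [a] vanish and [red_expand] reduces to [F * pD (red a) = 0],
    where F is regular. *)
Lemma reduction_map : exists rho : {additive D -> D}, forall a, rho (pD a) = pD (red a).
Proof.
have h a : pD a = 0 -> (pD \o red) a = 0.
  move=> a0 /=; apply: F_reg; have [N /red_expand] := short_exists a; rewrite a0.
  have [q qE] := extension_proj hpL hpD; rewrite -qE a0 rmorph0.
  rewrite big1 ?add0r // => k _; rewrite big1 // => t _.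
  by rewrite raddf0 rmorph0 mul0r.
by have [rho rhoE] := quotient_map_lift_additive hpD h; exists rho.
Qed.

Lemma extension_basis_exists (R0 : L -> Prop) :
  (forall a j, R0 (j0 a * (c j / c j1))) -> exists (mu : seq 'I_n -> {additive D -> L}) rho,
    extension_basis wordL pD b F R0 mu rho /\ (forall a, rho (pD a) = pD (red a)).
Proof.
move=> hR; have [rho rhoE] := reduction_map; have [q qE] := extension_proj hpL hpD.
have R0j a : R0 (j0 a) by have := hR a j1; rewrite divff // mulr1.
have /choice [mu muE] : forall t, exists mu : {additive D -> L}, forall y, mu y = lam t (q y).
  by move=> t; apply: additive_of => x y; rewrite !raddfB.
have mu_word t u : mu t (pD (wordL u)) = j0 (e t u).
  by rewrite muE qE -[wordL u]mul1r -(rmorph1 (str TL)) lamE mul1r.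
have red1 u : red (wordL u) =
    \sum_(q <- rl u) str TL (j0 q.1 * (c q.2.1.2 / c j1)) * wordL (q.2.1.1 ++ q.2.2).
  by rewrite -[wordL u]mul1r -(rmorph1 (str TL)) redE rmorph1 mul1r.
have redZ d a : red (str TL d * a) = str TL d * red a.
  elim/(word_span hTL): a => [|x y hx hy|d' u]; first by rewrite mulr0 raddf0 mulr0.
    by rewrite mulrDr !(raddfD red) hx hy mulrDr.
  by rewrite mulrA -rmorphM !redE rmorphM mulrA.
exists mu, rho; split=> //; split.
- by move=> t d y; rewrite !muE rmorphM -(quotient_str hpD) qE (quotient_str hpL) lamZ.
- move=> d y; have [a ->] := quotient_surj hpD y.
  by rewrite -(quotient_str hpD) -rmorphM !rhoE redZ rmorphM.
- move=> y; have [a ->] := quotient_surj hpD y; have [N hN] := short_exists a; exists N.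
  (* In the induction the bound on the powers of F decreases, while the bound on the lengths of the
     words stays fixed; hence two bounds. *)
  suff h M M2 : (N <= M)%N -> (N <= M2)%N -> pD a = \sum_(k < M) \sum_(q < M2)
      \sum_(t <- b q) str D (mu t (iter k rho (pD a))) * (F ^+ k * pD (wordL t)).
    by move=> M NM; apply: h.
  elim: N a hN M => [|N ih] a hN M.
    have -> : a = 0 by apply: (hN (fun a => a = 0)) => // x z -> ->; rewrite addr0.
    move=> _ _; rewrite raddf0 big1 // => k _; rewrite big1 // => i _; rewrite big1 // => t _.
    have -> : iter k rho 0 = 0 by elim: (val k) => //= j ->; rewrite raddf0.
    by rewrite raddf0 rmorph0 mul0r.
  case: M => // M NM NM2; rewrite big_ord_recl /= {1}(red_expand (short_mono NM2 hN)).
  congr (_ + _).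
    by apply: eq_bigr => i _; apply: eq_bigr => t _; rewrite -qE -muE expr0 (mul1r (pD (wordL t))).
  rewrite (ih _ (red_short hN) M NM (ltnW NM2)) mulr_sumr.
  apply: eq_bigr => k _; rewrite mulr_sumr; apply: eq_bigr => i _; rewrite mulr_sumr.
  apply: eq_bigr => t _; rewrite -rhoE -iterSr.
  exact (mul_central_str _ _ _ F_central).
- by move=> t u; rewrite mu_word.
move=> u; rewrite rhoE red1; eexists; last by [].
apply: (big_ind (span_in wordL R0)) => [||v _]; [exact: SpanIn0|exact: SpanInD|].
exact: SpanInU.
Qed.

End ExtensionBasis.

(** A coordinate [lam i] induces a map from the tensor product with N to N. It sends the given zero
    tensor to 0, and injectivity of [phi] brings this back to N'; expanding the finitely many second
    factors then gives the zero tensor. *)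
Lemma flat_of_dual_basis (R : comPzRingType) (M : gralg R) :
  (forall ys : seq M, exists (I : Type) (r : seq I) (lam : I -> M -> R) (g : I -> M),
    [/\ forall i y z, lam i (y + z) = lam i y + lam i z,
        forall i d y, lam i (str M d * y) = d * lam i y &
        forall y, y \in ys -> y = \sum_(i <- r) str M (lam i y) * g i]) -> flat M.
Proof.
move=> H N' N phi phi_inj s hs.
have [I [r [lam [g [lamD lamZ gE]]]]] := H (map snd s).
have coef0 i : \sum_(q <- s) lam i q.2 *: q.1 = 0.
  have h0 : \sum_(q <- [seq (phi q.1, q.2) | q <- s]) lam i q.2 *: q.1 = 0.
    apply: (hs N (fun u y => lam i y *: u)) => [u u' y|u y y'|d u y].
    - by rewrite scalerDr.
    - by rewrite lamD scalerDl.
    by rewrite lamZ scalerA mulrC.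
  apply: phi_inj; rewrite raddf0 raddf_sum -[RHS]h0 big_map.
  by apply: eq_bigr => q _ /=; rewrite linearZ.
move=> G beta betaDl betaDr betaZ.
have beta0l y : beta 0 y = 0 by apply: (addrI (beta 0 y)); rewrite -betaDl !addr0.
have beta0r u : beta u 0 = 0 by apply: (addrI (beta u 0)); rewrite -betaDr !addr0.
have beta_suml y (l : seq (N' * M)) (F : N' * M -> N') :
    beta (\sum_(q <- l) F q) y = \sum_(q <- l) beta (F q) y.
  by elim: l => [|q l ih]; rewrite ?big_nil ?beta0l // !big_cons betaDl ih.
have beta_sumr u (l : seq I) (F : I -> M) :
    beta u (\sum_(q <- l) F q) = \sum_(q <- l) beta u (F q).
  by elim: l => [|q l ih]; rewrite ?big_nil ?beta0r // !big_cons betaDr ih.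
transitivity (\sum_(q <- s) \sum_(i <- r) beta (lam i q.2 *: q.1) (g i)).
  apply: eq_big_seq => q qs; rewrite {1}[q.2]gE ?map_f // beta_sumr.
  by apply: eq_bigr => i _; rewrite betaZ.
by rewrite exchange_big big1 // => i _; rewrite -beta_suml coef0 beta0l.
Qed.

Section SectionFlat.
Context (L : fieldType) (n : nat) (T : gralg L) (word : seq 'I_n -> T)
  (hT : free_algebra word) (D : gralg L) (p : {rmorphism T -> D})
  (pstr : forall c, p (str T c) = str D c).
Context (b : nat -> seq (seq 'I_n)) (F : D) (R0 : L -> Prop)
  (lam : seq 'I_n -> {additive D -> L}) (rho : {additive D -> D})
  (H : extension_basis word p b F R0 lam rho).
Context (R1 : R0 1) (RB : forall a b, R0 a -> R0 b -> R0 (a - b))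
  (RM : forall a b, R0 a -> R0 b -> R0 (a * b)).
Context (X : lattice D) (XE : forall z, X z <-> span_image word p R0 z) (XF : X F).
Context (ne : Prop) (hne : ne) (R : comPzRingType) (v : {rmorphism R -> L})
  (v_inj : injective v) (v_surj : forall z, R0 z -> exists r, v r = z)
  (v_lat : forall r, X (str D (v r))).

Let R00 : R0 0. Proof. by rewrite -(subrr 1); apply: RB. Qed.
Let RD a a' : R0 a -> R0 a' -> R0 (a + a').
Proof. by move=> ha ha'; rewrite -[a']opprK; apply: (RB) => //; rewrite -sub0r; apply: RB. Qed.

Lemma lam_lat t z : X z -> R0 (lam t z).
Proof.
move=> /XE [a ha ->]; elim: ha => [|x y _ hx _ hy|d u hd]; first by rewrite !raddf0.
  by rewrite !raddfD; apply: RD.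
by rewrite rmorphM pstr (lam_linear H); apply: RM => //; apply: (lam_word H).
Qed.

Lemma rho_lat z : X z -> X (rho z).
Proof.
move=> /XE [a ha ->]; apply/XE; elim: ha => [|x y _ [a1 h1 hx] _ [a2 h2 hy]|d u hd].
- by rewrite !raddf0; exists 0; [apply: SpanIn0 | rewrite rmorph0].
- rewrite (rmorphD p) raddfD hx hy; exists (a1 + a2); [exact: SpanInD | by rewrite (rmorphD p)].
rewrite (rmorphM p) pstr (rho_linear H); have [a1 h1 ->] := rho_word H u.
by exists (str T d * a1); [apply: span_inZ | rewrite (rmorphM p) pstr].
Qed.

Lemma rho_iter_lat k z : X z -> X (iter k rho z).
Proof. by move=> hz; elim: k => //= k; apply: rho_lat. Qed.

Let unit1 : sect_unit D ne = 1.
Proof. by rewrite /sect_unit; case: asboolP. Qed.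

Lemma sect_flat : flat (sect_alg ne v_lat).
Proof.
apply: flat_of_dual_basis => ys.
have [M hM] : exists M, forall y : sect X ne, y \in ys -> sect_val y =
    \sum_(k < M) \sum_(q < M) \sum_(t <- b q)
      str D (lam t (iter k rho (sect_val y))) * (F ^+ k * p (word t)).
  suff [N hN] : exists N, forall M, (N <= M)%N -> forall y : sect X ne, y \in ys ->
      sect_val y = \sum_(k < M) \sum_(q < M) \sum_(t <- b q)
        str D (lam t (iter k rho (sect_val y))) * (F ^+ k * p (word t)).
    by exists N; apply: hN.
  elim: ys => [|y ys [N hN]]; first by exists 0%N.
  have [N' hN'] := basis_expand H (sect_val y).
  exists (maxn N N') => M; rewrite geq_max => /andP [NM NM'] z; rewrite inE => /orP [/eqP ->|].
    exact: hN'.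
  exact: hN.
pose I := (nat * seq 'I_n)%type.
pose r : seq I := [seq (k, t) | k <- index_iota 0 M, t <- flatten [seq b q | q <- index_iota 0 M]].
have /choice [mu muE] : forall iy : I * sect X ne, exists d,
    v d = lam iy.1.2 (iter iy.1.1 rho (sect_val iy.2)).
  by move=> [[k t] y]; apply/v_surj/lam_lat/rho_iter_lat/sect_val_lat.
have FX k : X (F ^+ k).
  by elim: k => [|k ih]; rewrite ?expr0 ?exprS; [apply: lat_1 | apply: lat_M].
have wX u : X (p (word u)).
  by apply/XE; exists (word u) => //; rewrite -[word u]mul1r -(rmorph1 (str T)); apply: SpanInU.
have /choice [g gE] : forall i : I, exists g : sect X ne, sect_val g = F ^+ i.1 * p (word i.2).
  by move=> i; have [g gE] := sect_exists ne (lat_M (FX i.1) (wX i.2)); exists g; rewrite gE unit1 mul1r.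
have rhoZ k d y : iter k rho (str D d * y) = str D d * iter k rho y.
  by elim: k => //= k ->; rewrite (rho_linear H).
exists I, r, (fun i y => mu (i, y)), g; split.
- move=> i y z; apply: v_inj; rewrite rmorphD !muE /= (raddfD (@sect_val _ _ X ne)).
  have -> : iter i.1 rho (sect_val y + sect_val z) =
      iter i.1 rho (sect_val y) + iter i.1 rho (sect_val z).
    by elim: (i.1) => //= k ->; rewrite raddfD.
  by rewrite raddfD.
- move=> i d y; apply: v_inj; rewrite rmorphM !muE /= sect_valM sect_strE unit1 mul1r rhoZ.
  by rewrite (lam_linear H).
move=> y /hM yE; apply: sect_val_inj; rewrite {1}yE (raddf_sum (@sect_val _ _ X ne)).
rewrite big_allpairs_dep big_mkord; apply: eq_bigr => k _ /=.
rewrite big_flatten big_map big_mkord; apply: eq_bigr => q _; apply: eq_bigr => t _.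
by rewrite sect_valM sect_strE unit1 mul1r muE gE.
Qed.

End SectionFlat.

(** * Specialization from the generic point to a rational point *)

Section FiberAtRationalPoint.
Context (K L : fieldType) (j0 : {rmorphism K -> L}) (n m : nat) (m_gt0 : (0 < m)%N).
Context (T : gralg K) (word : seq 'I_n -> T) (hT : free_algebra word).
Context (TL : gralg L) (wordL : seq 'I_n -> TL) (hTL : free_algebra wordL).
Context (w : tensor K n m.+1) (wL : tensor L n m.+1) (wLE : forall t, wL t = j0 (w t)).
Context (A : gralg K) (p : {rmorphism T -> A})
  (hp : quotient_map (potential_span word w) p).
Context (AL : gralg L) (pL : {rmorphism TL -> AL})
  (hpL : quotient_map (potential_span wordL wL) pL).
Context (c : 'I_n -> L) (x : 'I_n -> K) (j1 : 'I_n) (c_j1 : c j1 != 0) (x_j1 : x j1 != 0).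
Context (D : gralg L) (pD : {rmorphism TL -> D})
  (hpD : quotient_map (extension_span wordL wL c) pD).
Context (Dx : gralg K) (px : {rmorphism T -> Dx})
  (hpx : quotient_map (extension_span word w x) px).
Context (om_reg : forall d, omega wordL wL c pD j1 * d = 0 -> d = 0).
Local Notation F := (pD (potential_rel wordL wL j1)).

Context (reg mx : L -> Prop) (reg1 : reg 1)
  (regB : forall a b, reg a -> reg b -> reg (a - b))
  (regM : forall a b, reg a -> reg b -> reg (a * b)) (reg_j0 : forall d, reg (j0 d))
  (mx_reg : forall a, mx a -> reg a) (mx0 : mx 0)
  (mxD : forall a b, mx a -> mx b -> mx (a + b))
  (mxM : forall a b, mx a -> reg b -> mx (a * b))
  (mx_j0 : forall d, mx (j0 d) -> d = 0)
  (reg_mx : forall a, reg a -> exists d, mx (a - j0 d))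
  (mx_ratio : forall j, mx (c j / c j1 - j0 (x j / x j1))).

Definition specializes (a : L) (d : K) : Prop := reg a /\ mx (a - j0 d).

Let mxN a : mx a -> mx (- a).
Proof.
move=> ha; rewrite -mulrN1; apply: mxM ha _.
by rewrite -(rmorph1 j0) -rmorphN; apply: reg_j0.
Qed.

Let regD a b : reg a -> reg b -> reg (a + b).
Proof.
move=> ha hb; rewrite -[b]opprK; apply: (regB) => //; rewrite -sub0r; apply: (regB) => //.
by rewrite -(rmorph0 j0); apply: reg_j0.
Qed.

Let specD a a' d d' : specializes a d -> specializes a' d' -> specializes (a + a') (d + d').
Proof.
move=> [h1 h2] [h3 h4]; split; first exact: regD.
by rewrite rmorphD opprD addrACA; apply: mxD.
Qed.

Let specM a a' d d' : specializes a d -> specializes a' d' -> specializes (a * a') (d * d').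
Proof.
move=> [h1 h2] [h3 h4]; split; first exact: regM.
have -> : a * a' - j0 (d * d') = (a - j0 d) * a' + (a' - j0 d') * j0 d.
  by rewrite rmorphM !mulrBl (mulrC a' (j0 d)) (mulrC (j0 d')) addrA subrK.
by apply: mxD; apply: mxM.
Qed.

Let spec_j0 d : specializes (j0 d) d.
Proof. by split; [apply: reg_j0 | rewrite subrr]. Qed.

Let spec_mx a : mx a -> specializes a 0.
Proof. by move=> ha; split; [apply: mx_reg | rewrite rmorph0 subr0]. Qed.

(* [t] has coefficients in the local ring, words shorter than [N], and residue [a]. *)
Inductive spec_span (N : nat) : TL -> T -> Prop :=
| SpecSpan0 : spec_span N 0 0
| SpecSpanD t t' a a' : spec_span N t a -> spec_span N t' a' -> spec_span N (t + t') (a + a')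
| SpecSpanU d e u : specializes d e -> (size u < N)%N ->
    spec_span N (str TL d * wordL u) (str T e * word u).

Lemma spec_span_mono N M t a : (N <= M)%N -> spec_span N t a -> spec_span M t a.
Proof.
move=> NM; elim=> [|t1 t2 a1 a2 _ h1 _ h2|d e u hd hu]; first exact: SpecSpan0.
  exact: SpecSpanD.
by apply: SpecSpanU => //; apply: leq_trans hu NM.
Qed.

Lemma spec_spanD t t' a a' : (exists N, spec_span N t a) -> (exists N, spec_span N t' a') ->
  exists N, spec_span N (t + t') (a + a').
Proof.
move=> [N h] [M h']; exists (maxn N M); apply: SpecSpanD; [apply: spec_span_mono h|
  apply: spec_span_mono h'].
  exact: leq_maxl.
exact: leq_maxr.
Qed.

Lemma spec_spanZ N d e t a : specializes d e -> spec_span N t a ->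
  spec_span N (str TL d * t) (str T e * a).
Proof.
move=> hd; elim=> [|t1 t2 a1 a2 _ h1 _ h2|d' e' u hd' hu].
- by rewrite !mulr0; apply: SpecSpan0.
- by rewrite !mulrDr; apply: SpecSpanD.
by rewrite !mulrA -!rmorphM; apply: SpecSpanU => //; apply: specM.
Qed.

Lemma spec_span_exists t : span_in wordL reg t -> exists N a, spec_span N t a.
Proof.
elim=> [|t1 t2 _ [N1 [a1 h1]] _ [N2 [a2 h2]]|d u hd].
- by exists 0%N, 0; apply: SpecSpan0.
- have [||N hN] := @spec_spanD t1 t2 a1 a2; [by exists N1|by exists N2|].
  by exists N, (a1 + a2).
have [e he] := reg_mx hd; exists (size u).+1, (str T e * word u).
by apply: SpecSpanU.
Qed.

Lemma spec_span_base (fL : {rmorphism T -> TL}) : (forall u, fL (word u) = wordL u) ->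
  (forall d, fL (str T d) = str TL (j0 d)) -> forall a, exists N, spec_span N (fL a) a.
Proof.
move=> fw fs a; elim/(word_span hT): a => [|a a' ha ha'|d u].
- by exists 0%N; rewrite rmorph0; apply: SpecSpan0.
- by rewrite rmorphD; apply: spec_spanD.
by exists (size u).+1; rewrite rmorphM fw fs; apply: SpecSpanU.
Qed.

(** The same rewriting expands [t] in [D] and [a] in [Dx]. The coordinates of [a] are residues of
    those of [t], which vanish; there remain multiples of the reductions, again related by
    specialization, with a smaller bound on the length, and [rho] shows that the one of [t] is 0 in
    [D]. *)
Lemma spec_span_kernel N t a : spec_span N t a -> pD t = 0 -> px a = 0.
Proof.
have [b [e [be _]]] := basis_exists hT hp.
have [rl hrl] := rewriting_exists hT hp be.
have [red redE] := reduce_exists j0 hTL rl c j1.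
have [redx redxE] := reduce_exists idfun hT rl x j1.
have /choice [lam lamP] := coordinate_exists hT hTL wLE hp hpL be.
have /choice [lamx lamxP] :=
  coordinate_exists (j0 := idfun) hT hT (fun _ => erefl) hp hp be.
have expandx := red_expand (j0 := idfun) hT hT (fun _ => erefl) be hrl x_j1 hpx redxE
  (fun t => proj2 (lamxP t)).
have [rho rhoE] := reduction_map hT hTL wLE hpL be hrl c_j1 hpD om_reg redE
  (fun t => proj2 (lamP t)).
have [q qE] := extension_proj hpL hpD.
have spec_lam M t' s y : spec_span M s y -> specializes (lam t' (pL s)) (lamx t' (p y)).
  elim=> [|s1 s2 y1 y2 _ h1 _ h2|d k u hd _].
  - by rewrite !raddf0 -(rmorph0 j0); apply: spec_j0.
  - by rewrite !raddfD; apply: specD.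
  by rewrite (proj2 (lamP t')) (proj2 (lamxP t')); apply: specM.
have spec_red M s y : spec_span M.+1 s y -> spec_span M (red s) (redx y).
  elim=> [|s1 s2 y1 y2 _ h1 _ h2|d k u hd hu].
  - by rewrite !raddf0; apply: SpecSpan0.
  - by rewrite !raddfD; apply: SpecSpanD.
  rewrite redE redxE; apply: spec_spanZ hd _; have [_ hsz] := hrl u.
  elim: (rl u) hsz => [|r l ih] hsz; first by rewrite !big_nil; apply: SpecSpan0.
  rewrite !big_cons; apply: SpecSpanD; last first.
    by apply: ih => r' hr'; apply: hsz; rewrite inE hr' orbT.
  apply: SpecSpanU.
    by apply: specM; first exact: spec_j0; split;
      [rewrite -[c _ / _](subrK (j0 (x r.2.1.2 / x j1))); apply: regD; first exact: mx_reg
      | exact: mx_ratio].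
  rewrite -ltnS; apply: leq_trans hu; rewrite -(hsz r (mem_head _ _)) size_cat.
  by rewrite ltnS -addnA ltn_add2l -addn1 addnC leq_add2r.
have short_span M s y : spec_span M s y -> short wordL M s /\ short word M y.
  elim=> [|s1 s2 y1 y2 _ [h1 h1'] _ [h2 h2']|d k u hd hu].
  - by split=> P.
  - by split; apply: shortD.
  by split=> P P0 PD PU; apply: PU.
elim: N t a => [|N ih] t a h t0.
  suff -> : a = 0 by rewrite rmorph0.
  by elim: h => // s1 s2 y1 y2 _ -> _ ->; rewrite addr0.
have [hs hsx] := short_span _ _ _ h.
have lam0 t' : lamx t' (p a) = 0.
  apply: mx_j0; have [_] := spec_lam _ t' _ _ h.
  by rewrite -qE t0 rmorph0 raddf0 sub0r => /mxN; rewrite opprK.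
rewrite (expandx _ _ hsx) big1 ?add0r => [|i _]; last first.
  by rewrite big1 // => t' _; rewrite lam0 rmorph0 mul0r.
by rewrite (ih _ _ (spec_red _ _ _ h)) ?mulr0 // -rhoE t0 raddf0.
Qed.

Context (X : lattice D) (XE : forall z, X z <-> span_image wordL pD reg z).
Context (ne : Prop) (hne : ne) (R : comPzRingType) (v : {rmorphism R -> L})
  (v_surj : forall z, reg z -> exists r, v r = z)
  (v_lat : forall r, X (str D (v r))).
Local Notation M := (sect_alg ne v_lat).
Context (cst : {rmorphism K -> R}) (cstE : forall d, v (cst d) = j0 d).
Context (I : M -> Prop) (IE : forall y, I y <-> exists2 f, mx (v f) & y = str M f)
  (hI : homogeneous_set I).

Let unit1 : sect_unit D ne = 1.
Proof. by rewrite /sect_unit; case: asboolP. Qed.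

Let str_val r : sect_val (str M r : sect X ne) = str D (v r).
Proof. by rewrite sect_strE unit1 mul1r. Qed.

Let pstr : forall d, pD (str TL d) = str D d := quotient_str hpD.

(** The constants map T to the fiber, surjectively because every regular coefficient has a residue
    in K. An element of the ideal generated by the maximal ideal is the image of some [t] with
    residue 0, so [spec_span_kernel] determines the kernel. *)
Lemma sect_fiber : exists q : {rmorphism T -> restrict_scalars cst (gquot hI)},
  quotient_map (extension_span word w x) q.
Proof.
have [fL [fw fs]] := base_ring_map j0 hT hTL.
have latL a : X (pD (fL a)).
  apply/XE; exists (fL a) => //; elim/(word_span hT): a => [|a a' ha ha'|d u].
  - by rewrite rmorph0; apply: SpanIn0.
  - by rewrite rmorphD; apply: SpanInD.
  by rewrite rmorphM fs fw; apply: SpanInU.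
have /choice [phi0 phi0E] : forall a, exists s : sect X ne, sect_val s = pD (fL a).
  by move=> a; have [s sE] := sect_exists ne (latL a); exists s; rewrite sE unit1 mul1r.
have phiB : zmod_morphism phi0.
  by move=> a a'; apply: sect_val_inj; rewrite raddfB /= !phi0E !rmorphB.
have phiM : monoid_morphism phi0.
  split=> [|a a']; apply: sect_val_inj; first by rewrite phi0E !rmorph1 sect_val1 unit1.
  by rewrite sect_valM !phi0E !rmorphM.
have [phi phiE0] := rmorphism_of phiB phiM.
have {phi0 phi0E phiB phiM phiE0} phiE a : sect_val (phi a) = pD (fL a) by rewrite phiE0.
have [r [_ hr]] := gquot_quotient_map hI.
pose q : {rmorphism T -> restrict_scalars cst (gquot hI)} := r \o phi.
have qE a : q a = r (phi a) by [].
have fL_rel j : fL (potential_rel word w j) = potential_rel wordL wL j.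
  by rewrite rmorph_sum; apply: eq_bigr => t _; rewrite rmorphM fs fw wLE.
have phi_ideal t a : (exists N, spec_span N t a) -> forall s : sect X ne,
    sect_val s = pD (t - fL a) -> ideal_gen I s.
  move=> [N h]; elim: h => [|t1 t2 a1 a2 h1 ih1 h2 ih2|d e u [hd hde] _] s.
  - rewrite rmorph0 subr0 => s0; have -> : s = 0; last exact: IdealGen0.
    by apply: sect_val_inj; rewrite s0 !raddf0.
  - rewrite (rmorphD fL) opprD addrACA (rmorphD pD) => sE.
    have lat_diff t' a' : spec_span N t' a' -> X (pD (t' - fL a')).
      move=> h; rewrite (rmorphB pD); apply: lat_B (latL a'); apply/XE; exists t' => //.
      elim: h => [|? ? ? ? _ h3 _ h4|? ? ? [? _] _]; [exact: SpanIn0|exact: SpanInD|exact: SpanInU].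
    have [s1 s1E] := sect_exists ne (lat_diff _ _ h1).
    have [s2 s2E] := sect_exists ne (lat_diff _ _ h2).
    have -> : s = s1 + s2.
      by apply: sect_val_inj; rewrite (raddfD (@sect_val _ _ X ne)) /= sE s1E s2E unit1 !mul1r.
    by apply: ideal_genD; [apply: ih1 | apply: ih2]; rewrite ?s1E ?s2E unit1 mul1r.
  rewrite (rmorphM fL) fs fw -mulrBl -rmorphB (rmorphM pD) pstr => sE.
  have [f fE] := v_surj (mx_reg hde).
  have -> : s = (str M f : sect X ne) * phi (word u).
    by apply: sect_val_inj; rewrite sect_valM str_val phiE fw sE fE.
  by apply/ideal_genMr/ideal_gen_sub/IE; exists f; rewrite ?fE.
have ideal_spec s : ideal_gen I s -> exists t, (exists N, spec_span N t 0) /\ sect_val s = pD t.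
  elim=> [|a s0 b y /IE [f hf ->] _ [t [ht yE]]].
    by exists 0; split; [exists 0%N; apply: SpecSpan0 | rewrite !raddf0].
  have /XE [ta hta aE] := sect_val_lat a; have /XE [tb htb bE] := sect_val_lat b.
  exists (str TL (v f) * (ta * tb) + t); split.
    have [N [a' h]] := spec_span_exists (span_inM hTL regM hta htb).
    rewrite -[0]addr0; apply: spec_spanD => //; exists N.
    by have := spec_spanZ (spec_mx hf) h; rewrite rmorph0 mul0r.
  rewrite (raddfD (@sect_val _ _ X ne)) /= yE !sect_valM str_val aE bE -str_central.
  by rewrite (rmorphD pD) !(rmorphM pD) pstr !mulrA.
have q_str d : q (str T d) = str (restrict_scalars cst (gquot hI)) d.
  rewrite qE -[RHS](quotient_str hr); congr (r _); apply: sect_val_inj.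
  by rewrite phiE fs pstr str_val cstE.
have q_surj y : exists a, y = q a.
  have [s ->] := quotient_surj hr y; have /XE [t ht sE] := sect_val_lat s.
  have [N [a h]] := spec_span_exists ht; exists a; rewrite qE.
  apply/eqP; rewrite -subr_eq0 -rmorphB; apply/eqP/(quotient_ker hr).
  apply: (phi_ideal t a); first by exists N.
  by rewrite raddfB /= sE phiE rmorphB.
have q_deg k a : adeg T k a -> adeg (restrict_scalars cst (gquot hI)) k (q a).
  move=> ha; apply: (quotient_deg hr (k := k)).
  rewrite [adeg _ _ _]/(adeg D k (sect_val (phi a))) phiE; apply: (quotient_deg hpD).
  case: k ha => [k|k] ha; last by rewrite (adegN _ ha) // rmorph0; apply: deg_0 (adegP TL) _.
  apply: (word_deg_span hT (P := fun a => adeg TL k%:Z (fL a))) ha.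
  - by rewrite rmorph0; apply: deg_0 (adegP TL) _.
  - by move=> a1 a2 h1 h2; rewrite rmorphD; apply: gradingD (adegP TL) _ _ _ h1 h2.
  move=> d u <-; rewrite rmorphM fs fw -[(size u)%:Z]add0r.
  by apply: adegM; [apply: adeg_str | apply: (word_deg hTL)].
exists q; split=> //; last first.
  move=> k y hy; have [a ya] := q_surj y; move: hy; rewrite ya.
  exact (graded_lift q_deg (k := k) (a := a)).
move=> a; split=> [|ha].
  rewrite qE => /(quotient_ker hr) /ideal_spec [t [ht aE]].
  apply/(quotient_ker hpx).
  have [N' hN'] := spec_span_base fw fs a; have [N hN] := ht.
  have [N1 h1] : exists N1, spec_span N1 (fL a - t) (a + 0).
    apply: spec_spanD; first by exists N'.
    exists N; have := spec_spanZ (spec_j0 (-1)) hN.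
    by rewrite mulr0 !rmorphN !rmorph1 mulN1r.
  rewrite -[a]addr0; apply: (spec_span_kernel h1).
  by rewrite rmorphB -aE phiE subrr.
rewrite qE; apply/(quotient_ker hr).
have phi_sum psi : sect_val (phi (\sum_j str T (psi j) * potential_rel word w j)) =
    str D (\sum_j j0 (psi j) * (c j / c j1)) * F.
  rewrite phiE (rmorph_sum fL) (rmorph_sum pD) (rmorph_sum (str D)) mulr_suml.
  apply: eq_bigr => j _.
  rewrite (rmorphM fL) fs fL_rel (rmorphM pD) pstr (omegaE hpD c_j1 j) (omegaE hpD c_j1 j1).
  rewrite (rmorphM (str D)) -(mulrA (str D (j0 (psi j)))); congr (_ * _).
  by rewrite (mulrA (str D (c j / c j1))) -(rmorphM (str D)) divfK.
have phi_comm y' psi : phi ((\sum_i str T (y' i) * word [:: i]) *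
      (\sum_j str T (psi j) * potential_rel word w j) -
    (\sum_j str T (psi j) * potential_rel word w j) *
      (\sum_i str T (y' i) * word [:: i])) = 0.
  apply: sect_val_inj; rewrite phiE raddf0; apply/(quotient_ker hpD)/ideal_gen_sub; right.
  exists (fun i => j0 (y' i)), (fun i => j0 (psi i)).
  rewrite (rmorphB fL) !(rmorphM fL) !(rmorph_sum fL).
  have -> : \sum_i fL (str T (y' i) * word [:: i]) = \sum_i str TL (j0 (y' i)) * wordL [:: i].
    by apply: eq_bigr => i _; rewrite rmorphM fs fw.
  have -> // : \sum_i fL (str T (psi i) * potential_rel word w i) =
     \sum_i str TL (j0 (psi i)) * potential_rel wordL wL i.
  by apply: eq_bigr => i _; rewrite rmorphM fs fL_rel.
elim: ha => [|a0 s b y hs _ ih]; first by rewrite rmorph0; apply: IdealGen0.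
rewrite rmorphD !rmorphM; apply: ideal_genD ih; apply: ideal_genMr; apply: ideal_genMl.
case: hs => [[psi hpsi ->]|[y' [psi ->]]]; last by rewrite phi_comm; apply: IdealGen0.
(* The residue of this sum is the sum of the [psi j * x j] divided by [x j1], which is 0. *)
have mxg : mx (\sum_j j0 (psi j) * (c j / c j1)).
  have -> : \sum_j j0 (psi j) * (c j / c j1) =
      \sum_j (c j / c j1 - j0 (x j / x j1)) * j0 (psi j).
    transitivity (\sum_j ((c j / c j1 - j0 (x j / x j1)) * j0 (psi j) +
        j0 (x j * psi j) / j0 (x j1))); last first.
      by rewrite big_split /= -mulr_suml -rmorph_sum hpsi rmorph0 mul0r addr0.
    apply: eq_bigr => j _; rewrite mulrBl fmorph_div (rmorphM j0) (mulrAC (j0 (x j))) subrK.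
    exact: mulrC.
  by apply: (big_ind mx) => // j _; apply: mxM.
have [g gE] := v_surj (mx_reg mxg); rewrite -gE in mxg.
have -> : phi (\sum_j str T (psi j) * potential_rel word w j) =
    (str M g : sect X ne) * phi (potential_rel word w j1).
  by apply: sect_val_inj; rewrite phi_sum sect_valM str_val gE phiE fL_rel.
by apply/ideal_genMr/ideal_gen_sub/IE; exists g.
Qed.

End FiberAtRationalPoint.

(** * The sheaf *)

Section SectionsOverOpens.
Context (K : fieldType) (n : nat).
Local Notation S := (mpoly.mpoly n K).
Context (L : fieldType) (toL : {rmorphism S -> L}) (toL_inj : forall f, toL f = 0 -> f = 0).
Local Notation reg := (reg toL).
Context (Rg : (point K n -> Prop) -> comPzRingType) (v : forall U, {rmorphism Rg U -> L})
  (v_inj : forall U, injective (v U)) (v_reg : forall U r p, U p -> reg p (v U r))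
  (v_surj : forall U z, (forall p, U p -> reg p z) -> exists r, v U r = z).
Context (TL : gralg L) (wordL : seq 'I_n -> TL) (hTL : free_algebra wordL)
  (D : gralg L) (pD : {rmorphism TL -> D}) (pD_str : forall c, pD (str TL c) = str D c)
  (pD_deg : forall k a, adeg TL k a -> adeg D k (pD a)).

Definition lat (U : point K n -> Prop) : lattice D :=
  lat_on hTL pD_deg (reg1 toL) (fun p => @regB K n L toL toL_inj p) (@regM K n L toL) U.

Lemma lat_str U r : lat U (str D (v U r)).
Proof. by apply: (lat_on_str hTL pD_str) => p Up; apply: v_reg. Qed.

Lemma lat_word U u : lat U (pD (wordL u)).
Proof. exact: lat_on_word. Qed.

Definition sections (U : point K n -> Prop) : gralg (Rg U) :=
  sect_alg (exists p, U p) (@lat_str U).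

Definition sec_val U (s : sections U) : D := sect_val s.
Local Notation unit U := (sect_unit D (exists p, U p)).

Lemma sec_val_inj U : injective (@sec_val U).
Proof. exact: sect_val_inj. Qed.

Lemma sec_val_lat U s : lat U (@sec_val U s).
Proof. exact: sect_val_lat. Qed.

Lemma sec_val_str U r : sec_val (str (sections U) r) = unit U * str D (v U r).
Proof. exact: sect_strE. Qed.

Lemma sec_valM U s t : @sec_val U (s * t) = sec_val s * sec_val t.
Proof. by []. Qed.

Lemma sec_valD U s t : @sec_val U (s + t) = sec_val s + sec_val t.
Proof. by []. Qed.

Lemma sec_val_unit U s : unit U * @sec_val U s = sec_val s.
Proof. exact: sect_valU. Qed.

Lemma unit_nonempty U (p : point K n) : U p -> unit U = 1.
Proof. by move=> Up; rewrite /sect_unit; case: asboolP => // -[]; exists p. Qed.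

Lemma sec_val_empty U s : ~ (exists p, U p) -> @sec_val U s = 0.
Proof. exact: sect_val_empty. Qed.

Lemma sec_exists U (p : point K n) z : U p -> lat U z -> exists s : sections U, sec_val s = z.
Proof.
move=> Up /(sect_exists (exists p, U p)) [s sE]; exists s.
by rewrite /sec_val sE (unit_nonempty Up) mul1r.
Qed.

Lemma sec_valX U (p : point K n) (s : sections U) k : U p -> sec_val (s ^+ k) = sec_val s ^+ k.
Proof.
move=> Up; elim: k => [|k ih]; first by rewrite !expr0 [LHS](sect_val1 (lat U)) (unit_nonempty Up).
by rewrite !exprS sec_valM ih.
Qed.

Section Restrictions.
Context (U W : point K n -> Prop) (h : forall p, W p -> U p).

Lemma nonempty_mono : (exists p, W p) -> exists p, U p.
Proof. by move=> [p /h]; exists p. Qed.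

Lemma lat_mono : (exists p, U p) -> forall z, lat U z -> lat W z.
Proof. by move=> _ z hz p /h; apply: hz. Qed.

Definition restriction : {rmorphism sections U -> sections W} :=
  sect_res nonempty_mono lat_mono.

Lemma restrictionE s : sec_val (restriction s) = unit W * sec_val s.
Proof. exact: sect_resE. Qed.

Lemma unit_mono : unit W * unit U = unit W.
Proof.
rewrite /sect_unit; case: asboolP => [/nonempty_mono hU|_]; last by rewrite mul0r.
by case: asboolP => // _; rewrite mul1r.
Qed.

Lemma restriction_str f g : v U f = v W g ->
  restriction (str (sections U) f) = str (sections W) g.
Proof.
move=> fg; apply: sec_val_inj.
by rewrite restrictionE !sec_val_str mulrA unit_mono fg.
Qed.

Lemma restriction_deg k s : adeg (sections U) k s -> adeg (sections W) k (restriction s).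
Proof. exact: sect_res_deg. Qed.

Lemma restriction_nonempty (p : point K n) s : W p -> sec_val (restriction s) = sec_val s.
Proof. by move=> Wp; rewrite restrictionE (unit_nonempty Wp) mul1r. Qed.

End Restrictions.

Lemma restriction_id U (h : forall p, U p -> U p) s : restriction h s = s.
Proof. by apply: sec_val_inj; rewrite restrictionE sec_val_unit. Qed.

Lemma restriction_comp U W Z (h : forall p, W p -> U p) (h' : forall p, Z p -> W p)
    (h'' : forall p, Z p -> U p) s : restriction h' (restriction h s) = restriction h'' s.
Proof. by apply: sec_val_inj; rewrite !restrictionE mulrA (unit_mono h'). Qed.

Lemma sections_separated U (I : Type) (C : I -> point K n -> Prop)
    (h : forall i p, C i p -> U p) : (forall p, U p -> exists i, C i p) ->
  forall s t, (forall i, restriction (h i) s = restriction (h i) t) -> s = t.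
Proof.
move=> cov s t e; apply: sec_val_inj.
have [[p Up]|hU] := pselect (exists p, U p); last by rewrite !sec_val_empty.
have [i Cp] := cov p Up.
by rewrite -(restriction_nonempty (h i) s Cp) e (restriction_nonempty (h i) t Cp).
Qed.

(** Any two non-empty members of the covering contain the generic point, so the local sections on
    them are one and the same element of [D]; it is integral at each point of [U]. *)
Lemma sections_glue (U : opens K n) (I : Type) (C : I -> opens K n)
    (h : forall i p, C i p -> U p) : (forall p, U p -> exists i, C i p) ->
  forall s : (forall i, sections (C i)),
  (forall i j (W : opens K n) (hi : forall p, W p -> C i p) (hj : forall p, W p -> C j p),
     restriction hi (s i) = restriction hj (s j)) ->
  exists t : sections U, forall i, restriction (h i) t = s i.
Proof.
move=> cov s comp; have [[p Up]|hU] := pselect (exists p, U p); last first.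
  exists 0 => i; have hC : ~ (exists q, C i q) by move=> [q /(h i) Uq]; apply: hU; exists q.
  by apply: sec_val_inj; rewrite !sec_val_empty.
have [i0 Cp] := cov p Up.
have [j _] := pt_relevant p; have [eta etaE] := generic_point K j.
have val_eq i q : C i q -> sec_val (s i) = sec_val (s i0).
  move=> Cq; have Ce := generic_in_open etaE Cq; have Ce0 := generic_in_open etaE Cp.
  have [W WE] := opens_inter (C i) (C i0).
  have hi r : W r -> C i r by move/WE => [].
  have hj r : W r -> C i0 r by move/WE => [].
  have We : W eta by apply/WE.
  by rewrite -(restriction_nonempty hi _ We) (comp _ _ _ hi hj) (restriction_nonempty hj _ We).
have [|t tE] := sec_exists (z := sec_val (s i0)) Up.
  move=> q Uq; have [i Cq] := cov q Uq; rewrite -(val_eq i q Cq).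
  exact (sec_val_lat (s i) Cq).
exists t => i; apply: sec_val_inj; have [[q Cq]|hC] := pselect (exists q, C i q).
  by rewrite (restriction_nonempty _ _ Cq) tE (val_eq _ _ Cq).
by rewrite !sec_val_empty.
Qed.

Lemma sections_quasi_coherent (i : 'I_n) d (a : S) (f : Rg (basic_open 'X_i)) :
  a \is d.-homog -> v _ f = toL a / toL ('X_i ^+ d) ->
  forall h : (forall p, basic_open ('X_i * a) p -> basic_open 'X_i p),
    (forall t : sections (basic_open ('X_i * a)), exists k s,
       restriction h (str (sections _) f) ^+ k * t = restriction h s) /\
    (forall s : sections (basic_open 'X_i), restriction h s = 0 ->
       exists k, str (sections _) f ^+ k * s = 0).
Proof.
move=> ha fE h; have [[p Wp]|hW] := pselect (exists p, basic_open ('X_i * a) p); last first.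
  split=> [t|s _].
    by exists 0%N, 0; apply: sec_val_inj; rewrite !sec_val_empty.
  (* If the smaller open set is empty, it misses the generic point; hence a = 0, and f kills every
     section. *)
  exists 1%N; apply: sec_val_inj; rewrite expr1 sec_valM sec_val_str fE.
  have [eta etaE] := generic_point K i.
  suff -> : a = 0 by rewrite rmorph0 mul0r rmorph0 mulr0 mul0r.
  apply: contrapT => a0; apply: hW; exists eta => /etaE /eqP; rewrite mulf_eq0.
  by case/orP => /eqP // /letter_neq0.
have Up := h p Wp; split=> [t|s s0]; last first.
  exists 0%N; rewrite expr0 mul1r; apply: sec_val_inj.
  by rewrite -(restriction_nonempty h s Wp) s0.
have [k [t' ht' e]] := chart_extension toL_inj pD_str ha (fun x hx => sec_val_lat t hx).
have [|s sE] := sec_exists (z := str D (toL a / toL ('X_i ^+ d)) ^+ k * sec_val t) Up.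
  move=> q Uq; rewrite e; exists t' => //; apply: span_in_mono ht' => z hz.
  exact: chart_reg_at hz.
exists k, s; apply: sec_val_inj.
rewrite (restriction_nonempty h _ Wp) sE sec_valM (sec_valX _ _ Wp).
by rewrite (restriction_nonempty h _ Wp) sec_val_str (unit_nonempty Up) mul1r fE.
Qed.

Lemma sections_generated (i : 'I_n) : exists s : seq (sections (basic_open 'X_i)),
  (forall y, y \in s -> adeg (sections (basic_open 'X_i)) 1 y) /\
  generates (fun y : sections (basic_open 'X_i) => y \in s).
Proof.
set U := basic_open 'X_i.
have /choice [wd wdE] : forall u, exists s : sections U, sec_val s = unit U * pD (wordL u).
  by move=> u; apply/sect_exists/lat_word.
exists [seq wd [:: j] | j <- enum 'I_n]; split.
  move=> _ /mapP [j _ ->]; rewrite [adeg _ _ _]/(adeg D 1 (sec_val _)) wdE.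
  rewrite /sect_unit; case: asboolP => _; rewrite ?mul1r ?mul0r; last exact: deg_0 (adegP D) _.
  exact (pD_deg (word_deg hTL [:: j])).
move=> P Pstr Pgen PD PM y.
have [[p Up]|hU] := pselect (exists p, U p); last first.
  suff -> : y = str (sections U) 0 by apply: Pstr.
  by apply: sec_val_inj; rewrite !sec_val_empty.
have Pwd u : P (wd u).
  elim: u => [|j u ih].
    suff -> : wd [::] = str (sections U) 1 by apply: Pstr.
    by apply: sec_val_inj; rewrite wdE sec_val_str !rmorph1 (word_nil hTL) rmorph1.
  suff -> : wd (j :: u) = wd [:: j] * wd u.
    by apply: PM => //; apply: Pgen; apply: map_f; rewrite mem_enum.
  apply: sec_val_inj; rewrite sec_valM !wdE (unit_nonempty Up) !mul1r.
  by rewrite (word_cons hTL j u) rmorphM.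
(* With a = 1 the extension lemma shows that a section over the chart is a combination of words over
   the coordinate ring of the chart. *)
have hz x : basic_open ('X_i * 1) x -> span_image wordL pD (reg x) (sec_val y).
  by rewrite mulr1 => hx; apply: (sec_val_lat y hx).
have [k [t ht yE]] := chart_extension toL_inj pD_str (dhomog1 K mpoly.mdeg) hz.
move: yE; rewrite expr0 divff ?rmorph1 ?oner_eq0 // expr1n mul1r => yE.
elim: ht y yE {hz} => [|t1 t2 h1 ih1 h2 ih2|d u hd] y yE.
- suff -> : y = str (sections U) 0 by apply: Pstr.
  by apply: sec_val_inj; rewrite yE sec_val_str !rmorph0 mulr0.
- have chart_lat t' : span_in wordL (chart_reg toL i) t' -> lat U (pD t').
    move=> h q Uq; exists t' => //; apply: span_in_mono h => z hz.
    exact: chart_reg_at hz.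
  have [s1 e1] := sec_exists Up (chart_lat _ h1).
  have [s2 e2] := sec_exists Up (chart_lat _ h2).
  have -> : y = s1 + s2 by apply: sec_val_inj; rewrite yE sec_valD e1 e2 rmorphD.
  by apply: PD; [apply: ih1 | apply: ih2].
have [r rE] : exists r, v U r = d by apply: v_surj => q Uq; apply: chart_reg_at hd.
have -> : y = str (sections U) r * wd u; last exact: PM.
apply: sec_val_inj; rewrite yE sec_valM sec_val_str wdE (unit_nonempty Up) !mul1r rE.
by rewrite rmorphM pD_str.
Qed.

End SectionsOverOpens.

(** * Maximal ideals of the local rings and residues at rational points *)

Section MaximalIdeal.
Context (K : fieldType) (n : nat).
Local Notation S := (mpoly.mpoly n K).
Context (L : fieldType) (toL : {rmorphism S -> L}) (toL_inj : forall f, toL f = 0 -> f = 0).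
Context (j0 : {rmorphism K -> L}) (j0E : forall d, j0 d = toL (mpolyC n d)).
Local Notation reg := (reg toL).

Definition max_at (p : point K n) (z : L) : Prop := exists d (a b : S),
  [/\ a \is d.-homog, b \is d.-homog, p a, ~ p b & z = toL a / toL b].

Lemma max_at_reg p z : max_at p z -> reg p z.
Proof. by move=> [d [a [b [ha hb _ pb ->]]]]; exists d, a, b. Qed.

Lemma max_at0 p : max_at p 0.
Proof.
exists 0%N, 0, 1; split; [exact: dhomog0 | exact: dhomog1 | exact: pt_0 | exact: pt_1 |].
by rewrite rmorph0 mul0r.
Qed.

Lemma max_atD p y z : max_at p y -> max_at p z -> max_at p (y + z).
Proof.
move=> [d [a [b [ha hb pa pb ->]]]] [e [a' [b' [ha' hb' pa' pb' ->]]]].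
exists (d + e)%N, (a * b' + a' * b), (b * b'); split.
- by rewrite rpredD ?[a' * b]mulrC ?dhomogM.
- exact: dhomogM.
- by apply: pt_D; rewrite mulrC; apply: pt_M.
- by case/pt_prime.
rewrite addf_div ?(reg_nz toL_inj pb) ?(reg_nz toL_inj pb') //.
by rewrite rmorphD !(rmorphM toL).
Qed.

Lemma max_atM p y z : max_at p y -> reg p z -> max_at p (y * z).
Proof.
move=> [d [a [b [ha hb pa pb ->]]]] [e [a' [b' [ha' hb' pb' ->]]]].
exists (d + e)%N, (a * a'), (b * b'); split; rewrite ?dhomogM //.
- by rewrite mulrC; apply: pt_M.
- by case/pt_prime.
by rewrite !rmorphM mulf_div.
Qed.

Lemma max_at_const p d : max_at p (j0 d) -> d = 0.
Proof.
move=> [e [a [b [_ _ pa pb]]]]; rewrite j0E => h; apply/eqP; apply: contraT => d0.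
have bnz := reg_nz toL_inj pb.
have ab : a = mpolyC n d * b.
  apply/eqP; rewrite -subr_eq0; apply/eqP/toL_inj.
  by rewrite rmorphB (rmorphM toL) h divfK // subrr.
case: pb; have -> : b = mpolyC n d^-1 * a; last exact: pt_M.
by rewrite ab mulrA -mpoly.mpolyCM mulVf // mpolyC1 mul1r.
Qed.

Lemma max_at_unit p z : max_at p z -> forall y, reg p y -> z * y <> 1.
Proof.
move=> hz y hy; have h := max_atM hz hy; move=> e; rewrite e -(rmorph1 j0) in h.
by have /eqP := max_at_const h; rewrite oner_eq0.
Qed.

Lemma not_max_at p z : reg p z -> ~ max_at p z -> exists2 y, reg p y & z * y = 1.
Proof.
move=> [d [a [b [ha hb pb zE]]]] hz.
have pa : ~ p a by move=> pa; apply: hz; exists d, a, b.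
exists (toL b / toL a); first by exists d, b, a.
by rewrite zE mulf_div (mulrC (toL b)) divff // mulf_neq0 ?(reg_nz toL_inj pa) ?(reg_nz toL_inj pb).
Qed.

Section Rational.
Context (x : 'rV[K]_n) (x_neq0 : x != 0).
Local Notation p := (kpoint x_neq0).

Lemma line_ideal_homog d (f : S) : f \is d.-homog -> line_ideal x f <-> f.@[x 0] = 0.
Proof.
move=> hf; split=> [/(_ d)|f0 e]; first by rewrite pihomog_dE.
have [<-|de] := eqVneq d e; first by rewrite pihomog_dE.
by rewrite (pihomog_ne0 de hf) raddf0.
Qed.

Lemma residue_exists z : reg p z -> exists d, max_at p (z - j0 d).
Proof.
move=> [d [a [b [ha hb pb ->]]]]; exists (a.@[x 0] / b.@[x 0]).
have b0 : b.@[x 0] != 0 by apply/eqP => /(line_ideal_homog hb).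
have hc e (f : S) : f \is d.-homog -> mpolyC n e * f \is d.-homog.
  by move=> hf; rewrite mul_mpolyC dhomogZ.
have hnum : a - mpolyC n (a.@[x 0] / b.@[x 0]) * b \is d.-homog by rewrite rpredB // hc.
exists d, (a - mpolyC n (a.@[x 0] / b.@[x 0]) * b), b; split=> //.
  apply/(line_ideal_homog hnum).
  by rewrite mevalB mevalM mevalC divfK // subrr.
by rewrite j0E rmorphB (rmorphM toL) mulrBl mulfK // (reg_nz toL_inj pb).
Qed.

Lemma kpoint_letter j : x 0 j != 0 -> ~ p 'X_j.
Proof.
move=> xj; move/(line_ideal_homog (homogX K j)); rewrite mevalXU => /eqP.
exact/negP.
Qed.

Lemma max_at_ratio i j : x 0 j != 0 ->
  max_at p (toL 'X_i / toL 'X_j - j0 (x 0 i / x 0 j)).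
Proof.
move=> xj; have Xj := kpoint_letter xj.
have hnum : 'X_i - mpolyC n (x 0 i / x 0 j) * 'X_j \is 1.-homog.
  by rewrite rpredB ?mul_mpolyC ?dhomogZ // homogX.
exists 1%N, ('X_i - mpolyC n (x 0 i / x 0 j) * 'X_j), 'X_j; split=> //; first exact: homogX.
  by apply/(line_ideal_homog hnum); rewrite mevalB mevalM mevalC !mevalXU divfK // subrr.
by rewrite j0E rmorphB (rmorphM toL) mulrBl mulfK // (reg_nz toL_inj Xj).
Qed.

End Rational.
End MaximalIdeal.

Section GenericExtension.
Context (K : fieldType) (n m : nat) (w : tensor K n m.+1) (m_ge2 : (2 <= m)%N)
  (w_sup : superpotential w) (A_3CY : calabi_yau 3 (Aw w)).
Local Notation S := (mpoly.mpoly n K).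
Context (L : fieldType) (toL : {rmorphism S -> L}) (toL_inj : forall f, toL f = 0 -> f = 0).
Local Notation reg := (reg toL).

(* The family is the central extension over the function field attached to the generic
   point X, seen as a constant sheaf, with the lattices of integral elements at each point. *)
Lemma generic_extension : exists (TL : gralg L) (wordL : seq 'I_n -> TL)
  (hTL : free_algebra wordL) (D : gralg L) (pD : {rmorphism TL -> D})
  (pD_str : forall c, pD (str TL c) = str D c)
  (pD_deg : forall k a, adeg TL k a -> adeg D k (pD a)),
  forall (Rg : (point K n -> Prop) -> comPzRingType) (v : forall U, {rmorphism Rg U -> L})
    (v_inj : forall U, injective (v U)) (v_reg : forall U r p, U p -> reg p (v U r))
    (v_surj : forall U z, (forall p, U p -> reg p z) -> exists r, v U r = z),
  (forall p, flat (sections toL_inj v_reg hTL pD_str pD_deg (eq p))) /\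
  (forall (x : 'rV[K]_n) (x_neq0 : x != 0) (cst : {rmorphism K -> Rg (eq (kpoint x_neq0))}),
     (forall d, v _ (cst d) = toL (mpolyC n d)) ->
   forall (I : sections toL_inj v_reg hTL pD_str pD_deg (eq (kpoint x_neq0)) -> Prop)
     (hI : homogeneous_set I),
     (forall y, I y <-> exists2 f, ~ (exists g, f * g = 1) & y = str _ f) ->
     gralg_iso (restrict_scalars cst (gquot hI)) (Dw w x)).
Proof.
have hT := TV_free K n; have hTL := TV_free L n.
have j0B : zmod_morphism (fun d : K => toL (mpolyC n d)).
  by move=> a b; rewrite mpolyCB rmorphB.
have j0M : monoid_morphism (fun d : K => toL (mpolyC n d)).
  by split=> [|a b]; rewrite ?mpolyC1 ?mpoly.mpolyCM ?rmorph1 ?rmorphM.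
have [j0 j0E] := rmorphism_of j0B j0M.
pose c : 'rV[L]_n := \row_j toL 'X_j.
pose wL : tensor L n m.+1 := [ffun t => j0 (w t)].
have wLE t : wL t = j0 (w t) by rewrite ffunE.
have [p [_ hp]] := Aw_quotient w; have [pL [_ hpL]] := Aw_quotient wL.
have [pD [_ hpD]] := Dw_quotient wL c.
have [EA [P [ext _]]] := A_3CY.
have [duA duAE] := der_exists hT p EA.
have prel i : p (potential_rel (@tv_word K n) w i) = 0 by apply: (potential_rel0 hp).
have ext0 : ext_zero P 0 by apply: ext.
have ext1 : ext_zero P 1 by apply: ext.
have [_ exact2] := calabi_yau_exact hT w_sup (quotient_str hp) (quotient_surj hp)
  (fun a => proj1 (quotient_ker hp a)) prel duAE ext0 ext1.
have cE j : c 0 j = toL 'X_j by rewrite mxE.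
have c_neq0 j : c 0 j != 0 by rewrite cE; apply/eqP => /toL_inj; apply: letter_neq0.
have om_reg j d : omega (@tv_word L n) wL (fun i => c 0 i) pD j * d = 0 -> d = 0.
  exact: (@omega_regular K L j0 n m _ _ hT _ _ hTL w wL wLE w_sup (ltnW m_ge2)
    _ p hp _ pL hpL EA duA duAE exact2 _ _ pD hpD j (c_neq0 j) d).
exists (TV L n), (@tv_word L n), hTL, (Dw wL c), pD, (quotient_str hpD), (quotient_deg hpD).
move: (Aw wL) pL hpL (Dw wL c) pD hpD om_reg => AL pL hpL D pD hpD om_reg.
move: (TV L n) (@tv_word L n) hTL pL hpL pD hpD om_reg => TL wordL hTL pL hpL pD hpD om_reg.
move=> Rg v v_inj v_reg v_surj.
have unit_eq (q : point K n) : exists r, q = r by exists q.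
have [b [e [be _]]] := basis_exists hT hp.
have [rl hrl] := rewriting_exists hT hp be.
have latE q z : lat toL_inj hTL (quotient_deg hpD) (eq q) z <->
    span_image wordL pD (reg q) z.
  by split=> [h|h r <- //]; apply: h.
have lat_wL q t : reg q (wL t) by rewrite wLE j0E; apply: reg_const.
split=> [q|x x_neq0 cst cstE I hI IE].
  have [j1 qj] := pt_relevant q.
  have [red redE] := reduce_exists j0 hTL rl (fun i => c 0 i) j1.
  have /choice [lam lamP] := coordinate_exists hT hTL wLE hp hpL be.
  have [|mu [rho [H _]]] := extension_basis_exists (ltnW m_ge2) hT hTL wLE hpL be hrl
    (c_neq0 j1) hpD (om_reg j1) redE (fun t => proj1 (lamP t)) (fun t => proj2 (lamP t))
    (R0 := reg q).
    move=> a j; rewrite j0E !cE; apply: regM; first exact: reg_const.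
    exact: reg_ratio.
  apply: (sect_flat (quotient_str hpD) H (reg1 toL q) (@regB K n L toL toL_inj q)
    (@regM K n L toL q) (latE q) _ (unit_eq q) (@v_inj _)).
  - apply/latE; exists (potential_rel wordL wL j1) => //.
    apply: (big_ind (span_in wordL (reg q))); [exact: SpanIn0|exact: SpanInD|].
    by move=> t _; apply: SpanInU.
  by move=> z hz; apply: v_surj => r <-.
have [j1 xj] := row_neq0 x_neq0.
have [px [_ hpx]] := Dw_quotient w x.
set q := kpoint x_neq0 in cst cstE I hI IE *.
have max_idealE (f : Rg (eq q)) : ~ (exists g, f * g = 1) <-> max_at toL q (v _ f).
  split=> [hf|hf [g fg]]; last first.
    apply: (max_at_unit toL_inj j0E hf (v_reg _ g q erefl)).
    by rewrite -rmorphM fg rmorph1.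
  apply: contrapT => h; apply: hf.
  have [y hy fy] := not_max_at toL_inj (v_reg _ f q erefl) h.
  have [|g gE] := v_surj (eq q) y; first by move=> r <-.
  by exists g; apply: v_inj; rewrite rmorphM gE fy rmorph1.
have IE' y : I y <-> exists2 f, max_at toL q (v _ f) & y = str _ f.
  rewrite IE; split=> -[f hf ->]; exists f => //; exact/max_idealE.
have cstE' d : v _ (cst d) = j0 d by rewrite cstE j0E.
have reg_j0 d : reg q (j0 d) by rewrite j0E; apply: reg_const.
have max_ratio j : max_at toL q (c 0 j / c 0 j1 - j0 (x 0 j / x 0 j1)).
  by rewrite !cE; apply: max_at_ratio.
have v_surj_q z : reg q z -> exists r, v (eq q) r = z.
  by move=> hz; apply: v_surj => r <-.
have [r hr] := sect_fiber (ltnW m_ge2) hT hTL wLE hp hpL (c_neq0 j1) xj hpD hpx (om_reg j1)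
  (@regB K n L toL toL_inj q) (@regM K n L toL q) reg_j0 (@max_at_reg K n L toL q)
  (max_at0 toL q) (@max_atD K n L toL toL_inj q) (@max_atM K n L toL q)
  (max_at_const toL_inj j0E (p := q)) (residue_exists toL_inj j0E (x_neq0 := x_neq0))
  max_ratio (latE q) (unit_eq q) v_surj_q cstE' IE' hI.
have [f [_ fiso]] := quotient_map_unique hr hpx; by exists f.
Qed.

End GenericExtension.

Section RegularSections.
Context (K : fieldType) (n : nat).
Local Notation S := (mpoly.mpoly n K).
Local Notation L := {fraction S}.

Definition numer_map : {rmorphism S -> L} := @tofrac S.

Lemma numer_map_inj f : numer_map f = 0 -> f = 0.
Proof. by move/eqP; rewrite tofrac_eq0 => /eqP. Qed.

Definition reg_val (U : point K n -> Prop) : {rmorphism regring U -> L} := \val.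

Lemma reg_val_inj U : injective (reg_val U).
Proof. exact: val_inj. Qed.

Lemma reg_val_regular U (r : regring U) p : U p -> reg numer_map p (reg_val U r).
Proof. by move=> Up; have /asboolP := valP r; apply. Qed.

Lemma reg_val_surj U z : (forall p, U p -> reg numer_map p z) -> exists r, reg_val U r = z.
Proof.
move=> hz; have h : z \in regular_pred U by apply/asboolP.
by exists (Sub z h : regring U).
Qed.

End RegularSections.

(** * The sheaf over the fraction field, and its stalks *)

Section ConcreteSheaf.
Context (K : fieldType) (n : nat).
Local Notation S := (mpoly.mpoly n K).
Local Notation L := {fraction S}.
Context (TL : gralg L) (wordL : seq 'I_n -> TL) (hTL : free_algebra wordL)
  (D : gralg L) (pD : {rmorphism TL -> D}) (pD_str : forall c, pD (str TL c) = str D c)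
  (pD_deg : forall k a, adeg TL k a -> adeg D k (pD a)).

Local Notation inj := (@numer_map_inj K n).
Local Notation vreg := (@reg_val_regular K n).
Local Notation Sec U := (sections inj vreg hTL pD_str pD_deg U).
Local Notation rst h := (restriction inj vreg hTL pD_str pD_deg h).

Definition section_sheaf : gr_sheaf K n :=
  @GrSheaf K n (fun U : opens K n => Sec U) (fun U W h => rst h)
    (fun U W h f g fg => restriction_str inj vreg hTL pD_str pD_deg h fg)
    (fun U W h k s hs => restriction_deg (pD_str := pD_str) h hs)
    (fun U h s => restriction_id h s)
    (fun U W Z h h' h'' s => restriction_comp h h' h'' s)
    (fun U I C h cov s t e => sections_separated cov e)
    (fun U I C h cov s e => sections_glue h cov e).
Local Notation F := section_sheaf.

Lemma section_sheaf_quasi_coherent : quasi_coherent F.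
Proof.
move=> i d a f ha hf h.
exact (sections_quasi_coherent inj vreg hTL pD_str pD_deg ha hf h).
Qed.

Lemma section_sheaf_fg : locally_fg_in_degree_one F.
Proof. by move=> i; apply: (sections_generated inj vreg (@reg_val_surj K n) hTL pD_str pD_deg i). Qed.

Section Stalk.
Context (p : point K n).

Let eqU (U : opens K n) (hU : U p) q (e : p = q) : U q := eq_ind p U hU q e.

Let germ_map (U : opens K n) (hU : U p) : {rmorphism Sec U -> Sec (eq p)} := rst (eqU hU).

(** An element integral at p involves finitely many coefficients, all of them regular on a common
    neighbourhood of p. *)
Lemma germ_surjective (y : Sec (eq p)) : exists (U : opens K n) (hU : U p) s, y = germ_map hU s.
Proof.
have [t ht yE] := sec_val_lat y erefl.
have [W [Wp hW]] : exists W : opens K n, W p /\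
    forall q, W q -> span_in wordL (reg (numer_map K n) q) t.
  elim: ht => [|t1 t2 _ [W1 [W1p h1]] _ [W2 [W2p h2]]|c u /reg_open [W [Wp hW]]].
  - by exists (basic_open 1); split=> [|q _]; [apply: pt_1 | apply: SpanIn0].
  - have [W WE] := opens_inter W1 W2; exists W; split=> [|q /WE [q1 q2]]; first by apply/WE.
    by apply: SpanInD; [apply: h1 | apply: h2].
  by exists W; split=> // q /hW; apply: SpanInU.
have latW : lat inj hTL pD_deg W (sec_val y) by move=> q /hW h; exists t.
have [s sE] := sec_exists vreg pD_str Wp latW.
exists W, Wp, s; apply: sec_val_inj.
by rewrite (restriction_nonempty _ _ (erefl p)) sE.
Qed.

Lemma germ_zero (U : opens K n) (hU : U p) s : germ_map hU s = 0 ->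
  exists2 W : opens K n, W p & exists h : (forall q, W q -> U q), res F h s = 0.
Proof.
move=> s0; exists U => //; exists (fun q h => h); apply: sec_val_inj.
rewrite [res F _ _]/(rst _ s) restrictionE -(restriction_nonempty (eqU hU) s (erefl p)).
by rewrite [restriction _ _ _ _ _ _ _]s0 mulr0.
Qed.

(** The stalk is the ring of elements of [D] integral at p, which is the construction of [sections]
    applied to the one-point set of p, open or not. *)
Definition section_stalk : stalk F p :=
  @Stalk K n F p (Sec (eq p)) (fun U hU => germ_map hU)
    (fun U W h hU hW s => restriction_comp h (eqU hW) (eqU hU) s)
    (fun U hU f g fg => restriction_str inj vreg hTL pD_str pD_deg (eqU hU) fg)
    (fun U hU k s hs => restriction_deg (pD_str := pD_str) (eqU hU) hs)
    germ_surjective germ_zero.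

End Stalk.
End ConcreteSheaf.

Lemma flat_family_exists (K : fieldType) (n m : nat) (w : tensor K n m.+1) :
  (2 <= m)%N -> superpotential w -> calabi_yau 3 (Aw w) ->
  exists F : gr_sheaf K n,
    [/\ quasi_coherent F, locally_fg_in_degree_one F, flat_sheaf F
      & forall (x : 'rV[K]_n) (x_neq0 : x != 0), has_fiber F (kpoint x_neq0) (Dw w x)].
Proof.
move=> m_ge2 w_sup A_3CY.
have [TL [wordL [hTL [D [pD [pD_str [pD_deg H]]]]]]] :=
  generic_extension m_ge2 w_sup A_3CY (@numer_map_inj K n).
have [flatF fiberF] := H (@regring K n) (@reg_val K n) (@reg_val_inj K n)
  (@reg_val_regular K n) (@reg_val_surj K n).
exists (section_sheaf hTL pD_str pD_deg); split.
- exact: section_sheaf_quasi_coherent.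
- exact: section_sheaf_fg.
- by move=> p; exists (section_stalk hTL pD_str pD_deg p); apply: flatF.
move=> x x_neq0; exists (section_stalk hTL pD_str pD_deg (kpoint x_neq0)).
by apply: fiberF.
Qed.
Theorem theorem1p3 (K : fieldType) (n m : nat) (w : tensor K n m.+1)
    (m_ge2 : (2 <= m)%N) (w_sup : superpotential w)
    (A_3CY : calabi_yau 3 (Aw w)) :
  (* D_0 = A(w), and D_x depends only on the line through x *)
  [/\ forall a, ideal_gen (D_rel w 0) a <-> ideal_gen (A_rel w) a,
      forall (c : K) (x : 'rV[K]_n), c != 0 ->
        forall a, ideal_gen (D_rel w (c *: x)) a <-> ideal_gen (D_rel w x) a,
  (* the flat family of 4-Calabi-Yau algebras D_x, x in P(V) *)
      (exists F : gr_sheaf K n,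
         [/\ quasi_coherent F, locally_fg_in_degree_one F, flat_sheaf F
           & forall (x : 'rV[K]_n) (x_neq0 : x != 0),
               has_fiber F (kpoint x_neq0) (Dw w x)]) /\
      (forall x : 'rV[K]_n, x != 0 ->
         calabi_yau 4 (Dw w x) /\
         exists (Omega : Dw w x) (dOmega : adeg (Dw w x) m%:Z Omega),
           [/\ central Omega, regular Omega
             & exists2 f : {rmorphism gquot1 dOmega -> Aw w},
                 gralg_iso_map f &
                 forall a : TV K n,
                   f (gquot1_proj dOmega (D_proj w x a)) = A_proj w a])
  (* all degree-m central extensions are of this form *)
    & forall (D' : gralg K) (Omega' : D') (dOmega' : adeg D' m%:Z Omega'),
        connected D' -> generated_in_degree_one D' ->
        central Omega' -> regular Omega' ->
        gralg_iso (gquot1 dOmega') (Aw w) ->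
        (exists x : 'rV[K]_n, x != 0 /\ gralg_iso D' (Dw w x)) /\
        calabi_yau 4 D'].
Proof.
split.
- exact: D_rel0.
- by move=> c x c0; apply: D_rel_scale.
- split; first exact: flat_family_exists.
  by move=> x x0; split; [apply: Dw_calabi_yau | apply: Dw_central_extension].
by move=> D' Omega' dOmega' conn gen cen reg iso; apply: central_extension_unique iso.
Qed.
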